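(* Let $p\geq 2$ and $s>s_p^\star$, where $s_p^\star=1/4$ if $p\leq 4$ and $s_p^\star=1/2-1/p$ if $p>4$. Let $R_s(x)=\sum_{n=1}^\infty n^{-2s}e^{2\pi i n^2 x}$ on $\mathbb T$. Then, as $\ell\to 0$ (with implicit constants independent of $\ell$): \begin{itemize} \item if $s<5/4$: $G_{R_s,p}(\ell)\simeq 1$ for $p<4$, $G_{R_s,4}(\ell)\simeq \log(\ell^{-1})$, and $G_{R_s,p}(\ell)\simeq \ell^{-(p/4-1)}$ for $p>4$; \item if $s=5/4$: $G_{R_s,p}(\ell)\simeq 1$ for $p<4$, $G_{R_s,p}(\ell)\simeq \ell^{-(p/4-1)}(\log(\ell^{-1}))^{-p/2}$ for $p>4$, and $1\lesssim G_{R_s,4}(\ell)\lesssim \log(\ell^{-1})$; \item if $5/4<s<3/2$: $G_{R_s,p}(\ell)\simeq 1$ for $p<2/(3-2s)$, $G_{R_s,p}(\ell)\simeq \ell^{-(3p/2-1-ps)}$ for $p>2/(3-2s)$, and $1\lesssim G_{R_s,p}(\ell)\lesssim (\log(\ell^{-1}))^{p/2}$ for $p=2/(3-2s)$; \item if $s\geq 3/2$: $G_{R_s,p}(\ell)\simeq 1$ for all $p>0$. \end{itemize}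
   Context: $\mathbb T=\mathbb R/\mathbb Z$. For $s\le1/2$, $R_s$ is understood as the limit in $L^p(\mathbb T)$ of its partial sums. For a function $f$ on $\mathbb T$ and $p>0$, $0<\ell<1$, the structure function is $S_{f,p}(\ell)=\int_{\mathbb T}|f(x+\ell)-f(x)|^p\,dx$, and the flatness in the sense of structure functions is $G_{f,p}(\ell)=S_{f,p}(\ell)/S_{f,2}(\ell)^{p/2}$. $A\lesssim B$ means $A\le CB$ for a constant $C>0$ independent of $\ell$; $A\simeq B$ means $A\lesssim B$ and $B\lesssim A$. *)

(* Defs.v *)
From HB Require Import structures.
From mathcomp Require Import all_boot all_order all_algebra.
From mathcomp Require Import all_classical all_reals all_analysis.
Set Implicit Arguments. Unset Strict Implicit. Unset Printing Implicit Defensive.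
Import Order.TTheory GRing.Theory Num.Theory.
Import numFieldNormedType.Exports.
Local Open Scope classical_set_scope.
Local Open Scope ring_scope.

(* A complex-valued function on the circle T = R/Z is represented by its
   real and imaginary parts fr, fi : R -> R, both 1-periodic.
   Modulus of the complex number a + i b. *)
Definition cmod {R : realType} (a b : R) : R := Num.sqrt (a ^+ 2 + b ^+ 2).

Definition Rs_re {R : realType} (s : R) (N : nat) (x : R) : R :=
  \sum_(1 <= n < N.+1) ((n%:R) `^ (- (2 * s)) * cos (2 * pi * (n ^ 2)%:R * x)).
Definition Rs_im {R : realType} (s : R) (N : nat) (x : R) : R :=
  \sum_(1 <= n < N.+1) ((n%:R) `^ (- (2 * s)) * sin (2 * pi * (n ^ 2)%:R * x)).

(* (fr, fi) is (a representative of) R_s, defined as the L^p(T)-limit of the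
   partial sums: fr, fi are 1-periodic and measurable, and
   int_T |S_N - f|^p -> 0 as N -> oo. *)
Definition is_Rs {R : realType} (s p : R) (fr fi : R -> R) : Prop :=
  (forall x, fr (x + 1) = fr x /\ fi (x + 1) = fi x) /\
  measurable_fun setT fr /\ measurable_fun setT fi /\
  ((fun N : nat => (\int[lebesgue_measure]_(x in `[(0:R)%R, (1:R)%R]%classic)
        ((cmod (Rs_re s N x - fr x) (Rs_im s N x - fi x)) `^ p)%:E)%E)
     @ \oo --> 0%E).

Definition Sfun {R : realType} (fr fi : R -> R) (p l : R) : R :=
  Rintegral lebesgue_measure `[(0:R)%R, (1:R)%R]%classic
    (fun x => (cmod (fr (x + l) - fr x) (fi (x + l) - fi x)) `^ p).

Definition Gfun {R : realType} (fr fi : R -> R) (p l : R) : R :=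
  Sfun fr fi p l / (Sfun fr fi 2 l) `^ (p / 2).

Definition lesim {R : realType} (A B : R -> R) : Prop :=
  exists C l0 : R, 0 < C /\ 0 < l0 /\ l0 < 1 /\
    forall l, 0 < l -> l < l0 -> A l <= C * B l.

Definition simeq {R : realType} (A B : R -> R) : Prop := lesim A B /\ lesim B A.

Definition sstar {R : realType} (p : R) : R :=
  if p <= 4 then 1 / 4 else 1 / 2 - 1 / p.

(* Main.v *)
(** The L^p limit of the partial sums of R_s is also the limit of their averages
    over dyadic ranges, i.e. of smooth truncations V_J cut into pieces of
    frequency n ~ 2^j. Translating by l multiplies the n-th coefficient of V_J
    by 2i sin (pi n^2 l) up to a translation by l/2, so every structure integral
    is the L^p norm of an exponential sum over squares with real coefficients,
    small for n^2 l < 1 and oscillating beyond.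

    Upper bounds. Weyl's inequality near a/q, obtained by two summations by parts
    in the correlations of the sum, gives the L^p norm of each piece, with growth
    2^(j max (1/2, 1 - 2/p)) and a logarithm at p = 4; the pieces are then summed.
    At s = 5/4 and p <= 4 all pieces with n^2 l < 1 have the same size, and the L^4 norm is
    computed from the solutions of a^2 + b^2 = c^2 + d^2, parametrized by
    a - c = al be, a + c = ga de, d - b = al ga, d + b = be de.

    Lower bounds. Parseval at p = 2, which propagates to p >= 2; pairing with a
    Fejer kernel of degree 1/l, which detects the peak at the origin; and, at
    p = 4, the number of solutions of a^2 + b^2 = c^2 + d^2 of size l^(-1/2), which is
    large because sums of gcd (x, z) carry a logarithm. *)

Require Import Defs.
From HB Require Import structures.
From mathcomp Require Import all_boot all_order all_algebra.
From mathcomp Require Import all_classical all_reals all_analysis.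
From mathcomp Require Import measurable_realfun cyclic.
From mathcomp Require Import ring lra zify.
Import Order.TTheory GRing.Theory Num.Theory.
Import numFieldNormedType.Exports.
Local Open Scope ring_scope.

(** * Elementary inequalities *)

(** No L^p space is used: Holder, Minkowski and Jensen are replaced by pointwise power inequalities
    with a free threshold or free geometric weights, which are then integrated. This costs constants
    only, and almost all integrals are of nonnegative functions. The natural variable is
    [l * 4 ^ j], equal to 1 at the transition scale. A piece contributes a power of [l] times a
    power of this variable, with one exponent below the transition and another above. If the
    contributions rise up to the transition and fall after it, that scale decides; if they already
    fall below it, the lowest frequencies decide. When the lower exponent vanishes, about [ln l^-1]
    scales have the same norm, and adding norms would raise their number to the power [p]. For
    [p > 4] this loss is avoided by playing the exponents [p - eta] and [p + eta] against each
    other, which leaves a single logarithm. At [s = 5/4] and [p <= 4] that is impossible, since the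
    norm of one piece at exponent 4 already carries a logarithm; hence the low scales are kept
    together in one fourth moment. *)

Lemma abs_sin_le {R : realType} (t : R) : `|sin t| <= `|t|.
Proof.
wlog t0 : t / 0 <= t => [H|].
  have [/H//|/ltW t0] := leP 0 t.
  by rewrite -normrN -sinN -(normrN t); apply: H; rewrite oppr_ge0.
rewrite (ger0_norm t0).
have [->|tn0] := eqVneq t 0; first by rewrite sin0 normr0.
have tp : 0 < t by rewrite lt_neqAle eq_sym tn0.
have [c _] := @MVT R sin cos 0 t tp (fun x _ => is_derive_sin x)
  (continuous_subspaceT (@continuous_sin R)).
rewrite sin0 !subr0 => ->.
rewrite normrM (ger0_norm t0) ler_piMl//.
exact: cos_max.
Qed.

(** Writing [sin t = 2 * sin (t / 2) * cos (t / 2)] and [sin (t / 2) = t / 2 * cos c], it remains to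
    see that [cos (t / 2) * cos c >= 1 / 2]. Both arguments lie in [[0, pi / 4]], where
    [cos (2 * y) >= 0] forces [cos y ^ 2 >= 1 / 2]. *)
Lemma sin_ge_half {R : realType} (t : R) : 0 <= t <= pi / 2 -> t / 2 <= sin t.
Proof.
move=> /andP[t0 t1]; have p2 := @pi_ge2 R.
have [->|tn0] := eqVneq t 0; first by rewrite sin0 mul0r.
have tp : 0 < t by rewrite lt_neqAle eq_sym tn0.
have up : 0 < t / 2 by lra.
have [c] := @MVT R sin cos 0 (t/2) up (fun x _ => is_derive_sin x)
  (continuous_subspaceT (@continuous_sin R)).
rewrite in_itv/= => /andP[c0 c1].
rewrite sin0 !subr0 => su.
have cosq (y : R) : 0 <= y -> y <= t / 2 -> 1 / 2 <= cos y ^+ 2 /\ 0 <= cos y.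
  move=> y0 y1; split; last by apply: cos_ge0_pihalf; apply/andP; split; lra.
  have := cos_mulr2n y.
  have : 0 <= cos (y *+ 2).
    by apply: cos_ge0_pihalf; apply/andP; split; lra.
  by move=> h e; move: h; rewrite e; lra.
have [c2 cp] := cosq c (ltW c0) (ltW c1).
have [u2 uu] := cosq (t/2) (ltW up) (lexx _).
have -> : t = (t/2) *+ 2 by lra.
rewrite sin_mulr2n su.
have h : 1 / 2 <= cos (t/2) * cos c.
  have hq : (1/2)^+2 <= (cos (t/2) * cos c)^+2.
    by rewrite [leRHS]exprMn expr2; apply: ler_pM => //; lra.
  by move: hq; rewrite ler_pXn2r// nnegrE ?mulr_ge0//; lra.
by have := ler_wpM2l (ltW up) h; lra.
Qed.

Lemma sinpi_ge {R : realType} (z : R) : 0 <= z <= 1 / 2 -> z <= sin (pi * z).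
Proof.
move=> /andP[z0 z1]; have p2 := @pi_ge2 R.
apply: le_trans (sin_ge_half _ _); first by have := ler_wpM2r z0 p2; lra.
by apply/andP; split; [nra|have := ler_wpM2l (ltW (@pi_gt0 R)) z1; lra].
Qed.

Lemma sinpi_ge_sub {R : realType} (z : R) : 1 / 2 <= z <= 1 -> 1 - z <= sin (pi * z).
Proof.
move=> /andP[z0 z1].
have -> : sin (pi * z) = sin (pi * (1 - z)).
  have -> : pi * (1 - z) = - (pi * z) + pi by ring.
  by rewrite sinDpi sinN opprK.
by apply: sinpi_ge; lra.
Qed.

Lemma one_sub_cos {R : realType} (t : R) : 1 - cos t = 2 * sin (t / 2) ^+ 2.
Proof.
have := cos_mulr2n (t / 2); rewrite cos2sin2.
have -> : (t / 2) *+ 2 = t by lra.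
by move=> ->; ring.
Qed.

Lemma one_sub_cos_le {R : realType} (t : R) : 0 <= 1 - cos t <= t ^+ 2 / 2.
Proof.
rewrite one_sub_cos; apply/andP; split; first by rewrite mulr_ge0// sqr_ge0.
have : sin (t/2) ^+ 2 <= (t/2)^+2.
  rewrite -ler_sqrt ?sqr_ge0// !sqrtr_sqr; exact: abs_sin_le.
by rewrite expr_div_n; lra.
Qed.

Lemma cosDn {R : realType} (x : R) (n : nat) : cos (x + 2 * pi * n%:R) = cos x.
Proof.
have -> : 2 * pi * n%:R = (pi *+ 2) *+ n :> R by rewrite -(mulr_natr pi 2) -(mulr_natr (pi * 2) n); ring.
by rewrite (periodicn (@cosD2pi R)).
Qed.

Lemma sinDn {R : realType} (x : R) (n : nat) : sin (x + 2 * pi * n%:R) = sin x.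
Proof.
have -> : 2 * pi * n%:R = (pi *+ 2) *+ n :> R by rewrite -(mulr_natr pi 2) -(mulr_natr (pi * 2) n); ring.
by rewrite (periodicn (@sinD2pi R)).
Qed.

Lemma sinpiDn_sqr {R : realType} (z : R) (n : nat) :
  sin (pi * (z + n%:R)) ^+ 2 = sin (pi * z) ^+ 2.
Proof.
elim: n => [|n IH]; first by rewrite addr0.
rewrite -natr1 -IH.
have -> : pi * (z + (n%:R + 1)) = pi * (z + n%:R) + pi by ring.
by rewrite sinDpi sqrrN.
Qed.

(** * Geometric sums over the scales on either side of 1 *)

Lemma geo_sum_lt {R : realType} (z r : R) (J : nat) : 0 <= z -> 1 < r ->
  \sum_(j < J) z * r ^+ j <= z * r ^+ J / (r - 1).
Proof.
move=> z0 r1; elim: J => [|J IH].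
  by rewrite big_ord0 expr0 mulr1 divr_ge0// subr_ge0 ltW.
rewrite big_ord_recr/= exprSr.
have -> : z * (r ^+ J * r) / (r - 1) = z * r ^+ J / (r - 1) + z * r ^+ J.
  by field; lra.
by rewrite lerD2r.
Qed.

(** The last retained term is at most 1 and dominates the sum, so that the bound depends neither on
    [z] nor on [J]. *)
Lemma geo_low {R : realType} (z r : R) (J : nat) : 0 <= z -> 1 < r ->
  \sum_(j < J | z * r ^+ j <= 1) z * r ^+ j <= r / (r - 1).
Proof.
move=> z0 r1; have rp : 0 < r - 1 by lra.
elim: J => [|J IH]; first by rewrite big_ord0 divr_ge0; lra.
have [h|h] := leP (z * r ^+ J) 1; last first.
  by rewrite big_mkcond big_ord_recr/= (lt_geF h) addr0 -big_mkcond.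
apply: (@le_trans _ _ (\sum_(j < J.+1) z * r ^+ j)).
  rewrite big_mkcond/=; apply: ler_sum => i _; case: ifP => // _.
  by rewrite mulr_ge0// exprn_ge0; lra.
apply: le_trans (geo_sum_lt z r J.+1 z0 r1) _.
by rewrite ler_pM2r ?invr_gt0// exprSr mulrA; nra.
Qed.

Lemma geo_high {R : realType} (z r : R) (J : nat) : 0 < z -> 1 < r ->
  \sum_(j < J | 1 < z * r ^+ j) (z * r ^+ j)^-1 <= r / (r - 1).
Proof.
move=> z0 r1; have rp : 0 < r - 1 by lra.
have full y : 0 < y -> 1 < y -> forall K, \sum_(j < K) (y * r ^+ j)^-1 <= r / (r - 1).
  move=> y0 y1 K.
  have : \sum_(j < K) (y * r ^+ j)^-1 <= (r / (r - 1) - (y * r ^+ K)^-1 / (r - 1) * r).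
    elim: K => [|K IH].
      rewrite big_ord0 expr0 mulr1 subr_ge0 mulrAC ler_pM2r ?invr_gt0//.
      by rewrite ler_piMl ?invf_le1//; lra.
    rewrite big_ord_recr/= exprSr.
    have rn : r ^+ K != 0 by rewrite expf_neq0; lra.
    have -> : r / (r - 1) - (y * (r ^+ K * r))^-1 / (r - 1) * r =
       r / (r - 1) - (y * r ^+ K)^-1 / (r - 1) * r + (y * r ^+ K)^-1.
      by field; rewrite rn; apply/and3P; split; lra.
    by rewrite lerD2r.
  move=> h; apply: le_trans h _; rewrite gerBl mulr_ge0 ?divr_ge0 ?invr_ge0 ?mulr_ge0 ?exprn_ge0//; lra.
elim: J z z0 => [|J IH] z z0; first by rewrite big_ord0 divr_ge0; lra.
have [h|h] := ltP 1 z.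
  apply: le_trans (full z z0 h J.+1).
  rewrite big_mkcond/=; apply: ler_sum => i _; case: ifP => // _.
  by rewrite invr_ge0 mulr_ge0// ?exprn_ge0; lra.
rewrite big_mkcond big_ord_recl/= expr0 mulr1 (le_gtF h) add0r -big_mkcond/=.
have := IH (z * r); rewrite mulr_gt0; [move=> /(_ isT)|lra|lra].
apply: le_trans; rewrite le_eqVlt; apply/orP; left; apply/eqP.
by apply: eq_big => i; rewrite /bump/= add1n exprS mulrA.
Qed.

Definition geo_const {R : realType} (b e : R) : R := b `^ e / (b `^ e - 1).

Lemma powR_gt1 {R : realType} (b e : R) : 1 < b -> 0 < e -> 1 < b `^ e.
Proof.
move=> b1 e0; rewrite -(powRr0 b) /powR !ifF; [|by apply/eqP; lra|by apply/eqP; lra].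
by rewrite ltr_expR mul0r mulr_gt0// ln_gt0.
Qed.

Lemma geo_const_gt0 {R : realType} (b e : R) : 1 < b -> 0 < e -> 0 < geo_const b e.
Proof. by move=> b1 e0; have := powR_gt1 b e b1 e0 => h; rewrite /geo_const divr_gt0//; lra. Qed.

Lemma powR_le1 {R : realType} (y e : R) : 0 < y -> 0 < e -> (y `^ e <= 1) = (y <= 1).
Proof.
move=> y0 e0; apply/idP/idP => h.
  by rewrite leNgt; apply/negP => /powR_gt1/(_ e0); rewrite ltNge h.
by rewrite -(powRr0 y); apply: ger_powR => //; rewrite ?y0 ?h// ltW.
Qed.

Lemma powR_geo {R : realType} (z b e : R) (j : nat) : 0 < z -> 1 < b ->
  (z * b ^+ j) `^ e = z `^ e * (b `^ e) ^+ j.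
Proof.
move=> z0 b1; rewrite powRM ?exprn_ge0 ?ltW//; last lra.
congr (_ * _); rewrite -(@powR_mulrn _ b j); last lra.
have E := @powR_mulrn _ (b `^ e) j (powR_ge0 _ _).
by rewrite -E powRAC.
Qed.

(** Used with [z = l] and [b = 4] for the frequencies [n ~ 2 ^ j] on the two sides of
    [n ^ 2 * l = 1], and in [powR_interp_sum] with a threshold that depends on the terms
    themselves. *)
Lemma geo_low_pow {R : realType} (z b e : R) (J : nat) : 0 < z -> 1 < b -> 0 < e ->
  \sum_(j < J | z * b ^+ j <= 1) (z * b ^+ j) `^ e <= geo_const b e.
Proof.
move=> z0 b1 e0.
have := geo_low (z `^ e) (b `^ e) J (powR_ge0 _ _) (powR_gt1 b e b1 e0).
apply: le_trans; rewrite le_eqVlt; apply/orP; left; apply/eqP; apply: eq_big => i.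
  by rewrite -powR_geo// powR_le1// mulr_gt0// exprn_gt0//; lra.
by move=> _; rewrite powR_geo.
Qed.

Lemma geo_high_pow {R : realType} (z b e : R) (J : nat) : 0 < z -> 1 < b -> 0 < e ->
  \sum_(j < J | 1 < z * b ^+ j) (z * b ^+ j) `^ (- e) <= geo_const b e.
Proof.
move=> z0 b1 e0.
have := geo_high (z `^ e) (b `^ e) J (powR_gt0 _ z0) (powR_gt1 b e b1 e0).
apply: le_trans; rewrite le_eqVlt; apply/orP; left; apply/eqP; apply: eq_big => i.
  by rewrite -powR_geo// !ltNge powR_le1// mulr_gt0// exprn_gt0//; lra.
by move=> _; rewrite powRN powR_geo.
Qed.

(** * Power inequalities in place of Holder and Minkowski *)

Lemma powRrV {R : realType} (x e : R) : 0 <= x -> e != 0 -> (x `^ e) `^ e^-1 = x.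
Proof. by move=> x0 e0; rewrite -powRrM divff// powRr1. Qed.

Lemma powRVr {R : realType} (x e : R) : 0 <= x -> e != 0 -> (x `^ e^-1) `^ e = x.
Proof. by move=> x0 e0; rewrite -powRrM mulVf// powRr1. Qed.

Lemma ler_powR_inv {R : realType} (x y e : R) : 0 <= x -> 0 <= y -> 0 < e ->
  x `^ e <= y -> x <= y `^ e^-1.
Proof.
move=> x0 y0 e0 h; rewrite -(powRrV x e x0) ?gt_eqF//.
by apply: ge0_ler_powR => //; rewrite ?nnegrE ?powR_ge0// invr_ge0 ltW.
Qed.

Lemma ler_powR2r {R : realType} (x y e : R) : 0 <= x -> 0 <= e -> x <= y -> x `^ e <= y `^ e.
Proof.
by move=> x0 e0 h; apply: ge0_ler_powR => //; rewrite ?nnegrE//; exact: le_trans h.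
Qed.

Lemma ler_sum1 {R : realType} (J : nat) (a : nat -> R) (i : 'I_J) :
  (forall j, 0 <= a j) -> a i <= \sum_(j < J) a j.
Proof. by move=> a0; rewrite (bigD1 i)//= lerDl sumr_ge0. Qed.

(** If [M] is the sum on the right, every [a j] is at most [lam j * M ^ (1 / p)]. With weights that
    decay geometrically away from the dominant scale, the sum of [lam] is bounded uniformly in [J]
    and this replaces Minkowski. *)
Lemma sum_powR_weight {R : realType} (J : nat) (a lam : nat -> R) (p : R) : 0 < p ->
  (forall j, 0 <= a j) -> (forall j, 0 < lam j) ->
  (\sum_(j < J) a j) `^ p <=
  (\sum_(j < J) lam j) `^ p * \sum_(j < J) (a j / lam j) `^ p.
Proof.
move=> p0 a0 l0; set M := (X in _ <= _ * X).
have M0 : 0 <= M by rewrite sumr_ge0// => i _; rewrite powR_ge0.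
have h : \sum_(j < J) a j <= (\sum_(j < J) lam j) * M `^ p^-1.
  rewrite mulr_suml; apply: ler_sum => i _.
  rewrite mulrC -ler_pdivrMr//; apply: ler_powR_inv => //.
    by rewrite divr_ge0// ltW.
  apply: (@ler_sum1 R J (fun j => (a j / lam j) `^ p)) => j; exact: powR_ge0.
apply: le_trans (ler_powR2r _ _ p _ (ltW p0) h) _; first by rewrite sumr_ge0.
by rewrite powRM ?powR_ge0 ?sumr_ge0// => [|j _]; [rewrite powRVr ?gt_eqF|rewrite ltW].
Qed.

Lemma powR_addl {R : realType} (a b p : R) : 0 < p -> 0 <= a -> 0 <= b ->
  (a + b) `^ p <= 2 `^ p * (a `^ p + b `^ p).
Proof.
move=> p0 a0 b0.
wlog ab : a b a0 b0 / a <= b => [H|].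
  by have [/H->//|/ltW ba] := leP a b; rewrite addrC [X in _ * X]addrC; exact: H.
apply: le_trans (ler_powR2r _ (2 * b) p _ (ltW p0) _) _; [by rewrite addr_ge0|lra|].
by rewrite powRM//; apply: ler_wpM2l; rewrite ?powR_ge0// lerDr powR_ge0.
Qed.

(** One of the two terms on the right suffices, according to whether [t <= g] or [g < t]. Integrated
    over a set of measure 1 with a suitable [t], it compares the L^p and L^q norms without
    Holder. *)
Lemma powR_interp_le {R : realType} (t g p q : R) : 0 < t -> 0 <= g -> 0 < p -> p <= q ->
  t `^ (q - p) * g `^ p <= g `^ q + t `^ q.
Proof.
move=> t0 g0 p0 pq.
have [tg|gt] := leP t g.
  have g1 : 0 < g by lra.
  apply: (@le_trans _ _ (g `^ q)); last by rewrite lerDl powR_ge0.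
  have -> : g `^ q = g `^ (q - p) * g `^ p.
    by rewrite -powRD; [rewrite subrK|apply/implyP => _; rewrite gt_eqF].
  by apply: ler_wpM2r; rewrite ?powR_ge0//; apply: ler_powR2r; lra.
apply: (@le_trans _ _ (t `^ q)); last by rewrite lerDr powR_ge0.
have -> : t `^ q = t `^ (q - p) * t `^ p.
  by rewrite -powRD; [rewrite subrK|apply/implyP => _; rewrite gt_eqF].
by apply: ler_wpM2l; rewrite ?powR_ge0//; apply: ler_powR2r; lra.
Qed.

(** The last term dominates where [t <= g], the other one where [g < t]. Integrated, it bounds an
    L^p integral with [p <= 2] from below through the integrals with exponents 2 and 4. *)
Lemma powR_interp_ge {R : realType} (t g p : R) : 0 < t -> 0 <= g -> 0 < p -> p <= 2 ->
  g ^+ 2 <= t `^ (2 - p) * g `^ p + t ^- 2 * g ^+ 4.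
Proof.
move=> t0 g0 p0 pq.
have [tg|gt] := leP t g.
  apply: (@le_trans _ _ (t ^- 2 * g ^+ 4)); last by rewrite lerDr mulr_ge0 ?powR_ge0.
  rewrite mulrC ler_pdivlMr ?exprn_gt0//.
  have -> : g ^+ 4 = g ^+ 2 * g ^+ 2 by ring.
  by apply: ler_wpM2l; rewrite ?sqr_ge0// ler_pXn2r ?nnegrE// ltW.
apply: (@le_trans _ _ (t `^ (2 - p) * g `^ p)); last first.
  by rewrite lerDl mulr_ge0// ?exprn_ge0// invr_ge0 exprn_ge0// ltW.
have [->|gn0] := eqVneq g 0; first by rewrite expr0n/= mulr_ge0 ?powR_ge0.
have -> : g ^+ 2 = g `^ (2 - p) * g `^ p.
  by rewrite -powRD ?subrK ?powR_mulrn// gn0 implybT.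
by apply: ler_wpM2r; rewrite ?powR_ge0//; apply: ler_powR2r; lra.
Qed.

(** Jensen's inequality up to the factor [2 ^ p]. With [t] the mean, a term below [t / 2] is paid by
    [t ^ p / 2], and a larger one satisfies [t ^ (p - 1) * b j <= 2 ^ (p - 1) * b j ^ p]; after
    summation half of [t ^ p] remains on the left. *)
Lemma powR_mean {R : realType} (m : nat) (b : nat -> R) (p : R) : 1 <= p -> (0 < m)%N ->
  (forall j, 0 <= b j) ->
  ((\sum_(j < m) b j) / m%:R) `^ p <= 2 `^ p * ((\sum_(j < m) b j `^ p) / m%:R).
Proof.
move=> p1 m0 b0; set t := _ / _.
have mR : 0 < m%:R :> R by rewrite ltr0n.
have t0 : 0 <= t by rewrite divr_ge0 ?sumr_ge0// ltW.
have [->|tn0] := eqVneq t 0.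
  rewrite powR0; last by apply/eqP; lra.
  by rewrite mulr_ge0 ?powR_ge0// divr_ge0 ?(ltW mR)// sumr_ge0// => i _; exact: powR_ge0.
have tp : 0 < t by rewrite lt_neqAle eq_sym tn0.
have key j : t `^ (p - 1) * b j <= 2 `^ (p - 1) * b j `^ p + t `^ p / 2.
  have tE : t `^ p = t * t `^ (p - 1) by rewrite mulr_powRB1//; lra.
  have T0 := powR_ge0 t (p - 1).
  have B0 := powR_ge0 (b j) p.
  have C0 := powR_ge0 2 (p - 1) : 0 <= 2 `^ (p - 1) :> R.
  have [h|h] := leP (b j) (t / 2).
    have := ler_wpM2l T0 h; have := mulr_ge0 C0 B0; rewrite tE; lra.
  have bE : b j `^ p = b j * b j `^ (p - 1) by rewrite mulr_powRB1//; lra.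
  have h2 : t `^ (p - 1) <= 2 `^ (p - 1) * b j `^ (p - 1).
    by rewrite -powRM//; apply: ler_powR2r; lra.
  have := ler_wpM2r (b0 j) h2; rewrite tE bE; have := mulr_ge0 t0 T0; lra.
have hs : \sum_(j < m) (t `^ (p - 1) * b j) <= \sum_(j < m) (2 `^ (p - 1) * b j `^ p + t `^ p / 2).
  by apply: ler_sum => i _.
rewrite big_split/= -!mulr_sumr sumr_const card_ord in hs.
have sE : \sum_(j < m) b j = t * m%:R by rewrite /t divfK ?gt_eqF.
have tE : t `^ p = t * t `^ (p - 1) by rewrite mulr_powRB1//; lra.
have e2 : 2 `^ p = 2 * 2 `^ (p - 1) :> R by rewrite mulr_powRB1//; lra.
rewrite mulrA ler_pdivlMr// e2.
have hE : t `^ p * m%:R = t * t `^ (p - 1) * m%:R by rewrite tE.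
have hm : t `^ p * (2^-1 *+ m) = t `^ p * m%:R / 2 by rewrite -[X in _ * X]mulr_natr; ring.
by move: hs; rewrite hm sE; lra.
Qed.

(** Let [W] be the sum on the right and [M = W ^ (1 / p)]. Each of the two terms is at most [W], so
    [a j] is at most [M] times a positive power of [b ^ j / M], and also at most [M] times a
    negative one. The [a j] thus decay geometrically on both sides of [b ^ j = M], and their sum is
    of order [M]. No power of [J] is lost, although the dominant index depends on the [a j]; in the
    application it varies with [x]. *)
Lemma powR_interp_sum {R : realType} (b eta p : R) : 1 < b -> 0 < eta -> eta < p ->
  exists2 C : R, 0 < C & forall (J : nat) (a : nat -> R), (forall j, 0 <= a j) ->
  (\sum_(j < J) a j) `^ p <=
  C * \sum_(j < J) ((b `^ eta) ^+ j * a j `^ (p - eta) + (b `^ eta) ^- j * a j `^ (p + eta)).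
Proof.
move=> b1 e0 ep.
have p0 : 0 < p by lra.
have b0 : 0 < b by lra.
pose e1 := eta / (p + eta); pose e2 := eta / (p - eta).
have e10 : 0 < e1 by rewrite divr_gt0//; lra.
have e20 : 0 < e2 by rewrite divr_gt0//; lra.
pose C0 := geo_const b e1 + geo_const b e2.
have C00 : 0 < C0 by rewrite addr_gt0 ?geo_const_gt0.
exists (C0 `^ p); first exact: powR_gt0.
move=> J a a0; set W := (X in _ <= _ * X).
have tp j : 0 <= (b `^ eta) ^+ j * a j `^ (p - eta) + (b `^ eta) ^- j * a j `^ (p + eta).
  by rewrite addr_ge0// mulr_ge0 ?powR_ge0// ?invr_ge0 exprn_ge0// powR_ge0.
have W0 : 0 <= W by rewrite sumr_ge0// => i _; exact: tp.
have bj j : 0 < b ^+ j by exact: exprn_gt0.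
have Bj j : 0 < (b `^ eta) ^+ j by rewrite exprn_gt0// powR_gt0.
have BE j : (b `^ eta) ^+ j = (b ^+ j) `^ eta.
  by have := powR_geo 1 b eta j ltr01 b1; rewrite !mul1r powR1 mul1r.
have h1 (j : 'I_J) : (b `^ eta) ^+ j * a j `^ (p - eta) <= W.
  have := @ler_sum1 R J _ j tp; apply: le_trans; rewrite lerDl.
  by rewrite mulr_ge0 ?powR_ge0 ?invr_ge0// ltW.
have h2 (j : 'I_J) : (b `^ eta) ^- j * a j `^ (p + eta) <= W.
  have := @ler_sum1 R J _ j tp; apply: le_trans; rewrite lerDr.
  by rewrite mulr_ge0 ?powR_ge0// ltW.
have [W00|Wn0] := eqVneq W 0.
  have az (j : 'I_J) : a j = 0.
    have := h1 j; rewrite W00 pmulr_rle0// => h.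
    apply: (@powR_eq0_eq0 _ _ (p - eta)); apply/eqP.
    by rewrite eq_le h powR_ge0.
  by rewrite big1 ?W00 ?mulr0 ?powR0 ?gt_eqF// => j _; exact: az.
have Wp : 0 < W by rewrite lt_neqAle eq_sym Wn0.
pose M := W `^ p^-1.
have M0 : 0 < M by exact: powR_gt0.
have WE : W = M `^ p by rewrite /M powRVr// gt_eqF.
have key : \sum_(j < J) a j <= M * C0.
  have -> : M * C0 = M * geo_const b e1 + M * geo_const b e2 by rewrite /C0 mulrDr.
  rewrite (bigID (fun j : 'I_J => M^-1 * b ^+ j <= 1))/=.
  apply: lerD.
    apply: le_trans (ler_wpM2l (ltW M0) (geo_low_pow M^-1 b e1 J _ b1 e10)); last by rewrite invr_gt0.
    rewrite mulr_sumr; apply: ler_sum => j _.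
    have hh : a j `^ (p + eta) <= M `^ (p + eta) * (M^-1 * b ^+ j) `^ eta.
      have := h2 j; rewrite mulrC ler_pdivrMr// => /le_trans; apply.
      rewrite WE BE powRM ?invr_ge0 ?(ltW M0) ?(ltW (bj _))//.
      rewrite mulrA ler_wpM2r ?powR_ge0//.
      rewrite -(powR_inv1 (ltW M0)) -powRrM -powRD; last by rewrite (gt_eqF M0) implybT.
      by rewrite le_eqVlt; apply/orP; left; apply/eqP; congr (powR _ _); ring.
    have pe : 0 < p + eta by lra.
    have := ler_powR_inv _ _ _ (a0 j) _ pe hh.
    rewrite mulr_ge0 ?powR_ge0// => /(_ isT) /le_trans; apply.
    rewrite powRM ?powR_ge0// powRrV ?(ltW M0) ?gt_eqF//.
    by rewrite -powRrM.
  apply: le_trans (ler_wpM2l (ltW M0) (geo_high_pow M^-1 b e2 J _ b1 e20)); last by rewrite invr_gt0.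
  rewrite mulr_sumr [leLHS]big_mkcond [leRHS]big_mkcond/=; apply: ler_sum => j _.
  rewrite -ltNge; case: ifP => // _.
  have hh : a j `^ (p - eta) <= M `^ (p - eta) * (M^-1 * b ^+ j) `^ (- eta).
    have := h1 j; rewrite mulrC -ler_pdivlMr// => /le_trans; apply.
    rewrite WE BE powRM ?invr_ge0 ?(ltW M0) ?(ltW (bj _))//.
    rewrite mulrA (powRN (b ^+ j)) ler_wpM2r ?invr_ge0 ?powR_ge0//.
    rewrite -(powR_inv1 (ltW M0)) -powRrM -powRD; last by rewrite (gt_eqF M0) implybT.
    by rewrite le_eqVlt; apply/orP; left; apply/eqP; congr (powR _ _); ring.
  have pe : 0 < p - eta by lra.
  have := ler_powR_inv _ _ _ (a0 j) _ pe hh.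
  rewrite mulr_ge0 ?powR_ge0// => /(_ isT) /le_trans; apply.
  rewrite powRM ?powR_ge0// powRrV ?(ltW M0) ?gt_eqF//.
  by rewrite -powRrM mulNr.
apply: le_trans (ler_powR2r _ _ p _ (ltW p0) key) _; first by rewrite sumr_ge0.
by rewrite powRM ?(ltW M0) ?(ltW C00)// -WE mulrC.
Qed.

Local Open Scope classical_set_scope.

(** * Integrals over a period *)

(** Extended real value, so that nonnegative measurable integrands need no integrability. *)
Definition Ig {R : realType} (g : R -> R) : \bar R :=
  (\int[lebesgue_measure]_(x in `[(0:R)%R, (1:R)%R]) (g x)%:E)%E.

Lemma measurable_addr {R : realType} (t : R) :
  measurable_fun [set: measurableTypeR R] (fun x : measurableTypeR R => (x + t : measurableTypeR R)).
Proof. exact: measurable_funD. Qed.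

Lemma preimage_addr_oc {R : realType} (t a b : R) :
  (fun x : R => x + t) @^-1` `]a, b] = `]a - t, b - t].
Proof.
by apply/seteqP; split => x /=; rewrite !in_itv/= ltrBlDr lerBrDr.
Qed.

Lemma lebesgue_shift {R : realType} (t : R) (A : set R) : measurable A ->
  pushforward lebesgue_measure ((fun x => x + t) : _ -> measurableTypeR R) A = lebesgue_measure A.
Proof.
move=> mA; apply/esym/lebesgue_measure_unique => //=.
  exact: measurable_addr.
move=> mf _ [[a b]] _ <-.
rewrite /pushforward/= preimage_addr_oc !lebesgue_measure_itv/=.
rewrite !lte_fin ltrD2r; case: ifP => // _.
by rewrite -!EFinB; congr (_%:E); ring.
Qed.

Lemma integral_shift_oc {R : realType} (t a b : R) (f : R -> \bar R) :
  measurable_fun [set: R] f -> (forall x, 0 <= f x)%E ->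
  (\int[lebesgue_measure]_(x in `](a:R), b]) f x = \int[lebesgue_measure]_(x in `](a - t)%R, (b - t)%R]) f (x + t)%R)%E.
Proof.
move=> mf f0.
rewrite -(preimage_addr_oc t a b).
rewrite -(@ge0_integral_pushforward _ _ _ _ _ _ (measurable_addr t))//=; last exact: measurable_funS mf.
apply: eq_measure_integral => //=; first exact: measurable_addr.
by move=> mf' A mA _; exact/esym/lebesgue_shift.
Qed.

Lemma Ig_oc {R : realType} (g : R -> R) : measurable_fun setT g ->
  Ig g = (\int[lebesgue_measure]_(x in `](0:R)%R, (1:R)%R]) (g x)%:E)%E.
Proof.
move=> mg; rewrite /Ig -integral_itv_obnd_cbnd//.
by apply/measurable_EFinP; exact: measurable_funS mg.
Qed.

Lemma measurable_shift {R : realType} (g : R -> R) (t : R) : measurable_fun setT g ->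
  measurable_fun setT (fun x : R => g (x + t)).
Proof. by move=> mg; apply: (measurableT_comp mg); exact: measurable_addr. Qed.

(** Half-open intervals make the pieces match exactly: []0, 1 - t]] is carried to []t, 1]], and []1
    - t, 1]] is carried by periodicity to []0, t]]. *)
Lemma Ig_shift {R : realType} (g : R -> R) (t : R) : measurable_fun setT g ->
  (forall x, 0 <= g x) -> (forall x, g (x + 1) = g x) -> 0 <= t <= 1 ->
  Ig (fun x : R => g (x + t)) = Ig g.
Proof.
move=> mg g0 pg /andP[t0 t1].
have mG : measurable_fun setT (EFin \o g) by exact/measurable_EFinP.
have mGt s : measurable_fun setT (fun x : R => (g (x + s))%:E).
  by apply/measurable_EFinP; exact: measurable_shift.
rewrite !Ig_oc//; last exact: measurable_shift.
have sp (h : R -> \bar R) (a b c : R) : measurable_fun setT h -> (forall x, 0 <= h x)%E ->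
    a <= b -> b <= c ->
    (\int[lebesgue_measure]_(x in `]a, c]) h x =
     \int[lebesgue_measure]_(x in `]a, b]) h x + \int[lebesgue_measure]_(x in `]b, c]) h x)%E.
  move=> mh h0 ab bc.
  have -> : `]a, c] = `]a, b] `|` `]b, c] :> set R.
    by rewrite -itv_bndbnd_setU// bnd_simp.
  rewrite ge0_integral_setU//.
  - exact: measurable_funS mh.
  - apply/disj_setPLR => x /=; rewrite !in_itv/= => /andP[_ xb] /andP[bx _].
    by move: (lt_le_trans bx xb); rewrite ltxx.
rewrite (sp _ 0 (1 - t) 1 (mGt t)); [|by move=> x; rewrite lee_fin|lra|lra].
rewrite (sp _ 0 t 1 mG); [|by move=> x; rewrite lee_fin|lra|lra].
rewrite addeC; congr (_ + _)%E.
  rewrite (integral_shift_oc (1 - t))//; last by move=> x; rewrite lee_fin.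
  rewrite subrr opprB addrC subrK.
  by apply: eq_integral => x _; congr (_%:E); rewrite -addrA subrK pg.
rewrite (integral_shift_oc t t 1)//.
by rewrite subrr.
Qed.

(** * Orthogonality of the exponentials *)

Lemma Int_cos {R : realType} (w th : R) : w != 0 ->
  (\int[lebesgue_measure]_(x in `[(0:R)%R, (1:R)%R]) (cos (w * x + th))%:E)%E = (w^-1 * (sin (w + th) - sin th))%:E.
Proof.
move=> w0.
have h (x : R) : is_derive x (1:R) (fun x : R => w^-1 * sin (w * x + th)) (cos (w * x + th)).
  have h1 : is_derive x (1:R) (fun x : R => w * x + th) w.
    by apply: is_derive_eq; rewrite ?scaler0 ?addr0 ?scaler1.
  have h2 := @is_derive1_comp R sin (fun x : R => w * x + th) x _ _ (is_derive_sin _) h1.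
  have h3 := @is_deriveZ _ _ _ (sin \o (fun x : R => w * x + th)) w^-1 x 1 _ h2.
  apply: is_derive_eq h3 _.
  by rewrite /GRing.scale/= mulrCA mulVf// mulr1.
have cF : continuous (fun x : R => w^-1 * sin (w * x + th)).
  by move=> x; apply/differentiable_continuous/derivable1_diffP; case: (h x).
rewrite (@continuous_FTC2 _ _ (fun x : R => w^-1 * sin (w * x + th)))//.
- by rewrite mulr1 mulr0 add0r -EFinB mulrBr.
- apply: continuous_subspaceT => x.
  apply: continuous_comp; last exact: continuous_cos.
  by apply: cvgD; [apply: cvgM; [exact: cvg_cst|exact: cvg_id]|exact: cvg_cst].
- split.
  + by move=> x _; case: (h x).
  + exact/cvg_at_right_filter/cF.
  + exact/cvg_at_left_filter/cF.
- by move=> x _; rewrite derive1E derive_val.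
Qed.

(** Real-valued counterpart of [Ig], for continuous integrands of any sign. *)
Definition Int {R : realType} (g : R -> R) : R :=
  Rintegral lebesgue_measure `[(0:R), (1:R)]%classic g.

Lemma continuous_sum {R : realType} (I : Type) (r : seq I) (f : I -> R -> R) :
  (forall i, continuous (f i)) -> continuous (fun x => \sum_(i <- r) f i x).
Proof.
move=> cf; elim: r => [|i r IH].
  have -> : (fun x => \sum_(i <- [::]) f i x) = (fun=> 0 : R).
    by apply/funext => x; rewrite big_nil.
  exact: cst_continuous.
have -> : (fun x => \sum_(i <- (i :: r)) f i x) = (fun x => f i x + \sum_(i <- r) f i x).
  by apply/funext => x; rewrite big_cons.
by move=> x; apply: cvgD; [exact: cf|exact: IH].
Qed.

Lemma continuous_mul {R : realType} (f g : R -> R) :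
  continuous f -> continuous g -> continuous (fun x => f x * g x).
Proof. by move=> cf cg x; apply: cvgM; [exact: cf|exact: cg]. Qed.

Lemma continuous_add {R : realType} (f g : R -> R) :
  continuous f -> continuous g -> continuous (fun x => f x + g x).
Proof. by move=> cf cg x; apply: cvgD; [exact: cf|exact: cg]. Qed.

Lemma continuous_affine {R : realType} (w th : R) : continuous (fun x : R => w * x + th).
Proof.
by move=> x; apply: cvgD; [apply: cvgM; [exact: cvg_cst|exact: cvg_id]|exact: cvg_cst].
Qed.

Lemma continuous_cos_affine {R : realType} (w th : R) : continuous (fun x : R => cos (w * x + th)).
Proof.
by move=> x; apply: continuous_comp; [exact: continuous_affine|exact: continuous_cos].
Qed.

Lemma continuous_cosM {R : realType} (w : R) : continuous (fun x : R => cos (w * x)).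
Proof.
by have := continuous_cos_affine w 0; under eq_fun do rewrite addr0.
Qed.

Lemma continuous_sinM {R : realType} (w : R) : continuous (fun x : R => sin (w * x)).
Proof.
move=> x; apply: (@continuous_comp _ _ _ (fun x : R => w * x) sin); last exact: continuous_sin.
by have := continuous_affine w 0; under eq_fun do rewrite addr0; apply.
Qed.

Lemma continuous_integrable01 {R : realType} (g : R -> R) : continuous g ->
  lebesgue_measure.-integrable `[(0:R), (1:R)]%classic (EFin \o g).
Proof.
move=> cg; apply: continuous_compact_integrable; first exact: segment_compact.
exact: continuous_subspaceT.
Qed.

Lemma Int_Ig {R : realType} (g : R -> R) : continuous g -> Ig g = (Int g)%:E.
Proof.
move=> cg; rewrite /Ig /Int /Rintegral fineK//.
exact: integrable_fin_num (continuous_integrable01 g cg).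
Qed.

Lemma IntD {R : realType} (f g : R -> R) : continuous f -> continuous g ->
  Int (fun x => f x + g x) = Int f + Int g.
Proof.
by move=> cf cg; rewrite /Int RintegralD//; exact: continuous_integrable01.
Qed.

Lemma IntZ {R : realType} (c : R) (f : R -> R) : continuous f ->
  Int (fun x => c * f x) = c * Int f.
Proof.
by move=> cf; rewrite /Int RintegralZl//; exact: continuous_integrable01.
Qed.

Lemma Int_sum {R : realType} (I : Type) (r : seq I) (f : I -> R -> R) :
  (forall i, continuous (f i)) ->
  Int (fun x => \sum_(i <- r) f i x) = \sum_(i <- r) Int (f i).
Proof.
move=> cf; elim: r => [|i r IH].
  rewrite big_nil; have -> : (fun x => \sum_(i <- [::]) f i x) = (fun=> 0 : R).
    by apply/funext => x; rewrite big_nil.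
  by rewrite /Int Rintegral_cst// mul0r.
have -> : (fun x => \sum_(i <- (i :: r)) f i x) = (fun x => f i x + \sum_(i <- r) f i x).
  by apply/funext => x; rewrite big_cons.
by rewrite big_cons IntD ?IH//; exact: continuous_sum.
Qed.

Lemma Int_cos_freq {R : realType} (a b : nat) (th : R) :
  Int (fun x => cos (2 * pi * (a%:R - b%:R) * x + th)) = (a == b)%:R * cos th.
Proof.
have [->|ab] := eqVneq a b.
  rewrite subrr mulr0; under [X in Int X]eq_fun do rewrite mul0r add0r.
  rewrite /Int Rintegral_cst//= lebesgue_measure_itv/= lte_fin ltr01 oppr0 adde0/=.
  by rewrite mul1r mulr1.
rewrite mul0r; set w := 2 * pi * _.
have w0 : w != 0.
  rewrite /w mulf_neq0//; last by rewrite subr_eq0 eqr_nat.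
  by rewrite mulf_neq0// gt_eqF// pi_gt0.
have -> : Int (fun x => cos (w * x + th)) = w^-1 * (sin (w + th) - sin th).
  rewrite /Int /Rintegral Int_cos//.
have -> : sin (w + th) = sin th; last by rewrite subrr mulr0.
rewrite -(sinDn (w + th) b) -[RHS](sinDn th a); congr sin; rewrite /w; ring.
Qed.

(* [GT I c k x] is the squared modulus of the sum of the [c i * e(k i * x)]. *)
Definition GC {R : realType} (I : finType) (c : I -> R) (k : I -> nat) (x : R) : R :=
  \sum_i c i * cos (2 * pi * (k i)%:R * x).
Definition GS {R : realType} (I : finType) (c : I -> R) (k : I -> nat) (x : R) : R :=
  \sum_i c i * sin (2 * pi * (k i)%:R * x).
Definition GT {R : realType} (I : finType) (c : I -> R) (k : I -> nat) (x : R) : R :=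
  GC I c k x ^+ 2 + GS I c k x ^+ 2.

Lemma GTE {R : realType} (I : finType) (c : I -> R) (k : I -> nat) (x : R) :
  GT I c k x = \sum_i \sum_j c i * c j * cos (2 * pi * ((k i)%:R - (k j)%:R) * x).
Proof.
rewrite /GT /GC /GS !expr2 !mulr_suml -big_split/=; apply: eq_bigr => i _.
rewrite !mulr_sumr -big_split/=; apply: eq_bigr => j _.
have -> : 2 * pi * ((k i)%:R - (k j)%:R) * x =
  2 * pi * (k i)%:R * x - 2 * pi * (k j)%:R * x by ring.
by rewrite cosB; ring.
Qed.

Lemma GT_ge0 {R : realType} (I : finType) (c : I -> R) (k : I -> nat) (x : R) :
  0 <= GT I c k x.
Proof. by rewrite /GT addr_ge0// sqr_ge0. Qed.

Lemma continuous_GC {R : realType} (I : finType) (c : I -> R) (k : I -> nat) :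
  continuous (GC I c k).
Proof.
apply: continuous_sum => i; apply: continuous_mul; first exact: cst_continuous.
exact: continuous_cosM.
Qed.

Lemma continuous_GS {R : realType} (I : finType) (c : I -> R) (k : I -> nat) :
  continuous (GS I c k).
Proof.
apply: continuous_sum => i; apply: continuous_mul; first exact: cst_continuous.
exact: continuous_sinM.
Qed.

Lemma continuous_GT {R : realType} (I : finType) (c : I -> R) (k : I -> nat) :
  continuous (GT I c k).
Proof.
rewrite /GT; under eq_fun do rewrite !expr2.
apply: continuous_add; apply: continuous_mul; solve [exact: continuous_GC|exact: continuous_GS].
Qed.

(** Parseval without injectivity of [k]: coinciding frequencies stay in the formula, which then
    counts the solutions of equations. *)
Lemma Int_GT {R : realType} (I : finType) (c : I -> R) (k : I -> nat) :
  Int (GT I c k) = \sum_i \sum_j c i * c j * (k i == k j)%:R.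
Proof.
have cc (w : R) (a : R) : continuous (fun x => a * cos (w * x)).
  by apply: continuous_mul; [exact: cst_continuous|exact: continuous_cosM].
have -> : GT I c k = (fun x => \sum_i \sum_j c i * c j * cos (2 * pi * ((k i)%:R - (k j)%:R) * x)).
  by apply/funext => x; exact: GTE.
rewrite Int_sum => [|i]; last by apply: continuous_sum => j; exact: cc.
apply: eq_bigr => i _; rewrite Int_sum => [|j]; last exact: cc.
apply: eq_bigr => j _; rewrite IntZ; last exact: continuous_cosM.
have := @Int_cos_freq R (k i) (k j) 0; under [X in Int X]eq_fun do rewrite addr0.
by move=> ->; rewrite cos0 mulr1.
Qed.

(** The square of an exponential sum is the exponential sum over pairs of indices. Combined with
    [Int_GT] it evaluates fourth moments. *)
Lemma GT_sqr {R : realType} (I : finType) (c : I -> R) (k : I -> nat) (x : R) :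
  GT (I * I)%type (fun i => c i.1 * c i.2) (fun i => k i.1 + k i.2)%N x = GT I c k x ^+ 2.
Proof.
have E (i : I * I) : 2 * pi * (k i.1 + k i.2)%:R * x =
    2 * pi * (k i.1)%:R * x + 2 * pi * (k i.2)%:R * x by rewrite natrD; ring.
have C : GC (I * I)%type (fun i => c i.1 * c i.2) (fun i => k i.1 + k i.2)%N x =
    GC I c k x ^+ 2 - GS I c k x ^+ 2.
  rewrite /GC /GS !expr2 !mulr_suml -sumrB.
  under [RHS]eq_bigr do rewrite !mulr_sumr -sumrB.
  rewrite pair_bigA; apply: eq_bigr => i _; rewrite E cosD; ring.
have S : GS (I * I)%type (fun i => c i.1 * c i.2) (fun i => k i.1 + k i.2)%N x =
    GC I c k x * GS I c k x + GS I c k x * GC I c k x.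
  rewrite /GC /GS !mulr_suml -big_split/=.
  under [RHS]eq_bigr do rewrite !mulr_sumr -big_split/=.
  rewrite pair_bigA; apply: eq_bigr => i _; rewrite E sinD; ring.
by rewrite {1}/GT C S /GT; ring.
Qed.

Local Close Scope classical_set_scope.

(** * Weyl's inequality *)

Definition D2 {R : realType} (w : nat -> R) (n : nat) : R := w n.+2 - 2 * w n.+1 + w n.

(** The size conditions of a smooth bump of height [A] at scale [N]. The second difference is
    controlled only in sum, which admits piecewise linear windows, whose second difference sits at
    the corners. *)
Definition bumpw {R : realType} (N : nat) (A : R) (w : nat -> R) : Prop :=
  [/\ w 0%N = 0, (forall n, (2 * N <= n)%N -> w n = 0), (forall n, `|w n| <= A),
      (forall n, `|w n.+1 - w n| <= A / N%:R)
    & \sum_(n < 2 * N) `|D2 w n| <= A / N%:R].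

(* The squared modulus of the sum of [c n * e(n ^ 2 * x)] over [n < L]. *)
Definition T2 {R : realType} (c : nat -> R) (L : nat) (x : R) : R :=
  GT 'I_L (fun n => c n) (fun n => n ^ 2)%N x.

(** Two summations by parts: the second difference of a cosine sequence with step [d] is that
    sequence times [2 * cos d - 2]. The last group collects the boundary terms at [L]. *)
Lemma cos_second_difference {R : realType} (v : nat -> R) (L : nat) (d th : R) : v 0%N = 0 ->
  \sum_(n < L) D2 v n * cos (n.+1%:R * d + th) + v 1%N * cos th =
  (2 * cos d - 2) * (\sum_(n < L) v n * cos (n%:R * d + th)) +
  (v L.+1 * cos (L%:R * d + th) + v L * cos ((L%:R - 1) * d + th)
     - 2 * v L * cos (L%:R * d + th)).
Proof.
move=> v0; elim: L => [|L IH].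
  have e : 0%:R * d + th = th by rewrite mul0r add0r.
  by rewrite !big_ord0 v0 e; ring.
rewrite !big_ord_recr/= addrAC IH mulrDr /D2.
have e1 : L.+1%:R * d + th = (L%:R * d + th) + d by rewrite -natr1; ring.
have e2 : (L%:R - 1) * d + th = (L%:R * d + th) - d by ring.
have e3 : (L.+1%:R - 1) * d + th = L%:R * d + th by rewrite -natr1; ring.
rewrite e1 e2 e3; set X := L%:R * d + th.
by rewrite (cosD X d) (cosB X d); ring.
Qed.

(** The term [v 1] is the second difference centred at 0 of [v] extended by 0 to the left. Two
    summations rather than one yield an inverse square of the sine, which is summable over residues
    without a logarithm. *)
Lemma cos_sum_bound {R : realType} (v : nat -> R) (L : nat) (d th : R) : v 0%N = 0 ->
  (forall n, (L <= n)%N -> v n = 0) ->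
  `|\sum_(n < L) v n * cos (n%:R * d + th)| * (4 * sin (d / 2) ^+ 2) <=
  \sum_(n < L) `|D2 v n| + `|v 1%N|.
Proof.
move=> v0 vL; have := cos_second_difference v L d th v0.
have -> : v L.+1 = 0 by apply: vL; exact: leqnSn.
have -> : v L = 0 by apply: vL.
rewrite !(mul0r, mulr0, subr0, addr0) => E.
have -> : 4 * sin (d / 2) ^+ 2 = `|2 * cos d - 2|.
  have := one_sub_cos d; have := cos_le1 d => h1 h2.
  by rewrite ler0_norm; lra.
rewrite mulrC -normrM -E; apply: le_trans (ler_normD _ _) _; apply: lerD.
  apply: le_trans (ler_norm_sum _ _ _) _; apply: ler_sum => i _.
  by rewrite normrM ler_piMr// cos_max.
by rewrite normrM ler_piMr// cos_max.
Qed.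

Lemma D2M {R : realType} (f g : nat -> R) (n : nat) :
  D2 (fun n => f n * g n) n = D2 f n * g n.+1 + f n.+1 * D2 g n +
   (f n.+2 - f n.+1) * (g n.+2 - g n.+1) + (f n.+1 - f n) * (g n.+1 - g n).
Proof. by rewrite /D2; ring. Qed.

Lemma bumpw_ge0 {R : realType} (N : nat) (A : R) (w : nat -> R) : bumpw N A w -> 0 <= A.
Proof. by case=> _ _ /(_ 0%N) + _ _; apply: le_trans. Qed.

(** By the Leibniz rule for [D2]. The constant is [7 = 1 + 1 + 4 + 1]: a second difference on either
    factor, two products of first differences over [2 * N] indices, and the boundary term. *)
Lemma bump_corr {R : realType} (N : nat) (A : R) (w : nat -> R) (h : nat) :
  (0 < N)%N -> bumpw N A w ->
  \sum_(n < 2 * N) `|D2 (fun n => w n * w (n + h)%N) n| + `|w 1%N * w (1 + h)%N| <= 7 * A ^+ 2 / N%:R.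
Proof.
move=> N0 bw; have A0 := bumpw_ge0 _ _ _ bw; case: bw => w0 wL wA w1 w2.
have NR : 0 < N%:R :> R by rewrite ltr0n.
have AN : 0 <= A / N%:R by rewrite divr_ge0// ltW.
have hM (a b c d : R) : `|a| <= c -> `|b| <= d -> `|a * b| <= c * d.
  by move=> *; rewrite normrM ler_pM.
have s2 : \sum_(n < 2 * N) `|D2 (fun n => w (n + h)%N) n| <= A / N%:R.
  apply: le_trans w2; pose F n := `|D2 w n|.
  have FL n : (2 * N <= n)%N -> F n = 0.
    by move=> h'; rewrite /F /D2 !wL ?normr0 ?subr0 ?mulr0 ?addr0 ?subr0 ?normr0//; lia.
  rewrite -(big_mkord xpredT (fun n => F (n + h)%N)) -(big_mkord xpredT F).
  have -> : \sum_(0 <= i < 2 * N) F (i + h)%N = \sum_(h <= i < 2 * N + h) F i.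
    by rewrite -{2}(add0n h) big_addn addnK.
  have [hL|hL] := leqP h (2 * N).
    rewrite (big_cat_nat hL)//=; last lia.
    rewrite [X in _ + X]big_nat_cond [X in _ + X]big1 ?addr0; last by move=> i; rewrite andbT => /andP[/FL].
    rewrite [leRHS](big_cat_nat (n := h))//= lerDr.
    by apply: sumr_ge0 => i _; exact: normr_ge0.
  rewrite [leLHS]big_nat_cond [leLHS]big1; first by apply: sumr_ge0 => i _; exact: normr_ge0.
  by move=> i /andP[/andP[hi _] _]; apply: FL; lia.
have key : \sum_(n < 2 * N) `|D2 (fun n => w n * w (n + h)%N) n| <=
    \sum_(n < 2 * N) (`|D2 w n| * A + A * `|D2 (fun n => w (n + h)%N) n| + 2 * (A / N%:R * (A / N%:R))).
  apply: ler_sum => i _; rewrite D2M.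
  apply: le_trans (ler_normD _ _) _; rewrite (mulr_natl _ 2) mulr2n addrA; apply: lerD; last first.
    by apply: hM; [exact: w1|rewrite addSn; exact: w1].
  apply: le_trans (ler_normD _ _) _; apply: lerD; last first.
    by apply: hM; [exact: w1|rewrite !addSn; exact: w1].
  apply: le_trans (ler_normD _ _) _; apply: lerD; rewrite normrM.
    by apply: ler_wpM2l => //; exact: wA.
  by apply: ler_wpM2r => //; exact: wA.
rewrite !big_split/= -mulr_suml -mulr_sumr sumr_const card_ord in key.
have k1 := ler_wpM2r A0 w2.
have k2 := ler_wpM2l A0 s2.
have k3 : `|w 1%N * w (1 + h)%N| <= A / N%:R * A.
  by apply: hM; [have := w1 0%N; rewrite w0 subr0|exact: wA].
have k4 : 2 * (A / N%:R * (A / N%:R)) *+ (2 * N) = 4 * (A ^+ 2 / N%:R).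
  by rewrite -mulr_natr natrM; field; rewrite gt_eqF.
rewrite k4 in key.
have e : 7 * A ^+ 2 / N%:R = 7 * (A * (A / N%:R)) by field; rewrite gt_eqF.
have e2 : A ^+ 2 / N%:R = A * (A / N%:R) by field; rewrite gt_eqF.
rewrite e; rewrite e2 in key; lra.
Qed.

Lemma sum_sym_shift {R : realType} (F : nat -> nat -> R) (L : nat) :
  (forall i j, F i j = F j i) -> (forall i j, (L <= j)%N -> F i j = 0) ->
  \sum_(i < L) \sum_(j < L) F i j =
  \sum_(i < L) F i i + 2 * \sum_(1 <= h < L) \sum_(n < L) F n (n + h)%N.
Proof.
move=> Fs FL.
have up i : (i < L)%N -> \sum_(j < L | (i < j)%N) F i j = \sum_(1 <= h < L) F i (i + h)%N.
  move=> iL; rewrite -(big_mkord (fun j => i < j)%N (fun j => F i j)).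
  rewrite (@big_cat_nat _ _ _ i.+1)//=.
  rewrite [X in X + _]big_nat_cond [X in X + _]big1 ?add0r; last first.
    by move=> j /andP[/andP[_ h1] h2]; lia.
  have -> : \sum_(i.+1 <= j < L | (i < j)%N) F i j = \sum_(1 + i <= j < L) F i j.
    by rewrite add1n big_nat_cond [RHS]big_nat_cond; apply: eq_bigl => j; lia.
  rewrite big_addn [RHS](@big_cat_nat _ _ _ (L - i)%N)//=; [|lia|lia].
  rewrite [X in _ = _ + X]big_nat_cond [X in _ = _ + X]big1 ?addr0.
    by apply: eq_bigr => h _; rewrite addnC.
  by move=> h /andP[/andP[h1 _] _]; apply: FL; lia.
pose U := \sum_(i < L) \sum_(j < L | (i < j)%N) F i j.
have UE : U = \sum_(1 <= h < L) \sum_(n < L) F n (n + h)%N.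
  by rewrite exchange_big/=; apply: eq_bigr => i _; rewrite up.
have VE : \sum_(i < L) \sum_(j < L | (j < i)%N) F i j = U.
  rewrite /U; under eq_bigr do rewrite big_mkcond.
  under [RHS]eq_bigr do rewrite big_mkcond.
  rewrite exchange_big/=; apply: eq_bigr => i _; apply: eq_bigr => j _.
  by rewrite Fs.
rewrite -UE mulr_natl mulr2n -{1}VE -!big_split/=; apply: eq_bigr => i _.
rewrite (bigID (fun j : 'I_L => (j < i)%N))/= addrC.
rewrite (bigD1 i)/= ?ltnn// -addrA [X in _ + X]addrC; congr (_ + (_ + _)).
by apply: eq_bigl => j; rewrite -leqNgt [in RHS]ltn_neqAle andbC eq_sym.
Qed.

(** Weyl differencing: in the correlation of shift [h] the phase is linear in [n] with step
    proportional to [h * (2 * x)]. This is why rational approximations of [2 * x], not of [x], are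
    used. *)
Lemma T2_corr {R : realType} (w : nat -> R) (L : nat) (x : R) :
  (forall n, (L <= n)%N -> w n = 0) ->
  T2 w L x = \sum_(n < L) w n ^+ 2 + 2 * \sum_(1 <= h < L)
    \sum_(n < L) (w n * w (n + h)%N) * cos (n%:R * (2 * pi * (h%:R * (2 * x))) + 2 * pi * (h ^ 2)%:R * x).
Proof.
move=> wL; rewrite /T2 GTE.
rewrite (sum_sym_shift (fun i j => w i * w j * cos (2 * pi * ((i ^ 2)%:R - (j ^ 2)%:R) * x))).
- congr (_ + _ * _).
    apply: eq_bigr => i _.
    have -> : 2 * pi * ((i ^ 2)%:R - (i ^ 2)%:R) * x = 0 by ring.
    by rewrite cos0 mulr1.
  apply: eq_bigr => h _; apply: eq_bigr => n _; congr (_ * _).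
  rewrite -cosN; congr cos; rewrite !natrX natrD; ring.
- move=> i j; rewrite -[in RHS]cosN (mulrC (w j)); congr (_ * cos _); ring.
- by move=> i j h; rewrite (wL j h) mulr0 mul0r.
Qed.

Lemma sin_corr_bound {R : realType} (w : nat -> R) (N : nat) (A x : R) (h : nat) :
  (0 < N)%N -> bumpw N A w ->
  `|\sum_(n < 2 * N) (w n * w (n + h)%N) *
      cos (n%:R * (2 * pi * (h%:R * (2 * x))) + 2 * pi * (h ^ 2)%:R * x)|
    * (4 * sin (pi * (h%:R * (2 * x))) ^+ 2) <= 7 * A ^+ 2 / N%:R.
Proof.
move=> N0 bw; have := bump_corr _ _ _ h N0 bw; case: bw => w0 wL wA w1 w2.
apply: le_trans.
have -> : pi * (h%:R * (2 * x)) = (2 * pi * (h%:R * (2 * x))) / 2 by field.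
apply: (cos_sum_bound (fun n => w n * w (n + h)%N)); first by rewrite w0 mul0r.
by move=> n hn; rewrite wL// mul0r.
Qed.

Lemma triv_corr_bound {R : realType} (w : nat -> R) (N : nat) (A : R) (h : nat) (t : nat -> R) :
  (0 < N)%N -> bumpw N A w ->
  `|\sum_(n < 2 * N) (w n * w (n + h)%N) * cos (t n)| <= 2 * N%:R * A ^+ 2.
Proof.
move=> N0 bw; have A0 := bumpw_ge0 _ _ _ bw; case: bw => w0 wL wA w1 w2.
apply: le_trans (ler_norm_sum _ _ _) _.
apply: (@le_trans _ _ (\sum_(n < 2 * N) A ^+ 2)).
  apply: ler_sum => i _; rewrite !normrM -[leRHS]mulr1.
  by apply: ler_pM; rewrite ?mulr_ge0 ?normr_ge0 ?cos_max// expr2 ler_pM.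
by rewrite sumr_const card_ord -[leLHS]mulr_natl natrM.
Qed.

Lemma sum_inv_sqr {R : realType} (n : nat) : \sum_(r < n) (r.+1%:R ^+ 2)^-1 <= 2 :> R.
Proof.
suff h : \sum_(r < n.+1) (r.+1%:R ^+ 2)^-1 <= 2 - n.+1%:R^-1 :> R.
  move: h; rewrite big_ord_recr/= => h.
  apply: (le_trans _ (le_trans h _)).
    by rewrite lerDl invr_ge0 sqr_ge0.
  by rewrite gerBl invr_ge0.
elim: n => [|n IH]; first by rewrite big_ord1 expr1n invr1; lra.
rewrite big_ord_recr/=; apply: le_trans (lerD IH (lexx _)) _.
have n0 : 0 < n.+1%:R :> R by rewrite ltr0n.
have e : n.+2%:R = n.+1%:R + 1 :> R by rewrite -natr1.
rewrite e; set m := n.+1%:R in n0 *.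
have m1 : 0 < m + 1 by lra.
have -> : 2 - m^-1 + ((m + 1) ^+ 2)^-1 = 2 - (m + 1)^-1 - (m * (m + 1) ^+ 2)^-1.
  by field; apply/andP; split; lra.
by rewrite gerBl invr_ge0 mulr_ge0 ?sqr_ge0// ltW.
Qed.

(** With [u = k.+1 * tau] and [v = k * tau], the two bounds give [m k <= 4 * P / (1 + u) ^ 2 <= 4 *
    P / ((1 + u) * (1 + v))], and the last expression telescopes. *)
Lemma sum_min_inv_sqr {R : realType} (B : nat) (m : nat -> R) (P tau : R) : 0 < tau -> 0 <= P ->
  (forall k, m k <= P) -> (forall k, m k * (k.+1%:R * tau) ^+ 2 <= P) ->
  \sum_(k < B) m k <= P * (4 / tau).
Proof.
move=> t0 P0 h1 h2.
have key k : m k <= P * (4 / tau) * ((1 + k%:R * tau)^-1 - (1 + k.+1%:R * tau)^-1).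
  have u0 : 0 < k.+1%:R * tau by rewrite mulr_gt0// ltr0n.
  have v0 : 0 <= k%:R * tau by rewrite mulr_ge0// ltW.
  have uv : k.+1%:R * tau = k%:R * tau + tau by rewrite -natr1; ring.
  have := h1 k; have := h2 k; move: (m k) => M; set u := k.+1%:R * tau in u0 uv *.
  set v := k%:R * tau in v0 uv * => Mu MP.
  have M4 : M * (1 + u) ^+ 2 <= 4 * P.
    have [M0|M0] := leP M 0.
      have : M * (1 + u) ^+ 2 <= 0 by rewrite mulr_le0_ge0// sqr_ge0.
      lra.
    have [u1|u1] := leP u 1.
      have : (1 + u) ^+ 2 <= 4 by rewrite expr2; nra.
      by move=> /(ler_wpM2l (ltW M0)); lra.
    have : (1 + u) ^+ 2 <= 4 * u ^+ 2 by rewrite !expr2; nra.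
    by move=> /(ler_wpM2l (ltW M0)); lra.
  have -> : P * (4 / tau) * ((1 + v)^-1 - (1 + u)^-1) = 4 * P / ((1 + v) * (1 + u)).
    by rewrite uv; field; apply/and3P; split; lra.
  rewrite ler_pdivlMr; last by rewrite mulr_gt0; lra.
  have [M0|M0] := leP M 0.
    have : M * ((1 + v) * (1 + u)) <= 0 by rewrite mulr_le0_ge0// mulr_ge0; lra.
    lra.
  apply: le_trans M4; rewrite ler_pM2l// expr2 ler_pM2r; lra.
apply: (@le_trans _ _ (\sum_(k < B) P * (4 / tau) * ((1 + k%:R * tau)^-1 - (1 + k.+1%:R * tau)^-1))).
  by apply: ler_sum => k _.
rewrite -mulr_sumr -[leRHS]mulr1; apply: ler_wpM2l; first by rewrite mulr_ge0// divr_ge0// ltW.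
have -> : \sum_(k < B) ((1 + k%:R * tau)^-1 - (1 + k.+1%:R * tau)^-1) = 1 - (1 + B%:R * tau)^-1.
  elim: B => [|B IH]; first by rewrite big_ord0 mul0r addr0 invr1 subrr.
  by rewrite big_ord_recr/= IH; ring.
by rewrite gerBl invr_ge0 addr_ge0// mulr_ge0// ltW.
Qed.

Lemma sum_blocks {R : realType} (F : nat -> R) (q B : nat) :
  \sum_(h < q * B) F h = \sum_(t < B) \sum_(u < q) F (q * t + u)%N.
Proof.
elim: B => [|B IH]; first by rewrite muln0 !big_ord0.
by rewrite mulnS addnC big_split_ord/= IH big_ord_recr.
Qed.

Lemma sum_residues {R : realType} (g : nat -> R) (a q : nat) : (0 < q)%N -> coprime a q ->
  \sum_(u < q) g ((u * a) %% q)%N = \sum_(r < q) g r.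
Proof.
move=> q0 cop.
pose h (u : 'I_q) := Ordinal (ltn_pmod (u * a) q0).
have hi : injective h.
  move=> u v /(congr1 val)/= /eqP.
  wlog uv : u v / (u <= v)%N => [H|].
    by have [/H//|/ltnW vu] := leqP u v; rewrite eq_sym => e; apply/esym/H.
  rewrite eq_sym eqn_mod_dvd ?leq_mul2r ?uv ?orbT// -mulnBl Gauss_dvdl; last by rewrite coprime_sym.
  move=> /dvdn_leq; have := ltn_ord v; have := ltn_ord u => lu lv H.
  apply: val_inj => /=; have [e|e] := posnP (v - u)%N; first lia.
  by have := H e; lia.
by rewrite [RHS](reindex_inj hi).
Qed.

Lemma sum_two_sided {R : realType} (q : nat) :
  \sum_(r < q) (if r == 0%N :> nat then 0 else (r%:R ^+ 2)^-1 + ((q%:R - r%:R) ^+ 2)^-1) <= 4 :> R.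
Proof.
case: q => [|q]; first by rewrite big_ord0.
rewrite big_ord_recl/= add0r.
have -> : \sum_(i < q) (if bump 0 i == 0%N then 0 else ((bump 0 i)%:R ^+ 2)^-1 + ((q.+1%:R - (bump 0 i)%:R) ^+ 2)^-1) =
  \sum_(i < q) (i.+1%:R ^+ 2)^-1 + \sum_(i < q) (i.+1%:R ^+ 2)^-1 :> R.
  rewrite [X in _ = _ + X](reindex_inj rev_ord_inj) -big_split/=; apply: eq_bigr => i _.
  rewrite /bump/= add1n/= -natrB; last by have := ltn_ord i; lia.
  by congr (_ + (_%:R ^+ 2)^-1); have := ltn_ord i; lia.
have := @sum_inv_sqr R q; lra.
Qed.

Lemma sinpi_sqr_ge {R : realType} (z : R) : `|z| <= 1 / 2 -> z ^+ 2 <= sin (pi * z) ^+ 2.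
Proof.
move=> h; rewrite -(real_normK (num_real z)).
have -> : sin (pi * z) ^+ 2 = sin (pi * `|z|) ^+ 2.
  by case: (ger0P z) => // _; rewrite mulrN sinN sqrrN.
rewrite ler_pXn2r ?nnegrE//; first by apply: sinpi_ge; rewrite normr_ge0.
by apply: le_trans (sinpi_ge _ _); rewrite normr_ge0.
Qed.

(** The error [e] is at most half the spacing of the fractions [r / q], so the point stays at
    distance at least [r / (2 * q)] from 0 and [(q - r) / (2 * q)] from 1. Adding the two inverse
    squares avoids deciding which end is nearer. *)
Lemma inv_sin_residue {R : realType} (q r : nat) (e : R) : (0 < r < q)%N ->
  `|e| <= 1 / (2 * q%:R) ->
  1 <= 4 * q%:R ^+ 2 * sin (pi * (r%:R / q%:R + e)) ^+ 2
         * ((r%:R ^+ 2)^-1 + ((q%:R - r%:R) ^+ 2)^-1).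
Proof.
move=> /andP[r0 rq] he.
have q0 : 0 < q%:R :> R by rewrite ltr0n (ltn_trans r0).
have R0 : 1 <= r%:R :> R by rewrite ler1n.
have RQ : 1 <= q%:R - r%:R :> R by rewrite -natrB ?ler1n ?subn_gt0// ltnW.
set z := r%:R / q%:R + e; set s := sin (pi * z).
have he' : `|e| * (2 * q%:R) <= 1 by rewrite -ler_pdivlMr// mulr_gt0.
have zq : z * (2 * q%:R) = 2 * r%:R + e * (2 * q%:R) by rewrite /z; field; rewrite gt_eqF.
have en : `|e * (2 * q%:R)| <= 1 by rewrite normrM (@ger0_norm _ (2 * q%:R))// mulr_ge0// ltW.
move: en; rewrite ler_norml => /andP[en1 en2].
have q2 : 0 < 2 * q%:R :> R by rewrite mulr_gt0.
have z0 : r%:R / (2 * q%:R) <= z by rewrite ler_pdivrMr// zq; lra.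
have z1 : (q%:R - r%:R) / (2 * q%:R) <= 1 - z.
  by rewrite ler_pdivrMr// mulrBl zq; lra.
have rp : 0 < r%:R / (2 * q%:R) :> R by rewrite divr_gt0//; lra.
have rp' : 0 < (q%:R - r%:R) / (2 * q%:R) :> R by rewrite divr_gt0//; lra.
have ri : 0 < (r%:R ^+ 2)^-1 :> R by rewrite invr_gt0 exprn_gt0//; lra.
have ri' : 0 < ((q%:R - r%:R) ^+ 2)^-1 :> R by rewrite invr_gt0 exprn_gt0//; lra.
have fin (u v : R) : 0 < u -> 0 < v -> u / (2 * q%:R) <= s -> 0 < v ->
    1 <= 4 * q%:R ^+ 2 * s ^+ 2 * ((u ^+ 2)^-1 + v).
  move=> u0 v0 us _.
  have : (u / (2 * q%:R)) ^+ 2 <= s ^+ 2.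
    by rewrite ler_pXn2r ?nnegrE//; [rewrite divr_ge0// ltW|apply: le_trans us; rewrite divr_ge0// ltW].
  move=> h; apply: (@le_trans _ _ (4 * q%:R ^+ 2 * (u / (2 * q%:R)) ^+ 2 * (u ^+ 2)^-1)).
    by rewrite le_eqVlt; apply/orP; left; apply/eqP; field; rewrite !gt_eqF.
  apply: ler_pM.
  - by rewrite mulr_ge0 ?sqr_ge0// mulr_ge0 ?sqr_ge0.
  - by rewrite invr_ge0 sqr_ge0.
  - by apply: ler_wpM2l => //; rewrite mulr_ge0 ?sqr_ge0.
  - by rewrite lerDl ltW.
have zp : 0 <= z := le_trans (ltW rp) z0.
have zp1 : 0 <= 1 - z := le_trans (ltW rp') z1.
have [zh|zh] := leP z (1 / 2).
  apply: fin => //; first lra.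
  by apply: le_trans z0 _; apply: sinpi_ge; rewrite zp zh.
rewrite (addrC (_^-1)); apply: fin => //; first lra.
by apply: le_trans z1 _; apply: sinpi_ge_sub; rewrite (ltW zh) -subr_ge0 zp1.
Qed.

(** The correlations are split by the residue of [h * a] modulo [q]. For [h] not divisible by [q]
    the sine is bounded below by the residue, and all these [h] together give [A ^ 2 * q]. For [h]
    divisible by [q] only [h * beta] is left in the sine: the trivial bound for each such [h] gives
    the first claim, the decay in [h * beta] gives the second. *)
Lemma weyl_bound {R : realType} (w : nat -> R) (N : nat) (A x : R) (a q : nat) :
  (0 < N)%N -> bumpw N A w -> (0 < q)%N -> (q <= 4 * N)%N -> coprime a q ->
  `|2 * x - a%:R / q%:R| <= 1 / (4 * N%:R * q%:R) ->
  T2 w (2 * N) x <= (80 * A) ^+ 2 * (N%:R ^+ 2 / q%:R) /\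
  T2 w (2 * N) x * (q%:R * `|2 * x - a%:R / q%:R|) <= (80 * A) ^+ 2.
Proof.
move=> N0 bw q0 qN cop; set beta := 2 * x - a%:R / q%:R => hb.
have A0 := bumpw_ge0 _ _ _ bw.
have NR : 0 < N%:R :> R by rewrite ltr0n.
have qR : 0 < q%:R :> R by rewrite ltr0n.
have q1 : 1 <= q%:R :> R by rewrite ler1n.
have qNR : q%:R <= 4 * N%:R :> R by rewrite -natrM ler_nat.
have A2 : 0 <= A ^+ 2 by exact: sqr_ge0.
pose M h := `|\sum_(n < 2 * N) (w n * w (n + h)%N) *
      cos (n%:R * (2 * pi * (h%:R * (2 * x))) + 2 * pi * (h ^ 2)%:R * x)|.
have M0 h : 0 <= M h by exact: normr_ge0.
pose P := 2 * N%:R * A ^+ 2.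
have P0 : 0 <= P by rewrite /P mulr_ge0// mulr_ge0// ltW.
have MP h : M h <= P.
  exact: (triv_corr_bound w N A h (fun n => n%:R * (2 * pi * (h%:R * (2 * x))) + 2 * pi * (h ^ 2)%:R * x)).
have hyE h : h%:R * (2 * x) = ((h * a) %% q)%:R / q%:R + h%:R * beta + ((h * a) %/ q)%:R.
  have e : ((h * a) %/ q)%:R * q%:R + ((h * a) %% q)%:R = h%:R * a%:R :> R.
    by rewrite -!natrM -natrD -divn_eq.
  have e2 : ((h * a) %% q)%:R = h%:R * a%:R - ((h * a) %/ q)%:R * q%:R :> R by rewrite -e; ring.
  by rewrite e2 /beta; field; rewrite gt_eqF.
have MS h : M h * (4 * sin (pi * (((h * a) %% q)%:R / q%:R + h%:R * beta)) ^+ 2) <= 7 * A ^+ 2 / N%:R.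
  have := sin_corr_bound w N A x h N0 bw.
  by rewrite hyE sinpiDn_sqr -hyE.
pose F h := if (0 < h < 2 * N)%N then M h else 0.
have F0 h : 0 <= F h by rewrite /F; case: ifP.
have FP h : F h <= P by rewrite /F; case: ifP.
(* The precision [1 / (4 * N * q)] is needed here: multiplied by [h < 2 * N], the error stays within
   half the spacing of the residues. *)
have hbeta h : (h < 2 * N)%N -> `|h%:R * beta| <= 1 / (2 * q%:R).
  move=> hN; rewrite normrM ger0_norm//.
  have hR : h%:R <= 2 * N%:R :> R by rewrite -natrM ler_nat ltnW.
  have := ler_pM (ler0n _ h) (normr_ge0 beta) hR hb => /le_trans; apply.
  by rewrite le_eqVlt; apply/orP; left; apply/eqP; field; rewrite !gt_eqF.
pose G := 7 * A ^+ 2 * q%:R ^+ 2 / N%:R.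
have G0 : 0 <= G by rewrite /G divr_ge0 ?(ltW NR)// mulr_ge0 ?sqr_ge0// mulr_ge0.
pose g r : R := if r == 0%N then 0 else (r%:R ^+ 2)^-1 + ((q%:R - r%:R) ^+ 2)^-1.
have g0 r : 0 <= g r by rewrite /g; case: ifP => // _; rewrite addr_ge0// invr_ge0 sqr_ge0.
have FG h : ((h * a) %% q != 0)%N -> F h <= G * g ((h * a) %% q)%N.
  move=> hr; rewrite /F; case: ifP => [/andP[h0 hN]|_]; last exact: mulr_ge0.
  rewrite /g (negbTE hr).
  have := inv_sin_residue q ((h * a) %% q) (h%:R * beta).
  rewrite lt0n hr ltn_mod q0 => /(_ isT (hbeta h hN)).
  have := MS h; set s2 := sin _ ^+ 2; set gg := _ + _ => m1 m2.
  have gg0 : 0 <= gg by rewrite addr_ge0// invr_ge0 sqr_ge0.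
  rewrite -[leLHS]mulr1; apply: le_trans (ler_wpM2l (M0 h) m2) _.
  have -> : M h * (4 * q%:R ^+ 2 * s2 * gg) = M h * (4 * s2) * (q%:R ^+ 2 * gg) by ring.
  have -> : G * gg = 7 * A ^+ 2 / N%:R * (q%:R ^+ 2 * gg) by rewrite /G; ring.
  by apply: ler_wpM2r => //; rewrite mulr_ge0// sqr_ge0.
(* For [h = q * k.+1] the quantity [k.+1 * tau] is [N * |h * beta|]. *)
pose tau := N%:R * (q%:R * `|beta|).
have Ftau k : F (q * k.+1)%N * (k.+1%:R * tau) ^+ 2 <= P.
  rewrite /F; case: ifP => [/andP[h0 hN]|_]; last by rewrite mul0r.
  have := MS (q * k.+1)%N.
  have -> : (q * k.+1 * a %% q = 0)%N by rewrite -mulnA modnMr.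
  rewrite mul0r add0r => m1.
  have hb2 := hbeta _ hN.
  have : `|(q * k.+1)%:R * beta| <= 1 / 2.
    by apply: le_trans hb2 _; rewrite !mul1r lef_pV2 ?posrE ?mulr_gt0//; lra.
  move=> /sinpi_sqr_ge m2.
  have e : (k.+1%:R * tau) ^+ 2 = N%:R ^+ 2 * ((q * k.+1)%:R * beta) ^+ 2.
    by rewrite /tau natrM !exprMn real_normK ?num_real//; ring.
  rewrite e; set s2 := sin _ ^+ 2 in m1 m2; set b2 := _ ^+ 2 in m2 *.
  have := ler_wpM2l (M0 (q * k.+1)%N) m2 => m3.
  have m4 : M (q * k.+1)%N * (4 * s2) * N%:R ^+ 2 <= 7 * A ^+ 2 / N%:R * N%:R ^+ 2.
    by apply: ler_wpM2r => //; rewrite sqr_ge0.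
  have e5 : 7 * A ^+ 2 / N%:R * N%:R ^+ 2 = 7 * (A ^+ 2 * N%:R) by field; rewrite gt_eqF.
  have m6 : M (q * k.+1)%N * b2 * N%:R ^+ 2 <= M (q * k.+1)%N * s2 * N%:R ^+ 2.
    by apply: ler_wpM2r => //; rewrite sqr_ge0.
  have AN : 0 <= A ^+ 2 * N%:R by rewrite mulr_ge0// ltW.
  rewrite e5 in m4; rewrite /P; lra.
pose B' := (2 * N %/ q)%N.
have B'R : B'%:R <= 2 * N%:R / q%:R :> R.
  by rewrite ler_pdivlMr// -!natrM ler_nat leq_trunc_div.
(* A block of [q] consecutive [h] meets every residue once: the nonzero residues contribute at most
   [4 * G] together, and the zero residue is kept apart. As [q <= 4 * N], there are
   [B' + 1 <= 6 * N / q] blocks, whence 24. *)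
have sumF : \sum_(1 <= h < 2 * N) M h <= 24 * G * N%:R / q%:R + \sum_(k < B') F (q * k.+1)%N.
  have -> : \sum_(1 <= h < 2 * N) M h = \sum_(h < 2 * N) F h.
    rewrite -(big_mkord xpredT F) big_ltn ?muln_gt0//.
    rewrite {1}/F ltnn add0r [LHS]big_nat_cond [RHS]big_nat_cond; apply: eq_bigr => h; rewrite andbT /F => /andP[h1 h2].
    by rewrite h2 h1.
  apply: (@le_trans _ _ (\sum_(h < q * B'.+1) F h)).
    have le : (2 * N <= q * B'.+1)%N by rewrite (mulnC q); apply: ltnW; exact: ltn_ceil.
    by rewrite (big_ord_widen _ F le) big_mkcond; apply: ler_sum => i _; case: ifP.
  rewrite sum_blocks.
  apply: (@le_trans _ _ (\sum_(t < B'.+1) (G * 4 + F (q * t)%N))).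
    apply: ler_sum => t _.
    apply: (@le_trans _ _ (\sum_(u < q) (G * g ((u * a) %% q)%N + (if u == 0%N :> nat then F (q * t)%N else 0)))).
      apply: ler_sum => u _; case: eqP => [->|/eqP u0].
        by rewrite addn0 lerDr mulr_ge0.
      have e : ((q * t + u) * a %% q = u * a %% q)%N by rewrite mulnDl -mulnA (mulnC q) modnMDl.
      rewrite addr0 -e; apply: FG; rewrite e.
      apply/negP => /eqP /eqP; rewrite -/(dvdn _ _) Gauss_dvdl; last by rewrite coprime_sym.
      by move=> /dvdn_leq; rewrite lt0n u0 => /(_ isT); rewrite leqNgt ltn_ord.
    rewrite big_split/= -mulr_sumr (sum_residues g a q q0 cop).
    apply: lerD; first by apply: ler_wpM2l => //; exact: sum_two_sided.
    case: (q) q0 => // q' _; rewrite big_ord_recl/= big1 ?addr0//.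
  rewrite big_split/= sumr_const card_ord big_ord_recl/= muln0 {1}/F ltnn add0r.
  apply: lerD => //; rewrite -[leLHS]mulr_natr -(natr1 B').
  have -> : 24 * G * N%:R / q%:R = G * 4 * (6 * N%:R / q%:R) by ring.
  apply: ler_wpM2l; first by rewrite mulr_ge0.
  have : 1 <= 4 * N%:R / q%:R :> R by rewrite ler_pdivlMr// mul1r.
  have -> : 6 * N%:R / q%:R = 2 * N%:R / q%:R + 4 * N%:R / q%:R :> R by field; rewrite gt_eqF.
  by move=> h; apply: lerD.
have T2le : T2 w (2 * N) x <= P + 2 * (168 * A ^+ 2 * q%:R + \sum_(k < B') F (q * k.+1)%N).
  case: (bw) => w0 wL wA _ _.
  rewrite T2_corr//; apply: lerD.
    apply: (@le_trans _ _ (\sum_(n < 2 * N) A ^+ 2)).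
      by apply: ler_sum => i _; rewrite -(real_normK (num_real (w i))) ler_pXn2r ?nnegrE.
    by rewrite sumr_const card_ord -[leLHS]mulr_natr natrM /P mulrC.
  apply: ler_wpM2l => //.
  apply: (@le_trans _ _ (\sum_(1 <= h < 2 * N) M h)).
    by apply: ler_sum => h _; exact: ler_norm.
  apply: le_trans sumF _; apply: lerD => //.
  rewrite /G le_eqVlt; apply/orP; left; apply/eqP; field; rewrite !gt_eqF//.
(* Since [q <= 4 * N], the terms [A ^ 2 * q] and [A ^ 2 * N] are both dominated by
   [A ^ 2 * N ^ 2 / q]. *)
have qN2 : q%:R <= 16 * N%:R ^+ 2 / q%:R :> R.
  rewrite ler_pdivlMr// -expr2.
  have -> : 16 * N%:R ^+ 2 = (4 * N%:R) ^+ 2 :> R by ring.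
  by rewrite ler_pXn2r ?nnegrE ?mulr_ge0// ltW.
have NN : N%:R <= 4 * N%:R ^+ 2 / q%:R :> R.
  rewrite ler_pdivlMr//; have := ler_wpM2l (ltW NR) qNR; lra.
split.
  apply: le_trans T2le _.
  have S1 : \sum_(k < B') F (q * k.+1)%N <= 2 * N%:R / q%:R * P.
    apply: le_trans (ler_wpM2r P0 B'R).
    rewrite mulr_natl -[X in _ *+ X]card_ord -sumr_const; apply: ler_sum => k _; exact: FP.
  have a1 := ler_wpM2l A2 qN2; have a2 := ler_wpM2l A2 NN.
  have -> : (80 * A) ^+ 2 * (N%:R ^+ 2 / q%:R) = 80 * (80 * (A ^+ 2 * (N%:R ^+ 2 / q%:R))) by ring.
  have e1 : A ^+ 2 * (16 * N%:R ^+ 2 / q%:R) = 16 * (A ^+ 2 * (N%:R ^+ 2 / q%:R)) by ring.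
  have e2 : A ^+ 2 * (4 * N%:R ^+ 2 / q%:R) = 4 * (A ^+ 2 * (N%:R ^+ 2 / q%:R)) by ring.
  have e3 : 2 * N%:R / q%:R * P = 4 * (A ^+ 2 * (N%:R ^+ 2 / q%:R)) by rewrite /P; ring.
  have D0 : 0 <= A ^+ 2 * (N%:R ^+ 2 / q%:R) by rewrite mulr_ge0// divr_ge0 ?sqr_ge0// ltW.
  rewrite e1 in a1; rewrite e2 in a2; rewrite e3 in S1; rewrite /P.
  set D := A ^+ 2 * (_ / _) in a1 a2 S1 D0 *; lra.
have [b0|bn0] := eqVneq beta 0; first by rewrite b0 normr0 !mulr0 sqr_ge0.
have bp : 0 < `|beta| by rewrite normr_gt0.
have tau0 : 0 < tau by rewrite /tau !mulr_gt0.
have S2 := sum_min_inv_sqr B' (fun k => F (q * k.+1)%N) P tau tau0 P0 (fun k => FP _) Ftau.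
have qb0 : 0 <= q%:R * `|beta| by rewrite mulr_ge0// ltW.
apply: le_trans (ler_wpM2r qb0 T2le) _.
have qb1 : q%:R * `|beta| * (4 * N%:R) <= 1.
  by move: hb; rewrite ler_pdivlMr ?mulr_gt0// => hb; lra.
have a1 : P * (q%:R * `|beta|) <= A ^+ 2.
  have := ler_wpM2l A2 qb1; rewrite /P; lra.
have a2 : q%:R * (q%:R * `|beta|) <= 1.
  have := ler_wpM2r qb0 qNR; lra.
have a3 := ler_wpM2l A2 a2.
have a4 : (\sum_(k < B') F (q * k.+1)%N) * (q%:R * `|beta|) <= 8 * A ^+ 2.
  apply: le_trans (ler_wpM2r qb0 S2) _.
  by rewrite /P /tau le_eqVlt; apply/orP; left; apply/eqP; field; rewrite !gt_eqF.
have -> : (80 * A) ^+ 2 = 80 * (80 * A ^+ 2) by ring.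
lra.
Qed.

Local Open Scope classical_set_scope.

(** * Covering of the period by arcs around rationals *)

(** Pigeonhole: the fractional parts of [Q + 1] multiples of [y] fall into [Q] boxes. Reducing the
    fraction afterwards only lowers the denominator, which weakens the bound to be met. *)
Lemma dirichlet_approx {R : realType} (y : R) (Q : nat) : 0 <= y -> (0 < Q)%N ->
  exists a q : nat, [/\ (0 < q)%N, (q <= Q)%N, coprime a q &
    `|y - a%:R / q%:R| <= 1 / (Q%:R * q%:R)].
Proof.
move=> y0 Q0.
have QR : 0 < Q%:R :> R by rewrite ltr0n.
pose fl (k : nat) := Num.truncn (k%:R * y).
have flP k : (fl k)%:R <= k%:R * y < (fl k)%:R + 1.
  by rewrite natr1; apply: truncn_itv; rewrite mulr_ge0.
pose box (k : nat) := Num.truncn (Q%:R * (k%:R * y - (fl k)%:R)).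
have boxP k : (box k)%:R <= Q%:R * (k%:R * y - (fl k)%:R) < (box k)%:R + 1.
  by rewrite natr1; apply: truncn_itv; rewrite mulr_ge0// subr_ge0; case/andP: (flP k).
have boxQ k : (box k < Q)%N.
  rewrite -(ltr_nat R); case/andP: (boxP k) => + _ => /le_lt_trans; apply.
  rewrite -[ltRHS]mulr1 ltr_pM2l// ltrBlDl; by case/andP: (flP k).
pose f (k : 'I_Q.+1) := Ordinal (boxQ k).
have /injectivePn[k [k' kk' /(congr1 val)/= e]] : ~~ injectiveb f.
  by apply/negP => /injectiveP/leq_card; rewrite !card_ord ltnn.
wlog lt : k k' kk' e / (k < k')%N => [H|].
  have [lt|lt|eq] := ltngtP k k'; first exact: (H k k').
    by apply: (H k' k) => //; rewrite eq_sym.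
  by move: kk'; rewrite (val_inj eq) eqxx.
pose q0 := (k' - k)%N; pose a0 := (fl k' - fl k)%N.
have q00 : (0 < q0)%N by rewrite subn_gt0.
have q0Q : (q0 <= Q)%N by rewrite (leq_trans (leq_subr _ _))// -ltnS ltn_ord.
have flm : (fl k <= fl k')%N.
  by apply: le_truncn; rewrite ler_wpM2r// ler_nat ltnW.
have key : `|q0%:R * y - a0%:R| <= 1 / Q%:R.
  rewrite /q0 /a0 !natrB//; last exact: ltnW.
  rewrite ler_pdivlMr// -[X in _ * X](ger0_norm (ltW QR)) -normrM.
  have := boxP k; have := boxP k'; rewrite e => /andP[b1 b2] /andP[b3 b4].
  by rewrite ler_norml; apply/andP; split; lra.
pose g := gcdn a0 q0.
have g0 : (0 < g)%N by rewrite gcdn_gt0 q00 orbT.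
have qg : (q0 %/ g * g = q0)%N by rewrite divnK// dvdn_gcdr.
have ag : (a0 %/ g * g = a0)%N by rewrite divnK// dvdn_gcdl.
have gR : 0 < g%:R :> R by rewrite ltr0n.
have q1 : (0 < q0 %/ g)%N by rewrite divn_gt0// dvdn_leq// dvdn_gcdr.
have qR : 0 < (q0 %/ g)%:R :> R by rewrite ltr0n.
have q0R : 0 < q0%:R :> R by rewrite ltr0n.
exists (a0 %/ g)%N, (q0 %/ g)%N; split => //.
- by rewrite (leq_trans (leq_div _ _)).
- rewrite /coprime -(eqn_pmul2r g0) muln_gcdl qg ag mul1n//.
have -> : (a0 %/ g)%:R / (q0 %/ g)%:R = a0%:R / q0%:R :> R.
  by rewrite -[in RHS]qg -[in RHS]ag !natrM; field; rewrite !gt_eqF.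
have -> : y - a0%:R / q0%:R = (q0%:R * y - a0%:R) / q0%:R by field; rewrite gt_eqF.
rewrite normrM normfV (ger0_norm (ltW q0R)) ler_pdivrMr//; apply: le_trans key _.
have -> : 1 / (Q%:R * (q0 %/ g)%:R) * q0%:R = (1 / Q%:R) * g%:R :> R.
  by rewrite -[in X in _ * X]qg natrM; field; rewrite !gt_eqF.
by rewrite ler_peMr ?ler1n// divr_ge0// ltW.
Qed.

Lemma Ig_le {R : realType} (f g : R -> R) : measurable_fun setT f -> measurable_fun setT g ->
  (forall x, 0 <= x <= 1 -> 0 <= f x) -> (forall x, 0 <= x <= 1 -> f x <= g x) -> (Ig f <= Ig g)%E.
Proof.
move=> mf mg f0 fg; apply: ge0_le_integral => //.
- by apply/measurable_EFinP; exact: measurable_funS mf.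
- by apply/measurable_EFinP; exact: measurable_funS mg.
Qed.

Lemma Ig_ge0 {R : realType} (f : R -> R) : (forall x, 0 <= f x) -> (0 <= Ig f)%E.
Proof. by move=> f0; apply: integral_ge0 => x _; rewrite lee_fin. Qed.

Lemma IgZ {R : realType} (f : R -> R) (c : R) : measurable_fun setT f -> (forall x, 0 <= f x) ->
  0 <= c -> Ig (fun x => c * f x) = (c%:E * Ig f)%E.
Proof.
move=> mf f0 c0; rewrite /Ig; under eq_integral do rewrite EFinM.
rewrite ge0_integralZl_EFin//; first by move=> x _; rewrite lee_fin.
by apply/measurable_EFinP; exact: measurable_funS mf.
Qed.

Lemma IgD {R : realType} (f g : R -> R) : measurable_fun setT f -> measurable_fun setT g ->
  (forall x, 0 <= f x) -> (forall x, 0 <= g x) -> Ig (fun x => f x + g x) = (Ig f + Ig g)%E.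
Proof.
move=> mf mg f0 g0; rewrite /Ig; under eq_integral do rewrite EFinD.
rewrite ge0_integralD//.
- by move=> x _; rewrite lee_fin.
- by apply/measurable_EFinP; exact: measurable_funS mf.
- by move=> x _; rewrite lee_fin.
- by apply/measurable_EFinP; exact: measurable_funS mg.
Qed.

Lemma Ig_sum {R : realType} (I : Type) (r : seq I) (f : I -> R -> R) :
  (forall i, measurable_fun setT (f i)) -> (forall i x, 0 <= f i x) ->
  Ig (fun x => \sum_(i <- r) f i x) = (\sum_(i <- r) Ig (f i))%E.
Proof.
move=> mf f0; rewrite /Ig; under eq_integral do rewrite -sumEFin.
rewrite ge0_integral_sum//.
- by move=> i; apply/measurable_EFinP; exact: measurable_funS (mf i).
- by move=> i x _; rewrite lee_fin.
Qed.

Lemma Ig_cst {R : realType} (c : R) : Ig (fun=> c) = c%:E.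
Proof.
rewrite /Ig integral_cst//= lebesgue_measure_itv/= lte_fin ltr01 oppr0 adde0.
by rewrite mule1.
Qed.

(** The points with [|2 * x - c| <= rho], an interval of length [rho]. *)
Definition window {R : realType} (c rho : R) : set R := `[(c - rho) / 2, (c + rho) / 2].

Lemma Ig_window {R : realType} (c rho : R) : 0 <= rho ->
  (Ig (\1_(window c rho) : R -> R) <= rho%:E)%E.
Proof.
move=> r0; rewrite /Ig integral_indic//; last exact: measurable_itv.
apply: (@le_trans _ _ (lebesgue_measure (window c rho))).
  by apply: le_measure; rewrite ?inE//; [apply: measurableI; exact: measurable_itv|exact: measurable_itv].
rewrite lebesgue_measure_itv/= lte_fin; case: ifP => // _.
by rewrite -EFinB lee_fin; lra.
Qed.

Lemma Ig_le_windows {R : realType} (I : finType) (g : R -> R) (e c rho : I -> R) :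
  measurable_fun setT g -> (forall x, 0 <= g x) -> (forall i, 0 <= e i) -> (forall i, 0 <= rho i) ->
  (forall x, 0 <= x <= 1 -> exists2 i, `|2 * x - c i| <= rho i & g x <= e i) ->
  (Ig g <= (\sum_i e i * rho i)%:E)%E.
Proof.
move=> mg g0 e0 r0 h.
pose F i (x : R) := e i * \1_(window (c i) (rho i)) x.
have F0 i x : 0 <= F i x by rewrite mulr_ge0// indicE ler0n.
have m1 i : measurable_fun setT (\1_(window (c i) (rho i)) : R -> R).
  by apply: measurable_indic; exact: measurable_itv.
have mF i : measurable_fun setT (F i) by apply: measurable_funM.
apply: (@le_trans _ _ (Ig (fun x => \sum_i F i x))).
  apply: Ig_le => //; first exact: measurable_sum.
  move=> x /h[i hi ge]; rewrite (bigD1 i)//= -[leLHS]addr0.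
  apply: lerD; last exact: sumr_ge0.
  rewrite /F indicE mem_set ?mulr1// /window/= in_itv/=.
  by move: hi; rewrite ler_norml; lra.
rewrite Ig_sum// -sumEFin; apply: lee_sum => i _.
rewrite IgZ// EFinM.
by apply: lee_wpmul2l; rewrite ?lee_fin//; exact: Ig_window.
Qed.

Local Close Scope classical_set_scope.

Lemma geo_dec {R : realType} (r : R) (K : nat) : 1 < r -> \sum_(k < K) (r ^+ k)^-1 <= r / (r - 1).
Proof.
move=> r1; have rn K' : 0 < r ^+ K' by rewrite exprn_gt0//; lra.
have -> : \sum_(k < K) (r ^+ k)^-1 = (1 - (r ^+ K)^-1) * (r / (r - 1)).
  elim: K => [|K IH]; first by rewrite big_ord0 expr0 invr1 subrr mul0r.
  have a1 : r != 0 by rewrite gt_eqF//; lra.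
  have a2 : r - 1 != 0 by rewrite gt_eqF//; lra.
  have a3 : r ^+ K != 0 by rewrite expf_neq0.
  by rewrite big_ord_recr/= IH exprS; field; rewrite ?a1 ?a2 ?a3.
rewrite ler_piMl ?divr_ge0//; [lra|lra|].
by rewrite gerBl invr_ge0 ltW.
Qed.

Lemma powR_sqr_half {R : realType} (a p : R) : 0 <= a -> (a ^+ 2) `^ (p / 2) = a `^ p.
Proof.
move=> a0; rewrite -(powR_mulrn _ a0) -powRrM; congr (_ `^ _).
by rewrite mulrC divfK.
Qed.

Lemma powRVl {R : realType} (a p : R) : 0 <= a -> (a^-1) `^ p = (a `^ p)^-1.
Proof. by move=> a0; rewrite -(powR_inv1 a0) powRAC powR_inv1// powR_ge0. Qed.

Lemma powR_expn {R : realType} (b e : R) (k : nat) : 1 < b -> (b ^+ k) `^ e = (b `^ e) ^+ k.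
Proof.
move=> b1; have := powR_geo 1 b e k ltr01 b1.
by rewrite mul1r => ->; rewrite powR1 mul1r.
Qed.

Lemma measurable_powR_comp {R : realType} (f : R -> R) (e : R) : measurable_fun setT f ->
  measurable_fun setT (fun x : R => f x `^ e).
Proof. by move=> mf; apply: (@measurableT_comp _ _ _ _ _ _ (fun y : R => y `^ e) _ f) => //; exact: measurable_powR. Qed.

(** The windows have centre [a / q] and radius [4 ^ k / N ^ 2], and on each of them [T2] is at most
    a constant times [A ^ 2 * N ^ 2 / (q * 4 ^ k)]. Value to the power [p / 2] times length decays
    geometrically in [k] because [p > 2]. A denominator has at most [2 * q + 1 <= 3 * q] numerators,
    which turns [q ^ (- p / 2)] into [q ^ (1 - p / 2)]. *)
Lemma weyl_Lp {R : realType} (p : R) : 2 < p -> exists2 C : R, 0 < C &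
  forall (N : nat) (A : R) (w : nat -> R), (0 < N)%N -> bumpw N A w ->
  (Ig (fun x => T2 w (2 * N) x `^ (p / 2))%R <=
    (C * (A `^ p * N%:R `^ (p - 2) * \sum_(q < 4 * N) q.+1%:R `^ (1 - p / 2)))%R%:E)%E.
Proof.
move=> p2; pose r : R := 4 `^ (p / 2 - 1).
have r1 : 1 < r by apply: powR_gt1; lra.
pose Cr := r / (r - 1).
have Cr0 : 0 < Cr by rewrite divr_gt0; lra.
exists (3 * 160 `^ p * Cr); first by apply: mulr_gt0 => //; apply: mulr_gt0 => //; exact: powR_gt0.
move=> N A w N0 bw.
have A0 := bumpw_ge0 _ _ _ bw.
have NR : 0 < N%:R :> R by rewrite ltr0n.
(* The index type cannot depend on [q]: the numerators range up to [8 * N], and [e] is 0 for those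
   above [2 * q]. The index [q] stands for the denominator [q + 1]. *)
pose I := ('I_(4 * N) * 'I_((8 * N).+1) * 'I_N.+1)%type.
pose val (q k : nat) : R := (160 * A) ^+ 2 * (N%:R ^+ 2 / (q.+1%:R * 4 ^+ k)).
have val0 q k : 0 <= val q k.
  by rewrite /val mulr_ge0 ?sqr_ge0// divr_ge0 ?sqr_ge0// mulr_ge0// exprn_ge0.
pose e (i : I) : R := if (i.1.2 < (2 * i.1.1.+1).+1)%N then val i.1.1 i.2 `^ (p / 2) else 0.
pose c (i : I) : R := i.1.2%:R / i.1.1.+1%:R.
pose rho (i : I) : R := 4 ^+ i.2 / N%:R ^+ 2.
have mT : measurable_fun setT (fun x : R => T2 w (2 * N) x `^ (p / 2)).
  apply: measurable_powR_comp.
  by apply: continuous_measurable_fun; exact: continuous_GT.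
apply: le_trans (Ig_le_windows I _ e c rho mT _ _ _ _) _.
- by move=> x; exact: powR_ge0.
- by move=> i; rewrite /e; case: ifP => // _; exact: powR_ge0.
- by move=> i; rewrite /rho divr_ge0 ?sqr_ge0// exprn_ge0.
- move=> x /andP[x0 x1].
  have y0 : 0 <= 2 * x by lra.
  have N4 : (0 < 4 * N)%N by rewrite muln_gt0.
  have [a [q [q0 qN cop hb]]] := dirichlet_approx (2 * x) (4 * N) y0 N4.
  rewrite natrM in hb.
  have qR : 0 < q%:R :> R by rewrite ltr0n.
  have q1 : 1 <= q%:R :> R by rewrite ler1n.
  have N1 : 1 <= N%:R :> R by rewrite ler1n.
  have [w1 w2] := weyl_bound w N A x a q N0 bw q0 qN cop hb.
  set beta := `|2 * x - _| in hb w2.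
  have b0 : 0 <= beta by exact: normr_ge0.
  have bN : beta <= 4 ^+ N / N%:R ^+ 2.
    apply: le_trans hb _; rewrite ler_pdivrMr; last by rewrite !mulr_gt0.
    have NN : N%:R <= 4 ^+ N :> R.
      by rewrite -natrX ler_nat ltnW// ltn_expl.
    have e1 : 4 ^+ N / N%:R ^+ 2 * (4 * N%:R * q%:R) = 4 ^+ N / N%:R * (4 * q%:R) :> R.
      by field; rewrite gt_eqF.
    rewrite e1; have : 1 <= 4 ^+ N / N%:R :> R by rewrite ler_pdivlMr// mul1r.
    by move=> h; rewrite -[leLHS]mulr1; apply: ler_pM => //; lra.
  (* With the smallest such [k], either [k = 0] and the bound by [N ^ 2 / q] serves, or [beta]
     exceeds the previous radius and the bound by [1 / (q * beta)] serves. The ratio 4 of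
     consecutive radii turns 80 into 160. *)
  have ex : exists k, beta <= 4 ^+ k / N%:R ^+ 2 by exists N.
  case: (ex_minnP ex) => k kb kmin.
  have kN : (k < N.+1)%N by rewrite ltnS; apply: kmin.
  have aq : (a < (2 * q).+1)%N.
    rewrite -(ltr_nat R) -natr1 natrM.
    have : `|2 * x - a%:R / q%:R| * q%:R <= 1 / 4.
      rewrite -ler_pdivlMr//; apply: le_trans hb _.
      rewrite ler_pdivlMr//.
      have -> : 1 / (4 * N%:R * q%:R) * q%:R = (4 * N%:R)^-1 :> R by field; rewrite !gt_eqF.
      by rewrite mul1r lef_pV2 ?posrE ?mulr_gt0//; lra.
    rewrite -[X in _ * X](ger0_norm (ltW qR)) -normrM mulrBl divfK ?gt_eqF//.
    rewrite ler_norml => /andP[h1 h2]; have := ler_wpM2r (ltW qR) x1; lra.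
  have qlt : (q.-1 < 4 * N)%N by rewrite prednK.
  have alt : (a < (8 * N).+1)%N.
    by rewrite (leq_trans aq)// ltnS (leq_trans (leq_mul (leqnn 2) qN))// mulnA.
  exists (Ordinal qlt, Ordinal alt, Ordinal kN).
    by rewrite /c /rho/= prednK.
  rewrite /e/= prednK// aq; apply: ler_powR2r; [exact: GT_ge0|lra|].
  have D0 : 0 <= N%:R ^+ 2 / q%:R :> R by rewrite divr_ge0 ?sqr_ge0// ltW.
  rewrite /val prednK//.
  case: k kb kmin {kN} => [|k] kb kmin.
    apply: le_trans w1 _; rewrite expr0 mulr1; apply: ler_wpM2r => //.
    by rewrite ler_pXn2r ?nnegrE ?mulr_ge0//; lra.
  have kb' : 4 ^+ k / N%:R ^+ 2 < beta.
    by rewrite ltNge; apply/negP => /kmin; rewrite ltnn.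
  have k4 : 0 < 4 ^+ k :> R by rewrite exprn_gt0.
  have pos : 0 < 4 ^+ k / N%:R ^+ 2 :> R by rewrite divr_gt0// exprn_gt0.
  have -> : (160 * A) ^+ 2 * (N%:R ^+ 2 / (q%:R * 4 ^+ k.+1)) =
      (80 * A) ^+ 2 / (q%:R * (4 ^+ k / N%:R ^+ 2)).
    by rewrite (exprS _ k); field; rewrite !gt_eqF.
  rewrite ler_pdivlMr; last exact: mulr_gt0.
  apply: le_trans w2; apply: ler_wpM2l; first exact: GT_ge0.
  by apply: ler_wpM2l; exact: ltW.
rewrite lee_fin.
have eE q k : val q k `^ (p / 2) * (4 ^+ k / N%:R ^+ 2) =
    160 `^ p * (A `^ p * N%:R `^ (p - 2)) * (q.+1%:R `^ (- (p / 2)) * (r ^+ k)^-1).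
  have Q0 : 0 <= q.+1%:R :> R by [].
  have F0 : 0 <= 4 ^+ k :> R by exact: exprn_ge0.
  have e1 : val q k `^ (p / 2) = 160 `^ p * A `^ p * (N%:R `^ p * (q.+1%:R `^ (- (p / 2)) * ((4 `^ (p / 2)) ^+ k)^-1)).
    have QF : 0 <= q.+1%:R * 4 ^+ k :> R by exact: mulr_ge0.
    have QFi : 0 <= (q.+1%:R * 4 ^+ k)^-1 :> R by rewrite invr_ge0.
    rewrite /val (@powRM _ _ _ _ (sqr_ge0 _) (divr_ge0 (sqr_ge0 _) QF)).
    rewrite (powR_sqr_half _ _ (mulr_ge0 (ler0n _ 160) A0)) (@powRM _ _ _ _ (ler0n _ 160) A0).
    congr (_ * _).
    rewrite (@powRM _ _ _ _ (sqr_ge0 _) QFi) (powR_sqr_half _ _ (ltW NR)); congr (_ * _).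
    rewrite (powRVl _ _ QF) (@powRM _ _ _ _ Q0 F0) invfM powRN; congr (_ * _^-1).
    by apply: powR_expn; lra.
  have e2 : N%:R `^ p = N%:R `^ (p - 2) * N%:R ^+ 2 :> R.
    by rewrite -(powR_mulrn _ (ltW NR)) -powRD ?subrK// (gt_eqF NR) implybT.
  have e3 : 4 `^ (p / 2) = r * 4 :> R.
    have -> : r * 4 = r * 4 `^ 1 :> R by rewrite powRr1.
    by rewrite /r -powRD ?subrK// pnatr_eq0 implybT.
  rewrite e1 e2 e3 exprMn.
  have rk : r ^+ k != 0 by rewrite expf_neq0// gt_eqF//; lra.
  have k4 : 4 ^+ k != 0 :> R by rewrite expf_neq0.
  by field; rewrite rk k4 gt_eqF.
have -> : \sum_i e i * rho i = \sum_(q < 4 * N) \sum_(a < (8 * N).+1)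
   \sum_(k < N.+1) (if (a < (2 * q.+1).+1)%N then val q k `^ (p / 2) else 0) * (4 ^+ k / N%:R ^+ 2).
  by rewrite pair_bigA pair_bigA/=; apply: eq_bigr => -[[q a] k].
set D := A `^ p * N%:R `^ (p - 2); have D0 : 0 <= D by rewrite mulr_ge0 ?powR_ge0.
rewrite mulr_sumr mulr_sumr; apply: ler_sum => q _.
have inner : \sum_(k < N.+1) val q k `^ (p / 2) * (4 ^+ k / N%:R ^+ 2) <=
    160 `^ p * D * (q.+1%:R `^ (- (p / 2)) * Cr).
  under eq_bigr do rewrite eE.
  rewrite -mulr_sumr -mulr_sumr; apply: ler_wpM2l; first by rewrite mulr_ge0 ?powR_ge0.
  by apply: ler_wpM2l; [exact: powR_ge0|exact: geo_dec].
apply: (@le_trans _ _ (\sum_(a < (8 * N).+1 | (a < (2 * q.+1).+1)%N) 160 `^ p * D * (q.+1%:R `^ (- (p / 2)) * Cr))).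
  rewrite [leRHS]big_mkcond/=; apply: ler_sum => a _; case: ifP => _ //.
  by rewrite big1// => k _; rewrite mul0r.
have qle : ((2 * q.+1).+1 <= (8 * N).+1)%N by have := ltn_ord q; lia.
rewrite -(big_ord_widen _ (fun=> 160 `^ p * D * (q.+1%:R `^ (- (p / 2)) * Cr)) qle).
rewrite sumr_const card_ord -[leLHS]mulr_natr.
have -> : q.+1%:R `^ (1 - p / 2) = q.+1%:R * q.+1%:R `^ (- (p / 2)) :> R.
  by rewrite powRD ?powRr1// pnatr_eq0 implybT.
have -> : 3 * 160 `^ p * Cr * (D * (q.+1%:R * q.+1%:R `^ (- (p / 2)))) =
  160 `^ p * D * (q.+1%:R `^ (- (p / 2)) * Cr) * (3 * q.+1%:R) by ring.
apply: ler_wpM2l; last by rewrite -natrM ler_nat; lia.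
apply: mulr_ge0; first by apply: mulr_ge0 => //; exact: powR_ge0.
by apply: mulr_ge0; [exact: powR_ge0|exact: ltW].
Qed.

(** * Dyadic windows *)

(* [cutoff M] is 1 up to [M], 0 from [2 * M] on, and linear in between. *)
Definition hinge {R : realType} (k : R) (n : nat) : R := Num.max 0 (k - n%:R).

Definition cutoff {R : realType} (M : R) (n : nat) : R := (hinge (2 * M) n - hinge M n) / M.

(** Difference of consecutive plateaus, supported in [N / 2 < n < 2 * N]; the windows with
    [N = 2 ^ j] telescope to a single [cutoff]. *)
Definition dyad {R : realType} (N : nat) (n : nat) : R := cutoff (N%:R : R) n - cutoff (N%:R / 2 : R) n.

Lemma hingeP {R : realType} (k : R) (n : nat) :
  (n%:R <= k /\ hinge k n = k - n%:R) \/ (k <= n%:R /\ hinge k n = 0).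
Proof.
rewrite /hinge; have [h|h] := leP 0 (k - n%:R); [left|right]; split; lra.
Qed.

Lemma hinge_diff {R : realType} (k : R) (n : nat) : -1 <= hinge k n.+1 - hinge k n <= 0.
Proof.
have e : n.+1%:R = n%:R + 1 :> R by rewrite -natr1.
by case: (hingeP k n) => -[h ->]; case: (hingeP k n.+1) => -[h' ->]; rewrite e in h' *; lra.
Qed.

Lemma hinge_D2_ge0 {R : realType} (k : R) (n : nat) : 0 <= D2 (hinge k) n.
Proof.
have e : n.+1%:R = n%:R + 1 :> R by rewrite -natr1.
have e2 : n.+2%:R = n%:R + 2 :> R by rewrite -(natr1 n.+1) e; ring.
rewrite /D2; case: (hingeP k n) => -[h ->]; case: (hingeP k n.+1) => -[h' ->];
case: (hingeP k n.+2) => -[h'' ->]; rewrite ?e ?e2 in h h' h'' *; lra.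
Qed.

Lemma sum_D2 {R : realType} (f : nat -> R) (m n : nat) : (m <= n)%N ->
  \sum_(m <= i < n) D2 f i = (f n.+1 - f n) - (f m.+1 - f m).
Proof.
move=> mn; rewrite -(telescope_sumr (fun i => f i.+1 - f i))//.
by apply: eq_bigr => i _; rewrite /D2; ring.
Qed.

(** A hinge is convex, so the absolute values drop and the sum telescopes to the total change of
    slope. *)
Lemma sum_hinge_D2 {R : realType} (k : R) (L : nat) : \sum_(n < L) `|D2 (hinge k) n| <= 1.
Proof.
under eq_bigr do rewrite ger0_norm ?hinge_D2_ge0//.
rewrite -(big_mkord xpredT) sum_D2//.
have := hinge_diff k L; have := hinge_diff k 0; lra.
Qed.

Lemma cutoff_le {R : realType} (M : R) (n : nat) : 0 < M -> n%:R <= M -> cutoff M n = 1.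
Proof.
move=> M0 nM; rewrite /cutoff; case: (hingeP (2 * M) n) => -[h ->]; last lra.
case: (hingeP M n) => -[h' ->]; first by field; lra.
have -> : n%:R = M by lra.
by field; lra.
Qed.

Lemma cutoff_ge {R : realType} (M : R) (n : nat) : 0 < M -> 2 * M <= n%:R -> cutoff M n = 0.
Proof.
move=> M0 nM; rewrite /cutoff; case: (hingeP (2 * M) n) => -[h ->]; last first.
  by case: (hingeP M n) => -[h' ->]; [lra|rewrite subrr mul0r].
case: (hingeP M n) => -[h' ->]; first lra.
have -> : n%:R = 2 * M by lra.
by rewrite subrr subr0 mul0r.
Qed.

Lemma cutoff_01 {R : realType} (M : R) (n : nat) : 0 < M -> 0 <= cutoff M n <= 1.
Proof.
move=> M0; rewrite /cutoff; apply/andP; split.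
  rewrite divr_ge0 ?(ltW M0)//.
  by case: (hingeP (2 * M) n) => -[h ->]; case: (hingeP M n) => -[h' ->]; lra.
rewrite ler_pdivrMr//.
by case: (hingeP (2 * M) n) => -[h ->]; case: (hingeP M n) => -[h' ->]; lra.
Qed.

Lemma cutoff_diff {R : realType} (M : R) (n : nat) : 0 < M -> `|cutoff M n.+1 - cutoff M n| <= 2 / M.
Proof.
move=> M0; rewrite /cutoff -mulrBl normrM [X in _ * X]ger0_norm; last by rewrite invr_ge0 ltW.
rewrite ler_pM2r ?invr_gt0//; have := hinge_diff (2 * M) n; have := hinge_diff M n.
by move=> h1 h2; rewrite ler_norml; lra.
Qed.

Lemma cutoff_D2 {R : realType} (M : R) (L : nat) : 0 < M -> \sum_(n < L) `|D2 (cutoff M) n| <= 2 / M.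
Proof.
move=> M0; apply: (@le_trans _ _ (\sum_(n < L) (`|D2 (hinge (2 * M)) n| + `|D2 (hinge M) n|) / M)).
  apply: ler_sum => i _.
  have -> : D2 (cutoff M) i = (D2 (hinge (2 * M)) i - D2 (hinge M) i) / M.
    by rewrite /D2 /cutoff; ring.
  rewrite normrM [X in _ * X]ger0_norm; last by rewrite invr_ge0 ltW.
  by rewrite ler_pM2r ?invr_gt0//; exact: ler_normB.
rewrite -mulr_suml ler_pM2r ?invr_gt0// big_split/=.
have := sum_hinge_D2 (2 * M) L; have := sum_hinge_D2 M L; lra.
Qed.

Lemma dyad_le {R : realType} (N n : nat) : (0 < N)%N -> (2 * n <= N)%N -> dyad N n = 0 :> R.
Proof.
move=> N0 nN; have NR : 0 < N%:R :> R by rewrite ltr0n.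
have : 2 * n%:R <= N%:R :> R by rewrite -natrM ler_nat.
have n0 : 0 <= n%:R :> R by [].
by move=> h; rewrite /dyad !cutoff_le ?subrr//; lra.
Qed.

Lemma dyad_ge {R : realType} (N n : nat) : (0 < N)%N -> (2 * N <= n)%N -> dyad N n = 0 :> R.
Proof.
move=> N0 nN; have NR : 0 < N%:R :> R by rewrite ltr0n.
have : 2 * N%:R <= n%:R :> R by rewrite -natrM ler_nat.
by move=> h; rewrite /dyad !cutoff_ge ?subrr//; lra.
Qed.

Lemma dyad_abs {R : realType} (N n : nat) : (0 < N)%N -> `|dyad N n| <= 1 :> R.
Proof.
move=> N0; have NR : 0 < N%:R :> R by rewrite ltr0n.
have N2 : 0 < N%:R / 2 :> R by lra.
rewrite /dyad ler_norml; have := cutoff_01 _ n NR; have := cutoff_01 _ n N2; lra.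
Qed.

Lemma dyad_diff {R : realType} (N n : nat) : (0 < N)%N -> `|dyad N n.+1 - dyad N n| <= 6 / N%:R :> R.
Proof.
move=> N0; have NR : 0 < N%:R :> R by rewrite ltr0n.
have N2 : 0 < N%:R / 2 :> R by lra.
have h1 := cutoff_diff _ n NR; have h2 := cutoff_diff _ n N2.
have -> : dyad N n.+1 - dyad N n = (cutoff N%:R n.+1 - cutoff N%:R n) -
   (cutoff (N%:R / 2) n.+1 - cutoff (N%:R / 2) n) :> R by rewrite /dyad; ring.
apply: le_trans (ler_normB _ _) _; apply: le_trans (lerD h1 h2) _.
by rewrite le_eqVlt; apply/orP; left; apply/eqP; field; rewrite gt_eqF.
Qed.

Lemma dyad_D2 {R : realType} (N L : nat) : (0 < N)%N -> \sum_(n < L) `|D2 (dyad N : nat -> R) n| <= 6 / N%:R.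
Proof.
move=> N0; have NR : 0 < N%:R :> R by rewrite ltr0n.
have N2 : 0 < N%:R / 2 :> R by lra.
apply: (@le_trans _ _ (\sum_(n < L) (`|D2 (cutoff (N%:R : R)) n| + `|D2 (cutoff (N%:R / 2 : R)) n|))).
  apply: ler_sum => i _.
  have -> : D2 (dyad N) i = D2 (cutoff (N%:R : R)) i - D2 (cutoff (N%:R / 2 : R)) i.
    by rewrite /D2 /dyad; ring.
  exact: ler_normB.
rewrite big_split/=; apply: le_trans (lerD (cutoff_D2 _ L NR) (cutoff_D2 _ L N2)) _.
by rewrite le_eqVlt; apply/orP; left; apply/eqP; field; rewrite gt_eqF.
Qed.

(* Bounds for a sequence on a neighbourhood of the support of [dyad N], in the
   units natural at scale [N]. *)
Definition Wd {R : realType} (N : nat) (G : R) (g : nat -> R) : Prop :=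
  [/\ forall n, (0 < n)%N -> (N <= 8 * n)%N -> (n <= 4 * N)%N -> `|g n| <= G,
      forall n, (0 < n)%N -> (N <= 8 * n)%N -> (n < 4 * N)%N -> `|g n.+1 - g n| <= G / N%:R
    & \sum_(1 <= n < 2 * N | (N <= 8 * n)%N) `|D2 g n| <= G / N%:R].

Lemma Wd_mul {R : realType} (N : nat) (F G : R) (f g : nat -> R) : (0 < N)%N ->
  0 <= F -> 0 <= G -> Wd N F f -> Wd N G g -> Wd N (6 * (F * G)) (fun n => f n * g n).
Proof.
move=> N0 F0 G0 [f1 f2 f3] [g1 g2 g3].
have NR : 0 < N%:R :> R by rewrite ltr0n.
have FG : 0 <= F * G by exact: mulr_ge0.
have FN : 0 <= F / N%:R by rewrite divr_ge0// ltW.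
have GN : 0 <= G / N%:R by rewrite divr_ge0// ltW.
have hM (a b c d : R) : `|a| <= c -> `|b| <= d -> `|a * b| <= c * d.
  by move=> *; rewrite normrM ler_pM.
split.
- move=> n n0 n1 n2; apply: le_trans (hM _ _ _ _ (f1 n n0 n1 n2) (g1 n n0 n1 n2)) _; lra.
- move=> n n0 n1 n2.
  have -> : f n.+1 * g n.+1 - f n * g n = f n.+1 * (g n.+1 - g n) + (f n.+1 - f n) * g n by ring.
  apply: le_trans (ler_normD _ _) _.
  have N1' : (N <= 8 * n.+1)%N by rewrite (leq_trans n1)// leq_mul.
  have h1 := hM _ _ _ _ (f1 n.+1 isT N1' n2) (g2 n n0 n1 n2).
  have h2 := hM _ _ _ _ (f2 n n0 n1 n2) (g1 n n0 n1 (ltnW n2)).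
  apply: le_trans (lerD h1 h2) _.
  have -> : F * (G / N%:R) + F / N%:R * G = 2 * (F * G) / N%:R by ring.
  by rewrite ler_pM2r ?invr_gt0//; lra.
- apply: (@le_trans _ _ (\sum_(1 <= n < 2 * N | (N <= 8 * n)%N)
     (`|D2 f n| * G + F * `|D2 g n| + 2 * (F / N%:R * (G / N%:R))))).
    rewrite big_nat_cond [leRHS]big_nat_cond; apply: ler_sum => n /andP[/andP[n1 n2] n3].
    have a1 : (N <= 8 * n.+1)%N by rewrite (leq_trans n3)// leq_mul.
    have a2 : (n.+1 < 4 * N)%N by lia.
    have a3 : (n < 4 * N)%N by lia.
    rewrite D2M; apply: le_trans (ler_normD _ _) _.
    have -> : `|D2 f n| * G + F * `|D2 g n| + 2 * (F / N%:R * (G / N%:R)) =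
      `|D2 f n| * G + F * `|D2 g n| + F / N%:R * (G / N%:R) + F / N%:R * (G / N%:R) by ring.
    apply: lerD; last by apply: hM; [exact: f2|exact: g2].
    apply: le_trans (ler_normD _ _) _.
    apply: lerD; last by apply: hM; [exact: f2|exact: g2].
    apply: le_trans (ler_normD _ _) _.
    rewrite !normrM; apply: lerD.
      by apply: ler_wpM2l => //; apply: g1 => //; exact: ltnW.
    by apply: ler_wpM2r => //; apply: f1 => //; exact: ltnW.
  rewrite !big_split/= -mulr_suml -mulr_sumr.
  have c3 : \sum_(1 <= n < 2 * N | (N <= 8 * n)%N) 2 * (F / N%:R * (G / N%:R)) <= 4 * (F * G / N%:R).
    apply: (@le_trans _ _ (\sum_(0 <= n < 2 * N) 2 * (F / N%:R * (G / N%:R)))).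
      rewrite (@big_cat_nat _ _ _ 1 0 (2 * N))//=; last by rewrite muln_gt0.
      rewrite big_nat1 -[leLHS]add0r; apply: lerD; first by rewrite !mulr_ge0.
      by rewrite big_mkcond; apply: ler_sum => i _; case: ifP => // _; rewrite !mulr_ge0.
    rewrite sumr_const_nat subn0 -[leLHS]mulr_natr natrM le_eqVlt; apply/orP; left; apply/eqP.
    by field; rewrite gt_eqF.
  have c1 := ler_wpM2r G0 f3; have c2 := ler_wpM2l F0 g3.
  have -> : 6 * (F * G) / N%:R = F / N%:R * G + F * (G / N%:R) + 4 * (F * G / N%:R) by ring.
  by apply: lerD => //; apply: lerD.
Qed.

(** Leibniz rule again. The sum of second differences gives [40 = 9 + 6 + 1 + 24]: the index 0, the
    window, the factor [g], and the products of first differences. *)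
Lemma bumpw_dyad {R : realType} (N : nat) (G : R) (g : nat -> R) : (0 < N)%N -> 0 <= G ->
  Wd N G g -> bumpw N (40 * G) (fun n => dyad N n * g n).
Proof.
move=> N0 G0 [g1 g2 g3].
have NR : 0 < N%:R :> R by rewrite ltr0n.
have GN : 0 <= G / N%:R by rewrite divr_ge0// ltW.
have hM (a b c d : R) : `|a| <= c -> `|b| <= d -> `|a * b| <= c * d.
  by move=> *; rewrite normrM ler_pM.
have wA n : `|dyad N n * g n| <= G.
  have [h|h] := leqP (2 * n) N; first by rewrite dyad_le// mul0r normr0.
  have [h'|h'] := leqP (2 * N) n; first by rewrite dyad_ge// mul0r normr0.
  have -> : G = 1 * G by rewrite mul1r.
  by apply: hM; [exact: dyad_abs|apply: g1; lia].
have AN : 40 * G / N%:R = 40 * (G / N%:R) by rewrite mulrA.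
(* For [N <= 3] the window reaches indices next to 0, where nothing is assumed on [g]; then [G]
   itself is of size [G / N] and the trivial bounds suffice. *)
have small : (N <= 3)%N -> G <= 3 * (G / N%:R).
  move=> h; have : N%:R <= 3 :> R by rewrite (ler_nat _ N 3).
  by move=> /(ler_wpM2r GN); rewrite [X in X <= _]mulrC divfK ?gt_eqF.
split.
- by rewrite dyad_le// mul0r.
- by move=> n h; rewrite dyad_ge// mul0r.
- by move=> n; apply: le_trans (wA n) _; lra.
- move=> n; rewrite AN.
  have [h|h] := leqP (2 * N) n.
    by rewrite !dyad_ge ?mul0r ?subrr ?normr0 ?mulr_ge0//; lia.
  have [h3|h3] := leqP N 3.
    apply: le_trans (ler_normB _ _) _.
    by have := small h3; have := wA n; have := wA n.+1; lra.
  have [h2|h2] := leqP (2 * n.+1) N.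
    by rewrite !dyad_le ?mul0r ?subrr ?normr0 ?mulr_ge0//; lia.
  have -> : dyad N n.+1 * g n.+1 - dyad N n * g n =
     dyad N n.+1 * (g n.+1 - g n) + (dyad N n.+1 - dyad N n) * g n by ring.
  apply: le_trans (ler_normD _ _) _.
  have n0 : (0 < n)%N by lia.
  have n1 : (N <= 8 * n)%N by lia.
  have n2 : (n < 4 * N)%N by lia.
  have b1 := hM _ _ _ _ (dyad_abs N n.+1 N0) (g2 n n0 n1 n2).
  have b2 := hM _ _ _ _ (dyad_diff N n N0) (g1 n n0 n1 (ltnW n2)).
  have e : 6 / N%:R * G = 6 * (G / N%:R) by ring.
  by rewrite e in b2; lra.
- rewrite AN -(big_mkord xpredT (fun n => `|D2 (fun n => dyad N n * g n) n|)).
  rewrite big_ltn ?muln_gt0//.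
  have first : `|D2 (fun n => dyad N n * g n) 0| <= 9 * (G / N%:R).
    have [h3|h3] := leqP N 3.
      rewrite /D2 (@dyad_le R N 0 N0 (leq0n _)) mul0r addr0; apply: le_trans (ler_normB _ _) _.
      rewrite (normrM 2) (@ger0_norm _ 2)//.
      by have := small h3; have := wA 2%N; have := wA 1%N; lra.
    rewrite /D2 !dyad_le ?mul0r ?mulr0 ?subr0 ?addr0 ?normr0 ?mulr_ge0//; lia.
  have rest : \sum_(1 <= n < 2 * N) `|D2 (fun n => dyad N n * g n) n| <=
     \sum_(1 <= n < 2 * N | (N <= 8 * n)%N) (`|D2 (dyad N : nat -> R) n| * G + 1 * `|D2 g n| +
       2 * (6 / N%:R * (G / N%:R))).
    rewrite [leRHS]big_mkcond/=; apply: ler_sum_nat => n /andP[n1 n2]; case: leqP => h; last first.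
      by rewrite /D2 !dyad_le ?mul0r ?mulr0 ?subr0 ?addr0 ?normr0//; lia.
    have a1 : (N <= 8 * n.+1)%N by rewrite (leq_trans h)// leq_mul.
    have a2 : (n.+1 < 4 * N)%N by lia.
    have a3 : (n < 4 * N)%N by lia.
    have dd := @dyad_diff R N; have da := @dyad_abs R N.
    rewrite D2M; apply: le_trans (ler_normD _ _) _.
    have -> : `|D2 (dyad N) n| * G + 1 * `|D2 g n| + 2 * (6 / N%:R * (G / N%:R)) =
      `|D2 (dyad N) n| * G + 1 * `|D2 g n| + 6 / N%:R * (G / N%:R) + 6 / N%:R * (G / N%:R) by ring.
    apply: lerD; last by apply: hM; [exact: dd|exact: g2].
    apply: le_trans (ler_normD _ _) _.
    apply: lerD; last by apply: hM; [exact: dd|exact: g2].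
    apply: le_trans (ler_normD _ _) _.
    rewrite !normrM; apply: lerD.
      by apply: ler_wpM2l => //; apply: g1 => //; exact: ltnW.
    by apply: ler_wpM2r => //; exact: da.
  rewrite !big_split/= -mulr_suml -mulr_sumr in rest.
  have c3 : \sum_(1 <= n < 2 * N | (N <= 8 * n)%N) 2 * (6 / N%:R * (G / N%:R)) <= 24 * (G / N%:R).
    apply: (@le_trans _ _ (\sum_(0 <= n < 2 * N) 2 * (6 / N%:R * (G / N%:R)))).
      rewrite (@big_cat_nat _ _ _ 1 0 (2 * N))//=; last by rewrite muln_gt0.
      have p0 : 0 <= 2 * (6 / N%:R * (G / N%:R)).
        by apply: mulr_ge0 => //; apply: mulr_ge0 => //; rewrite divr_ge0// ltW.
      rewrite big_nat1 -[leLHS]add0r; apply: lerD => //.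
      by rewrite big_mkcond; apply: ler_sum => i _; case: ifP.
    rewrite sumr_const_nat subn0 -[leLHS]mulr_natr natrM le_eqVlt; apply/orP; left; apply/eqP.
    by field; rewrite gt_eqF.
  have c1 : (\sum_(1 <= i < 2 * N | (N <= 8 * i)%N) `|D2 (dyad N : nat -> R) i|) * G <= 6 * (G / N%:R).
    have -> : 6 * (G / N%:R) = 6 / N%:R * G by ring.
    apply: ler_wpM2r => //; apply: le_trans (dyad_D2 N (2 * N) N0).
    rewrite -(big_mkord xpredT (fun n => `|D2 (dyad N : nat -> R) n|)).
    rewrite (@big_cat_nat _ _ _ 1 0 (2 * N))//=; last by rewrite muln_gt0.
    rewrite big_nat1 -[leLHS]add0r; apply: lerD => //.
    by rewrite big_mkcond; apply: ler_sum => i _; case: ifP.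
  lra.
Qed.

(** * Powers and sines as weights *)

Lemma powRN_diff {R : realType} (a : R) (n : nat) : 0 < a -> (0 < n)%N ->
  - (a * (n%:R `^ (- a) / n%:R)) <= (n.+1%:R `^ (- a) - n%:R `^ (- a) : R) <= 0.
Proof.
move=> a0 n0; have nR : 0 < n%:R :> R by rewrite ltr0n.
have nR1 : 0 < n.+1%:R :> R by rewrite ltr0n.
have P0 := @powR_ge0 R n%:R (- a).
apply/andP; split; last first.
  rewrite subr_le0 !powRN lef_pV2 ?posrE ?powR_gt0//.
  by apply: ler_powR2r; [exact: ler0n|exact: ltW|rewrite ler_nat].
have e : n.+1%:R `^ (- a) = n%:R `^ (- a) * (1 + n%:R^-1) `^ (- a) :> R.
  have x0 : 0 <= 1 + n%:R^-1 :> R by rewrite addr_ge0// invr_ge0 ltW.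
  rewrite -(@powRM _ _ _ _ (ltW nR) x0).
  by congr (_ `^ _); rewrite -natr1; field; rewrite gt_eqF.
have h : 1 - a / n%:R <= (1 + n%:R^-1) `^ (- a).
  have x0 : 0 < n%:R^-1 :> R by rewrite invr_gt0.
  rewrite /powR gt_eqF; last lra.
  apply: le_trans (expR_ge1Dx _); rewrite lerD2l mulNr lerN2.
  by apply: ler_wpM2l; [exact: ltW|apply: le_ln1Dx; lra].
rewrite e; have := ler_wpM2l P0 h; lra.
Qed.

(** Since [n * (n + 2) <= (n + 1) ^ 2], the middle value is at most the geometric mean of its
    neighbours, hence at most their arithmetic mean. Convexity lets the second differences telescope
    in [Wd_powR]. *)
Lemma powRN_D2_ge0 {R : realType} (a : R) (n : nat) : 0 < a -> (0 < n)%N ->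
  0 <= D2 (fun n => n%:R `^ (- a) : R) n.
Proof.
move=> a0 n0; rewrite /D2.
have n1 : 0 < n%:R :> R by rewrite ltr0n.
have n2 : 0 < n.+1%:R :> R by rewrite ltr0n.
have n3 : 0 < n.+2%:R :> R by rewrite ltr0n.
have s0 := powR_gt0 (- a) n1; have t0 := powR_gt0 (- a) n3; have u0 := powR_gt0 (- a) n2.
have st : (n.+1%:R `^ (- a)) ^+ 2 <= n%:R `^ (- a) * n.+2%:R `^ (- a) :> R.
  rewrite expr2 -(@powRM _ _ _ _ (ltW n2) (ltW n2)) -(@powRM _ _ _ _ (ltW n1) (ltW n3)).
  rewrite !powRN lef_pV2 ?posrE; [|by apply: powR_gt0; apply: mulr_gt0|by apply: powR_gt0; apply: mulr_gt0].
  apply: ler_powR2r; [by rewrite mulr_ge0|exact: ltW|rewrite -!natrM ler_nat; lia].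
set s := n%:R `^ _ in s0 st *; set t := n.+2%:R `^ _ in t0 st *; set u := n.+1%:R `^ _ in u0 st *.
have : (2 * u) ^+ 2 <= (s + t) ^+ 2.
  have -> : (2 * u) ^+ 2 = 4 * u ^+ 2 by ring.
  have := sqr_ge0 (s - t); rewrite sqrrB sqrrD; lra.
have p1 : 0 <= 2 * u by lra.
have p2 : 0 <= s + t by lra.
by rewrite ler_pXn2r ?nnegrE//; lra.
Qed.

Lemma Wd_powR {R : realType} (a : R) (N : nat) : 0 < a -> (0 < N)%N ->
  Wd N ((1 + 8 * a) * 8 `^ a * N%:R `^ (- a)) (fun n => n%:R `^ (- a)).
Proof.
move=> a0 N0.
have NR : 0 < N%:R :> R by rewrite ltr0n.
have c0 : 0 < 8 `^ a * N%:R `^ (- a) :> R by rewrite mulr_gt0 ?powR_gt0.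
have low (n : nat) : (0 < n)%N -> (N <= 8 * n)%N -> n%:R `^ (- a) <= 8 `^ a * N%:R `^ (- a) :> R.
  move=> n0 h; have nR : 0 < n%:R :> R by rewrite ltr0n.
  have -> : 8 `^ a * N%:R `^ (- a) = (N%:R / 8) `^ (- a) :> R.
    by rewrite powRM ?(ltW NR)// mulrC (powRVl 8)// (powRN 8) invrK.
  rewrite !powRN lef_pV2 ?posrE ?powR_gt0 ?divr_gt0//.
  apply: ler_powR2r; [by rewrite divr_ge0// ltW|exact: ltW|].
  by rewrite ler_pdivrMr// -natrM ler_nat mulnC.
have diff (n : nat) : (0 < n)%N -> (N <= 8 * n)%N ->
    `|n.+1%:R `^ (- a) - n%:R `^ (- a)| <= (1 + 8 * a) * 8 `^ a * N%:R `^ (- a) / N%:R.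
  move=> n0 h; have /andP[d1 d2] := powRN_diff a n a0 n0.
  rewrite ler0_norm//; have nR : 0 < n%:R :> R by rewrite ltr0n.
  have h1 : n%:R `^ (- a) / n%:R <= (8 `^ a * N%:R `^ (- a)) * (8 / N%:R).
    apply: ler_pM; rewrite ?powR_ge0 ?invr_ge0 ?(ltW nR)//; first exact: low.
    rewrite ler_pdivlMr// ler_pdivrMl//; rewrite -natrM ler_nat; lia.
  have h2 := ler_wpM2l (ltW a0) h1.
  have h3 : 0 <= 8 `^ a * N%:R `^ (- a) / N%:R by rewrite divr_ge0// ltW.
  have -> : (1 + 8 * a) * 8 `^ a * N%:R `^ (- a) / N%:R = 8 `^ a * N%:R `^ (- a) / N%:R +
     a * (8 `^ a * N%:R `^ (- a) * (8 / N%:R)) by ring.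
  lra.
split.
- move=> n n0 n1 n2; rewrite ger0_norm ?powR_ge0//; apply: le_trans (low n n0 n1) _.
  by have := mulr_ge0 (ltW a0) (ltW c0); lra.
- by move=> n n0 n1 n2; exact: diff.
- pose n0 := maxn 1 ((N + 7) %/ 8).
  have n0P n : ((0 < n) && (N <= 8 * n))%N = (n0 <= n)%N.
    rewrite /n0 geq_max; congr andb; apply/idP/idP; lia.
  have n01 : (0 < n0)%N by rewrite /n0 leq_max.
  have n0N : (N <= 8 * n0)%N by have := n0P n0; rewrite leqnn => /andP[].
  apply: (@le_trans _ _ (\sum_(n0 <= n < maxn n0 (2 * N)) D2 (fun n => n%:R `^ (- a) : R) n)).
    have -> : \sum_(1 <= n < 2 * N | (N <= 8 * n)%N) `|D2 (fun n => n%:R `^ (- a) : R) n| =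
       \sum_(n0 <= n < 2 * N) D2 (fun n => n%:R `^ (- a) : R) n.
      rewrite big_nat_cond (big_nat_widenl n0 0)//.
      rewrite (big_nat_widenl 1 0)//; apply: congr_big_nat => // n nn.
        by rewrite -n0P; lia.
      rewrite ger0_norm//; apply: powRN_D2_ge0 => //; lia.
    have [h|h] := leqP n0 (2 * N); first by [].
    by rewrite !big_geq// ltnW.
  rewrite sum_D2 ?leq_maxl//.
  have m0 : (0 < maxn n0 (2 * N))%N by rewrite leq_max n01.
  have /andP[_ d2] := powRN_diff a _ a0 m0.
  have d1 := diff n0 n01 n0N.
  have := ler_norm (- (n0.+1%:R `^ (- a) - n0%:R `^ (- a)) : R); rewrite normrN; lra.
Qed.

Lemma sin_diff_le {R : realType} (x y : R) : `|sin x - sin y| <= `|x - y|.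
Proof.
have -> : sin x - sin y = 2 * (cos ((x + y) / 2) * sin ((x - y) / 2)).
  set u := (x + y) / 2; set v := (x - y) / 2.
  have xe : x = u + v by rewrite /u /v; lra.
  have ye : y = u - v by rewrite /u /v; lra.
  by rewrite [in sin x]xe [in sin y]ye sinD sinB; ring.
rewrite !normrM (@ger0_norm _ 2)//.
have h1 := cos_max ((x + y) / 2); have h2 := abs_sin_le ((x - y) / 2).
have h3 : `|cos ((x + y) / 2)| * `|sin ((x - y) / 2)| <= 1 * `|(x - y) / 2| by apply: ler_pM.
have : `|(x - y) / 2| = `|x - y| / 2 by rewrite normrM (@ger0_norm _ (2^-1)).
lra.
Qed.

Lemma pi_le4 {R : realType} : pi <= 4 :> R.
Proof. by have := @pihalf_lt2 R; lra. Qed.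

(** As long as [N ^ 2 * l <= 1] the phase varies by a bounded amount over [n ~ N], and the sine
    behaves like a smooth function of size [N ^ 2 * l]. This is the gain for the pieces below the
    transition scale. *)
Lemma Wd_sin {R : realType} (N : nat) (l : R) : (0 < N)%N -> 0 < l -> N%:R ^+ 2 * l <= 1 ->
  Wd N (1200 * (N%:R ^+ 2 * l)) (fun n => sin (pi * (n ^ 2)%:R * l)).
Proof.
move=> N0 l0 Nl.
have NR : 0 < N%:R :> R by rewrite ltr0n.
have NR1 : 1 <= N%:R :> R by rewrite ler1n.
have p4 := @pi_le4 R; have p0 := @pi_gt0 R.
pose th : R := pi * l.
have th0 : 0 < th by exact: mulr_gt0.
have th4 : th <= 4 * l by apply: ler_wpM2r => //; exact: ltW.
have Nl0 : 0 < N%:R * l by exact: mulr_gt0.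
have lN : l <= N%:R * l by rewrite ler_peMl// ltW.
have E (n : nat) : pi * (n ^ 2)%:R * l = n%:R ^+ 2 * th by rewrite natrX /th; ring.
have G : 1200 * (N%:R ^+ 2 * l) / N%:R = 1200 * (N%:R * l) by field; rewrite gt_eqF.
split.
- move=> n _ _ n4; rewrite E; apply: le_trans (abs_sin_le _) _.
  rewrite ger0_norm; last by rewrite mulr_ge0 ?sqr_ge0// ltW.
  have : n%:R ^+ 2 <= (4 * N%:R) ^+ 2 :> R by rewrite ler_pXn2r ?nnegrE ?mulr_ge0// -natrM ler_nat.
  move=> h; apply: le_trans (ler_pM _ _ h th4) _; rewrite ?sqr_ge0 ?(ltW th0)//.
  have := mulr_ge0 (sqr_ge0 (N%:R : R)) (ltW l0).
  have -> : (4 * N%:R) ^+ 2 * (4 * l) = 64 * (N%:R ^+ 2 * l) :> R by ring.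
  lra.
- move=> n _ _ n4; rewrite !E G; apply: le_trans (sin_diff_le _ _) _.
  have -> : n.+1%:R ^+ 2 * th - n%:R ^+ 2 * th = (2 * n%:R + 1) * th by rewrite -natr1; ring.
  rewrite ger0_norm; last by rewrite mulr_ge0 ?(ltW th0)// addr_ge0// mulr_ge0.
  have h : 2 * n%:R + 1 <= 9 * N%:R :> R.
    have : n%:R <= 4 * N%:R :> R by rewrite -natrM ler_nat ltnW.
    lra.
  apply: le_trans (ler_pM _ _ h th4) _; [by rewrite addr_ge0// mulr_ge0|exact: ltW|].
  have -> : 9 * N%:R * (4 * l) = 36 * (N%:R * l) by ring.
  lra.
- rewrite G.
  apply: (@le_trans _ _ (\sum_(1 <= n < 2 * N | (N <= 8 * n)%N) 600 * l)).
    rewrite big_mkcond [leRHS]big_mkcond; apply: ler_sum_nat => n /andP[n1 n2]; case: ifP => // _.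
    rewrite /D2 !E; set m : R := n.+1%:R.
    have mN : m <= 2 * N%:R by rewrite /m -natrM ler_nat.
    have m0 : 0 <= m by [].
    have -> : n.+2%:R ^+ 2 * th = (m ^+ 2 + 1) * th + 2 * m * th by rewrite /m -(natr1 n.+1); ring.
    have -> : n%:R ^+ 2 * th = (m ^+ 2 + 1) * th - 2 * m * th by rewrite /m -(natr1 n); ring.
    set B := 2 * m * th; set A := (m ^+ 2 + 1) * th.
    (* The neighbours of [m] have phases [A + B] and [A - B]. The second difference is of order
       [th + B ^ 2], and [B ^ 2] is of order [N ^ 2 * l * l <= l]. *)
    have -> : sin (A + B) - 2 * sin (m ^+ 2 * th) + sin (A - B) =
       2 * ((sin A - sin (m ^+ 2 * th)) * cos B) - 2 * (sin (m ^+ 2 * th) * (1 - cos B)).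
      by rewrite sinD sinB; ring.
    apply: le_trans (ler_normB _ _) _; rewrite !normrM (@ger0_norm _ 2)//.
    have h1 : `|sin A - sin (m ^+ 2 * th)| <= th.
      apply: le_trans (sin_diff_le _ _) _.
      have -> : A - m ^+ 2 * th = th by rewrite /A; ring.
      by rewrite ger0_norm// ltW.
    have h2 : `|sin A - sin (m ^+ 2 * th)| * `|cos B| <= th * 1 by apply: ler_pM => //; exact: cos_max.
    have /andP[c0 c1] := one_sub_cos_le B.
    have h3 : `|sin (m ^+ 2 * th)| * `|1 - cos B| <= 1 * (B ^+ 2 / 2).
      by apply: ler_pM => //; [exact: sin_max|rewrite ger0_norm].
    have h4 : B ^+ 2 / 2 <= 2 * (4 * N%:R ^+ 2 * (4 * l)) * (4 * l).
      have -> : B ^+ 2 / 2 = 2 * (m ^+ 2 * th) * th by rewrite /B; field.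
      apply: ler_pM; [by rewrite !mulr_ge0 ?sqr_ge0// ltW|exact: ltW| |exact: th4].
      rewrite ler_pM2l//; apply: ler_pM => //; [exact: sqr_ge0|exact: ltW|].
      have -> : 4 * N%:R ^+ 2 = (2 * N%:R) ^+ 2 :> R by ring.
      by rewrite ler_pXn2r ?nnegrE ?mulr_ge0.
    have h5 : 2 * (4 * N%:R ^+ 2 * (4 * l)) * (4 * l) <= 128 * l.
      have -> : 2 * (4 * N%:R ^+ 2 * (4 * l)) * (4 * l) = 128 * (N%:R ^+ 2 * l) * l by ring.
      by rewrite ler_pM2r//; lra.
    lra.
  apply: (@le_trans _ _ (\sum_(0 <= n < 2 * N) 600 * l)).
    rewrite (@big_cat_nat _ _ _ 1 0 (2 * N))//=; last by rewrite muln_gt0.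
    have l00 : 0 <= 600 * l by have := ltW l0; lra.
    rewrite big_nat1 -[leLHS]add0r; apply: lerD => //.
    by rewrite big_mkcond; apply: ler_sum => i _; case: ifP.
  rewrite sumr_const_nat subn0 -[leLHS]mulr_natr natrM le_eqVlt; apply/orP; left; apply/eqP; ring.
Qed.

Lemma sum_powR_dyadic {R : realType} (be : R) (J : nat) : 0 <= be ->
  \sum_(q < 2 ^ J) q.+1%:R `^ (- be) <= 1 + \sum_(i < J) (2 `^ (1 - be)) ^+ i :> R.
Proof.
move=> b0; elim: J => [|J IH]; first by rewrite big_ord0 big_ord1 powR1 addr0.
rewrite expnS mul2n -addnn big_split_ord/= big_ord_recr/= addrA; apply: lerD => //.
apply: (@le_trans _ _ (\sum_(i < 2 ^ J) (2 ^ J)%N%:R `^ (- be))).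
  apply: ler_sum => i _; rewrite !powRN lef_pV2 ?posrE; last 2 first.
  - by apply: powR_gt0; rewrite ltr0n.
  - by apply: powR_gt0; rewrite ltr0n expn_gt0.
  by apply: ler_powR2r => //; rewrite ler_nat; lia.
rewrite sumr_const card_ord -[leLHS]mulr_natr natrX.
have -> : (2 `^ (1 - be)) ^+ J = 2 ^+ J * (2 ^+ J) `^ (- be) :> R.
  rewrite powR_expn ?ltr1n// -exprMn; congr (_ ^+ _).
  by rewrite powRD ?powRr1// pnatr_eq0 implybT.
by rewrite mulrC.
Qed.

(* [N `^ kap p] is the growth of the L^p norm of the sum of [e(n ^ 2 * x)] over [n ~ N],
   up to the factor [logf p] to the power [1 / p]. *)
Definition kap {R : realType} (p : R) : R := if p < 4 then 1 / 2 else 1 - 2 / p.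
Definition logf {R : realType} (p : R) (j : nat) : R := if p == 4 then j.+1%:R else 1.

(** Dyadic blocks of denominators form a geometric sequence of ratio [2 ^ (2 - p / 2)]: increasing
    for [p < 4], constant at [p = 4], where the number of blocks is the logarithm, decreasing for
    [p > 4]. *)
Lemma arc_sum_bound {R : realType} (p : R) : 2 < p -> exists2 C : R, 0 < C & forall j : nat,
  (2 ^+ j) `^ (p - 2) * \sum_(q < 4 * 2 ^ j) q.+1%:R `^ (1 - p / 2) <=
  C * (((2 ^+ j) `^ kap p) `^ p * logf p j).
Proof.
move=> p2.
have b0 : 0 <= p / 2 - 1 by lra.
have eq4 j : (4 * 2 ^ j = 2 ^ j.+2)%N by rewrite !expnS mulnA.
have S j : \sum_(q < 4 * 2 ^ j) q.+1%:R `^ (1 - p / 2) <=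
    1 + \sum_(i < j.+2) (2 `^ (2 - p / 2)) ^+ i :> R.
  have := sum_powR_dyadic (p / 2 - 1) j.+2 b0.
  have e1 : 1 - (p / 2 - 1) = 2 - p / 2 by ring.
  have e2 : - (p / 2 - 1) = 1 - p / 2 by ring.
  by rewrite eq4 e1 e2.
have J1 j : 1 <= 2 ^+ j :> R by apply: exprn_ege1; lra.
have J0 j : 0 < 2 ^+ j :> R by apply: exprn_gt0; lra.
have [p4|p4] := ltP p 4.
  have r1 : 1 < 2 `^ (2 - p / 2) :> R by apply: powR_gt1; lra.
  set r := 2 `^ (2 - p / 2) in r1 S.
  exists (1 + r ^+ 2 / (r - 1)); first by rewrite addr_gt0// divr_gt0 ?exprn_gt0//; lra.
  move=> j; rewrite /kap p4 /logf lt_eqF// mulr1 -powRrM.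
  have rj : (2 ^+ j) `^ (2 - p / 2) = r ^+ j by rewrite powR_expn; [|lra].
  have -> : (2 ^+ j) `^ (1 / 2 * p) = (2 ^+ j) `^ (p - 2) * r ^+ j.
    rewrite -rj -powRD; last by rewrite (gt_eqF (J0 j)) implybT.
    by congr (_ `^ _); field.
  rewrite mulrCA; apply: ler_wpM2l; first exact: powR_ge0.
  apply: le_trans (S j) _.
  have rj1 : 1 <= r ^+ j by apply: exprn_ege1; lra.
  have := geo_sum_lt 1 r j.+2 ler01 r1.
  under eq_bigr do rewrite mul1r.
  have -> : 1 * r ^+ j.+2 / (r - 1) = r ^+ 2 / (r - 1) * r ^+ j by rewrite !exprS expr0; field; lra.
  by move=> h; rewrite mulrDl mul1r; apply: lerD.
have k4 : kap p = 1 - 2 / p by rewrite /kap ltNge p4.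
have kE j : ((2 ^+ j) `^ kap p) `^ p = (2 ^+ j) `^ (p - 2) :> R.
  by rewrite -powRrM k4; congr (_ `^ _); field; lra.
have [e4|n4] := eqVneq p 4.
  exists 4; first lra.
  move=> j; rewrite kE mulrCA; apply: ler_wpM2l; first exact: powR_ge0.
  apply: le_trans (S j) _.
  have -> : 2 `^ (2 - p / 2) = 1 :> R by rewrite e4 (_ : 2 - 4 / 2 = 0) ?powRr0//; field.
  under eq_bigr do rewrite expr1n.
  rewrite sumr_const card_ord /logf e4 eqxx.
  by rewrite -(natrD _ 1) -natrM ler_nat; lia.
have r1 : 1 < 2 `^ (p / 2 - 2) :> R.
  by apply: powR_gt1; [lra|]; have : p != 4 by []; rewrite -subr_eq0 => /eqP; lra.
set r := 2 `^ (p / 2 - 2) in r1.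
exists (1 + r / (r - 1)); first by rewrite addr_gt0// divr_gt0//; lra.
move=> j; rewrite kE /logf (negbTE n4) mulr1 mulrC; apply: ler_wpM2r; first exact: powR_ge0.
apply: le_trans (S j) _; rewrite lerD2l; apply: le_trans (geo_dec r j.+2 r1).
apply: ler_sum => i _; rewrite /r -[in leRHS]exprVn -powRN opprB.
by [].
Qed.

Lemma cmodD {R : realType} (a b c d : R) : cmod (a + c) (b + d) <= cmod a b + cmod c d.
Proof.
rewrite /cmod.
have P (x y : R) : 0 <= x ^+ 2 + y ^+ 2 by rewrite addr_ge0 ?sqr_ge0.
set u := Num.sqrt (a ^+ 2 + b ^+ 2); set v := Num.sqrt (c ^+ 2 + d ^+ 2).
have u0 : 0 <= u by exact: sqrtr_ge0.
have v0 : 0 <= v by exact: sqrtr_ge0.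
have u2 : u ^+ 2 = a ^+ 2 + b ^+ 2 by rewrite sqr_sqrtr.
have v2 : v ^+ 2 = c ^+ 2 + d ^+ 2 by rewrite sqr_sqrtr.
have cs : a * c + b * d <= u * v.
  have h : (a * c + b * d) ^+ 2 <= (u * v) ^+ 2.
    rewrite exprMn u2 v2; have := sqr_ge0 (a * d - b * c).
    by rewrite !expr2; lra.
  apply: le_trans (ler_norm _) _; rewrite -(ger0_norm (mulr_ge0 u0 v0)).
  by rewrite -!sqrtr_sqr; exact: ler_wsqrtr.
have -> : (a + c) ^+ 2 + (b + d) ^+ 2 = a ^+ 2 + b ^+ 2 + (a * c + b * d) *+ 2 + (c ^+ 2 + d ^+ 2).
  by rewrite !expr2; ring.
have uv : (u + v) ^+ 2 = a ^+ 2 + b ^+ 2 + (u * v) *+ 2 + (c ^+ 2 + d ^+ 2).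
  by rewrite sqrrD u2 v2.
rewrite -(ger0_norm (addr_ge0 u0 v0)) -sqrtr_sqr uv; apply: ler_wsqrtr.
by move: cs; move: (u * v) (a * c + b * d) => U V cs; lra.
Qed.

Lemma cmod_sum {R : realType} (I : Type) (r : seq I) (A B : I -> R) :
  cmod (\sum_(i <- r) A i) (\sum_(i <- r) B i) <= \sum_(i <- r) cmod (A i) (B i).
Proof.
elim: r => [|i r IH]; first by rewrite !big_nil /cmod expr0n/= addr0 sqrtr0.
by rewrite !big_cons; apply: le_trans (cmodD _ _ _ _) _; rewrite lerD2l.
Qed.

Lemma cmod_ge0 {R : realType} (a b : R) : 0 <= cmod a b.
Proof. exact: sqrtr_ge0. Qed.

Lemma cmodN {R : realType} (a b : R) : cmod (- a) (- b) = cmod a b.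
Proof. by rewrite /cmod !sqrrN. Qed.

Definition TC {R : realType} (c : nat -> R) (L : nat) (x : R) : R :=
  \sum_(n < L) c n * cos (2 * pi * (n ^ 2)%:R * x).
Definition TS {R : realType} (c : nat -> R) (L : nat) (x : R) : R :=
  \sum_(n < L) c n * sin (2 * pi * (n ^ 2)%:R * x).

Lemma T2E {R : realType} (c : nat -> R) (L : nat) (x : R) : T2 c L x = TC c L x ^+ 2 + TS c L x ^+ 2.
Proof. by []. Qed.

Lemma cmod_T {R : realType} (c : nat -> R) (L : nat) (x : R) : cmod (TC c L x) (TS c L x) = Num.sqrt (T2 c L x).
Proof. by []. Qed.

Lemma continuous_T2 {R : realType} (c : nat -> R) (L : nat) : continuous (T2 c L).
Proof. exact: continuous_GT. Qed.

Lemma T2_ge0 {R : realType} (c : nat -> R) (L : nat) x : 0 <= T2 c L x.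
Proof. exact: GT_ge0. Qed.

Lemma T2_periodic {R : realType} (c : nat -> R) (L : nat) x : T2 c L (x + 1) = T2 c L x.
Proof.
have e (n : nat) : 2 * pi * (n ^ 2)%:R * (x + 1) = 2 * pi * (n ^ 2)%:R * x + 2 * pi * (n ^ 2)%:R by ring.
rewrite !T2E; congr (_ ^+ 2 + _ ^+ 2); apply: eq_bigr => n _; rewrite e ?cosDn ?sinDn//.
Qed.

(** * Differences of exponential sums *)

(* The coefficients of the difference, up to a factor 2i and a translation by [l / 2]. *)
Definition dcoef {R : realType} (l : R) (c : nat -> R) (n : nat) : R := c n * sin (pi * (n ^ 2)%:R * l).

Definition Dmod {R : realType} (c : nat -> R) (L : nat) (l x : R) : R :=
  cmod (TC c L (x + l) - TC c L x) (TS c L (x + l) - TS c L x).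

Lemma Dmod_sqr {R : realType} (c : nat -> R) (L : nat) (l x : R) :
  Dmod c L l x = 2 * Num.sqrt (T2 (dcoef l c) L (x + l / 2)).
Proof.
set y := x + l / 2.
have e1 (n : nat) : 2 * pi * (n ^ 2)%:R * (x + l) = 2 * pi * (n ^ 2)%:R * y + pi * (n ^ 2)%:R * l.
  by rewrite /y; field.
have e2 (n : nat) : 2 * pi * (n ^ 2)%:R * x = 2 * pi * (n ^ 2)%:R * y - pi * (n ^ 2)%:R * l.
  by rewrite /y; field.
have C : TC c L (x + l) - TC c L x = - (2 * TS (dcoef l c) L y).
  rewrite /TC /TS -sumrB mulr_sumr -sumrN; apply: eq_bigr => n _.
  by rewrite e1 e2 cosD cosB /dcoef; ring.
have S : TS c L (x + l) - TS c L x = 2 * TC (dcoef l c) L y.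
  rewrite /TC /TS -sumrB mulr_sumr; apply: eq_bigr => n _.
  by rewrite e1 e2 sinD sinB /dcoef; ring.
rewrite /Dmod C S /cmod sqrrN !exprMn addrC -mulrDr -T2E sqrtrM ?sqr_ge0//.
by rewrite sqrtr_sqr ger0_norm.
Qed.

Lemma Dmod_le {R : realType} (c : nat -> R) (L : nat) (l x : R) :
  Dmod c L l x <= Num.sqrt (T2 c L (x + l)) + Num.sqrt (T2 c L x).
Proof. by rewrite /Dmod -!cmod_T -(cmodN (TC c L x)); exact: cmodD. Qed.

Lemma powR_sqrt {R : realType} (y p : R) : 0 <= y -> (Num.sqrt y) `^ p = y `^ (p / 2).
Proof.
by move=> y0; rewrite -[in RHS](sqr_sqrtr y0) powR_sqr_half// sqrtr_ge0.
Qed.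

Lemma measurable_T2_powR {R : realType} (c : nat -> R) (L : nat) (e t : R) :
  measurable_fun setT (fun x : R => T2 c L (x + t) `^ e).
Proof.
apply: measurable_powR_comp; apply: (measurable_shift (T2 c L)).
by apply: continuous_measurable_fun; exact: continuous_T2.
Qed.

Lemma Ig_T2_shift {R : realType} (c : nat -> R) (L : nat) (e t : R) : 0 <= t <= 1 ->
  Ig (fun x => T2 c L (x + t) `^ e)%R = Ig (fun x => T2 c L x `^ e)%R.
Proof.
move=> t01; apply: (Ig_shift (fun x => T2 c L x `^ e)) => //.
- apply: measurable_powR_comp; apply: continuous_measurable_fun; exact: continuous_T2.
- by move=> x; exact: powR_ge0.
- by move=> x; rewrite T2_periodic.
Qed.

Definition rcoef {R : realType} (s : R) (n : nat) : R := n%:R `^ (- (2 * s)).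

Definition piece {R : realType} (s : R) (j : nat) (n : nat) : R := dyad (2 ^ j)%N n * rcoef s n.

Definition Dpiece {R : realType} (s : R) (j : nat) (l x : R) : R := Dmod (piece s j) (2 * 2 ^ j)%N l x.

Lemma Wd_coef {R : realType} (s : R) (j : nat) : 0 < s ->
  Wd (2 ^ j)%N ((1 + 8 * (2 * s)) * 8 `^ (2 * s) * (2 ^+ j) `^ (- (2 * s))) (rcoef s).
Proof.
move=> s0; have := Wd_powR (2 * s) (2 ^ j)%N; rewrite natrX; apply; first lra.
by rewrite expn_gt0.
Qed.

Lemma T2_Lp_gen {R : realType} (p : R) : 2 < p -> exists2 C : R, 0 < C &
  forall (j : nat) (A : R) (w : nat -> R), bumpw (2 ^ j)%N A w ->
  (Ig (fun x => T2 w (2 * 2 ^ j)%N x `^ (p / 2))%R <=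
    (C * ((A * (2 ^+ j) `^ kap p) `^ p * logf p j))%R%:E)%E.
Proof.
move=> p2; have [C1 C10 h1] := weyl_Lp p p2; have [C2 C20 h2] := arc_sum_bound p p2.
exists (C1 * C2); first exact: mulr_gt0.
move=> j A w bw; have N0 : (0 < 2 ^ j)%N by rewrite expn_gt0.
apply: le_trans (h1 _ A w N0 bw) _; rewrite lee_fin -[leRHS]mulrA; apply: ler_wpM2l; first exact: ltW.
have A0 := bumpw_ge0 _ _ _ bw.
rewrite powRM ?powR_ge0// natrX -[leLHS]mulrA.
have -> : C2 * (A `^ p * (2 ^+ j) `^ kap p `^ p * logf p j) =
  A `^ p * (C2 * ((2 ^+ j) `^ kap p `^ p * logf p j)) by ring.
by apply: ler_wpM2l; [exact: powR_ge0|exact: h2].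
Qed.

(** Above the transition scale the sine oscillates and is not an admissible weight. The difference
    is bounded by its two translates, each a piece without the sine. *)
Lemma Dpiece_high {R : realType} (s p : R) : 0 < s -> 2 < p -> exists2 C : R, 0 < C &
  forall (j : nat) (l : R), 0 < l < 1 ->
  (Ig (fun x => Dpiece s j l x `^ p)%R <=
    (C * (((2 ^+ j) `^ (kap p - 2 * s)) `^ p * logf p j))%R%:E)%E.
Proof.
move=> s0 p2; have [C0 C00 h] := T2_Lp_gen p p2.
pose K : R := 40 * ((1 + 8 * (2 * s)) * 8 `^ (2 * s)).
have K0 : 0 < K by rewrite /K; apply: mulr_gt0 => //; apply: mulr_gt0; [lra|exact: powR_gt0].
exists (2 `^ p * (2 * C0 * K `^ p)).
  by apply: mulr_gt0; [exact: powR_gt0|apply: mulr_gt0; [lra|exact: powR_gt0]].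
move=> j l /andP[l0 l1].
have J0 : 0 < 2 ^+ j :> R by apply: exprn_gt0; lra.
have N0 : (0 < 2 ^ j)%N by rewrite expn_gt0.
have G0 : 0 <= (1 + 8 * (2 * s)) * 8 `^ (2 * s) * (2 ^+ j) `^ (- (2 * s)) :> R.
  by apply: mulr_ge0; [apply: mulr_ge0; [lra|exact: powR_ge0]|exact: powR_ge0].
have bw := bumpw_dyad _ _ _ N0 G0 (Wd_coef s j s0).
have := h j _ _ bw; rewrite -/(piece s j).
have -> : (40 * ((1 + 8 * (2 * s)) * 8 `^ (2 * s) * (2 ^+ j) `^ (- (2 * s))) * (2 ^+ j) `^ kap p) `^ p =
   K `^ p * ((2 ^+ j) `^ (kap p - 2 * s)) `^ p.
  rewrite -(@powRM _ _ _ _ (ltW K0) (powR_ge0 _ _)); congr (_ `^ _); rewrite /K.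
  by rewrite powRD; [ring|rewrite (gt_eqF J0) implybT].
move=> h1.
apply: (@le_trans _ _ (Ig (fun x => 2 `^ p * (T2 (piece s j) (2 * 2 ^ j) (x + l) `^ (p / 2) +
   T2 (piece s j) (2 * 2 ^ j) (x + 0) `^ (p / 2)))%R)).
  apply: Ig_le.
  - under eq_fun do rewrite /Dpiece Dmod_sqr powRM ?sqrtr_ge0// powR_sqrt ?T2_ge0//.
    by apply: measurable_funM => //; exact: measurable_T2_powR.
  - by apply: measurable_funM => //; apply: measurable_funD; exact: measurable_T2_powR.
  - by move=> x _; exact: powR_ge0.
  - move=> x _; have := Dmod_le (piece s j) (2 * 2 ^ j) l x => h2.
    apply: le_trans (ler_powR2r _ _ p (cmod_ge0 _ _) _ h2) _; first lra.
    apply: le_trans (powR_addl _ _ _ _ (sqrtr_ge0 _) (sqrtr_ge0 _)) _; first lra.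
    by rewrite !powR_sqrt ?T2_ge0// addr0.
rewrite IgZ; [|by apply: measurable_funD; exact: measurable_T2_powR|by move=> x; rewrite addr_ge0 ?powR_ge0|exact: powR_ge0].
rewrite IgD; [|exact: measurable_T2_powR|exact: measurable_T2_powR|by move=> x; exact: powR_ge0|by move=> x; exact: powR_ge0].
rewrite !Ig_T2_shift; [|lra|lra].
apply: (@le_trans _ _ ((2 `^ p)%:E * ((C0 * (K `^ p * ((2 ^+ j) `^ (kap p - 2 * s)) `^ p * logf p j))%R%:E +
   (C0 * (K `^ p * ((2 ^+ j) `^ (kap p - 2 * s)) `^ p * logf p j))%R%:E))%E).
  by apply: lee_wpmul2l; [rewrite lee_fin powR_ge0|apply: leeD].
by rewrite -EFinD -EFinM lee_fin le_eqVlt; apply/orP; left; apply/eqP; ring.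
Qed.

(** Below the transition scale the sine is absorbed into the weight and contributes the factor
    [l * 4 ^ j]. *)
Lemma Dpiece_low {R : realType} (s p : R) : 0 < s -> 2 < p -> exists2 C : R, 0 < C &
  forall (j : nat) (l : R), 0 < l < 1 -> l * 4 ^+ j <= 1 ->
  (Ig (fun x => Dpiece s j l x `^ p)%R <=
    (C * ((l * 4 ^+ j * (2 ^+ j) `^ (kap p - 2 * s)) `^ p * logf p j))%R%:E)%E.
Proof.
move=> s0 p2; have [C0 C00 h] := T2_Lp_gen p p2.
pose K : R := 40 * (6 * ((1 + 8 * (2 * s)) * 8 `^ (2 * s) * 1200)).
have K0 : 0 < K.
  rewrite /K; apply: mulr_gt0; first lra. apply: mulr_gt0; first lra.
  apply: mulr_gt0; last lra. by apply: mulr_gt0; [lra|exact: powR_gt0].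
exists (2 `^ p * (C0 * K `^ p)).
  by apply: mulr_gt0; [exact: powR_gt0|apply: mulr_gt0; [lra|exact: powR_gt0]].
move=> j l /andP[l0 l1] lj.
have J0 : 0 < 2 ^+ j :> R by apply: exprn_gt0; lra.
have N0 : (0 < 2 ^ j)%N by rewrite expn_gt0.
have j4 : 4 ^+ j = (2 ^ j)%N%:R ^+ 2 :> R by rewrite natrX -exprM mulnC exprM; congr (_ ^+ _); ring.
have G0 : 0 <= (1 + 8 * (2 * s)) * 8 `^ (2 * s) * (2 ^+ j) `^ (- (2 * s)) :> R.
  by apply: mulr_ge0; [apply: mulr_ge0; [lra|exact: powR_ge0]|exact: powR_ge0].
have Nl : (2 ^ j)%N%:R ^+ 2 * l <= 1 :> R by rewrite -j4 mulrC.
have Nl0 : 0 <= 1200 * ((2 ^ j)%N%:R ^+ 2 * l) :> R.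
  by have := mulr_ge0 (sqr_ge0 ((2 ^ j)%N%:R : R)) (ltW l0); lra.
have W := Wd_mul _ _ _ _ _ N0 G0 Nl0 (Wd_coef s j s0) (Wd_sin _ l N0 l0 Nl).
have G1 := mulr_ge0 (ler0n R 6) (mulr_ge0 G0 Nl0).
have bw := bumpw_dyad _ _ _ N0 G1 W.
have := h j _ _ bw.
have -> : T2 (fun n => dyad (2 ^ j) n * (rcoef s n * sin (pi * (n ^ 2)%:R * l))) (2 * 2 ^ j) =
  T2 (dcoef l (piece s j)) (2 * 2 ^ j).
  by congr T2; apply/funext => n; rewrite /dcoef /piece mulrA.
have -> : (40 * (6 * ((1 + 8 * (2 * s)) * 8 `^ (2 * s) * (2 ^+ j) `^ (- (2 * s)) *
    (1200 * ((2 ^ j)%:R ^+ 2 * l)))) * (2 ^+ j) `^ kap p) `^ p =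
   K `^ p * (l * 4 ^+ j * (2 ^+ j) `^ (kap p - 2 * s)) `^ p.
  have l4 : 0 <= l * 4 ^+ j by rewrite mulr_ge0 ?exprn_ge0// ltW.
  rewrite -powRM ?(ltW K0)//; last by rewrite mulr_ge0// powR_ge0.
  congr (_ `^ _); rewrite /K j4.
  by rewrite powRD; [ring|rewrite (gt_eqF J0) implybT].
move=> h1.
have -> : (fun x => Dpiece s j l x `^ p)%R =
   (fun x => 2 `^ p * T2 (dcoef l (piece s j)) (2 * 2 ^ j) (x + l / 2) `^ (p / 2)).
  by apply/funext => x; rewrite /Dpiece Dmod_sqr powRM ?sqrtr_ge0// powR_sqrt ?T2_ge0//.
rewrite IgZ; [|exact: measurable_T2_powR|by move=> x; exact: powR_ge0|exact: powR_ge0].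
rewrite Ig_T2_shift; last lra.
set Y := (l * 4 ^+ j * _) `^ p in h1 *.
have -> : 2 `^ p * (C0 * K `^ p) * (Y * logf p j) = 2 `^ p * (C0 * (K `^ p * Y * logf p j)) by ring.
by rewrite EFinM; apply: lee_wpmul2l; [rewrite lee_fin powR_ge0|exact: h1].
Qed.

(** * Averages of the partial sums *)

Lemma cmod_powR {R : realType} (a b p : R) : cmod a b `^ p = (a ^+ 2 + b ^+ 2) `^ (p / 2).
Proof. by rewrite /cmod powR_sqrt// addr_ge0 ?sqr_ge0. Qed.

Lemma measurable_cmod_powR {R : realType} (f g : R -> R) (p : R) :
  measurable_fun setT f -> measurable_fun setT g ->
  measurable_fun setT (fun x : R => cmod (f x) (g x) `^ p).
Proof.
move=> mf mg; under eq_fun do rewrite cmod_powR.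
by apply: measurable_powR_comp; apply: measurable_funD; exact: measurable_funX.
Qed.

(* Coefficients of the average of the partial sums with [2 ^ (J - 1) <= N < 2 ^ J]:
   averaging avoids any bound on the partial-sum operators in L^p. *)
Definition vcoef {R : realType} (s : R) (J : nat) (n : nat) : R := \sum_(j < J) piece s j n.

Definition Vre {R : realType} (s : R) (J : nat) : R -> R := TC (vcoef s J) (2 ^ J).
Definition Vim {R : realType} (s : R) (J : nat) : R -> R := TS (vcoef s J) (2 ^ J).

Lemma continuous_TC {R : realType} (c : nat -> R) (L : nat) : continuous (TC c L).
Proof. exact: (continuous_GC 'I_L (fun n => c n) (fun n => n ^ 2)%N). Qed.
Lemma continuous_TS {R : realType} (c : nat -> R) (L : nat) : continuous (TS c L).
Proof. exact: (continuous_GS 'I_L (fun n => c n) (fun n => n ^ 2)%N). Qed.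

Lemma measurable_TC {R : realType} (c : nat -> R) (L : nat) : measurable_fun setT (TC c L).
Proof. apply: continuous_measurable_fun; exact: continuous_TC. Qed.
Lemma measurable_TS {R : realType} (c : nat -> R) (L : nat) : measurable_fun setT (TS c L).
Proof. apply: continuous_measurable_fun; exact: continuous_TS. Qed.

Lemma piece_ge {R : realType} (s : R) (j n : nat) : (2 * 2 ^ j <= n)%N -> piece s j n = 0.
Proof. by move=> h; rewrite /piece dyad_ge ?mul0r// expn_gt0. Qed.

Lemma vcoef_split {R : realType} (s : R) (J : nat) (F : nat -> R) :
  \sum_(n < 2 ^ J) vcoef s J n * F n = \sum_(j < J) \sum_(n < 2 * 2 ^ j) piece s j n * F n.
Proof.
rewrite /vcoef; under eq_bigr do rewrite mulr_suml.
rewrite exchange_big/=; apply: eq_bigr => j _.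
have le : (2 * 2 ^ j <= 2 ^ J)%N by rewrite -expnS leq_exp2l//; exact: ltn_ord.
rewrite [RHS](big_ord_widen _ (fun n => piece s j n * F n) le) [RHS]big_mkcond/=.
by apply: eq_bigr => n _; case: ltnP => // h; rewrite piece_ge ?mul0r.
Qed.

Lemma Dmod_V_le {R : realType} (s : R) (J : nat) (l x : R) :
  Dmod (vcoef s J) (2 ^ J) l x <= \sum_(j < J) Dpiece s j l x.
Proof.
rewrite /Dmod /TC /TS.
rewrite !(vcoef_split s J (fun n => cos (2 * pi * (n ^ 2)%:R * _))).
rewrite !(vcoef_split s J (fun n => sin (2 * pi * (n ^ 2)%:R * _))).
rewrite -!sumrB; exact: cmod_sum.
Qed.

(** The windows telescope, and the remaining cutoff at [1 / 2] vanishes from [n = 1] on. *)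
Lemma vcoefE {R : realType} (s : R) (J : nat) (n : nat) : (0 < n)%N ->
  vcoef s J.+1 n = cutoff (2 ^+ J) n * rcoef s n.
Proof.
move=> n0; rewrite /vcoef /piece -mulr_suml; congr (_ * _).
have h : cutoff (1 / 2 : R) n = 0.
  apply: cutoff_ge; first lra.
  have : 1 <= n%:R :> R by rewrite ler1n.
  lra.
elim: J => [|J IH].
  by rewrite big_ord1 /dyad expn0 h subr0 expr0.
rewrite big_ord_recr/= IH /dyad natrX.
have -> : 2 ^+ J.+1 / 2 = 2 ^+ J :> R by rewrite exprS; field.
ring.
Qed.

Lemma sum_le_shift {R : realType} (m n : nat) : (0 < m)%N -> (0 < n)%N ->
  \sum_(i < m) (n <= m + i)%N%:R = m%:R * cutoff (m%:R : R) n.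
Proof.
move=> m0 n0; have mR : 0 < m%:R :> R by rewrite ltr0n.
have [h|h] := leqP n m.
  rewrite cutoff_le ?ler_nat// mulr1 -[in RHS](card_ord m) -sumr_const; apply: eq_bigr => i _.
  by rewrite (leq_trans h)// leq_addr.
have [h2|h2] := leqP (2 * m) n.
  rewrite cutoff_ge//; last by rewrite -natrM ler_nat.
  rewrite mulr0 big1// => i _; rewrite leqNgt (_ : (m + i < n)%N)//.
  by have := ltn_ord i; lia.
have nm : m%:R <= n%:R :> R by rewrite ler_nat ltnW.
have nm2 : n%:R <= 2 * m%:R :> R by rewrite -natrM ler_nat ltnW.
have -> : m%:R * cutoff (m%:R : R) n = 2 * m%:R - n%:R.
  rewrite /cutoff; case: (hingeP (2 * m%:R : R) n) => -[a ->]; case: (hingeP (m%:R : R) n) => -[b ->];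
    rewrite mulrC divfK ?gt_eqF//; lra.
have key d : (d <= m)%N -> \sum_(i < m) (m + d <= m + i)%N%:R = m%:R - d%:R :> R.
  move=> dm; rewrite -(big_mkord xpredT (fun i => (m + d <= m + i)%N%:R)).
  rewrite (@big_cat_nat _ _ _ d)//=.
  rewrite [X in X + _]big_nat_cond [X in X + _]big1 ?add0r; last first.
    by move=> i /andP[/andP[_ id] _]; rewrite leq_add2l leqNgt id.
  rewrite big_nat_cond (eq_bigr (fun=> 1)); last by move=> i /andP[/andP[id _] _]; rewrite leq_add2l id.
  by rewrite -big_nat_cond sumr_const_nat natrB.
have := key (n - m)%N; rewrite subnKC ?(ltnW h)// => ->; last lia.
by rewrite natrB ?(ltnW h)//; ring.
Qed.

(** These are de la Vallee Poussin means: the linear descent of [cutoff] between [2 ^ J] and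
    [2 ^ J.+1] is the proportion of the sharp truncations in that range which contain [n]. *)
Lemma V_average {R : realType} (s : R) (J : nat) (F : nat -> R) :
  \sum_(n < 2 ^ J.+1) vcoef s J.+1 n * F n =
  (\sum_(i < 2 ^ J) \sum_(1 <= n < (2 ^ J + i).+1) rcoef s n * F n) / (2 ^ J)%N%:R.
Proof.
set m := (2 ^ J)%N; have m0 : (0 < m)%N by rewrite expn_gt0.
have mR : 0 < m%:R :> R by rewrite ltr0n.
have e1 (i : 'I_m) : \sum_(1 <= n < (m + i).+1) rcoef s n * F n =
   \sum_(1 <= n < 2 ^ J.+1) (n <= m + i)%N%:R * (rcoef s n * F n).
  rewrite [RHS](@big_cat_nat _ _ _ (m + i).+1)//=; last first.
    by rewrite expnS -/m; have := ltn_ord i; lia.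
  rewrite [X in _ = _ + X]big_nat_cond [X in _ = _ + X]big1 ?addr0; last first.
    by move=> n /andP[/andP[h _] _]; rewrite leqNgt h mul0r.
  rewrite big_nat_cond [RHS]big_nat_cond; apply: eq_bigr => n /andP[/andP[_ h] _].
  by rewrite -ltnS h mul1r.
under [in RHS]eq_bigr do rewrite e1.
rewrite exchange_big/= -(big_mkord xpredT (fun n => vcoef s J.+1 n * F n)).
rewrite big_ltn ?expn_gt0//.
have -> : vcoef s J.+1 0 * F 0%N = 0.
  rewrite /vcoef big1 ?mul0r// => j _; rewrite /piece dyad_le ?mul0r ?expn_gt0//.
rewrite add0r mulr_suml; apply: eq_big_nat => n /andP[n1 n2].
by rewrite vcoefE// -mulr_suml (@sum_le_shift R)// /m natrX; field; rewrite expf_neq0.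
Qed.

Local Open Scope classical_set_scope.

Lemma TC_periodic {R : realType} (c : nat -> R) (L : nat) x : TC c L (x + 1) = TC c L x.
Proof.
apply: eq_bigr => n _.
have -> : 2 * pi * (n ^ 2)%:R * (x + 1) = 2 * pi * (n ^ 2)%:R * x + 2 * pi * (n ^ 2)%:R by ring.
by rewrite cosDn.
Qed.

Lemma TS_periodic {R : realType} (c : nat -> R) (L : nat) x : TS c L (x + 1) = TS c L x.
Proof.
apply: eq_bigr => n _.
have -> : 2 * pi * (n ^ 2)%:R * (x + 1) = 2 * pi * (n ^ 2)%:R * x + 2 * pi * (n ^ 2)%:R by ring.
by rewrite sinDn.
Qed.

Lemma cmodM {R : realType} (a b k : R) : 0 <= k -> cmod (a * k) (b * k) = cmod a b * k.
Proof.
move=> k0; rewrite /cmod !exprMn -mulrDl sqrtrM ?addr_ge0 ?sqr_ge0//.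
by rewrite sqrtr_sqr ger0_norm.
Qed.

Lemma measurable_Rs_re {R : realType} (s : R) (N : nat) : measurable_fun setT (Rs_re s N).
Proof.
apply: continuous_measurable_fun; rewrite /Rs_re; apply: continuous_sum => n.
by apply: continuous_mul; [exact: cst_continuous|exact: continuous_cosM].
Qed.

Lemma measurable_Rs_im {R : realType} (s : R) (N : nat) : measurable_fun setT (Rs_im s N).
Proof.
apply: continuous_measurable_fun; rewrite /Rs_im; apply: continuous_sum => n.
by apply: continuous_mul; [exact: cst_continuous|exact: continuous_sinM].
Qed.

Definition Serr {R : realType} (s : R) (fr fi : R -> R) (N : nat) (x : R) : R :=
  cmod (Rs_re s N x - fr x) (Rs_im s N x - fi x).
Definition Verr {R : realType} (s : R) (fr fi : R -> R) (J : nat) (x : R) : R :=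
  cmod (Vre s J x - fr x) (Vim s J x - fi x).

Lemma measurable_Serr {R : realType} (s p : R) (fr fi : R -> R) (N : nat) :
  measurable_fun setT fr -> measurable_fun setT fi ->
  measurable_fun setT (fun x : R => Serr s fr fi N x `^ p).
Proof.
move=> mr mi; apply: measurable_cmod_powR; apply: measurable_funB => //.
  exact: measurable_Rs_re.
exact: measurable_Rs_im.
Qed.

Lemma measurable_Verr {R : realType} (s p : R) (fr fi : R -> R) (J : nat) :
  measurable_fun setT fr -> measurable_fun setT fi ->
  measurable_fun setT (fun x : R => Verr s fr fi J x `^ p).
Proof.
move=> mr mi; apply: measurable_cmod_powR; apply: measurable_funB => //.
  exact: measurable_TC.
exact: measurable_TS.
Qed.

Lemma is_Rs_cvg {R : realType} (s p : R) (fr fi : R -> R) : is_Rs s p fr fi ->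
  forall e : R, 0 < e -> exists N0, forall N, (N0 <= N)%N ->
    (Ig (fun x => Serr s fr fi N x `^ p)%R <= e%:E)%E.
Proof.
move=> [_ [_ [_ h]]] e e0.
have ne : nbhs (0%:E : \bar R) (fun u => (u < e%:E)%E).
  by apply: open_ereal_lt'; rewrite lte_fin.
have [N0 _ hN] := h _ ne.
by exists N0 => N NN; apply: ltW; exact: hN.
Qed.

Lemma Verr_le {R : realType} (s : R) (fr fi : R -> R) (J : nat) (x : R) :
  Verr s fr fi J.+1 x <= (\sum_(i < 2 ^ J) Serr s fr fi (2 ^ J + i) x) / (2 ^ J)%N%:R.
Proof.
set m := (2 ^ J)%N.
have mR : 0 < m%:R :> R by rewrite ltr0n expn_gt0.
have eC : Vre s J.+1 x - fr x = \sum_(i < m) (Rs_re s (m + i) x - fr x) * m%:R^-1.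
  rewrite /Vre /TC (V_average s J (fun n => cos (2 * pi * (n ^ 2)%:R * x))).
  rewrite -mulr_suml sumrB sumr_const card_ord -(mulr_natr (fr x) m) mulrBl mulfK ?gt_eqF//.
have eS : Vim s J.+1 x - fi x = \sum_(i < m) (Rs_im s (m + i) x - fi x) * m%:R^-1.
  rewrite /Vim /TS (V_average s J (fun n => sin (2 * pi * (n ^ 2)%:R * x))).
  rewrite -mulr_suml sumrB sumr_const card_ord -(mulr_natr (fi x) m) mulrBl mulfK ?gt_eqF//.
rewrite /Verr eC eS; apply: le_trans (cmod_sum _ _ _ _) _.
rewrite mulr_suml; apply: ler_sum => i _; rewrite cmodM// invr_ge0 ltW//.
Qed.

Lemma Verr_cvg {R : realType} (s p : R) (fr fi : R -> R) : 1 <= p -> is_Rs s p fr fi ->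
  forall e : R, 0 < e -> exists J0, forall J, (J0 <= J)%N ->
    (Ig (fun x => Verr s fr fi J x `^ p)%R <= e%:E)%E.
Proof.
move=> p1 hR e e0; have [_ [mr [mi _]]] := hR.
pose e' := e / 2 `^ p.
have e'0 : 0 < e' by rewrite divr_gt0// powR_gt0.
have [N0 hN] := is_Rs_cvg _ _ _ _ hR e' e'0.
exists N0.+1 => -[//|J]; rewrite ltnS => NJ.
set m := (2 ^ J)%N; have m0 : (0 < m)%N by rewrite expn_gt0.
have mR : 0 < m%:R :> R by rewrite ltr0n.
have Nm : (N0 <= m)%N by rewrite (leq_trans NJ)// ltnW// ltn_expl.
apply: (@le_trans _ _ (Ig (fun x => (2 `^ p / m%:R) * \sum_(i < m) Serr s fr fi (m + i) x `^ p)%R)).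
  apply: Ig_le.
  - exact: measurable_Verr.
  - by apply: measurable_funM => //; apply: measurable_sum => i; exact: measurable_Serr.
  - by move=> x _; exact: powR_ge0.
  - move=> x _; apply: le_trans (ler_powR2r _ _ p (cmod_ge0 _ _) _ (Verr_le s fr fi J x)) _; first lra.
    have := powR_mean m (fun i => Serr s fr fi (m + i) x) p p1 m0 (fun j => cmod_ge0 _ _).
    by rewrite [in X in _ -> X]mulrAC -[in X in _ -> X]mulrA.
rewrite IgZ; last first.
- by rewrite divr_ge0 ?powR_ge0// ltW.
- by move=> x; rewrite sumr_ge0// => i _; exact: powR_ge0.
- by apply: measurable_sum => i; exact: measurable_Serr.
rewrite Ig_sum; last first.
- by move=> i x; exact: powR_ge0.
- by move=> i; exact: measurable_Serr.
apply: (@le_trans _ _ ((2 `^ p / m%:R)%R%:E * (\sum_(i < m) e')%R%:E)%E).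
  apply: lee_wpmul2l; first by rewrite lee_fin divr_ge0 ?powR_ge0// ltW.
  by rewrite -sumEFin; apply: lee_sum => i _; apply: hN; rewrite (leq_trans Nm)// leq_addr.
rewrite -EFinM lee_fin sumr_const card_ord -[X in _ * X]mulr_natr /e'.
rewrite le_eqVlt; apply/orP; left; apply/eqP; field.
by rewrite gt_eqF// gt_eqF// powR_gt0.
Qed.

Lemma is_Rs_of_cvg {R : realType} (s q : R) (fr fi : R -> R) :
  (forall x, fr (x + 1) = fr x /\ fi (x + 1) = fi x) -> measurable_fun setT fr -> measurable_fun setT fi ->
  (forall e : R, 0 < e -> exists N0, forall N, (N0 <= N)%N ->
    (Ig (fun x => Serr s fr fi N x `^ q)%R <= e%:E)%E) -> is_Rs s q fr fi.
Proof.
move=> pf mr mi h; split=> //; split=> //; split=> //.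
move=> A; rewrite /nbhs/= => -[e /= e0 hA].
have e2 : 0 < e / 2 by lra.
have [N0 hN] := h _ e2; exists N0 => // N NN; have := hN N NN.
rewrite /= /Ig /Serr => le; set I := (X in A X).
have I0 : (0 <= I)%E by apply: integral_ge0 => x _; rewrite lee_fin powR_ge0.
have If : I \is a fin_num by rewrite ge0_fin_numE// (le_lt_trans le)// ltry.
rewrite -(fineK If); apply: hA; rewrite /ball_/= sub0r normrN ger0_norm ?fine_ge0//.
rewrite -lte_fin fineK//; apply: le_lt_trans le _; rewrite lte_fin; lra.
Qed.

Lemma is_Rs_le {R : realType} (s p q : R) (fr fi : R -> R) : 0 < q -> q <= p ->
  is_Rs s p fr fi -> is_Rs s q fr fi.
Proof.
move=> q0 qp hR; have [pf [mr [mi _]]] := hR; apply: is_Rs_of_cvg => //.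
move=> e e0.
(* Where the error is below [t] its power is at most [t ^ q = e / 2]; elsewhere it is controlled by
   the power [p], which tends to 0 in mean. *)
pose t := (e / 2) `^ q^-1.
have t0 : 0 < t by apply: powR_gt0; lra.
have tq : t `^ q = e / 2 by rewrite /t powRVr ?gt_eqF//; lra.
have tp0 : 0 < t `^ (p - q) by exact: powR_gt0.
pose e' := t `^ (p - q) * (e / 2).
have e'0 : 0 < e' by apply: mulr_gt0 => //; lra.
have [N0 hN] := is_Rs_cvg _ _ _ _ hR e' e'0.
exists N0 => N /hN h.
apply: (@le_trans _ _ (Ig (fun x => (t `^ (p - q))^-1 * Serr s fr fi N x `^ p + e / 2)%R)).
  apply: Ig_le.
  - exact: measurable_Serr.
  - by apply: measurable_funD => //; apply: measurable_funM => //; exact: measurable_Serr.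
  - by move=> x _; exact: powR_ge0.
  - move=> x _; have := powR_interp_le t (Serr s fr fi N x) q p t0 (cmod_ge0 _ _) q0 qp.
    rewrite mulrC -ler_pdivlMr// => /le_trans; apply.
    rewrite mulrDl mulrC lerD2l ler_pdivrMr//.
    by rewrite -tq -powRD; [rewrite addrC subrK|rewrite (gt_eqF t0) implybT].
rewrite IgD; last first.
- by move=> x; lra.
- by move=> x; rewrite mulr_ge0 ?powR_ge0// invr_ge0 ltW.
- exact: measurable_cst.
- by apply: measurable_funM => //; exact: measurable_Serr.
rewrite Ig_cst IgZ; last first.
- by rewrite invr_ge0 ltW.
- by move=> x; exact: powR_ge0.
- exact: measurable_Serr.
apply: (@le_trans _ _ ((t `^ (p - q))^-1%:E * e'%:E + (e / 2)%:E)%E).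
  by rewrite leeD2r//; apply: lee_wpmul2l => //; rewrite lee_fin invr_ge0 ltW.
rewrite -EFinM -EFinD lee_fin /e' le_eqVlt; apply/orP; left; apply/eqP; field.
by rewrite gt_eqF.
Qed.

Local Close Scope classical_set_scope.

(** * Structure integrals of the smooth truncations *)

Definition Sint {R : realType} (fr fi : R -> R) (p l : R) : \bar R :=
  Ig (fun x => cmod (fr (x + l) - fr x) (fi (x + l) - fi x) `^ p)%R.

Definition SV {R : realType} (s : R) (J : nat) (p l : R) : \bar R := Sint (Vre s J) (Vim s J) p l.

Lemma SfunE {R : realType} (fr fi : R -> R) (p l : R) : Sfun fr fi p l = fine (Sint fr fi p l).
Proof. by []. Qed.

Lemma Sint_ge0 {R : realType} (fr fi : R -> R) (p l : R) : (0 <= Sint fr fi p l)%E.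
Proof. by apply: Ig_ge0 => x; exact: powR_ge0. Qed.

Lemma SVE {R : realType} (s : R) (J : nat) (p l : R) :
  SV s J p l = Ig (fun x => Dmod (vcoef s J) (2 ^ J) l x `^ p)%R.
Proof. by []. Qed.

Lemma measurable_diff_powR {R : realType} (f g : R -> R) (p l : R) :
  measurable_fun setT f -> measurable_fun setT g ->
  measurable_fun setT (fun x : R => cmod (f (x + l) - f x) (g (x + l) - g x) `^ p).
Proof.
move=> mf mg; apply: measurable_cmod_powR.
  by apply: measurable_funB => //; exact: measurable_shift.
by apply: measurable_funB => //; exact: measurable_shift.
Qed.

Lemma measurable_Vre {R : realType} (s : R) (J : nat) : measurable_fun setT (Vre s J).
Proof. exact: measurable_TC. Qed.
Lemma measurable_Vim {R : realType} (s : R) (J : nat) : measurable_fun setT (Vim s J).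
Proof. exact: measurable_TS. Qed.

(** Many of the splittings below are pointwise bounds of this single shape, so that measurability
    and positivity are treated once. *)
Lemma Ig_combine {R : realType} (h G w1 w2 : R -> R) (c d : R) :
  measurable_fun setT h -> measurable_fun setT G -> measurable_fun setT w1 -> measurable_fun setT w2 ->
  (forall x, 0 <= h x) -> (forall x, 0 <= G x) -> (forall x, 0 <= w1 x) -> (forall x, 0 <= w2 x) ->
  0 <= c -> 0 <= d -> (forall x, h x <= c * (G x + d * (w1 x + w2 x))) ->
  (Ig h <= c%:E * (Ig G + d%:E * (Ig w1 + Ig w2)))%E.
Proof.
move=> mh mG m1 m2 h0 G0 w10 w20 c0 d0 hle.
have m12 : measurable_fun setT (fun x : R => w1 x + w2 x) by exact: measurable_funD.
have p12 x : 0 <= w1 x + w2 x by exact: addr_ge0.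
have md : measurable_fun setT (fun x : R => d * (w1 x + w2 x)) by exact: measurable_funM.
have pd x : 0 <= d * (w1 x + w2 x) by exact: mulr_ge0.
have mGd : measurable_fun setT (fun x : R => G x + d * (w1 x + w2 x)) by exact: measurable_funD.
have pGd x : 0 <= G x + d * (w1 x + w2 x) by exact: addr_ge0.
rewrite -(IgD w1 w2 m1 m2 w10 w20) -(IgZ _ d m12 p12 d0) -(IgD G _ mG md G0 pd) -(IgZ _ c mGd pGd c0).
by apply: Ig_le => //; exact: measurable_funM.
Qed.

Lemma Sint_compare {R : realType} (f1 f2 g1 g2 : R -> R) (p l : R) : 0 < p -> 0 <= l <= 1 ->
  measurable_fun setT f1 -> measurable_fun setT f2 ->
  measurable_fun setT g1 -> measurable_fun setT g2 ->
  (forall x, f1 (x + 1) = f1 x) -> (forall x, f2 (x + 1) = f2 x) ->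
  (forall x, g1 (x + 1) = g1 x) -> (forall x, g2 (x + 1) = g2 x) ->
  (Sint f1 f2 p l <= (2 `^ p)%R%:E * (Sint g1 g2 p l +
     (2 `^ p)%R%:E * (Ig (fun x => cmod (g1 x - f1 x) (g2 x - f2 x) `^ p)%R
        + Ig (fun x => cmod (g1 x - f1 x) (g2 x - f2 x) `^ p)%R)))%E.
Proof.
move=> p0 l01 m1 m2 m3 m4 pf1 pf2 pg1 pg2.
pose w x := cmod (g1 x - f1 x) (g2 x - f2 x) `^ p.
have mw : measurable_fun setT w by apply: measurable_cmod_powR; exact: measurable_funB.
have w0 x : 0 <= w x by exact: powR_ge0.
have wl : Ig (fun x => w (x + l)) = Ig w.
  by apply: Ig_shift => // x; rewrite /w pf1 pf2 pg1 pg2.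
have mwl : measurable_fun setT (fun x : R => w (x + l)) by exact: measurable_shift.
have := @Ig_combine R (fun x => cmod (f1 (x + l) - f1 x) (f2 (x + l) - f2 x) `^ p)
  (fun x => cmod (g1 (x + l) - g1 x) (g2 (x + l) - g2 x) `^ p) (fun x => w (x + l)) w (2 `^ p) (2 `^ p).
rewrite wl; apply.
- exact: measurable_diff_powR.
- exact: measurable_diff_powR.
- exact: mwl.
- exact: mw.
- by move=> x; exact: powR_ge0.
- by move=> x; exact: powR_ge0.
- by move=> x; exact: w0.
- exact: w0.
- exact: powR_ge0.
- exact: powR_ge0.
move=> x.
set a := cmod (g1 (x + l) - g1 x) (g2 (x + l) - g2 x).
set b := cmod (g1 (x + l) - f1 (x + l)) (g2 (x + l) - f2 (x + l)).
set c := cmod (g1 x - f1 x) (g2 x - f2 x).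
have a0 : 0 <= a by exact: cmod_ge0.
have b0 : 0 <= b by exact: cmod_ge0.
have c0 : 0 <= c by exact: cmod_ge0.
have h : cmod (f1 (x + l) - f1 x) (f2 (x + l) - f2 x) <= a + (b + c).
  have -> : f1 (x + l) - f1 x = (g1 (x + l) - g1 x) + (- (g1 (x + l) - f1 (x + l)) + (g1 x - f1 x)) by ring.
  have -> : f2 (x + l) - f2 x = (g2 (x + l) - g2 x) + (- (g2 (x + l) - f2 (x + l)) + (g2 x - f2 x)) by ring.
  apply: le_trans (cmodD _ _ _ _) _; rewrite lerD2l.
  by apply: le_trans (cmodD _ _ _ _) _; rewrite cmodN.
apply: le_trans (ler_powR2r _ _ p (cmod_ge0 _ _) (ltW p0) h) _.
apply: le_trans (powR_addl _ _ _ p0 a0 (addr_ge0 b0 c0)) _.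
apply: ler_wpM2l; first exact: powR_ge0.
by rewrite lerD2l; exact: powR_addl.
Qed.

Lemma SV_fin {R : realType} (s : R) (J : nat) (p l : R) : 0 < p -> (SV s J p l < +oo)%E.
Proof.
move=> p0; rewrite SVE.
pose M : R := 2 * \sum_(n < 2 ^ J) `|dcoef l (vcoef s J) n|.
have M0 : 0 <= M by rewrite mulr_ge0// sumr_ge0.
apply: (@le_lt_trans _ _ (Ig (fun=> (2 * M) `^ p)%R)); last by rewrite Ig_cst ltry.
apply: Ig_le.
- by apply: (measurable_diff_powR (Vre s J) (Vim s J)); [exact: measurable_Vre|exact: measurable_Vim].
- exact: measurable_cst.
- by move=> x _; exact: powR_ge0.
move=> x _; apply: ler_powR2r; [exact: cmod_ge0|exact: ltW|].
rewrite Dmod_sqr ler_pM2l//.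
set c := dcoef _ _; set y := x + _.
have bC : `|TC c (2 ^ J) y| <= \sum_(n < 2 ^ J) `|c n|.
  apply: le_trans (ler_norm_sum _ _ _) _; apply: ler_sum => i _.
  by rewrite normrM ler_piMr// cos_max.
have bS : `|TS c (2 ^ J) y| <= \sum_(n < 2 ^ J) `|c n|.
  apply: le_trans (ler_norm_sum _ _ _) _; apply: ler_sum => i _.
  by rewrite normrM ler_piMr// sin_max.
have S0 : 0 <= \sum_(n < 2 ^ J) `|c n| by exact: sumr_ge0.
rewrite T2E -(ger0_norm M0) -sqrtr_sqr; apply: ler_wsqrtr.
rewrite -(real_normK (num_real (TC _ _ _))) -(real_normK (num_real (TS _ _ _))).
have e : M = 2 * \sum_(n < 2 ^ J) `|c n| by [].
have h1 : `|TC c (2 ^ J) y| ^+ 2 <= (\sum_(n < 2 ^ J) `|c n|) ^+ 2 by rewrite ler_pXn2r ?nnegrE.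
have h2 : `|TS c (2 ^ J) y| ^+ 2 <= (\sum_(n < 2 ^ J) `|c n|) ^+ 2 by rewrite ler_pXn2r ?nnegrE.
have h3 := sqr_ge0 (\sum_(n < 2 ^ J) `|c n|).
rewrite e exprMn; lra.
Qed.

(** * Passage to the limit in the truncation *)

Section Transfer.
Context {R : realType}.

(** The loss is a factor [2 ^ p] independent of [J] and [l], while the rank [J0] may depend on [l].
    This is enough to transfer upper bounds uniform in [J] and lower bounds valid for large [J]. *)
Lemma Sint_approx (s p : R) (fr fi : R -> R) (l e : R) : 1 <= p -> is_Rs s p fr fi ->
  0 <= l <= 1 -> 0 < e -> exists J0, forall J, (J0 <= J)%N ->
  (Sint fr fi p l <= (2 `^ p)%R%:E * (SV s J p l + e%:E))%E /\
  (SV s J p l <= (2 `^ p)%R%:E * (Sint fr fi p l + e%:E))%E.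
Proof.
move=> p1 hR l01 e0; have [pf [mr [mi _]]] := hR.
have p0 : 0 < p by lra.
have q0 : 0 < 2 `^ p :> R by exact: powR_gt0.
pose e' := e / (2 * 2 `^ p).
have e'0 : 0 < e' by rewrite divr_gt0// mulr_gt0.
have [J0 hJ] := Verr_cvg s p fr fi p1 hR e' e'0.
exists J0 => J /hJ h.
have fin : ((2 `^ p)%R%:E * (e'%:E + e'%:E) = e%:E)%E.
  by rewrite -EFinD -EFinM; congr (_%:E); rewrite /e'; field; rewrite gt_eqF.
have p1r x : fr (x + 1) = fr x by case: (pf x).
have p1i x : fi (x + 1) = fi x by case: (pf x).
have mV := measurable_Vre s J; have mW := measurable_Vim s J.
have pV x : Vre s J (x + 1) = Vre s J x by exact: TC_periodic.
have pW x : Vim s J (x + 1) = Vim s J x by exact: TS_periodic.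
split.
  apply: le_trans (Sint_compare _ _ _ _ _ _ p0 l01 mr mi mV mW p1r p1i pV pW) _.
  apply: lee_wpmul2l; first by rewrite lee_fin powR_ge0.
  apply: leeD => //; rewrite -fin; apply: lee_wpmul2l; first by rewrite lee_fin powR_ge0.
  by apply: leeD; exact: h.
apply: le_trans (Sint_compare _ _ _ _ _ _ p0 l01 mV mW mr mi pV pW p1r p1i) _.
apply: lee_wpmul2l; first by rewrite lee_fin powR_ge0.
apply: leeD => //; rewrite -fin; apply: lee_wpmul2l; first by rewrite lee_fin powR_ge0.
have E : (fun x => cmod (fr x - Vre s J x) (fi x - Vim s J x) `^ p) = (fun x => Verr s fr fi J x `^ p).
  by apply/funext => x; rewrite /Verr -cmodN !opprB.
by rewrite E; apply: leeD; exact: h.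
Qed.

(** [Sfun] is the [fine] part of this integral, and [fine] sends infinity to 0; finiteness makes it
    the true value. It is inherited from a trigonometric polynomial. *)
Lemma Sint_fin (s p : R) (fr fi : R -> R) (l : R) : 1 <= p -> is_Rs s p fr fi ->
  0 <= l <= 1 -> Sint fr fi p l \is a fin_num.
Proof.
move=> p1 hR l01; have [J0 /(_ J0 (leqnn _))[h _]] := Sint_approx s p fr fi l 1 p1 hR l01 ltr01.
rewrite ge0_fin_numE ?Sint_ge0//; apply: le_lt_trans h _.
rewrite lte_mul_pinfty ?lee_fin ?powR_ge0// lte_add_pinfty ?ltry// SV_fin//; lra.
Qed.

Lemma Sfun_upper (s p : R) (fr fi : R -> R) (l B : R) : 1 <= p -> is_Rs s p fr fi ->
  0 <= l <= 1 -> 0 < B -> (forall J, (SV s J p l <= B%:E)%E) ->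
  Sfun fr fi p l <= 2 * 2 `^ p * B.
Proof.
move=> p1 hR l01 B0 hB.
have [J0 /(_ J0 (leqnn _))[h _]] := Sint_approx s p fr fi l B p1 hR l01 B0.
rewrite SfunE -lee_fin fineK; last exact: Sint_fin hR l01.
apply: le_trans h _.
apply: (@le_trans _ _ ((2 `^ p)%R%:E * (B%:E + B%:E))%E).
  by apply: lee_wpmul2l; [rewrite lee_fin powR_ge0|apply: leeD].
by rewrite -EFinD -EFinM lee_fin le_eqVlt; apply/orP; left; apply/eqP; ring.
Qed.

Lemma Sfun_lower (s p : R) (fr fi : R -> R) (l B : R) : 1 <= p -> is_Rs s p fr fi ->
  0 <= l <= 1 -> 0 < B -> (exists J1, forall J, (J1 <= J)%N -> (B%:E <= SV s J p l)%E) ->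
  B <= 2 * 2 `^ p * Sfun fr fi p l.
Proof.
move=> p1 hR l01 B0 [J1 hB].
have q0 : 0 < 2 `^ p :> R by exact: powR_gt0.
(* Multiplied by [2 ^ p] this error is half of [B], hence absorbed on the left. *)
have e0 : 0 < B / (2 * 2 `^ p) by rewrite divr_gt0// mulr_gt0.
have [J0 hJ] := Sint_approx s p fr fi l _ p1 hR l01 e0.
have [_ h] := hJ (maxn J0 J1) (leq_maxl _ _).
have := le_trans (hB _ (leq_maxr J0 J1)) h.
rewrite -(fineK (Sint_fin s p fr fi l p1 hR l01)) -SfunE -EFinD -EFinM lee_fin.
have -> : 2 `^ p * (Sfun fr fi p l + B / (2 * 2 `^ p)) = 2 `^ p * Sfun fr fi p l + B / 2.
  by field; rewrite gt_eqF.
by move=> ?; lra.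
Qed.

End Transfer.

Lemma measurable_Dpiece {R : realType} (s : R) (j : nat) (l p : R) :
  measurable_fun setT (fun x : R => Dpiece s j l x `^ p).
Proof.
apply: (measurable_diff_powR (TC (piece s j) (2 * 2 ^ j)) (TS (piece s j) (2 * 2 ^ j))).
  exact: measurable_TC.
exact: measurable_TS.
Qed.

Lemma Ig_weighted_sum {R : realType} (p : R) (J : nat) (h : R -> R) (a : nat -> R -> R) (lam M : nat -> R) :
  0 < p -> measurable_fun setT (fun x : R => h x `^ p) ->
  (forall j, measurable_fun setT (fun x : R => a j x `^ p)) ->
  (forall x, 0 <= h x) -> (forall j x, 0 <= a j x) -> (forall j, 0 < lam j) ->
  (forall x, h x <= \sum_(j < J) a j x) ->
  (forall j, (Ig (fun x => a j x `^ p)%R <= (M j)%:E)%E) ->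
  (Ig (fun x => h x `^ p)%R <= ((\sum_(j < J) lam j) `^ p * \sum_(j < J) M j / lam j `^ p)%R%:E)%E.
Proof.
move=> p0 mh ma h0 a0 l0 hle hM.
set Lm := (\sum_(j < J) lam j) `^ p.
have L0 : 0 <= Lm by exact: powR_ge0.
pose F (j : 'I_J) (x : R) := (lam j `^ p)^-1 * a j x `^ p.
have li (j : nat) : 0 <= (lam j `^ p)^-1 by rewrite invr_ge0 powR_ge0.
have mF j : measurable_fun setT (F j).
  by apply: measurable_funM; [exact: measurable_cst|exact: ma].
have F0 j x : 0 <= F j x by apply: mulr_ge0; [exact: li|exact: powR_ge0].
have mS : measurable_fun setT (fun x : R => \sum_(j < J) F j x) by exact: measurable_sum.
have S0 x : 0 <= \sum_(j < J) F j x by apply: sumr_ge0 => j _; exact: F0.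
apply: (@le_trans _ _ (Ig (fun x => Lm * \sum_(j < J) F j x)%R)).
  apply: Ig_le.
  - exact: mh.
  - by apply: measurable_funM; [exact: measurable_cst|exact: mS].
  - by move=> x _; exact: powR_ge0.
  move=> x _; apply: le_trans (ler_powR2r _ _ p (h0 x) (ltW p0) (hle x)) _.
  apply: le_trans (sum_powR_weight J (fun j => a j x) lam p p0 (fun j => a0 j x) l0) _.
  apply: ler_wpM2l => //; apply: ler_sum => j _.
  rewrite /F powRM ?a0 ?invr_ge0 ?(ltW (l0 j))// (powRVl _ _ (ltW (l0 j))) mulrC.
  exact: lexx.
rewrite (IgZ _ Lm mS S0 L0) (Ig_sum _ _ F mF F0) EFinM.
apply: lee_wpmul2l; first by rewrite lee_fin.
rewrite -sumEFin; apply: lee_sum => j _.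
rewrite /F (IgZ _ _ (ma j) (fun x => powR_ge0 _ _) (li j)) [X in (_ <= X)%E](_ : _ = ((lam j `^ p)^-1)%:E * (M j)%:E)%E.
  by apply: lee_wpmul2l; rewrite ?lee_fin.
by rewrite -EFinM mulrC.
Qed.

(** * Upper bounds for the structure integrals *)

Lemma SV_assemble {R : realType} (s p l : R) (J : nat) (lam M : nat -> R) : 0 < p ->
  (forall j, 0 < lam j) -> (forall j, (Ig (fun x => Dpiece s j l x `^ p)%R <= (M j)%:E)%E) ->
  (SV s J p l <= ((\sum_(j < J) lam j) `^ p * \sum_(j < J) M j / lam j `^ p)%R%:E)%E.
Proof.
move=> p0 l0 hM; rewrite SVE.
apply: (Ig_weighted_sum p J (Dmod (vcoef s J) (2 ^ J) l) (fun j => Dpiece s j l)) => //.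
- by apply: (measurable_diff_powR (Vre s J) (Vim s J)); [exact: measurable_Vre|exact: measurable_Vim].
- by move=> j; exact: measurable_Dpiece.
- by move=> x; exact: cmod_ge0.
- by move=> j x; exact: cmod_ge0.
- by move=> x; exact: Dmod_V_le.
Qed.

(** The added 1 keeps the factor at least 1 on all of [0 < l < 1]. *)
Definition Lam {R : realType} (p l : R) : R := if p == 4 then 1 + ln (l^-1) else 1.

Lemma ln4_ge1 {R : realType} : 1 <= ln 4 :> R.
Proof.
have h : ln (1 / 2) <= - (1 / 2) :> R.
  have := @le_ln1Dx R (- (1 / 2)); have -> : 1 + - (1 / 2) = 1 / 2 :> R by field.
  apply; lra.
have e : ln 4 = - (ln (1 / 2) + ln (1 / 2)) :> R.
  rewrite -lnM ?posrE ?divr_gt0//.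
  have -> : 1 / 2 * (1 / 2) = 4^-1 :> R by field.
  by rewrite lnV ?posrE// opprK.
lra.
Qed.

Lemma ln_inv_ge0 {R : realType} (l : R) : 0 < l < 1 -> 0 <= ln (l^-1).
Proof.
move=> /andP[l0 l1]; apply: ln_ge0; rewrite invf_ge1//; exact: ltW.
Qed.

Lemma index_le_log {R : realType} (l : R) (j : nat) : 0 < l < 1 ->
  j%:R <= ln (l^-1) + ln (l * 4 ^+ j).
Proof.
move=> /andP[l0 l1].
have j4 : 0 < 4 ^+ j :> R by rewrite exprn_gt0.
rewrite lnM ?posrE// lnV ?posrE// addKr lnXn// -[leRHS]mulr_natr.
have := @ln4_ge1 R; have j0 : 0 <= j%:R :> R by [].
by move=> h; rewrite ler_peMl.
Qed.

(** By [index_le_log] the index [j] is at most [ln l^-1] plus the logarithm of [l * 4 ^ j]. Above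
    the transition the second part is traded for a small power, to be absorbed by the decay of the
    pieces. *)
Lemma logf_le {R : realType} (p d : R) : 0 < d -> exists2 C : R, 1 <= C &
  forall (j : nat) (l : R), 0 < l < 1 ->
   (l * 4 ^+ j <= 1 -> logf p j <= C * Lam p l) /\
   (1 < l * 4 ^+ j -> logf p j <= C * Lam p l * (l * 4 ^+ j) `^ d).
Proof.
move=> d0; exists (1 + d^-1); first by rewrite lerDl invr_ge0 ltW.
move=> j l l01; have L0 := ln_inv_ge0 l l01.
have di : 0 < d^-1 by rewrite invr_gt0.
have jl := index_le_log l j l01.
case/andP: (l01) => l0 l1.
have x0 : 0 < l * 4 ^+ j by rewrite mulr_gt0// exprn_gt0.
rewrite /logf /Lam; case: eqP => _; last first.
  rewrite mulr1; split => [_|x1]; first lra.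
  have : 1 <= (l * 4 ^+ j) `^ d by apply: ltW; exact: powR_gt1.
  move=> h; rewrite -[leLHS]mulr1; apply: ler_pM => //; lra.
rewrite -(natr1 j); split => x1.
  have : ln (l * 4 ^+ j) <= 0 by exact: ln_le0.
  have := mulr_ge0 (ltW di) L0; lra.
have X1 : 1 <= (l * 4 ^+ j) `^ d by apply: ltW; exact: powR_gt1.
have lnx : ln (l * 4 ^+ j) <= d^-1 * (l * 4 ^+ j) `^ d.
  rewrite [leRHS]mulrC ler_pdivlMr// [leLHS]mulrC -ln_powR.
  have := @le_ln1Dx R ((l * 4 ^+ j) `^ d - 1).
  have -> : 1 + ((l * 4 ^+ j) `^ d - 1) = (l * 4 ^+ j) `^ d by ring.
  move=> h.
  by apply: le_trans (h _) _; lra.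
move: X1 lnx jl; set X := _ `^ d; set Y := ln (l * 4 ^+ j) => X1 lnx jl.
have e1 : 1 + ln l^-1 <= (1 + ln l^-1) * X by rewrite ler_peMr//; lra.
have e2 : d^-1 * X <= (1 + ln l^-1) * (d^-1 * X).
  by rewrite ler_peMl//; [rewrite mulr_ge0//; lra|lra].
have -> : (1 + d^-1) * (1 + ln l^-1) * X = (1 + ln l^-1) * X + (1 + ln l^-1) * (d^-1 * X) by ring.
lra.
Qed.

(** Passage to the variable [l * 4 ^ j]; the power of [l] extracted here is the final order of
    magnitude whenever the transition scale dominates. *)
Lemma two_pow_scale {R : realType} (l e : R) (j : nat) : 0 < l ->
  (2 ^+ j) `^ e = (l * 4 ^+ j) `^ (e / 2) * l `^ (- (e / 2)).
Proof.
move=> l0; have j4 : 0 < 4 ^+ j :> R by rewrite exprn_gt0.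
have j2 : 0 <= 2 ^+ j :> R by rewrite exprn_ge0.
rewrite powRM ?(ltW l0) ?(ltW j4)// powRN.
have -> : 4 ^+ j = (2 ^+ j) ^+ 2 :> R.
  by rewrite -exprM mulnC exprM; congr (_ ^+ _); ring.
rewrite (powR_sqr_half _ _ j2); field.
by rewrite gt_eqF// powR_gt0.
Qed.

(** Profile of the contributions of the scales in the variable [x = l * 4 ^ j], with its maximum at
    the transition [x = 1]. *)
Definition peak {R : realType} (e1 e2 x : R) : R := if x <= 1 then x `^ e1 else x `^ (- e2).

Lemma peak_gt0 {R : realType} (e1 e2 x : R) : 0 < x -> 0 < peak e1 e2 x.
Proof. by move=> x0; rewrite /peak; case: ifP => _; exact: powR_gt0. Qed.

Lemma sum_peak {R : realType} (e1 e2 l : R) (J : nat) : 0 < e1 -> 0 < e2 -> 0 < l ->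
  \sum_(j < J) peak e1 e2 (l * 4 ^+ j) <= geo_const 4 e1 + geo_const 4 e2.
Proof.
move=> h1 h2 l0; have b1 : 1 < 4 :> R by rewrite ltr1n.
rewrite (bigID (fun j : 'I_J => l * 4 ^+ j <= 1))/=; apply: lerD.
  apply: le_trans (geo_low_pow l 4 e1 J l0 b1 h1).
  by rewrite le_eqVlt; apply/orP; left; apply/eqP; apply: eq_bigr => j h; rewrite /peak h.
apply: le_trans (geo_high_pow l 4 e2 J l0 b1 h2).
rewrite le_eqVlt; apply/orP; left; apply/eqP; apply: eq_big => j; first by rewrite ltNge.
by move=> h; rewrite /peak (negbTE h).
Qed.

Lemma peakM {R : realType} (a1 a2 b1 b2 x : R) : 0 < x ->
  peak a1 a2 x * peak b1 b2 x = peak (a1 + b1) (a2 + b2) x.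
Proof.
move=> x0; rewrite /peak; case: ifP => _.
  by rewrite powRD// (gt_eqF x0) implybT.
by rewrite opprD powRD// (gt_eqF x0) implybT.
Qed.

Lemma peak_powR {R : realType} (a1 a2 p x : R) : (peak a1 a2 x) `^ p = peak (a1 * p) (a2 * p) x.
Proof. by rewrite /peak; case: ifP => _; rewrite -powRrM// mulNr. Qed.

(** The pieces have L^p norm of order [l ^ e2] times [(l * 4 ^ j) ^ e1] below the transition and
    [(l * 4 ^ j) ^ (- e2)] above, up to the logarithm. With both exponents positive the transition
    scale dominates. Positivity of [e2] is the condition on [s] in the theorem, as
    [sstar p = kap p / 2]. *)
Lemma SV_upper_pos {R : realType} (s p : R) : 2 < p -> 0 < s -> 0 < 1 + kap p / 2 - s ->
  0 < s - kap p / 2 -> exists2 C : R, 0 < C & forall (J : nat) (l : R), 0 < l < 1 ->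
  (SV s J p l <= (C * (l `^ ((s - kap p / 2) * p) * Lam p l))%R%:E)%E.
Proof.
move=> p2 s0; set e1 := 1 + kap p / 2 - s; set e2 := s - kap p / 2 => e10 e20.
have p0 : 0 < p by lra.
have [C1 C10 low] := Dpiece_low s p s0 p2.
have [C2 C20 high] := Dpiece_high s p s0 p2.
have pe20 : 0 < p * e2 / 4 by rewrite divr_gt0// mulr_gt0.
have [C3 C31 logb] := logf_le p (p * e2 / 4) pe20.
have C30 : 0 < C3 by lra.
have b4 : 1 < 4 :> R by rewrite ltr1n.
pose G1 : R := geo_const 4 (e1 / 2) + geo_const 4 (e2 / 2).
pose G2 : R := geo_const 4 (p * e1 / 2) + geo_const 4 (p * e2 / 4).
have G10 : 0 < G1 by apply: addr_gt0; apply: geo_const_gt0 => //; rewrite divr_gt0.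
have G20 : 0 < G2 by apply: addr_gt0; apply: geo_const_gt0 => //; rewrite divr_gt0// mulr_gt0.
pose C0 := (C1 + C2) * C3.
have C00 : 0 < C0 by apply: mulr_gt0 => //; exact: addr_gt0.
exists (G1 `^ p * C0 * G2).
  by apply: mulr_gt0 => //; apply: mulr_gt0 => //; exact: powR_gt0.
move=> J l l01; case/andP: (l01) => l0 l1.
have x0 (j : nat) : 0 < l * 4 ^+ j by rewrite mulr_gt0// exprn_gt0.
have L0 : 0 <= Lam p l.
  by rewrite /Lam; case: ifP => _ //; have := ln_inv_ge0 l l01; lra.
pose T := l `^ (e2 * p).
have T0 : 0 <= T by exact: powR_ge0.
(* The decay is shared: half of either exponent goes to the weights and, above the transition, a
   quarter pays for the logarithm. What is left is still summable. *)
pose lam (j : nat) := peak (e1 / 2) (e2 / 2) (l * 4 ^+ j).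
pose M (j : nat) := C0 * (T * Lam p l) * peak (p * e1) (p * e2 * 3 / 4) (l * 4 ^+ j).
have lam0 j : 0 < lam j by exact: peak_gt0.
have CTL : 0 <= C0 * (T * Lam p l) by apply: mulr_ge0; [exact: ltW|exact: mulr_ge0].
have hM j : (Ig (fun x => Dpiece s j l x `^ p)%R <= (M j)%:E)%E.
  have sc : (2 ^+ j) `^ (kap p - 2 * s) = (l * 4 ^+ j) `^ (- e2) * l `^ e2.
    by rewrite (two_pow_scale l _ j l0); congr (_ `^ _ * _ `^ _); rewrite /e2; field.
  have Tl : (l `^ e2) `^ p = T by rewrite -powRrM.
  have /orP[h|h] : (l * 4 ^+ j <= 1) || (1 < l * 4 ^+ j) by case: leP.
    apply: le_trans (low j l l01 h) _; rewrite lee_fin /M /peak h.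
    have -> : l * 4 ^+ j * (2 ^+ j) `^ (kap p - 2 * s) = (l * 4 ^+ j) `^ e1 * l `^ e2.
      rewrite sc mulrA; congr (_ * _).
      rewrite -[X in X * _](powRr1 (ltW (x0 j))) -powRD; last by rewrite (gt_eqF (x0 j)) implybT.
      by congr (_ `^ _); rewrite /e1 /e2; ring.
    rewrite (@powRM _ _ _ _ (powR_ge0 _ _) (powR_ge0 _ _)) Tl -powRrM (mulrC e1 p).
    have [lb _] := logb j l l01; have := lb h => {}lb.
    set X := _ `^ (p * e1).
    have XT : 0 <= X * T by apply: mulr_ge0 => //; exact: powR_ge0.
    have q1 := ler_wpM2l XT lb.
    apply: (@le_trans _ _ (C1 * (X * T * (C3 * Lam p l)))); first by apply: ler_wpM2l; [exact: ltW|exact: q1].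
    have -> : C0 * (T * Lam p l) * X = (C1 + C2) * (X * T * (C3 * Lam p l)) by rewrite /C0; ring.
    apply: ler_wpM2r; last by rewrite lerDl ltW.
    by apply: mulr_ge0 => //; apply: mulr_ge0 => //; exact: ltW.
  apply: le_trans (high j l l01) _; rewrite lee_fin /M /peak (lt_geF h).
  rewrite sc (@powRM _ _ _ _ (powR_ge0 _ _) (powR_ge0 _ _)) Tl -powRrM.
  have [_ lb] := logb j l l01; have := lb h => {}lb.
  have XE : (l * 4 ^+ j) `^ (- e2 * p) * (l * 4 ^+ j) `^ (p * e2 / 4) = (l * 4 ^+ j) `^ (- (p * e2 * 3 / 4)).
    rewrite -powRD; last by rewrite (gt_eqF (x0 j)) implybT.
    by congr (_ `^ _); field.
  set X := _ `^ (- e2 * p) in XE *; set Y := _ `^ (p * e2 / 4) in XE lb *.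
  have XT : 0 <= X * T by apply: mulr_ge0 => //; exact: powR_ge0.
  have q1 := ler_wpM2l XT lb.
  apply: (@le_trans _ _ (C2 * (X * T * (C3 * Lam p l * Y)))); first by apply: ler_wpM2l; [exact: ltW|exact: q1].
  have -> : C0 * (T * Lam p l) * (l * 4 ^+ j) `^ (- (p * e2 * 3 / 4)) =
     (C1 + C2) * (X * T * (C3 * Lam p l * Y)) by rewrite -XE /C0; ring.
  apply: ler_wpM2r; last by rewrite lerDr ltW.
  apply: mulr_ge0 => //; apply: mulr_ge0; last exact: powR_ge0.
  by apply: mulr_ge0 => //; exact: ltW.
apply: le_trans (SV_assemble s p l J lam M p0 lam0 hM) _; rewrite lee_fin.
have S1 : (\sum_(j < J) lam j) `^ p <= G1 `^ p.
  apply: ler_powR2r; [by apply: sumr_ge0 => j _; exact: ltW|exact: ltW|].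
  by apply: sum_peak => //; rewrite divr_gt0.
have S2 : \sum_(j < J) M j / lam j `^ p <= C0 * (T * Lam p l) * G2.
  have -> : \sum_(j < J) M j / lam j `^ p =
     C0 * (T * Lam p l) * \sum_(j < J) peak (p * e1 / 2) (p * e2 / 4) (l * 4 ^+ j).
    rewrite mulr_sumr; apply: eq_bigr => j _; rewrite /M -mulrA; congr (_ * _).
    have lp : 0 < lam j `^ p by exact: powR_gt0.
    have ln0 : lam j `^ p != 0 by rewrite gt_eqF.
    apply: (mulIf ln0).
    by rewrite divfK// /lam peak_powR peakM//; congr (peak _ _ _); field.
  by apply: ler_wpM2l => //; apply: sum_peak => //; rewrite divr_gt0// mulr_gt0.
apply: (@le_trans _ _ (G1 `^ p * (C0 * (T * Lam p l) * G2))).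
  apply: ler_pM; [exact: powR_ge0| |exact: S1|exact: S2].
  apply: sumr_ge0 => j _; apply: mulr_ge0; last by rewrite invr_ge0 powR_ge0.
  by apply: mulr_ge0 => //; apply: ltW; exact: peak_gt0.
by rewrite le_eqVlt; apply/orP; left; apply/eqP; rewrite /T; ring.
Qed.

Lemma Lam_ne4 {R : realType} (p l : R) : 4 < p -> Lam p l = 1.
Proof. by move=> h; rewrite /Lam gt_eqF. Qed.

Lemma kap_gt4 {R : realType} (p : R) : 4 < p -> kap p = 1 - 2 / p.
Proof. by move=> h; rewrite /kap ltNge ltW. Qed.

Lemma logf_gt4 {R : realType} (p : R) (j : nat) : 4 < p -> logf p j = 1.
Proof. by move=> h; rewrite /logf gt_eqF. Qed.

(** The bound is [l] times the size of the derivative of the piece. Above the transition it is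
    weaker than the trivial one because [l * 4 ^ j > 1], so it holds at all scales; [p > 4] excludes
    the logarithm. *)
Lemma Dpiece_lip {R : realType} (s p : R) : 0 < s -> 4 < p -> exists2 C : R, 0 < C &
  forall (j : nat) (l : R), 0 < l < 1 ->
  (Ig (fun x => Dpiece s j l x `^ p)%R <= (C * (l * (2 ^+ j) `^ (2 + kap p - 2 * s)) `^ p)%R%:E)%E.
Proof.
move=> s0 p4; have p2 : 2 < p by lra.
have [C1 C10 low] := Dpiece_low s p s0 p2.
have [C2 C20 high] := Dpiece_high s p s0 p2.
exists (C1 + C2); first exact: addr_gt0.
move=> j l l01; case/andP: (l01) => l0 l1.
have J0 : 0 < 2 ^+ j :> R by rewrite exprn_gt0.
have E : l * (2 ^+ j) `^ (2 + kap p - 2 * s) = l * 4 ^+ j * (2 ^+ j) `^ (kap p - 2 * s).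
  have -> : 4 ^+ j = (2 ^+ j) `^ 2 :> R.
    by rewrite (powR_mulrn 2 (ltW J0)) -exprM mulnC exprM; congr (_ ^+ _); ring.
  rewrite -mulrA -powRD; last by rewrite (gt_eqF J0) implybT.
  by congr (_ * _ `^ _); ring.
rewrite E; set Y := (2 ^+ j) `^ (kap p - 2 * s).
have Y0 : 0 <= Y by exact: powR_ge0.
have X0 : 0 < l * 4 ^+ j by rewrite mulr_gt0// exprn_gt0.
have XY0 : 0 <= l * 4 ^+ j * Y by apply: mulr_ge0 => //; exact: ltW.
have /orP[h|h] : (l * 4 ^+ j <= 1) || (1 < l * 4 ^+ j) by case: leP.
  apply: le_trans (low j l l01 h) _; rewrite lee_fin logf_gt4// mulr1.
  by apply: ler_wpM2r; [exact: powR_ge0|rewrite lerDl ltW].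
apply: le_trans (high j l l01) _; rewrite lee_fin logf_gt4// mulr1.
apply: ler_pM; [exact: ltW|exact: powR_ge0|by rewrite lerDr ltW|].
apply: ler_powR2r => //; first lra.
by rewrite ler_peMl// ltW.
Qed.

(** The derivatives of the pieces are summable in L^p, so the function is Lipschitz in L^p. Half of
    the negative exponent is spent on the weights. *)
Lemma SV_upper_neg {R : realType} (s p : R) : 4 < p -> 0 < s -> 2 + kap p - 2 * s < 0 ->
  exists2 C : R, 0 < C & forall (J : nat) (l : R), 0 < l < 1 ->
  (SV s J p l <= (C * l `^ p)%R%:E)%E.
Proof.
move=> p4 s0 neg; have p0 : 0 < p by lra.
have [C1 C10 lip] := Dpiece_lip s p s0 p4.
pose e := - (2 + kap p - 2 * s) / 2.
have e0 : 0 < e by rewrite /e; lra.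
have b1 : 1 < 2 :> R by rewrite ltr1n.
pose r : R := 2 `^ e; have r1 : 1 < r by exact: powR_gt1.
pose r2 : R := 2 `^ (e * p).
have r21 : 1 < r2 by apply: powR_gt1 => //; exact: mulr_gt0.
have g1 : 0 < r / (r - 1) by rewrite divr_gt0; lra.
have g2 : 0 < r2 / (r2 - 1) by rewrite divr_gt0; lra.
exists ((r / (r - 1)) `^ p * (C1 * (r2 / (r2 - 1)))).
  by apply: mulr_gt0; [exact: powR_gt0|exact: mulr_gt0].
move=> J l l01; case/andP: (l01) => l0 l1.
pose lam (j : nat) : R := (r ^+ j)^-1.
pose M (j : nat) := C1 * (l * (2 ^+ j) `^ (2 + kap p - 2 * s)) `^ p.
have rj (j : nat) : 0 < r ^+ j by apply: exprn_gt0; lra.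
have lam0 j : 0 < lam j by rewrite /lam invr_gt0.
apply: le_trans (SV_assemble s p l J lam M p0 lam0 (fun j => lip j l l01)) _; rewrite lee_fin.
have S1 : (\sum_(j < J) lam j) `^ p <= (r / (r - 1)) `^ p.
  apply: ler_powR2r; [by apply: sumr_ge0 => j _; exact: ltW|exact: ltW|exact: geo_dec].
have ME (j : nat) : M j / lam j `^ p = C1 * l `^ p * (r2 ^+ j)^-1.
  have j0 : 0 < 2 ^+ j :> R by exact: exprn_gt0.
  have rE : r ^+ j = (2 ^+ j) `^ e by rewrite powR_expn.
  have r2E : r2 ^+ j = (2 ^+ j) `^ (e * p) by rewrite powR_expn.
  rewrite /M /lam (powRVl _ _ (ltW (rj j))) invrK rE r2E (@powRM _ _ _ _ (ltW l0) (powR_ge0 _ _)).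
  rewrite -!powRrM -powRN -!mulrA; congr (_ * (_ * _)).
  rewrite -powRD; last by rewrite (gt_eqF j0) implybT.
  by congr (_ `^ _); rewrite /e; field.
have S2 : \sum_(j < J) M j / lam j `^ p <= C1 * l `^ p * (r2 / (r2 - 1)).
  under eq_bigr do rewrite ME.
  rewrite -mulr_sumr; apply: ler_wpM2l; last exact: geo_dec.
  by apply: mulr_ge0; [exact: ltW|exact: powR_ge0].
apply: (@le_trans _ _ ((r / (r - 1)) `^ p * (C1 * l `^ p * (r2 / (r2 - 1))))).
  apply: ler_pM; [exact: powR_ge0| |exact: S1|exact: S2].
  apply: sumr_ge0 => j _; rewrite ME; apply: mulr_ge0; last by rewrite invr_ge0 exprn_ge0//; lra.
  by apply: mulr_ge0; [exact: ltW|exact: powR_ge0].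
by rewrite le_eqVlt; apply/orP; left; apply/eqP; ring.
Qed.

Lemma measurable_Dpiece1 {R : realType} (s : R) (j : nat) (l : R) :
  measurable_fun setT (Dpiece s j l).
Proof.
have := measurable_Dpiece s j l 1.
by congr measurable_fun; apply/funext => x; rewrite powRr1// cmod_ge0.
Qed.

Lemma count_low {R : realType} (l : R) (J : nat) : 0 < l < 1 ->
  \sum_(j < J) (l * 4 ^+ j <= 1)%R%:R <= 1 + ln (l^-1).
Proof.
move=> l01; have L0 := ln_inv_ge0 l l01; case/andP: (l01) => l0 l1.
set t := Num.truncn (ln l^-1).
have /andP[t1 t2] := truncn_itv L0.
apply: (@le_trans _ _ (\sum_(j < J) (j < t.+1)%N%:R)).
  apply: ler_sum => j _; rewrite ler_nat; case h : (l * 4 ^+ j <= 1) => //=.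
  rewrite lt0b -(ltr_nat R); apply: le_lt_trans t2.
  have := index_le_log l j l01; have : ln (l * 4 ^+ j) <= 0 by exact: ln_le0.
  lra.
have -> : \sum_(j < J) (j < t.+1)%N%:R = (minn J t.+1)%:R :> R.
  rewrite -natr_sum; congr (_%:R).
  have [h|h] := leqP J t.+1.
    by rewrite (eq_bigr (fun=> 1%N)) ?sum1_card ?card_ord// => j _; rewrite (leq_trans (ltn_ord j) h).
  transitivity (\sum_(i < t.+1) 1)%N; last by rewrite sum_nat_const card_ord muln1.
  rewrite (big_ord_widen _ (fun=> 1%N) (ltnW h)) [RHS]big_mkcond/=.
  by apply: eq_bigr => j _; case: ifP.
apply: (@le_trans _ _ t.+1%:R); first by rewrite ler_nat geq_minr.
by rewrite -natr1 addrC lerD2l.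
Qed.

(** All pieces below the transition have L^p norm of order [l]. At the exponents [p - eta] and
    [p + eta] their norms are geometric in [j] in opposite directions; [powR_interp_sum], applied at
    each [x], bounds the integral by a constant per scale, hence by the number of scales to the
    first power. *)
Lemma SV_upper_crit {R : realType} (s p : R) : 4 < p -> 0 < s -> 2 + kap p - 2 * s = 0 ->
  exists2 C : R, 0 < C & forall (J : nat) (l : R), 0 < l < 1 ->
  (SV s J p l <= (C * (l `^ p * (1 + ln (l^-1))))%R%:E)%E.
Proof.
move=> p4 s0 crit; have p0 : 0 < p by lra.
have p2 : 2 < p by lra.
(* This keeps [p - eta] above 4, where no piece carries a logarithm. *)
pose eta := (p - 4) / 2.
have eta0 : 0 < eta by rewrite /eta; lra.
have etap : eta < p by rewrite /eta; lra.
have pm4 : 4 < p - eta by rewrite /eta; lra.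
have pp4 : 4 < p + eta by rewrite /eta; lra.
have [C1 C10 lip1] := Dpiece_lip s (p - eta) s0 pm4.
have [C2 C20 lip2] := Dpiece_lip s (p + eta) s0 pp4.
have [C3 C30 high] := Dpiece_high s p s0 p2.
have s32 : 3 - 2 * s = 2 / p by move: crit; rewrite kap_gt4//; lra.
(* At exponent [q] the low piece divided by [l] has integral of order [b ^ (j * (q - p))], because
   [(2 + kap q - 2 * s) * q = 2 / p * (q - p)]. The weights [b ^ (eta * j)] and [b ^ (- eta * j)]
   cancel it exactly. *)
pose b : R := 2 `^ (2 / p).
have b1 : 1 < b by apply: powR_gt1; rewrite ?ltr1n// divr_gt0.
have [C4 C40 interp] := powR_interp_sum b eta p b1 eta0 etap.
pose G1 : R := geo_const 4 2^-1 + geo_const 4 2^-1.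
pose G2 : R := geo_const 4 (p / 2) + geo_const 4 (p / 2).
have b4 : 1 < 4 :> R by rewrite ltr1n.
have G10 : 0 < G1 by apply: addr_gt0; apply: geo_const_gt0 => //; rewrite invr_gt0.
have G20 : 0 < G2 by apply: addr_gt0; apply: geo_const_gt0 => //; rewrite divr_gt0.
exists (2 `^ p * (C4 * (C1 + C2) + G1 `^ p * (C3 * G2))).
  apply: mulr_gt0; first exact: powR_gt0.
  apply: addr_gt0; apply: mulr_gt0 => //; first exact: addr_gt0.
    exact: powR_gt0.
  exact: mulr_gt0.
move=> J l l01; case/andP: (l01) => l0 l1.
have L0 := ln_inv_ge0 l l01.
have x0 (j : nat) : 0 < l * 4 ^+ j by rewrite mulr_gt0// exprn_gt0.
have lp0 : 0 < l `^ p by exact: powR_gt0.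
(* Low pieces are normalized by [l]; the high ones form [ah] and are summed with geometric
   weights. *)
pose al (j : nat) (x : R) : R := (l * 4 ^+ j <= 1)%R%:R * (Dpiece s j l x / l).
pose ah (j : nat) (x : R) : R := (1 < l * 4 ^+ j)%R%:R * Dpiece s j l x.
have D0 j x : 0 <= Dpiece s j l x by exact: cmod_ge0.
have al0 j x : 0 <= al j x by apply: mulr_ge0 => //; apply: divr_ge0 => //; exact: ltW.
have ah0 j x : 0 <= ah j x by apply: mulr_ge0.
have mal j : measurable_fun setT (al j).
  apply: measurable_funM; first exact: measurable_cst.
  by apply: measurable_funM; [exact: measurable_Dpiece1|exact: measurable_cst].
have mah j : measurable_fun setT (ah j).
  by apply: measurable_funM; [exact: measurable_cst|exact: measurable_Dpiece1].
pose Sl (x : R) := \sum_(j < J) al j x.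
pose Sh (x : R) := \sum_(j < J) ah j x.
have mSl : measurable_fun setT Sl by apply: measurable_sum => j; exact: mal.
have mSh : measurable_fun setT Sh by apply: measurable_sum => j; exact: mah.
have Sl0 x : 0 <= Sl x by apply: sumr_ge0 => j _.
have Sh0 x : 0 <= Sh x by apply: sumr_ge0 => j _.
have dec x : Dmod (vcoef s J) (2 ^ J) l x <= l * Sl x + Sh x.
  apply: le_trans (Dmod_V_le s J l x) _.
  rewrite /Sl /Sh mulr_sumr -big_split/=; apply: ler_sum => j _.
  rewrite /al /ah; case: leP => _; rewrite ?mul1r ?mul0r ?mulr0 ?addr0 ?add0r//.
  by rewrite mulrC divfK ?gt_eqF.
have mSlp : measurable_fun setT (fun x : R => Sl x `^ p) by exact: measurable_powR_comp.
have mShp : measurable_fun setT (fun x : R => Sh x `^ p) by exact: measurable_powR_comp.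
have lowB : (Ig (fun x => Sl x `^ p)%R <= (C4 * (C1 + C2) * (1 + ln (l^-1)))%R%:E)%E.
  pose B : R := b `^ eta.
  have B0 : 0 < B by apply: powR_gt0; lra.
  pose F (j : 'I_J) (x : R) := B ^+ j * al j x `^ (p - eta) + B ^- j * al j x `^ (p + eta).
  have Bj (j : nat) : 0 < B ^+ j by exact: exprn_gt0.
  have Bj' (j : nat) : 0 < B ^- j by rewrite invr_gt0.
  have mal1 j : measurable_fun setT (fun x : R => al j x `^ (p - eta)) by exact: measurable_powR_comp.
  have mal2 j : measurable_fun setT (fun x : R => al j x `^ (p + eta)) by exact: measurable_powR_comp.
  have mF1 (j : 'I_J) : measurable_fun setT (fun x : R => B ^+ j * al j x `^ (p - eta)).
    by apply: measurable_funM; [exact: measurable_cst|exact: mal1].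
  have mF2 (j : 'I_J) : measurable_fun setT (fun x : R => B ^- j * al j x `^ (p + eta)).
    by apply: measurable_funM; [exact: measurable_cst|exact: mal2].
  have F10 (j : 'I_J) x : 0 <= B ^+ j * al j x `^ (p - eta) by apply: mulr_ge0; [exact: ltW|exact: powR_ge0].
  have F20 (j : 'I_J) x : 0 <= B ^- j * al j x `^ (p + eta) by apply: mulr_ge0; [exact: ltW|exact: powR_ge0].
  have mF j : measurable_fun setT (F j) by exact: (measurable_funD (mF1 j) (mF2 j)).
  have F0 j x : 0 <= F j x by exact: addr_ge0 (F10 j x) (F20 j x).
  have mSF : measurable_fun setT (fun x : R => \sum_(j < J) F j x) by exact: measurable_sum.
  have SF0 x : 0 <= \sum_(j < J) F j x by apply: sumr_ge0 => j _; exact: F0.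
  apply: (@le_trans _ _ (Ig (fun x => C4 * \sum_(j < J) F j x)%R)).
    apply: Ig_le.
    - exact: mSlp.
    - by apply: measurable_funM; [exact: measurable_cst|exact: mSF].
    - by move=> x _; exact: powR_ge0.
    - by move=> x _; exact: (interp J (fun j => al j x)).
  rewrite (IgZ _ C4 mSF SF0 (ltW C40)) (Ig_sum _ _ F mF F0) -mulrA EFinM.
  apply: lee_wpmul2l; first by rewrite lee_fin ltW.
  apply: (@le_trans _ _ (\sum_(j < J) ((l * 4 ^+ j <= 1)%R%:R * (C1 + C2))%R%:E)%E); last first.
    rewrite sumEFin lee_fin -mulr_suml mulrC; apply: ler_wpM2l; last exact: count_low.
    by apply: ltW; exact: addr_gt0.
  apply: lee_sum => j _.
  rewrite (IgD _ _ (mF1 j) (mF2 j) (F10 j) (F20 j)).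
  rewrite (IgZ _ (B ^+ j) (mal1 j) (fun x => powR_ge0 _ _) (ltW (Bj j))).
  rewrite (IgZ _ (B ^- j) (mal2 j) (fun x => powR_ge0 _ _) (ltW (Bj' j))).
  have step (q C : R) : 4 < q ->
      (Ig (fun x => Dpiece s j l x `^ q)%R <= (C * (l * (2 ^+ j) `^ (2 + kap q - 2 * s)) `^ q)%R%:E)%E ->
      0 <= C ->
      (Ig (fun x => al j x `^ q)%R <= ((l * 4 ^+ j <= 1)%R%:R * (C * ((2 ^+ j) `^ (2 / p)) `^ (q - p)))%R%:E)%E.
    move=> q4 hq Cq; rewrite /al; have q0 : q != 0 by rewrite gt_eqF//; lra.
    case: (l * 4 ^+ j <= 1); last first.
      under [X in Ig X]eq_fun do rewrite mul0r powR0//.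
      by rewrite mul0r /Ig integral0.
    have mD := measurable_Dpiece s j l q.
    have -> : (fun x => (1%:R * (Dpiece s j l x / l)) `^ q) = (fun x => (l `^ q)^-1 * Dpiece s j l x `^ q).
      apply/funext => x; rewrite mul1r powRM ?D0 ?invr_ge0 ?(ltW l0)// (powRVl _ _ (ltW l0)) mulrC.
      by [].
    have li : 0 <= (l `^ q)^-1 by rewrite invr_ge0 powR_ge0.
    rewrite (IgZ _ _ mD (fun x => powR_ge0 _ _) li).
    apply: (@le_trans _ _ ((l `^ q)^-1%:E * (C * (l * (2 ^+ j) `^ (2 + kap q - 2 * s)) `^ q)%R%:E)%E).
      by apply: lee_wpmul2l; rewrite ?lee_fin.
    rewrite -EFinM lee_fin (@powRM _ _ _ _ (ltW l0) (powR_ge0 _ _)) mul1r -!powRrM.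
    have -> : (2 + kap q - 2 * s) * q = 2 / p * (q - p).
      rewrite kap_gt4// (_ : 2 + (1 - 2 / q) - 2 * s = 2 / p - 2 / q); last by rewrite -s32; ring.
      by field; rewrite gt_eqF//= q0.
    rewrite le_eqVlt; apply/orP; left; apply/eqP; field.
    by rewrite gt_eqF// powR_gt0.
  have bE : B ^+ j = ((2 ^+ j) `^ (2 / p)) `^ eta.
    have -> : (2 ^+ j) `^ (2 / p) = b ^+ j by rewrite powR_expn// ltr1n.
    by rewrite powR_expn.
  have Y0 : 0 < (2 ^+ j) `^ (2 / p) :> R by apply: powR_gt0; exact: exprn_gt0.
  have h1 := step _ _ pm4 (lip1 j l l01) (ltW C10).
  have h2 := step _ _ pp4 (lip2 j l l01) (ltW C20).
  apply: (@le_trans _ _ ((B ^+ j)%:E * ((l * 4 ^+ j <= 1)%R%:R * (C1 * ((2 ^+ j) `^ (2 / p)) `^ (p - eta - p)))%R%:E +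
     (B ^- j)%:E * ((l * 4 ^+ j <= 1)%R%:R * (C2 * ((2 ^+ j) `^ (2 / p)) `^ (p + eta - p)))%R%:E)%E).
    by apply: leeD; apply: lee_wpmul2l; rewrite ?lee_fin ?(ltW (Bj j)) ?(ltW (Bj' j)).
  rewrite -!EFinM -EFinD lee_fin.
  have -> : p - eta - p = - eta by ring.
  have -> : p + eta - p = eta by ring.
  rewrite powRN -bE le_eqVlt; apply/orP; left; apply/eqP; field.
  by rewrite gt_eqF.
have highB : (Ig (fun x => Sh x `^ p)%R <= (G1 `^ p * (C3 * G2) * l `^ p)%R%:E)%E.
  pose lam (j : nat) := peak 2^-1 2^-1 (l * 4 ^+ j).
  pose M (j : nat) := C3 * l `^ p * peak p p (l * 4 ^+ j).
  have lam0 j : 0 < lam j by exact: peak_gt0.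
  have mahp j : measurable_fun setT (fun x : R => ah j x `^ p) by exact: measurable_powR_comp.
  have hM j : (Ig (fun x => ah j x `^ p)%R <= (M j)%:E)%E.
    rewrite /ah /M /peak; case: ltP => h.
      under [X in Ig X]eq_fun do rewrite mul1r.
      apply: le_trans (high j l l01) _; rewrite lee_fin logf_gt4// mulr1.
      have -> : kap p - 2 * s = - 2 by lra.
      rewrite (two_pow_scale l _ j l0).
      have -> : - 2 / 2 = - 1 :> R by field.
      rewrite opprK powRr1 ?(ltW l0)// (@powRM _ _ _ _ (powR_ge0 _ _) (ltW l0)) -powRrM mulN1r.
      by rewrite le_eqVlt; apply/orP; left; apply/eqP; ring.
    under [X in Ig X]eq_fun do rewrite mul0r powR0 ?gt_eqF//.
    rewrite /Ig integral0 lee_fin; apply: mulr_ge0; last exact: powR_ge0.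
    by apply: mulr_ge0; exact: ltW.
  apply: le_trans (Ig_weighted_sum p J Sh ah lam M p0 mShp mahp Sh0 ah0 lam0 (fun x => lexx _) hM) _.
  rewrite lee_fin.
  have S1 : (\sum_(j < J) lam j) `^ p <= G1 `^ p.
    apply: ler_powR2r; [by apply: sumr_ge0 => j _; exact: ltW|exact: ltW|].
    by apply: sum_peak => //; rewrite invr_gt0.
  have S2 : \sum_(j < J) M j / lam j `^ p <= C3 * l `^ p * G2.
    have -> : \sum_(j < J) M j / lam j `^ p =
       C3 * l `^ p * \sum_(j < J) peak (p / 2) (p / 2) (l * 4 ^+ j).
      rewrite mulr_sumr; apply: eq_bigr => j _; rewrite /M -mulrA; congr (_ * _).
      have lp : 0 < lam j `^ p by exact: powR_gt0.
      have ln0 : lam j `^ p != 0 by rewrite gt_eqF.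
      apply: (mulIf ln0).
      by rewrite divfK// /lam peak_powR peakM//; congr (peak _ _ _); field.
    apply: ler_wpM2l; first by apply: mulr_ge0; exact: ltW.
    by apply: sum_peak => //; rewrite divr_gt0.
  apply: (@le_trans _ _ (G1 `^ p * (C3 * l `^ p * G2))).
    apply: ler_pM; [exact: powR_ge0| |exact: S1|exact: S2].
    apply: sumr_ge0 => j _; apply: mulr_ge0; last by rewrite invr_ge0 powR_ge0.
    apply: mulr_ge0; last by apply: ltW; exact: peak_gt0.
    by apply: mulr_ge0; exact: ltW.
  by rewrite le_eqVlt; apply/orP; left; apply/eqP; ring.
rewrite SVE.
have mh : measurable_fun setT (fun x : R => Dmod (vcoef s J) (2 ^ J) l x `^ p).
  by apply: (measurable_diff_powR (Vre s J) (Vim s J)); [exact: measurable_Vre|exact: measurable_Vim].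
have mz : measurable_fun setT (fun _ : R => (0 : R)) by exact: measurable_cst.
have mlS : measurable_fun setT (fun x : R => l `^ p * Sl x `^ p).
  by apply: measurable_funM; [exact: measurable_cst|exact: mSlp].
have lS0 x : 0 <= l `^ p * Sl x `^ p by apply: mulr_ge0; [exact: ltW|exact: powR_ge0].
have pt x : Dmod (vcoef s J) (2 ^ J) l x `^ p <= 2 `^ p * (0 + 1 * (l `^ p * Sl x `^ p + Sh x `^ p)).
  rewrite add0r mul1r.
  apply: le_trans (ler_powR2r _ _ p (cmod_ge0 _ _) (ltW p0) (dec x)) _.
  apply: le_trans (powR_addl _ _ _ p0 (mulr_ge0 (ltW l0) (Sl0 x)) (Sh0 x)) _.
  by rewrite (@powRM _ _ _ _ (ltW l0) (Sl0 x)).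
have := Ig_combine _ _ _ _ _ _ mh mz mlS mShp (fun x => powR_ge0 _ _) (fun x => lexx 0) lS0
  (fun x => powR_ge0 _ _) (powR_ge0 2 p) ler01 pt.
rewrite Ig_cst add0e mul1e (IgZ _ _ mSlp (fun x => powR_ge0 _ _) (ltW lp0)) => h.
apply: le_trans h _.
apply: (@le_trans _ _ ((2 `^ p)%:E * ((l `^ p)%:E * (C4 * (C1 + C2) * (1 + ln (l^-1)))%R%:E +
   (G1 `^ p * (C3 * G2) * l `^ p)%R%:E))%E).
  apply: lee_wpmul2l; first by rewrite lee_fin powR_ge0.
  by apply: leeD => //; apply: lee_wpmul2l => //; rewrite lee_fin ltW.
rewrite -(EFinM (l `^ p)) -EFinD -EFinM lee_fin -[leRHS]mulrA; apply: ler_wpM2l; first exact: powR_ge0.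
rewrite mulrDl; apply: lerD; first by rewrite le_eqVlt; apply/orP; left; apply/eqP; ring.
apply: ler_wpM2l; last by rewrite ler_peMr ?(ltW lp0)//; lra.
by apply: mulr_ge0; [exact: powR_ge0|apply: mulr_ge0; exact: ltW].
Qed.

(** * The quadratic structure function *)

Lemma Int_T2 {R : realType} (c : nat -> R) (L : nat) : Ig (T2 c L) = (\sum_(n < L) c n ^+ 2)%:E.
Proof.
rewrite (Int_Ig (T2 c L)); last exact: continuous_T2.
congr (_%:E); rewrite /T2 (Int_GT 'I_L (fun n => c n) (fun n => n ^ 2)%N).
apply: eq_bigr => i _; rewrite (bigD1 i)//= eqxx mulr1 big1 ?addr0 ?expr2// => j ji.
by rewrite eqn_exp2r// eq_sym (inj_eq val_inj) (negbTE ji) mulr0.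
Qed.

Lemma SV2E {R : realType} (s l : R) (J : nat) : 0 <= l <= 1 ->
  SV s J 2 l = (4 * \sum_(n < 2 ^ J) dcoef l (vcoef s J) n ^+ 2)%R%:E.
Proof.
move=> l01; rewrite SVE.
have e : (fun x => Dmod (vcoef s J) (2 ^ J) l x `^ 2) = (fun x => 4 * T2 (dcoef l (vcoef s J)) (2 ^ J) (x + l / 2) `^ 1).
  apply/funext => x; have D0 : 0 <= Dmod (vcoef s J) (2 ^ J) l x := cmod_ge0 _ _.
  rewrite (powR_mulrn 2 D0) Dmod_sqr exprMn sqr_sqrtr ?T2_ge0// powRr1 ?T2_ge0//.
  by congr (_ * _); ring.
have f0 x : 0 <= T2 (dcoef l (vcoef s J)) (2 ^ J) (x + l / 2) `^ 1 by exact: powR_ge0.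
rewrite e (IgZ _ 4 (measurable_T2_powR _ _ _ _) f0 (ler0n _ _)) Ig_T2_shift; last lra.
rewrite EFinM; congr (_ * _)%E; rewrite -Int_T2; congr Ig.
by apply/funext => x; rewrite powRr1// T2_ge0.
Qed.

Lemma sum_dyadic_blocks {R : realType} (F : nat -> R) (J : nat) :
  \sum_(n < 2 ^ J) F n = F 0%N + \sum_(i < J) \sum_(m < 2 ^ i) F (2 ^ i + m)%N.
Proof.
elim: J => [|J IH]; first by rewrite big_ord1 big_ord0 addr0.
by rewrite expnS mul2n -addnn big_split_ord/= IH big_ord_recr/= addrA.
Qed.

Lemma rcoef_ge0 {R : realType} (s : R) (n : nat) : 0 <= rcoef s n.
Proof. exact: powR_ge0. Qed.

Lemma vcoef0 {R : realType} (s : R) (J : nat) : vcoef s J 0 = 0.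
Proof. by rewrite /vcoef big1// => j _; rewrite /piece dyad_le ?mul0r ?expn_gt0. Qed.

Lemma vcoef_bounds {R : realType} (s : R) (J n : nat) : 0 <= vcoef s J n <= rcoef s n.
Proof.
case: n => [|n]; first by rewrite vcoef0 lexx rcoef_ge0.
case: J => [|J]; first by rewrite /vcoef big_ord0 lexx rcoef_ge0.
rewrite vcoefE//; have /andP[a b] := @cutoff_01 R (2 ^+ J) n.+1 (exprn_gt0 _ (ltr0n _ 2)).
by rewrite mulr_ge0 ?rcoef_ge0//= ler_piMl// rcoef_ge0.
Qed.

Lemma vcoef_eq {R : realType} (s : R) (J n : nat) : (0 < n)%N -> (n <= 2 ^ J)%N ->
  vcoef s J.+1 n = rcoef s n.
Proof.
move=> n0 nJ; rewrite vcoefE// cutoff_le ?mul1r ?exprn_gt0//.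
by rewrite -natrX ler_nat.
Qed.

Lemma dyadic_sq {R : realType} (i : nat) : ((2 ^ i)%N%:R : R) ^+ 2 = 4 ^+ i.
Proof. by rewrite natrX -exprM mulnC exprM; congr (_ ^+ _); ring. Qed.

Lemma dcoef_sqr_block {R : realType} (s l : R) (J i m : nat) : 0 < s -> 0 < l < 1 -> (m < 2 ^ i)%N ->
  dcoef l (vcoef s J) (2 ^ i + m) ^+ 2 <= (2 ^+ i) `^ (- (4 * s)) * (256 * (if l * 4 ^+ i <= 1 then (l * 4 ^+ i) ^+ 2 else 1)).
Proof.
move=> s0 /andP[l0 l1] mi; set n := (2 ^ i + m)%N.
have n0 : (0 < n)%N by rewrite addn_gt0 expn_gt0.
have i0 : 0 < 2 ^+ i :> R by rewrite exprn_gt0.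
have ni : 2 ^+ i <= n%:R :> R by rewrite -natrX ler_nat leq_addr.
have ni2 : n%:R <= 2 * 2 ^+ i :> R by rewrite -natrX -natrM ler_nat /n; lia.
rewrite /dcoef exprMn; apply: ler_pM; rewrite ?sqr_ge0//.
  have /andP[v0 v1] := vcoef_bounds s J n.
  apply: (@le_trans _ _ (rcoef s n ^+ 2)); first by rewrite ler_pXn2r ?nnegrE// rcoef_ge0.
  rewrite /rcoef -(powR_mulrn 2 (powR_ge0 _ _)) -powRrM.
  have -> : - (2 * s) * 2%:R = - (4 * s) by ring.
  rewrite !powRN lef_pV2 ?posrE ?powR_gt0//; last by rewrite ltr0n.
  by apply: ler_powR2r; [exact: ltW|lra|].
set y := pi * (n ^ 2)%:R * l.
have x0 : 0 < l * 4 ^+ i by rewrite mulr_gt0// exprn_gt0.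
have sy : sin y ^+ 2 <= 1.
  by have := sin_max y; rewrite -(real_normK (num_real (sin y))) => h; rewrite expr_le1.
case: ifP => h; last by apply: le_trans sy _; rewrite mulr1 ler1n.
have yb : `|y| <= 16 * (l * 4 ^+ i).
  rewrite ger0_norm; last by rewrite /y !mulr_ge0 ?(ltW l0)// ltW// pi_gt0.
  have n2 : (n ^ 2)%:R <= 4 * 4 ^+ i :> R.
    rewrite natrX -dyadic_sq natrX (_ : 4 * (2 ^+ i) ^+ 2 = (2 * 2 ^+ i) ^+ 2); last by ring.
    by rewrite ler_pXn2r ?nnegrE ?mulr_ge0// ltW.
  have h1 : pi * (n ^ 2)%:R <= 4 * (4 * 4 ^+ i) :> R.
    by apply: ler_pM; rewrite ?(ltW (pi_gt0 _))//; exact: pi_le4.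
  by have := ler_wpM2r (ltW l0) h1; rewrite -/y; lra.
have s1 := le_trans (abs_sin_le y) yb.
rewrite -(real_normK (num_real (sin y))) (_ : 256 * (l * 4 ^+ i) ^+ 2 = (16 * (l * 4 ^+ i)) ^+ 2); last by ring.
by rewrite ler_pXn2r ?nnegrE ?mulr_ge0// ltW.
Qed.

(** In the variable [l * 4 ^ i] the block is a power of [l] times a peak with exponents
    [(5 - 4 * s) / 2] and [(4 * s - 1) / 2]. Hence three regimes: transition scale for
    [1/4 < s < 5/4], equal contributions of all low blocks at [s = 5/4], lowest frequencies
    beyond. *)
Lemma SV2_block {R : realType} (s l : R) (J : nat) : 0 < s -> 0 < l < 1 ->
  (SV s J 2 l <= (1024 * \sum_(i < J) (2 ^+ i) `^ (1 - 4 * s) * (if l * 4 ^+ i <= 1 then (l * 4 ^+ i) ^+ 2 else 1))%R%:E)%E.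
Proof.
move=> s0 l01; have /andP[l0 l1] := l01.
rewrite SV2E ?(ltW l0) ?(ltW l1)// lee_fin (sum_dyadic_blocks (fun n => dcoef l (vcoef s J) n ^+ 2)).
have -> : dcoef l (vcoef s J) 0 ^+ 2 = 0 by rewrite /dcoef vcoef0 mul0r expr0n.
have -> : 1024 = 4 * 256 :> R by ring.
rewrite add0r -[leRHS]mulrA; apply: ler_wpM2l => //; rewrite mulr_sumr; apply: ler_sum => i _.
have i0 : 0 < 2 ^+ i :> R by rewrite exprn_gt0.
apply: (@le_trans _ _ (\sum_(m < 2 ^ i) (2 ^+ i) `^ (- (4 * s)) * (256 * (if l * 4 ^+ i <= 1 then (l * 4 ^+ i) ^+ 2 else 1)))).
  by apply: ler_sum => m _; exact: dcoef_sqr_block.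
rewrite sumr_const card_ord -[leLHS]mulr_natr natrX.
have -> : (2 ^+ i) `^ (1 - 4 * s) = 2 ^+ i * (2 ^+ i) `^ (- (4 * s)) :> R.
  by rewrite powRD ?powRr1// ?(ltW i0)// (gt_eqF i0) implybT.
by rewrite le_eqVlt; apply/orP; left; apply/eqP; ring.
Qed.

Lemma SV2_upper_lt {R : realType} (s : R) : 1 / 4 < s -> s < 5 / 4 ->
  exists2 C : R, 0 < C & forall (J : nat) (l : R), 0 < l < 1 ->
  (SV s J 2 l <= (C * l `^ (2 * s - 1 / 2))%R%:E)%E.
Proof.
move=> s1 s2; pose e1 := (5 - 4 * s) / 2; pose e2 := (4 * s - 1) / 2.
have e10 : 0 < e1 by rewrite /e1; lra.
have e20 : 0 < e2 by rewrite /e2; lra.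
have b4 : 1 < 4 :> R by rewrite ltr1n.
have G0 : 0 < geo_const 4 e1 + geo_const 4 e2 :> R by apply: addr_gt0; exact: geo_const_gt0.
exists (1024 * (geo_const 4 e1 + geo_const 4 e2)); first by apply: mulr_gt0; [lra|exact: G0].
move=> J l l01; have /andP[l0 l1] := l01; have s0 : 0 < s by lra.
apply: le_trans (SV2_block s l J s0 l01) _; rewrite lee_fin -mulrA; apply: ler_wpM2l; first lra.
have -> : \sum_(i < J) (2 ^+ i) `^ (1 - 4 * s) * (if l * 4 ^+ i <= 1 then (l * 4 ^+ i) ^+ 2 else 1) =
   (\sum_(i < J) peak e1 e2 (l * 4 ^+ i)) * l `^ (2 * s - 1 / 2).
  rewrite mulr_suml; apply: eq_bigr => i _.
  have x0 : 0 < l * 4 ^+ i by rewrite mulr_gt0// exprn_gt0.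
  have le : l `^ (2 * s - 1 / 2) = l `^ (- ((1 - 4 * s) / 2)) by congr (_ `^ _); field.
  rewrite (two_pow_scale l _ i l0) le /peak; case: ifP => _.
    rewrite mulrAC -(powR_mulrn 2 (ltW x0)) -powRD; last by rewrite (gt_eqF x0) implybT.
    by congr (_ `^ _ * _); rewrite /e1; field.
  by rewrite mulr1; congr (_ `^ _ * _); rewrite /e2; field.
by apply: ler_wpM2r; [exact: powR_ge0|exact: sum_peak].
Qed.

Lemma SV2_upper_eq {R : realType} (s : R) : s = 5 / 4 ->
  exists2 C : R, 0 < C & forall (J : nat) (l : R), 0 < l < 1 ->
  (SV s J 2 l <= (C * (l ^+ 2 * (1 + ln (l^-1))))%R%:E)%E.
Proof.
move=> s54; have b4 : 1 < 4 :> R by rewrite ltr1n.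
have G0 : 0 < geo_const 4 2 :> R by exact: geo_const_gt0.
exists (1024 * (1 + geo_const 4 2)); first by apply: mulr_gt0; lra.
move=> J l l01; have /andP[l0 l1] := l01; have s0 : 0 < s by lra.
have L0 := ln_inv_ge0 l l01.
apply: le_trans (SV2_block s l J s0 l01) _; rewrite lee_fin -mulrA; apply: ler_wpM2l; first lra.
have -> : \sum_(i < J) (2 ^+ i) `^ (1 - 4 * s) * (if l * 4 ^+ i <= 1 then (l * 4 ^+ i) ^+ 2 else 1) =
   l ^+ 2 * (\sum_(i < J) (l * 4 ^+ i <= 1)%R%:R + \sum_(i < J | 1 < l * 4 ^+ i) (l * 4 ^+ i) `^ (- 2)).
  rewrite [X in _ * (_ + X)]big_mkcond -big_split/= mulr_sumr; apply: eq_bigr => i _.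
  have x0 : 0 < l * 4 ^+ i by rewrite mulr_gt0// exprn_gt0.
  rewrite (two_pow_scale l _ i l0).
  have -> : (1 - 4 * s) / 2 = - 2 by rewrite s54; field.
  rewrite opprK (powR_mulrn 2 (ltW l0)); case: leP => h.
    rewrite addr0 mulr1 mulrAC -(powR_mulrn 2 (ltW x0)) -powRD; last by rewrite (gt_eqF x0) implybT.
    by rewrite addNr powRr0 mul1r.
  by rewrite mulr1 add0r mulrC.
rewrite mulrCA; apply: ler_wpM2l; first exact: sqr_ge0.
have h1 := count_low l J l01; have h2 := geo_high_pow l 4 2 J l0 b4 (ltr0n _ 2).
apply: le_trans (lerD h1 h2) _.
have := mulr_ge0 (ltW G0) L0; lra.
Qed.

Lemma SV2_upper_gt {R : realType} (s : R) : 5 / 4 < s ->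
  exists2 C : R, 0 < C & forall (J : nat) (l : R), 0 < l < 1 ->
  (SV s J 2 l <= (C * l ^+ 2)%R%:E)%E.
Proof.
move=> s54; pose r : R := 2 `^ (4 * s - 5).
have r1 : 1 < r by apply: powR_gt1; [rewrite ltr1n|lra].
exists (1024 * (r / (r - 1))); first by apply: mulr_gt0; [lra|apply: divr_gt0; lra].
move=> J l l01; have /andP[l0 l1] := l01; have s0 : 0 < s by lra.
apply: le_trans (SV2_block s l J s0 l01) _; rewrite lee_fin -mulrA; apply: ler_wpM2l; first lra.
apply: (@le_trans _ _ ((\sum_(i < J) (r ^+ i)^-1) * l ^+ 2)); last first.
  by apply: ler_wpM2r; [exact: sqr_ge0|exact: geo_dec].
rewrite mulr_suml; apply: ler_sum => i _.
have i0 : 0 < 2 ^+ i :> R by rewrite exprn_gt0.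
have x0 : 0 < l * 4 ^+ i by rewrite mulr_gt0// exprn_gt0.
have rE : r ^+ i = (2 ^+ i) `^ (4 * s - 5) by rewrite powR_expn// ltr1n.
have -> : (r ^+ i)^-1 * l ^+ 2 = (2 ^+ i) `^ (1 - 4 * s) * (l * 4 ^+ i) ^+ 2.
  have e4 : (4 ^+ i) ^+ 2 = (2 ^+ i) `^ 4 :> R.
    by rewrite (powR_mulrn 4 (ltW i0)) -dyadic_sq natrX; ring.
  rewrite rE -powRN exprMn e4.
  rewrite [in RHS]mulrCA -powRD; last by rewrite (gt_eqF i0) implybT.
  by rewrite mulrC; congr (_ * _ `^ _); ring.
apply: ler_wpM2l; first exact: powR_ge0.
have /orP[h|h] : (l * 4 ^+ i <= 1) || (1 < l * 4 ^+ i) by case: leP.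
  by rewrite h.
rewrite ifF; first by apply: exprn_ege1; exact: ltW.
by apply/negbTE; rewrite -ltNge.
Qed.

(** For [n <= 2 ^ K.+1] the argument [pi * n ^ 2 * l] stays in [[0, pi / 2]], where the sine is
    above its chord. Writing the scale as a successor guarantees a full block
    [2 ^ K <= n < 2 ^ K.+1] below it. *)
Lemma scale_exists {R : realType} (l : R) : 0 < l -> l < 1 / 8 ->
  exists2 K : nat, l * 4 ^+ K.+1 <= 1 / 2 & 1 / 8 < l * 4 ^+ K.+1.
Proof.
move=> l0 l8.
have ex : exists n, 1 / 2 < l * 4 ^+ n.
  have [n hn] := ltr_add_invr l0.
  exists n; rewrite add0r in hn.
  have h : n.+1%:R <= 4 ^+ n :> R.
    rewrite -natrX ler_nat; elim: n {hn} => // n IH; rewrite expnS; lia.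
  have h1 : 1 < l * n.+1%:R by rewrite -ltr_pdivrMr// div1r.
  have := ler_wpM2l (ltW l0) h; lra.
case: (ex_minnP ex) => m hm min.
case: m hm min => [|[|m]]; [lra|rewrite expr1; lra|] => hm min; exists m.
  by rewrite leNgt; apply/negP => /min; rewrite ltnn.
by move: hm; rewrite exprS; lra.
Qed.

Lemma dcoef_lower {R : realType} (s l : R) (K J n : nat) : 0 < l -> l * 4 ^+ K <= 1 / 2 ->
  (K < J)%N -> (0 < n)%N -> (n <= 2 ^ K)%N ->
  rcoef s n * ((n ^ 2)%:R * l) <= dcoef l (vcoef s J) n.
Proof.
move=> l0 hK KJ n0 nK; case: J KJ => // J KJ.
rewrite /dcoef vcoef_eq//; last by rewrite (leq_trans nK)// leq_exp2l.
apply: ler_wpM2l; first exact: rcoef_ge0.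
rewrite -mulrA; apply: sinpi_ge; rewrite mulr_ge0 ?ler0n ?(ltW l0)//=.
apply: le_trans hK; rewrite mulrC; apply: ler_wpM2l; first exact: ltW.
by rewrite -dyadic_sq natrX ler_pXn2r ?nnegrE ?ler0n// ler_nat.
Qed.

Lemma dcoef_block_lower {R : realType} (s l : R) (K J i m : nat) : 0 < s -> 0 < l ->
  l * 4 ^+ K <= 1 / 2 -> (K < J)%N -> (i < K)%N -> (m < 2 ^ i)%N ->
  (2 * 2 ^+ i) `^ (- (2 * s)) * ((2 ^+ i) ^+ 2 * l) <= dcoef l (vcoef s J) (2 ^ i + m).
Proof.
move=> s0 l0 hK KJ iK mi; set n := (2 ^ i + m)%N.
have n0 : (0 < n)%N by rewrite addn_gt0 expn_gt0.
have i0 : 0 < 2 ^+ i :> R by rewrite exprn_gt0.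
have ni : 2 ^+ i <= n%:R :> R by rewrite -natrX ler_nat leq_addr.
have ni2 : n%:R <= 2 * 2 ^+ i :> R by rewrite -natrX -natrM ler_nat /n; lia.
have nK : (n <= 2 ^ K)%N.
  by apply: (@leq_trans (2 ^ i.+1)); [rewrite expnS /n; lia|rewrite leq_exp2l].
apply: le_trans (dcoef_lower s l K J n l0 hK KJ n0 nK).
apply: ler_pM; [exact: powR_ge0|by rewrite mulr_ge0 ?sqr_ge0// ltW| |].
  rewrite /rcoef !powRN lef_pV2 ?posrE ?powR_gt0 ?mulr_gt0 ?ltr0n//.
  by apply: ler_powR2r => //; lra.
apply: ler_wpM2r; first exact: ltW.
by rewrite natrX ler_pXn2r ?nnegrE ?ler0n ?(ltW i0).
Qed.

Lemma dcoef_sqr_block_lower {R : realType} (s l : R) (K J i m : nat) : 0 < s -> 0 < l ->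
  l * 4 ^+ K <= 1 / 2 -> (K < J)%N -> (i < K)%N -> (m < 2 ^ i)%N ->
  2 `^ (- (4 * s)) * l ^+ 2 * (2 ^+ i) `^ (4 - 4 * s) <= dcoef l (vcoef s J) (2 ^ i + m) ^+ 2.
Proof.
move=> s0 l0 hK KJ iK mi.
have i0 : 0 < 2 ^+ i :> R by rewrite exprn_gt0.
pose u : R := (2 * 2 ^+ i) `^ (- (2 * s)) * ((2 ^+ i) ^+ 2 * l).
have u0 : 0 <= u by apply: mulr_ge0; [exact: powR_ge0|rewrite mulr_ge0 ?sqr_ge0// ltW].
have hu := dcoef_block_lower s l K J i m s0 l0 hK KJ iK mi; rewrite -/u in hu.
have -> : 2 `^ (- (4 * s)) * l ^+ 2 * (2 ^+ i) `^ (4 - 4 * s) = u ^+ 2.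
  rewrite /u exprMn -(powR_mulrn 2 (powR_ge0 _ _)) -powRrM.
  have -> : - (2 * s) * 2%:R = - (4 * s) by ring.
  rewrite (powRM _ (ler0n _ 2) (ltW i0)) powRD; last by rewrite (gt_eqF i0) implybT.
  by rewrite (powR_mulrn 4 (ltW i0)); ring.
by rewrite ler_pXn2r ?nnegrE// (le_trans u0 hu).
Qed.

Lemma SV2_lower {R : realType} (s l : R) (K J : nat) : 0 < s -> 0 < l < 1 ->
  l * 4 ^+ K <= 1 / 2 -> (K < J)%N ->
  ((2 `^ (- (4 * s)) * l ^+ 2 * \sum_(i < K) (2 ^+ i) `^ (5 - 4 * s))%R%:E <= SV s J 2 l)%E.
Proof.
move=> s0 /andP[l0 l1] hK KJ.
rewrite SV2E ?(ltW l0) ?(ltW l1)// lee_fin.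
set S := (X in _ <= 4 * X).
have S0 : 0 <= S by apply: sumr_ge0 => i _; exact: sqr_ge0.
suff h : 2 `^ (- (4 * s)) * l ^+ 2 * \sum_(i < K) (2 ^+ i) `^ (5 - 4 * s) <= S by lra.
rewrite /S (sum_dyadic_blocks (fun n => dcoef l (vcoef s J) n ^+ 2)).
rewrite -(subnKC (ltnW KJ)) big_split_ord/=.
have -> : dcoef l (vcoef s (K + (J - K))) 0 ^+ 2 = 0 by rewrite /dcoef vcoef0 mul0r expr0n.
rewrite add0r mulr_sumr -[leLHS]addr0; apply: lerD; last first.
  by apply: sumr_ge0 => i _; apply: sumr_ge0 => m _; exact: sqr_ge0.
apply: ler_sum => i _.
have i0 : 0 < 2 ^+ i :> R by rewrite exprn_gt0.
have KJ' : (K < K + (J - K))%N by lia.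
apply: (@le_trans _ _ (\sum_(m < 2 ^ i) 2 `^ (- (4 * s)) * l ^+ 2 * (2 ^+ i) `^ (4 - 4 * s))).
  rewrite sumr_const card_ord -[leRHS]mulr_natr natrX.
  have -> : (2 ^+ i) `^ (5 - 4 * s) = (2 ^+ i) `^ (4 - 4 * s) * 2 ^+ i :> R.
    have -> : (5 : R) - 4 * s = 4 - 4 * s + 1 by ring.
    by rewrite powRD ?(powRr1 (ltW i0))// (gt_eqF i0) implybT.
  by rewrite mulrA.
by apply: ler_sum => m _; exact: (dcoef_sqr_block_lower s l K _ i m s0 l0 hK KJ' (ltn_ord i) (ltn_ord m)).
Qed.

Definition SV_le {R : realType} (s p : R) (F : R -> R) : Prop :=
  exists2 C : R, 0 < C & forall (J : nat) (l : R), 0 < l < 1 -> (SV s J p l <= (C * F l)%R%:E)%E.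

(** The rank [J1] may depend on [l]: the truncation must have reached the frequencies with
    [n ^ 2 * l] of order 1. *)
Definition SV_ge {R : realType} (s p : R) (F : R -> R) : Prop :=
  exists2 c : R, 0 < c & exists2 l0 : R, 0 < l0 < 1 & forall l : R, 0 < l < l0 ->
    exists J1 : nat, forall J : nat, (J1 <= J)%N -> ((c * F l)%R%:E <= SV s J p l)%E.

Lemma SV2_ge_gt {R : realType} (s : R) : 0 < s -> SV_ge s 2 (fun l => l ^+ 2).
Proof.
move=> s0; exists (2 `^ (- (4 * s))); first by rewrite powR_gt0.
exists (1 / 8); first by lra.
move=> l /andP[l0 l1]; have l01 : 0 < l < 1 by lra.
(* The frequency [n = 1] alone gives this bound. *)
exists 2%N => J hJ; have h : l * 4 ^+ 1 <= 1 / 2 by rewrite expr1; lra.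
apply: le_trans (SV2_lower s l 1 J s0 l01 h hJ).
by rewrite big_ord1 expr0 powR1 mulr1.
Qed.

(** Only the last block below the transition scale is kept. *)
Lemma SV2_ge_lt {R : realType} (s : R) : 0 < s -> s < 5 / 4 ->
  SV_ge s 2 (fun l => l `^ (2 * s - 1 / 2)).
Proof.
move=> s0 s1; exists (2 `^ (- (4 * s)) * (1 / 32) `^ ((5 - 4 * s) / 2)).
  by rewrite mulr_gt0 ?powR_gt0//; lra.
exists (1 / 8); first by lra.
move=> l /andP[l0 l1]; have l01 : 0 < l < 1 by lra.
have [K h1 h2] := scale_exists l l0 l1; exists K.+2 => J hJ.
apply: le_trans (SV2_lower s l K.+1 J s0 l01 h1 hJ); rewrite lee_fin.
rewrite big_ord_recr/= -[leLHS]mulrA -[leRHS]mulrA; apply: ler_wpM2l; first exact: powR_ge0.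
rewrite mulrDr -[leLHS]add0r; apply: lerD.
  by rewrite mulr_ge0 ?sqr_ge0// sumr_ge0// => i _; exact: powR_ge0.
rewrite (two_pow_scale l _ K l0).
have x0 : 0 < l * 4 ^+ K by rewrite mulr_gt0// exprn_gt0.
have -> : l `^ (2 * s - 1 / 2) = l ^+ 2 * l `^ (- ((5 - 4 * s) / 2)).
  rewrite -(powR_mulrn 2 (ltW l0)) -powRD; last by rewrite (gt_eqF l0) implybT.
  by congr (_ `^ _); field.
rewrite mulrCA; apply: ler_wpM2l; first exact: sqr_ge0.
apply: ler_wpM2r; first exact: powR_ge0.
by apply: ler_powR2r; move: h2; rewrite exprS; lra.
Qed.

Lemma scale_log {R : realType} (l : R) (k : nat) : 0 < l -> 1 / 8 < l * 4 ^+ k ->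
  ln (l^-1) <= 4 * k%:R + 4.
Proof.
move=> l0 h2.
have -> : 4 * k%:R + 4 = ln (expR (4 * k%:R + 4)) :> R by rewrite expRK.
rewrite ler_ln ?posrE ?invr_gt0 ?expR_gt0//.
have h3 : l^-1 <= 8 * 4 ^+ k.
  by rewrite -[l^-1]mul1r ler_pdivrMr//; move: h2; lra.
apply: le_trans h3 _; rewrite mulrC expRD.
have e4 : (4 : R) <= expR 4 by have := expR_ge1Dx (4 : R); lra.
have e8 : (8 : R) <= expR 4.
  have e2 : (3 : R) <= expR 2 by have := expR_ge1Dx (2 : R); lra.
  have -> : (4 : R) = 2 + 2 by ring.
  by rewrite expRD; have := ler_pM (ler0n R 3) (ler0n R 3) e2 e2; lra.
rewrite (mulrC 4) expRM_natl; apply: ler_pM => //.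
by apply: lerXn2r; rewrite ?nnegrE ?expR_ge0.
Qed.

(** The low blocks contribute equally, and by [scale_log] their number is at least a constant times
    the logarithm. *)
Lemma SV2_ge_eq {R : realType} (s : R) : s = 5 / 4 ->
  SV_ge s 2 (fun l => l ^+ 2 * (1 + ln (l^-1))).
Proof.
move=> s54; have s0 : 0 < s by lra.
exists (2 `^ (- (4 * s)) / 12); first by rewrite divr_gt0 ?powR_gt0//; lra.
exists (1 / 8); first by lra.
move=> l /andP[l0 l1]; have l01 : 0 < l < 1 by lra.
have [K h1 h2] := scale_exists l l0 l1; exists K.+2 => J hJ.
apply: le_trans (SV2_lower s l K.+1 J s0 l01 h1 hJ); rewrite lee_fin.
have -> : \sum_(i < K.+1) (2 ^+ i) `^ (5 - 4 * s) = K.+1%:R :> R.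
  rewrite (eq_bigr (fun _ => 1)) => [|i _]; first by rewrite sumr_const card_ord.
  by rewrite s54 (_ : 5 - 4 * (5 / 4) = 0) ?powRr0//; field.
have hL := scale_log l K.+1 l0 h2.
have K1 : 1 <= K.+1%:R :> R by rewrite ler1n.
have hK : 1 + ln (l^-1) <= 12 * K.+1%:R by lra.
have := ler_wpM2l (mulr_ge0 (powR_ge0 2 (- (4 * s))) (sqr_ge0 l)) hK; lra.
Qed.

(** * Lower bound by the Fejer kernel *)

Lemma SV_T2 {R : realType} (s p l : R) (J : nat) : 0 <= l <= 1 ->
  SV s J p l = ((2 `^ p)%:E * Ig (fun x => T2 (dcoef l (vcoef s J)) (2 ^ J) x `^ (p / 2))%R)%E.
Proof.
move=> l01; rewrite SVE.
have e : (fun x => Dmod (vcoef s J) (2 ^ J) l x `^ p) =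
    (fun x => 2 `^ p * T2 (dcoef l (vcoef s J)) (2 ^ J) (x + l / 2) `^ (p / 2)).
  apply/funext => x; rewrite Dmod_sqr powRM ?sqrtr_ge0// powR_sqrt ?T2_ge0//.
have f0 x : 0 <= T2 (dcoef l (vcoef s J)) (2 ^ J) (x + l / 2) `^ (p / 2) by exact: powR_ge0.
rewrite e (IgZ _ (2 `^ p) (measurable_T2_powR _ _ _ _) f0 (powR_ge0 _ _)) Ig_T2_shift//; lra.
Qed.

(** The minorant [k] may be negative, whereas monotonicity of [Ig] is for nonnegative functions:
    [|k|] is added on both sides and its finite integral cancelled. *)
Lemma Ig_ge_Int {R : realType} (k g : R -> R) : continuous k -> measurable_fun setT g ->
  (forall x, 0 <= g x) -> (forall x, k x <= g x) -> ((Int k)%:E <= Ig g)%E.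
Proof.
move=> ck mg g0 kg.
have cn : continuous (fun x => `|k x|) by move=> x; apply: cvg_norm; exact: ck.
have cs : continuous (fun x => k x + `|k x|) by exact: continuous_add.
have mn := continuous_measurable_fun cn.
have s0 x : 0 <= k x + `|k x| by have := ler_norm (- k x); rewrite normrN; lra.
have h : (Ig (fun x => k x + `|k x|)%R <= Ig (fun x => g x + `|k x|)%R)%E.
  apply: Ig_le => //; first exact: continuous_measurable_fun.
    exact: measurable_funD.
  by move=> x _; rewrite lerD2r.
move: h; rewrite (Int_Ig _ cs) (IntD k _ ck cn) (IgD g _ mg mn g0 (fun x => normr_ge0 _)) (Int_Ig _ cn).
by rewrite EFinD leeD2rE.
Qed.

Lemma sum_shift_diag (R : realType) (M k : nat) :
  \sum_(a < M) \sum_(b < M) (((k + a)%N == b)%:R : R) = (M - k)%N%:R.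
Proof.
have h (a : 'I_M) : \sum_(b < M) (((k + a)%N == b)%:R : R) = (k + a < M)%:R.
  case: ltnP => h.
    rewrite (bigD1 (Ordinal h))//= eqxx big1 ?addr0// => j hj.
    by rewrite (_ : ((k + a)%N == j) = false)//; apply/negbTE; apply: contra hj => /eqP e; apply/eqP/val_inj.
  rewrite big1// => b _; rewrite (_ : ((k + a)%N == b) = false)//; apply/negbTE.
  by rewrite neq_ltn orbC (leq_trans (ltn_ord b) h).
rewrite (eq_bigr _ (fun a _ => h a)).
have [kM|Mk] := leqP k M; last first.
  rewrite (_ : (M - k)%N = 0%N); last by apply/eqP; rewrite subn_eq0 ltnW.
  by rewrite big1// => a _; rewrite ltnNge (leq_trans (ltnW Mk) (leq_addr _ _)).
rewrite -(subnK kM) big_split_ord/= [X in _ + X]big1 => [|a _]; last first.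
  by rewrite addnC ltn_add2r ltnNge leq_addr.
rewrite addr0 (eq_bigr (fun=> 1)) => [|a _]; first by rewrite sumr_const card_ord addnK.
by rewrite addnC ltn_add2r ltn_ord.
Qed.

(** The product formula yields two frequencies, which are exchanged with [a] and [b]; hence the
    factor 1/2 disappears in the double sum. It serves both the pairing with the Fejer kernel and
    the quartic pairing in [Ig_T2_sqr_ge]. *)
Lemma Int_cos_mul_GT {R : realType} (I J : finType) (u : I -> R) (k m : I -> nat) (c : J -> R) (h : J -> nat) :
  Int (fun x => (\sum_i u i * cos (2 * pi * ((k i)%:R - (m i)%:R) * x)) * GT J c h x) =
  \sum_i u i * \sum_a \sum_b c a * c b * (k i + h a == m i + h b)%N%:R.
Proof.
pose F (i : I) (a b : J) (x : R) := c a * c b * (2^-1 *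
  (cos (2 * pi * ((k i + h a)%:R - (m i + h b)%:R) * x + 0) + cos (2 * pi * ((k i + h b)%:R - (m i + h a)%:R) * x + 0))).
have e : (fun x => (\sum_i u i * cos (2 * pi * ((k i)%:R - (m i)%:R) * x)) * GT J c h x) =
   (fun x => \sum_i u i * \sum_a \sum_b F i a b x).
  apply/funext => x; rewrite GTE mulr_suml; apply: eq_bigr => i _.
  rewrite -mulrA; congr (_ * _); rewrite mulr_sumr; apply: eq_bigr => a _.
  rewrite mulr_sumr; apply: eq_bigr => b _; rewrite /F !addr0 !natrD.
  set v := 2 * pi * ((k i)%:R - (m i)%:R) * x; set w := 2 * pi * ((h a)%:R - (h b)%:R) * x.
  have -> : 2 * pi * ((k i)%:R + (h a)%:R - ((m i)%:R + (h b)%:R)) * x = v + w by rewrite /v /w; ring.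
  have -> : 2 * pi * ((k i)%:R + (h b)%:R - ((m i)%:R + (h a)%:R)) * x = v - w by rewrite /v /w; ring.
  by rewrite cosD cosB; field.
have cF i a b : continuous (F i a b).
  apply: continuous_mul; first exact: cst_continuous.
  apply: continuous_mul; first exact: cst_continuous.
  by apply: continuous_add; exact: continuous_cos_affine.
have c1 i a : continuous (fun x => \sum_b F i a b x) by apply: continuous_sum => b; exact: cF.
have c2 i : continuous (fun x => \sum_a \sum_b F i a b x) by apply: continuous_sum => a; exact: c1.
rewrite e Int_sum => [|i]; last by apply: continuous_mul; [exact: cst_continuous|exact: c2].
apply: eq_bigr => i _; rewrite IntZ; last exact: c2.
congr (_ * _); rewrite Int_sum => [|a]; last exact: c1.
pose g (a b : J) := c a * c b * (k i + h a == m i + h b)%N%:R.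
rewrite (eq_bigr (fun a => \sum_b 2^-1 * (g a b + g b a))) => [|a _]; last first.
  rewrite Int_sum => [|b]; last exact: cF.
  apply: eq_bigr => b _; rewrite /F IntZ; last first.
    by apply: continuous_mul; [exact: cst_continuous|apply: continuous_add; exact: continuous_cos_affine].
  rewrite IntZ; last by apply: continuous_add; exact: continuous_cos_affine.
  rewrite IntD ?Int_cos_freq ?cos0 ?mulr1; [|exact: continuous_cos_affine|exact: continuous_cos_affine].
  by rewrite /g; ring.
under eq_bigr do rewrite -mulr_sumr big_split/=.
by rewrite -mulr_sumr big_split/= [X in _ + X]exchange_big/= -/(g _ _); field.
Qed.

(* [GT 'I_M (fun=> 1) id / M] is the Fejer kernel *)
Lemma Int_Fejer {R : realType} (c : nat -> R) (L M : nat) :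
  Int (fun x => TC c L x * GT 'I_M (fun=> 1) (fun m => m : nat) x) = \sum_(n < L) c n * (M - n ^ 2)%N%:R.
Proof.
have e : TC c L = (fun x => \sum_(n < L) c n * cos (2 * pi * ((n ^ 2)%:R - 0%N%:R) * x)).
  by apply/funext => x; apply: eq_bigr => n _; rewrite subr0.
rewrite e (Int_cos_mul_GT 'I_L 'I_M (fun n => c n) (fun n => n ^ 2)%N (fun=> 0%N)).
apply: eq_bigr => n _; rewrite -(sum_shift_diag R M); congr (_ * _).
by apply: eq_bigr => a _; apply: eq_bigr => b _; rewrite !mul1r.
Qed.

(* Young's inequality [t ^ (p - 1) g <= g ^ p + t ^ p] against a kernel of mass 1 replaces Holder. *)
Lemma Fejer_test {R : realType} (c : nat -> R) (L M : nat) (p A : R) : (0 < M)%N -> 1 <= p -> 0 < A ->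
  A * M%:R <= \sum_(n < L) c n * (M - n ^ 2)%N%:R ->
  (((A / 2) `^ p)%:E <= M%:R%:E * Ig (fun x => T2 c L x `^ (p / 2))%R)%E.
Proof.
move=> M0 p1 A0 hA; set F := GT 'I_M (fun=> 1 : R) (fun m => m : nat).
have MR : 0 < M%:R :> R by rewrite ltr0n.
have F0 x : 0 <= F x by exact: GT_ge0.
have cF : continuous F by exact: continuous_GT.
have FM x : F x <= M%:R * M%:R.
  rewrite /F GTE; apply: (@le_trans _ _ (\sum_(a < M) \sum_(b < M) 1)).
    by apply: ler_sum => a _; apply: ler_sum => b _; rewrite !mul1r cos_le1.
  by rewrite !sumr_const card_ord !mulr_natr.
have IF : Int F = M%:R.
  rewrite Int_GT (eq_bigr (fun=> 1)); first by rewrite sumr_const card_ord.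
  move=> a _; rewrite (bigD1 a)//= eqxx !mul1r big1 ?addr0// => b ba.
  by rewrite eq_sym (inj_eq val_inj) (negbTE ba) mulr0.
(* With this threshold [t ^ (p - 1) * A - t ^ p = t ^ p]. *)
set t := A / 2; have t0 : 0 < t by rewrite /t divr_gt0.
have cT : continuous (TC c L) by exact: continuous_TC.
pose k x := M%:R^-1 * (t `^ (p - 1) * (TC c L x * F x) + - t `^ p * F x).
have cTF : continuous (fun x => TC c L x * F x) by exact: continuous_mul.
have ck1 : continuous (fun x => t `^ (p - 1) * (TC c L x * F x)).
  by apply: continuous_mul => //; exact: cst_continuous.
have ck2 : continuous (fun x => - t `^ p * F x) by apply: continuous_mul => //; exact: cst_continuous.
have ck : continuous k.
  by apply: continuous_mul; [exact: cst_continuous|exact: continuous_add].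
have mT : measurable_fun setT (fun x => T2 c L x `^ (p / 2)).
  by apply: measurable_powR_comp; apply: continuous_measurable_fun; exact: continuous_T2.
have T0 x : 0 <= T2 c L x `^ (p / 2) by exact: powR_ge0.
rewrite -(IgZ _ M%:R mT T0 (ltW MR)).
apply: (@le_trans _ _ (Int k)%:E); last first.
  apply: Ig_ge_Int => //.
  - exact: measurable_funM.
  - by move=> x; rewrite mulr_ge0// ltW.
  move=> x; rewrite /k ler_pdivrMl// mulrCA.
  have g0 : 0 <= Num.sqrt (T2 c L x) by exact: sqrtr_ge0.
  have TCg : TC c L x <= Num.sqrt (T2 c L x).
    apply: (le_trans (ler_norm _)); rewrite -sqrtr_sqr ler_wsqrtr// T2E.
    by have := sqr_ge0 (TS c L x); lra.
  have := powR_interp_le t _ 1 p t0 g0 ltr01 p1; rewrite powRr1// powR_sqrt ?T2_ge0// => h1.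
  have h2 : t `^ (p - 1) * TC c L x <= T2 c L x `^ (p / 2) + t `^ p.
    by apply: le_trans h1; apply: ler_wpM2l TCg; exact: powR_ge0.
  have := ler_wpM2r (F0 x) h2; have := ler_wpM2r (T0 x) (FM x); lra.
rewrite lee_fin /k IntZ; last exact: continuous_add.
rewrite IntD// !IntZ// IF Int_Fejer ler_pdivlMl//.
have tp : t `^ p = t `^ (p - 1) * t.
  rewrite -[X in _ * X](powRr1 (ltW t0)) -powRD; last by rewrite (gt_eqF t0) implybT.
  by rewrite subrK.
have := ler_wpM2l (powR_ge0 t (p - 1)) hA; rewrite tp.
have -> : A = t + t by rewrite /t; field.
lra.
Qed.

Lemma dyadic_sqr_le (i m : nat) : (m < 2 ^ i)%N -> ((2 ^ i + m) ^ 2 <= 4 ^ i.+1)%N.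
Proof.
move=> mi; have -> : (4 ^ i.+1 = (2 ^ i.+1) ^ 2)%N by rewrite -expnM mulnC expnM.
by rewrite leq_exp2r// expnS mul2n -addnn leq_add2l ltnW.
Qed.

(** The coefficients with [n ^ 2 * l <= 1] are nonnegative and their sum, the value at the origin,
    is of order [l ^ (s - 1 / 2)]. The test against a kernel of width about [l] gives this value to
    the power [p] times [l]. *)
Lemma SV_ge_Fejer {R : realType} (s p : R) : 0 < s -> s < 3 / 2 -> 1 <= p ->
  SV_ge s p (fun l => l `^ (p * s - p / 2 + 1)).
Proof.
move=> s0 s1 p1.
pose c1 : R := 2 `^ (- (2 * s)) / 2 * (1 / 32) `^ ((3 - 2 * s) / 2).
have c10 : 0 < c1 by rewrite /c1; apply: mulr_gt0; [apply: divr_gt0; rewrite ?powR_gt0//; lra|rewrite powR_gt0//; lra].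
exists (c1 `^ p); first by rewrite powR_gt0.
exists (1 / 8); first by lra.
move=> l /andP[l0 l1]; have l01 : 0 <= l <= 1 by lra.
have [K h1 h2] := scale_exists l l0 l1; exists K.+2 => J hJ.
(* Twice the square of the largest frequency used, so the Fejer weight is at least [M / 2] on the
   last block; still [M * l <= 1], so no coefficient with [n ^ 2 <= M] is negative. *)
pose M := (2 * 4 ^ K.+1)%N; have M0 : (0 < M)%N by rewrite muln_gt0 expn_gt0.
have MR : 0 < M%:R :> R by rewrite ltr0n.
have ME : M%:R = 2 * 4 ^+ K.+1 :> R by rewrite /M natrM natrX.
pose d := dcoef l (vcoef s J).
have d0 n : 0 <= d n * (M - n ^ 2)%N%:R.
  have [nM|Mn] := leqP (n ^ 2) M; last by rewrite (eqP (ltnW Mn)) mulr0.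
  apply: mulr_ge0 => //; rewrite /d /dcoef; apply: mulr_ge0.
    by have /andP[] := vcoef_bounds s J n.
  have nR : (n ^ 2)%:R <= 2 * 4 ^+ K.+1 :> R by rewrite -ME ler_nat.
  have := ler_wpM2l (ltW l0) nR => nl.
  have n0 : 0 <= (n ^ 2)%:R * l :> R by rewrite mulr_ge0 ?ler0n// ltW.
  apply: sin_ge0_pi; rewrite -mulrA mulr_ge0 ?(ltW (pi_gt0 _))//=.
  rewrite -[leRHS]mulr1; apply: ler_wpM2l; first exact: ltW (pi_gt0 _).
  by rewrite mulrC; apply: le_trans nl _; lra.
pose u : R := (2 * 2 ^+ K) `^ (- (2 * s)) * ((2 ^+ K) ^+ 2 * l).
have k0 : 0 < 2 ^+ K :> R by rewrite exprn_gt0.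
have u0 : 0 <= u by apply: mulr_ge0; [exact: powR_ge0|rewrite mulr_ge0 ?sqr_ge0// ltW].
pose A : R := c1 * l `^ (s - 1 / 2).
have A0 : 0 < A by rewrite mulr_gt0// powR_gt0.
have hA : A <= 2 ^+ K * u / 2.
  have -> : 2 ^+ K * u / 2 = 2 `^ (- (2 * s)) / 2 * ((2 ^+ K) `^ (3 - 2 * s) * l).
    have -> : (3 : R) - 2 * s = - (2 * s) + 3 by ring.
    rewrite /u (powRM _ (ler0n _ 2) (ltW k0)) powRD; last by rewrite (gt_eqF k0) implybT.
    by rewrite (powR_mulrn 3 (ltW k0)); ring.
  rewrite /A /c1 -mulrA; apply: ler_wpM2l; first by apply: divr_ge0; [exact: powR_ge0|lra].
  rewrite (two_pow_scale l _ K l0) -mulrA.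
  have -> : l `^ (- ((3 - 2 * s) / 2)) * l = l `^ (s - 1 / 2).
    rewrite -[X in _ * X](powRr1 (ltW l0)) -powRD; last by rewrite (gt_eqF l0) implybT.
    by congr (_ `^ _); field.
  apply: ler_wpM2r; first exact: powR_ge0.
  by apply: ler_powR2r; move: h2; rewrite exprS; lra.
have hs : A * M%:R <= \sum_(n < 2 ^ J) d n * (M - n ^ 2)%N%:R.
  rewrite (sum_dyadic_blocks (fun n => d n * (M - n ^ 2)%N%:R)).
  have KJ : (K < J)%N by exact: ltnW.
  rewrite (bigD1 (Ordinal KJ))//=.
  set S1 := d 0 * _; set S2 := \sum_(i < J | _) _.
  have S10 : 0 <= S1 by exact: (d0 0%N).
  have S20 : 0 <= S2 by apply: sumr_ge0 => i _; apply: sumr_ge0 => m _; exact: (d0 (2 ^ i + m)%N).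
  suff : A * M%:R <= \sum_(m < 2 ^ K) d (2 ^ K + m)%N * (M - (2 ^ K + m) ^ 2)%N%:R by lra.
  apply: (@le_trans _ _ (\sum_(m < 2 ^ K) u * (M%:R / 2))).
    rewrite sumr_const card_ord -[leRHS]mulr_natr natrX.
    by have := ler_wpM2r (ltW MR) hA; lra.
  apply: ler_sum => m _; apply: ler_pM => //.
    by apply: (dcoef_block_lower s l K.+1) => //; exact: ltn_ord.
  have hn := dyadic_sqr_le K m (ltn_ord m).
  rewrite natrB; last by rewrite /M (leq_trans hn)// mul2n -addnn leq_addr.
  have : ((2 ^ K + m) ^ 2)%:R <= 4 ^+ K.+1 :> R by rewrite -natrX ler_nat.
  rewrite ME; lra.
have := Fejer_test d (2 ^ J) M p A M0 p1 A0 hs.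
rewrite (SV_T2 s p l J l01) -/d; set I := Ig _ => hI.
have I0 : (0 <= I)%E by apply: Ig_ge0 => x; exact: powR_ge0.
have E : c1 `^ p * l `^ (p * s - p / 2 + 1) = 2 `^ p * (l * (A / 2) `^ p).
  have A2 : 0 <= A / 2 by rewrite divr_ge0// ltW.
  rewrite [RHS]mulrCA -(powRM p (ler0n R 2) A2).
  have -> : 2 * (A / 2) = A by field.
  rewrite /A powRM ?(ltW c10) ?powR_ge0// -powRrM [RHS]mulrCA; congr (_ * _).
  have -> : p * s - p / 2 + 1 = 1 + (s - 1 / 2) * p by field.
  by rewrite powRD ?(powRr1 (ltW l0))// (gt_eqF l0) implybT.
rewrite E EFinM; apply: lee_wpmul2l; first by rewrite lee_fin powR_ge0.
rewrite EFinM; apply: (@le_trans _ _ (l%:E * (M%:R%:E * I)))%E.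
  by apply: lee_wpmul2l => //; rewrite lee_fin ltW.
rewrite muleA -EFinM -[leRHS]mul1e; apply: lee_wpmul2r => //.
by rewrite lee_fin ME; lra.
Qed.

(** * The equation a^2 + b^2 = c^2 + d^2 *)

(* [n ^ (-1 / 2)], with value 0 at [n = 0]; truncated subtraction in an argument therefore
   encodes a strict inequality. *)
Definition isq {R : realType} (n : nat) : R := (Num.sqrt n%:R)^-1.

Lemma isq0 {R : realType} : isq 0 = 0 :> R.
Proof. by rewrite /isq sqrtr0 invr0. Qed.

Lemma isq_ge0 {R : realType} (n : nat) : 0 <= isq n :> R.
Proof. by rewrite /isq invr_ge0 sqrtr_ge0. Qed.

Lemma sqrt_nat_gt0 {R : realType} (n : nat) : (0 < n)%N -> 0 < Num.sqrt n%:R :> R.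
Proof. by move=> n0; rewrite sqrtr_gt0 ltr0n. Qed.

Lemma sqrt_nat_le {R : realType} (m n : nat) : (m <= n)%N -> Num.sqrt m%:R <= Num.sqrt n%:R :> R.
Proof. by move=> mn; rewrite ler_wsqrtr// ler_nat. Qed.

Lemma isq_sqr {R : realType} (n : nat) : isq n * isq n = n%:R^-1 :> R.
Proof. by rewrite /isq -invfM -expr2 sqr_sqrtr. Qed.

Lemma isqM {R : realType} (m n : nat) : isq (m * n) = isq m * isq n :> R.
Proof. by rewrite /isq natrM sqrtrM// invfM. Qed.

Lemma isq_le {R : realType} (m n : nat) : (0 < m)%N -> (m <= n)%N -> isq n <= isq m :> R.
Proof.
move=> m0 mn; rewrite /isq lef_pV2 ?posrE ?sqrt_nat_gt0 ?(leq_trans m0)//.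
by rewrite sqrt_nat_le.
Qed.

Lemma isq_le1 {R : realType} (n : nat) : isq n <= 1 :> R.
Proof.
case: n => [|n]; first by rewrite isq0.
by apply: (le_trans (isq_le 1 n.+1 _ _)) => //; rewrite /isq sqrtr1 invr1.
Qed.

Lemma isq_sqrt {R : realType} (n : nat) : (0 < n)%N -> isq n * Num.sqrt n%:R = 1 :> R.
Proof. by move=> n0; rewrite /isq mulVf// gt_eqF// sqrt_nat_gt0. Qed.

Lemma isq_sqrt_le1 {R : realType} (n : nat) : isq n * Num.sqrt n%:R <= 1 :> R.
Proof. by case: n => [|n]; [rewrite isq0 mul0r|rewrite isq_sqrt]. Qed.

(** Comparison of a sum with an integral for the inverse square root, in discrete form; the
    difference of the two sides is proportional to [(v - u) ^ 2]. *)
Lemma isq_step {R : realType} (r g : nat) : (g <= r)%N -> (0 < r)%N ->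
  g%:R * isq r <= 2 * (Num.sqrt r%:R - Num.sqrt (r - g)%N%:R) :> R.
Proof.
move=> gr r0; set v := Num.sqrt r%:R; set u := Num.sqrt (r - g)%N%:R.
have v0 : 0 < v by exact: sqrt_nat_gt0.
have u0 : 0 <= u by exact: sqrtr_ge0.
have uv : u <= v by rewrite /u /v sqrt_nat_le ?leq_subr.
have -> : g%:R = v ^+ 2 - u ^+ 2 by rewrite !sqr_sqrtr// natrB// opprB addrC subrK.
rewrite /isq -/v ler_pdivrMr// -subr_ge0.
have -> : 2 * (v - u) * v - (v ^+ 2 - u ^+ 2) = (v - u) ^+ 2 by ring.
exact: sqr_ge0.
Qed.

Lemma sum_isq {R : realType} (K : nat) : \sum_(n < K.+1) isq n <= 2 * Num.sqrt K%:R :> R.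
Proof.
elim: K => [|K IH]; first by rewrite big_ord1 isq0 sqrtr0 mulr0.
rewrite big_ord_recr/=; have := @isq_step R K.+1 1 isT isT.
rewrite subn1/= mul1r => h; move: IH; lra.
Qed.

(** The least positive element of the progression may be as small as 1, whatever the step: it is
    bounded trivially and gives the term [g]. The other elements telescope through [isq_step]. *)
Lemma sum_isq_down {R : realType} (g K m : nat) : (0 < g)%N ->
  g%:R * \sum_(k < K) isq (m - k.+1 * g) <= (g < m)%N%:R * (g%:R + 2 * Num.sqrt (m - g)%N%:R) :> R.
Proof.
move=> g0; have gR : 0 <= g%:R :> R by rewrite ler0n.
elim: K m => [|K IH] m.
  by rewrite big_ord0 mulr0 mulr_ge0// addr_ge0// mulr_ge0// sqrtr_ge0.
rewrite big_ord_recl/= mul1n.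
have -> : \sum_(i < K) isq (m - (bump 0 i).+1 * g) = \sum_(k < K) isq ((m - g) - k.+1 * g) :> R.
  by apply: eq_bigr => i _; rewrite /bump add1n -subnDA -mulSn.
have {}IH := IH (m - g)%N; rewrite mulrDr.
have [mg|mg] := leqP m g.
  move: IH; have -> : (m - g = 0)%N by apply/eqP; rewrite subn_eq0.
  by rewrite isq0 ltn0 mulr0 add0r !mul0r.
rewrite mul1r; set r := (m - g)%N in IH *.
have r0 : (0 < r)%N by rewrite /r subn_gt0.
have s0 : 0 <= Num.sqrt r%:R :> R by exact: sqrtr_ge0.
move: IH; have [gr|rg] := ltnP g r.
  by rewrite mul1r => IH; have := @isq_step R r g (ltnW gr) r0; lra.
by rewrite mul0r => IH; have := ler_wpM2l gR (@isq_le1 R r); lra.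
Qed.

Lemma sum_isq_up {R : realType} (g K n : nat) : (0 < g)%N ->
  g%:R * \sum_(k < K.+1) isq (k * g - n) <=
  (n < K * g)%N%:R * (g%:R + 2 * Num.sqrt (K * g - n)%N%:R) :> R.
Proof.
move=> g0; have gR : 0 <= g%:R :> R by rewrite ler0n.
elim: K => [|K IH].
  by rewrite big_ord1 mul0n sub0n isq0 mulr0 ltn0 mul0r.
rewrite big_ord_recr/= mulrDr; set r := (K.+1 * g - n)%N.
have [rz|nr] := leqP (K.+1 * g) n.
  have -> : r = 0%N by apply/eqP; rewrite subn_eq0.
  rewrite isq0 mulr0 addr0 mul0r; move: IH.
  by rewrite ltnNge (leq_trans _ rz) ?leq_mul2r ?leqnSn ?orbT// mul0r.
have r0 : (0 < r)%N by rewrite subn_gt0.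
have s0 : 0 <= Num.sqrt r%:R :> R by exact: sqrtr_ge0.
rewrite mul1r; move: IH; have [nK|Kn] := ltnP n (K * g).
  have -> : (K * g - n = r - g)%N by rewrite /r mulSn -subnDA (addnC n) subnDl.
  have gr : (g <= r)%N by rewrite /r mulSn -addnBA ?leq_addr// ltnW.
  by rewrite mul1r => IH; have := @isq_step R r g gr r0; lra.
by rewrite mul0r => IH; have := ler_wpM2l gR (@isq_le1 R r); lra.
Qed.

Lemma sum_widen_le {R : realType} (F : nat -> R) (M K : nat) : (forall n, 0 <= F n) -> (M <= K)%N ->
  \sum_(i < M) F i <= \sum_(i < K) F i.
Proof.
move=> F0 MK; rewrite (big_ord_widen _ F MK) big_mkcond/=.
by apply: ler_sum => i _; case: ifP.
Qed.

Lemma sum_trunc_le {R : realType} (F : nat -> R) (M K : nat) : (forall n, 0 <= F n) ->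
  \sum_(i < M) (i < K)%N%:R * F i <= \sum_(i < K) F i.
Proof.
move=> F0; have [MK|KM] := leqP M K.
  apply: le_trans (sum_widen_le F M K F0 MK); apply: ler_sum => i _.
  by case: (_ < _)%N; rewrite ?mul1r ?mul0r.
rewrite (big_ord_widen _ F (ltnW KM)) [leRHS]big_mkcond/=.
by apply: ler_sum => i _; case: (_ < _)%N; rewrite ?mul1r ?mul0r.
Qed.

(* Up to constants, the weight [(b * d) ^ (-1 / 2)] for [d - b = al * ga] and [d + b = be * de]. *)
Definition Uterm {R : realType} (ga de al be : nat) : R :=
  ((0 < al)%N && (be < (2 * ga).+1)%N)%:R * (isq (be * de) * isq (be * de - al * ga)).

Lemma Uterm_ge0 {R : realType} (ga de al be : nat) : 0 <= Uterm ga de al be :> R.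
Proof. by rewrite mulr_ge0// mulr_ge0// isq_ge0. Qed.

(* Sum over [al] first when [ga <= de], over [be] first otherwise: the progression with the
   step [ga], resp. [de], contributes [1 + 2 sqrt m / step]. *)
Lemma sum_Uterm_le {R : realType} (ga de M : nat) : (0 < ga)%N -> (ga <= de)%N ->
  \sum_(al < M) \sum_(be < M) Uterm ga de al be <= 12 :> R.
Proof.
move=> ga0 gd; have de0 := leq_trans ga0 gd.
have gR : 0 < ga%:R :> R by rewrite ltr0n.
have g1 : 1 <= ga%:R :> R by rewrite ler1n.
rewrite exchange_big/=.
have h (be : nat) : \sum_(al < M) Uterm ga de al be <=
    (be < (2 * ga).+1)%N%:R * (isq be * isq de + 2 / ga%:R) :> R.
  rewrite /Uterm; set m := (be * de)%N.
  case: (_ < _)%N; last by rewrite big1 ?mul0r// => al _; rewrite andbF mul0r.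
  rewrite mul1r; under eq_bigr do rewrite andbT.
  have -> : \sum_(al < M) (0 < al)%N%:R * (isq m * isq (m - al * ga)) =
     isq m * \sum_(al < M) (0 < al)%N%:R * isq (m - al * ga) :> R.
    by rewrite mulr_sumr; apply: eq_bigr => al _; rewrite mulrCA.
  have S : ga%:R * \sum_(al < M) (0 < al)%N%:R * isq (m - al * ga) <= ga%:R + 2 * Num.sqrt m%:R :> R.
    case: M => [|M]; first by rewrite big_ord0 mulr0 addr_ge0 ?mulr_ge0 ?sqrtr_ge0 ?(ltW gR).
    rewrite big_ord_recl/= mul0r add0r; under eq_bigr do rewrite mul1r.
    apply: le_trans (sum_isq_down ga M m ga0) _.
    have sm : Num.sqrt (m - ga)%N%:R <= Num.sqrt m%:R :> R by rewrite sqrt_nat_le ?leq_subr.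
    have s0 : 0 <= Num.sqrt (m - ga)%N%:R :> R by exact: sqrtr_ge0.
    by case: (_ < _)%N; rewrite ?mul1r ?mul0r; lra.
  rewrite -isqM -/m -(ler_pM2l gR).
  have -> : ga%:R * (isq m + 2 / ga%:R) = ga%:R * isq m + 2 :> R by field; rewrite gt_eqF.
  rewrite mulrCA; have := ler_wpM2l (@isq_ge0 R m) S; have := @isq_sqrt_le1 R m; lra.
apply: (@le_trans _ _ (\sum_(be < M) (be < (2 * ga).+1)%N%:R * (isq be * isq de + 2 / ga%:R))).
  by apply: ler_sum => be _; exact: h.
have ig0 : 0 <= 2 / ga%:R :> R by rewrite divr_ge0// ltW.
apply: le_trans (sum_trunc_le (fun be => isq be * isq de + 2 / ga%:R) M _ _) _.
  by move=> n; rewrite addr_ge0// mulr_ge0// isq_ge0.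
rewrite big_split/= -mulr_suml sumr_const card_ord -[X in _ + X]mulr_natr.
have s1 := ler_wpM2r (@isq_ge0 R de) (@sum_isq R (2 * ga)).
have s2 : Num.sqrt (2 * ga)%N%:R <= 2 * Num.sqrt de%:R :> R.
  have -> : 2 * Num.sqrt de%:R = Num.sqrt (4 * de)%N%:R :> R.
    rewrite natrM sqrtrM// (_ : 4%:R = 2 ^+ 2) ?sqrtr_sqr ?ger0_norm//; ring.
  by rewrite sqrt_nat_le ?leq_mul.
have s3 := ler_wpM2r (@isq_ge0 R de) s2.
have s4 := @isq_sqrt R de de0.
have s5 : 2 / ga%:R * (2 * ga).+1%:R <= 6 :> R.
  rewrite mulrAC ler_pdivrMr// -(natr1 (2 * ga)%N) natrM; lra.
lra.
Qed.

Lemma sum_Uterm_ge {R : realType} (ga de M : nat) : (0 < de)%N -> (de <= ga)%N ->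
  \sum_(al < M) \sum_(be < M) Uterm ga de al be <= 12 :> R.
Proof.
move=> de0 dg; have ga0 := leq_trans de0 dg.
have dR : 0 < de%:R :> R by rewrite ltr0n.
have h (al : nat) : \sum_(be < M) Uterm ga de al be <=
    (al < (2 * de).+1)%N%:R * (isq al * isq ga * (1 + 2 / de%:R * Num.sqrt (2 * ga * de)%N%:R)) :> R.
  (* Since [be <= 2 * ga], any [al > 2 * de] makes [be * de - al * ga] truncate to 0, where [isq]
     vanishes. This is what makes the range of [al] finite independently of [M]. *)
  have [al2|al2] := ltnP al (2 * de).+1; last first.
    rewrite mul0r big1// => be _; rewrite /Uterm; case: andP => [[_ b2]|_]; last by rewrite mul0r.
    rewrite (_ : (be * de - al * ga)%N = 0%N) ?isq0 ?mulr0//.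
    apply/eqP; rewrite subn_eq0; apply: (@leq_trans (2 * ga * de)); first by rewrite leq_mul2r -ltnS b2 orbT.
    by rewrite mulnAC leq_mul2r ltnW ?orbT.
  rewrite mul1r -isqM; set m := (al * ga)%N.
  apply: (@le_trans _ _ (isq m * \sum_(be < M) (be < (2 * ga).+1)%N%:R * isq (be * de - m))).
    rewrite mulr_sumr; apply: ler_sum => be _; rewrite /Uterm -/m.
    case: (_ < (_).+1)%N; last by rewrite andbF !mul0r mulr0.
    rewrite andbT mul1r; case: posnP => [_|al0]; first by rewrite mul0r mulr_ge0// isq_ge0.
    rewrite mul1r; have [le|lt] := leqP (be * de) m.
      by rewrite (_ : (be * de - m)%N = 0%N) ?isq0 ?mulr0//; apply/eqP; rewrite subn_eq0.
    apply: ler_wpM2r; first exact: isq_ge0.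
    by apply: isq_le; [rewrite muln_gt0 al0|exact: ltnW].
  apply: ler_wpM2l; first exact: isq_ge0.
  apply: le_trans (sum_trunc_le (fun be => isq (be * de - m)) M _ (fun=> isq_ge0 _)) _.
  have := @sum_isq_up R de (2 * ga) m de0.
  have sm : Num.sqrt (2 * ga * de - m)%N%:R <= Num.sqrt (2 * ga * de)%N%:R :> R by rewrite sqrt_nat_le ?leq_subr.
  have s0 : 0 <= Num.sqrt (2 * ga * de - m)%N%:R :> R by exact: sqrtr_ge0.
  move=> u; rewrite -(ler_pM2l dR); apply: le_trans u _.
  have -> : de%:R * (1 + 2 / de%:R * Num.sqrt (2 * ga * de)%N%:R) = de%:R + 2 * Num.sqrt (2 * ga * de)%N%:R :> R.
    by field; rewrite gt_eqF.
  by case: (_ < _)%N; rewrite ?mul1r ?mul0r; lra.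
set Z := 1 + 2 / de%:R * Num.sqrt (2 * ga * de)%N%:R in h.
have Z0 : 0 <= Z by rewrite addr_ge0// mulr_ge0 ?sqrtr_ge0// divr_ge0// ltW.
apply: (@le_trans _ _ (\sum_(al < M) (al < (2 * de).+1)%N%:R * (isq al * isq ga * Z))).
  by apply: ler_sum => al _; exact: h.
apply: le_trans (sum_trunc_le (fun al => isq al * isq ga * Z) M _ _) _.
  by move=> n; rewrite mulr_ge0// mulr_ge0// isq_ge0.
rewrite -!mulr_suml.
have s1 := ler_wpM2r (mulr_ge0 (@isq_ge0 R ga) Z0) (@sum_isq R (2 * de)).
rewrite -mulrA; apply: le_trans s1 _.
have a0 := @isq_ge0 R ga.
have s4 := @isq_sqrt R ga ga0.
have s2 : Num.sqrt (2 * de)%N%:R <= 2 * Num.sqrt ga%:R :> R.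
  have -> : 2 * Num.sqrt ga%:R = Num.sqrt (4 * ga)%N%:R :> R.
    rewrite natrM sqrtrM// (_ : 4%:R = 2 ^+ 2) ?sqrtr_sqr ?ger0_norm//; ring.
  by rewrite sqrt_nat_le ?leq_mul.
have s3 : Num.sqrt (2 * de)%N%:R * Num.sqrt (2 * ga * de)%N%:R = 2 * de%:R * Num.sqrt ga%:R :> R.
  rewrite -sqrtrM// -natrM (_ : (2 * de * (2 * ga * de) = (2 * de) ^ 2 * ga)%N); last by ring.
  by rewrite natrM sqrtrM// natrX sqrtr_sqr ger0_norm// natrM.
have -> : 2 * Num.sqrt (2 * de)%N%:R * (isq ga * Z) = 2 * (isq ga * Num.sqrt (2 * de)%N%:R) +
   4 * (isq ga * (Num.sqrt (2 * de)%N%:R * Num.sqrt (2 * ga * de)%N%:R) / de%:R).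
  by rewrite /Z; field; rewrite gt_eqF.
rewrite s3.
have -> : isq ga * (2 * de%:R * Num.sqrt ga%:R) / de%:R = 2 * (isq ga * Num.sqrt ga%:R) :> R.
  by field; rewrite gt_eqF.
have := ler_wpM2l a0 s2; rewrite mulrCA s4; lra.
Qed.

Lemma harmonic_le {R : realType} (k : nat) : \sum_(n < 2 ^ k) n%:R^-1 <= k%:R :> R.
Proof.
rewrite (sum_dyadic_blocks (fun n => n%:R^-1)) invr0 add0r.
rewrite -[X in _ <= X%:R](card_ord k) -sumr_const; apply: ler_sum => i _.
have i0 : 0 < (2 ^ i)%N%:R :> R by rewrite ltr0n expn_gt0.
apply: (@le_trans _ _ (\sum_(m < 2 ^ i) (2 ^ i)%N%:R^-1)).
  apply: ler_sum => m _.
  have m0 : 0 < (2 ^ i + m)%N%:R :> R by rewrite ltr0n addn_gt0 expn_gt0.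
  by rewrite lef_pV2 ?posrE// ler_nat leq_addr.
by rewrite sumr_const card_ord -[leLHS]mulr_natr mulVf// gt_eqF.
Qed.

(** Quadruples are grouped as pairs of pairs, as they come out of [Int_GT] for the squared sum. *)
Definition sum4 {R : realType} (N : nat) (F : nat -> nat -> nat -> nat -> R) : R :=
  \sum_(i : 'I_N * 'I_N) \sum_(j : 'I_N * 'I_N) F i.1 i.2 j.1 j.2.

Lemma sum4_swap12 {R : realType} (N : nat) (F : nat -> nat -> nat -> nat -> R) :
  sum4 N (fun a b c d => F b a c d) = sum4 N F.
Proof.
rewrite /sum4 [RHS](reindex_inj (h := fun i : 'I_N * 'I_N => (i.2, i.1)))//=.
by move=> [a b] [c d] /= [-> ->].
Qed.

Lemma sum4_swap34 {R : realType} (N : nat) (F : nat -> nat -> nat -> nat -> R) :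
  sum4 N (fun a b c d => F a b d c) = sum4 N F.
Proof.
apply: eq_bigr => i _; rewrite [RHS](reindex_inj (h := fun i : 'I_N * 'I_N => (i.2, i.1)))//=.
by move=> [a b] [c d] /= [-> ->].
Qed.

Lemma sum4_swap {R : realType} (N : nat) (F : nat -> nat -> nat -> nat -> R) :
  sum4 N (fun a b c d => F c d a b) = sum4 N F.
Proof. by rewrite /sum4 exchange_big. Qed.

Lemma sum4_le {R : realType} (N : nat) (F G : nat -> nat -> nat -> nat -> R) :
  (forall a b c d, F a b c d <= G a b c d) -> sum4 N F <= sum4 N G.
Proof. by move=> h; apply: ler_sum => i _; apply: ler_sum => j _. Qed.

Lemma sum4D {R : realType} (N : nat) (F G : nat -> nat -> nat -> nat -> R) :
  sum4 N (fun a b c d => F a b c d + G a b c d) = sum4 N F + sum4 N G.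
Proof. by rewrite /sum4 -big_split; apply: eq_bigr => i _; rewrite -big_split. Qed.

(* The 8 symmetries of the equation allow to assume [b <= d <= c <= a]. *)
Lemma sum4_order {R : realType} (N : nat) (F : nat -> nat -> nat -> nat -> R) :
  (forall a b c d, 0 <= F a b c d) -> (forall a b c d, F b a c d = F a b c d) ->
  (forall a b c d, F a b d c = F a b c d) -> (forall a b c d, F c d a b = F a b c d) ->
  sum4 N F <= 8 * sum4 N (fun a b c d => ((b <= a) && (d <= c) && (c <= a))%N%:R * F a b c d).
Proof.
move=> F0 F12 F34 Fs.
pose F1 a b c d := (b <= a)%N%:R * F a b c d.
pose F2 a b c d := (d <= c)%N%:R * F1 a b c d.
pose F3 a b c d := (c <= a)%N%:R * F2 a b c d.
have F10 a b c d : 0 <= F1 a b c d by rewrite mulr_ge0.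
have F20 a b c d : 0 <= F2 a b c d by rewrite mulr_ge0.
have h1 : sum4 N F <= 2 * sum4 N F1.
  have -> : 2 * sum4 N F1 = sum4 N F1 + sum4 N (fun a b c d => F1 b a c d).
    by rewrite sum4_swap12; ring.
  rewrite -sum4D; apply: sum4_le => a b c d; rewrite /F1 F12 -mulrDl ler_peMl//.
  by have /orP[->|->] := leq_total a b; rewrite ?lerDl ?lerDr.
have h2 : sum4 N F1 <= 2 * sum4 N F2.
  have -> : 2 * sum4 N F2 = sum4 N F2 + sum4 N (fun a b c d => F2 a b d c).
    by rewrite sum4_swap34; ring.
  rewrite -sum4D; apply: sum4_le => a b c d.
  have -> : F2 a b d c = (c <= d)%N%:R * F1 a b c d by rewrite /F2 /F1 F34.
  rewrite /F2 -mulrDl ler_peMl//.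
  by have /orP[->|->] := leq_total c d; rewrite ?lerDl ?lerDr.
have h3 : sum4 N F2 <= 2 * sum4 N F3.
  have -> : 2 * sum4 N F3 = sum4 N F3 + sum4 N (fun a b c d => F3 c d a b).
    by rewrite sum4_swap; ring.
  rewrite -sum4D; apply: sum4_le => a b c d.
  have -> : F3 c d a b = (a <= c)%N%:R * F2 a b c d by rewrite /F3 /F2 /F1 Fs [(b <= a)%N%:R * _]mulrCA.
  rewrite /F3 -mulrDl ler_peMl//.
  by have /orP[->|->] := leq_total a c; rewrite ?lerDl ?lerDr.
have -> : sum4 N (fun a b c d => ((b <= a) && (d <= c) && (c <= a))%N%:R * F a b c d) = sum4 N F3.
  apply: eq_bigr => i _; apply: eq_bigr => j _; rewrite /F3 /F2 /F1.
  by case: (_ <= _)%N; case: (_ <= _)%N; case: (_ <= _)%N; rewrite ?mul1r ?mul0r ?mulr0.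
lra.
Qed.

Lemma quad_factor (a b c d : nat) : (a ^ 2 + b ^ 2 = c ^ 2 + d ^ 2)%N ->
  (0 < b)%N -> (b < d)%N -> (d <= c)%N -> (c <= a)%N ->
  let ga := gcdn (a + c) (d - b) in let de := ((a + c) %/ ga)%N in
  let al := ((d - b) %/ ga)%N in let be := ((d + b) %/ de)%N in
  [/\ (a + c = ga * de)%N, (d - b = al * ga)%N, (d + b = be * de)%N, (a - c = al * be)%N &
      [/\ (0 < ga)%N, (0 < de)%N, (0 < al)%N & (be <= 2 * ga)%N]].
Proof.
move=> E b0 bd dc ca ga de al be.
have y0 : (0 < a + c)%N by rewrite addn_gt0 orbC (leq_trans _ dc)// (leq_trans _ bd).
have z0 : (0 < d - b)%N by rewrite subn_gt0.
have ga0 : (0 < ga)%N by rewrite gcdn_gt0 y0.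
have yE : (a + c = ga * de)%N by rewrite mulnC divnK// dvdn_gcdl.
have zE : (d - b = al * ga)%N by rewrite divnK// dvdn_gcdr.
have de0 : (0 < de)%N by move: y0; rewrite yE muln_gt0 => /andP[].
have al0 : (0 < al)%N by move: z0; rewrite zE muln_gt0 => /andP[].
have xy : ((a - c) * (a + c) = (d - b) * (d + b))%N.
  rewrite -!subn_sqr; apply/eqP; rewrite -(eqn_add2r (c ^ 2 + b ^ 2)) addnA subnK; last by rewrite leq_exp2r.
  by rewrite (addnC (c ^ 2)%N) addnA subnK ?leq_exp2r ?(ltnW bd)// E addnC.
have xd : ((a - c) * de = al * (d + b))%N.
  apply/eqP; rewrite -(eqn_pmul2r ga0); apply/eqP.
  by rewrite -mulnA (mulnC de) -yE xy zE mulnAC.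
have cop : coprime de al.
  have g1 : (gcdn (ga * de) (ga * al) = ga * 1)%N by rewrite muln1 (mulnC ga al) -yE -zE.
  by rewrite /coprime -(eqn_pmul2l ga0) muln_gcdr g1.
have dt : (de %| d + b)%N by rewrite -(Gauss_dvdr _ cop) -xd dvdn_mull.
have tE : (d + b = be * de)%N by rewrite divnK.
have xE : (a - c = al * be)%N.
  by apply/eqP; rewrite -(eqn_pmul2r de0) xd tE mulnA.
split=> //; split=> //.
rewrite -(leq_pmul2r de0) -tE -mulnA -yE; clear -bd dc ca; lia.
Qed.

Definition Wprod {R : realType} (a b c d : nat) : R := isq a * isq b * (isq c * isq d).

(** From [a ^ 2 <= c ^ 2 + d ^ 2 <= 2 * c ^ 2] the numbers [a] and [c] are comparable with their
    sum, and [d + b <= 2 * d]. The weight is thus expressed by [a + c], [d + b] and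
    [2 * b = (d + b) - (d - b)], all known from the parameters. *)
Lemma Wprod_le {R : realType} (a b c d : nat) : (a ^ 2 + b ^ 2 = c ^ 2 + d ^ 2)%N ->
  (0 < b)%N -> (b < d)%N -> (d <= c)%N -> (c <= a)%N ->
  Wprod a b c d <= 6 * ((a + c)%N%:R^-1 * (isq (d + b) * isq ((d + b) - (d - b)))) :> R.
Proof.
move=> E b0 bd dc ca; have c0 : (0 < c)%N by lia.
have e : ((d + b) - (d - b) = 2 * b)%N by lia.
have h1 : isq a * isq c <= 3 * (a + c)%N%:R^-1 :> R.
  have n : ((a + c) * (a + c) <= 9 * (a * c))%N by nia.
  have p : (0 < (a + c) * (a + c))%N by rewrite muln_gt0; lia.
  have := isq_le (R := R) _ _ p n; rewrite !isqM isq_sqr.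
  have -> : isq 9 = 3^-1 :> R.
    by rewrite /isq (_ : 9%:R = 3 ^+ 2) ?sqrtr_sqr ?ger0_norm//; ring.
  lra.
have h2 : isq b * isq d <= 2 * (isq (d + b) * isq (2 * b)) :> R.
  have n : ((d + b) * (2 * b) <= 4 * (b * d))%N by nia.
  have p : (0 < (d + b) * (2 * b))%N by rewrite muln_gt0; lia.
  have := isq_le (R := R) _ _ p n; rewrite !isqM.
  have -> : isq 4 = 2^-1 :> R.
    by rewrite /isq (_ : 4%:R = 2 ^+ 2) ?sqrtr_sqr ?ger0_norm//; ring.
  lra.
rewrite e; have -> : Wprod a b c d = (isq a * isq c) * (isq b * isq d) :> R by rewrite /Wprod; ring.
set u := isq (d + b) * _ in h2 *; set v := _^-1 in h1 *.
have -> : 6 * (v * u) = (3 * v) * (2 * u) by ring.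
by apply: ler_pM => //; rewrite mulr_ge0// isq_ge0.
Qed.

Lemma sum_inj_le {R : realType} (T U : finType) (P : pred T) (f : T -> U) (F : T -> R) (G : U -> R) :
  (forall u, 0 <= G u) -> {in P &, injective f} -> (forall x, P x -> F x <= G (f x)) ->
  \sum_(x | P x) F x <= \sum_u G u.
Proof.
move=> G0 inj FG; pose A := [set x | P x]%SET.
have e : \sum_(x | P x) F x = \sum_(x in A) F x by apply: eq_bigl => x; rewrite inE.
rewrite e; apply: (@le_trans _ _ (\sum_(x in A) G (f x))).
  by apply: ler_sum => x; rewrite inE; exact: FG.
rewrite -(big_imset (h := f) G)/=; last first.
  by move=> x y; rewrite !inE => Px Py; exact: inj.
by rewrite big_mkcond/=; apply: ler_sum => u _; case: ifP.
Qed.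

Definition offdiag (a b c d : nat) : bool :=
  [&& (a ^ 2 + b ^ 2 == c ^ 2 + d ^ 2)%N, (0 < b)%N, (b < d)%N, (d <= c)%N & (c <= a)%N].

(** Each parameter is at most one of [a + c], [d - b], [d + b], hence below [(2 * N).+1], and
    [inord] does not alter it. *)
Definition par (N : nat) (a b c d : nat) : ('I_(2 * N).+1 * 'I_(2 * N).+1) * ('I_(2 * N).+1 * 'I_(2 * N).+1) :=
  let ga := gcdn (a + c) (d - b) in let de := ((a + c) %/ ga)%N in
  let al := ((d - b) %/ ga)%N in let be := ((d + b) %/ de)%N in
  ((inord ga, inord de), (inord al, inord be)).

Lemma parE (N a b c d : nat) q : offdiag a b c d -> (a < N)%N -> par N a b c d = q ->
  [/\ (a + c = q.1.1 * q.1.2)%N, (d - b = q.2.1 * q.1.1)%N, (d + b = q.2.2 * q.1.2)%N, (a - c = q.2.1 * q.2.2)%N &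
      [/\ (0 < q.1.1)%N, (0 < q.1.2)%N, (0 < q.2.1)%N & (q.2.2 <= 2 * q.1.1)%N]].
Proof.
case/and5P => /eqP E b0 bd dc ca aN <- /=.
have := quad_factor a b c d E b0 bd dc ca.
set ga := gcdn _ _; set de := (_ %/ ga)%N; set al := ((d - b) %/ ga)%N; set be := (_ %/ de)%N.
move=> [h1 h2 h3 h4 [h5 h6 h7 h8]].
have y : (a + c < (2 * N).+1)%N by clear -ca aN; lia.
have t : (d + b < (2 * N).+1)%N by clear -bd dc ca aN; lia.
have z : (d - b < (2 * N).+1)%N by clear -dc ca aN; lia.
rewrite !inordK//.
- by apply: leq_ltn_trans t; rewrite h3 leq_pmulr.
- by apply: leq_ltn_trans z; rewrite h2 leq_pmulr.
- by apply: leq_ltn_trans y; rewrite h1 leq_pmull.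
- by apply: leq_ltn_trans y; rewrite h1 leq_pmulr.
Qed.

Lemma sum_diff_inj (a c a' c' : nat) : (c <= a)%N -> (c' <= a')%N -> (a + c = a' + c')%N ->
  (a - c = a' - c')%N -> a = a' /\ c = c'.
Proof. by move=> h1 h2 h3 h4; split; lia. Qed.

(** The four parameters determine the sums and differences, hence the quadruple. Once [al] and [be]
    are summed out, only [1 / (ga * de)] remains, with constant [72 = 6 * 12]: two harmonic sums,
    each at most [K + 2] because [2 * N < 2 ^ K.+2]. *)
Lemma sum_offdiag_le {R : realType} (K : nat) :
  sum4 (2 ^ K) (fun a b c d => (offdiag a b c d)%:R * Wprod a b c d) <= 72 * K.+2%:R ^+ 2 :> R.
Proof.
set N := (2 ^ K)%N; pose I := ('I_N * 'I_N)%type; pose J := 'I_(2 * N).+1.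
pose G (q : (J * J) * (J * J)) : R :=
  6 * (q.1.1%:R^-1 * q.1.2%:R^-1) * Uterm q.1.1 q.1.2 q.2.1 q.2.2.
have G0 q : 0 <= G q by rewrite /G !mulr_ge0// ?invr_ge0// Uterm_ge0.
pose P (p : I * I) := offdiag p.1.1 p.1.2 p.2.1 p.2.2.
pose f (p : I * I) := par N p.1.1 p.1.2 p.2.1 p.2.2.
have inj : {in P &, injective f}.
  move=> [[a b] [c d]] [[a' b'] [c' d']].
  change (offdiag a b c d -> offdiag a' b' c' d' -> par N a b c d = par N a' b' c' d' ->
    ((a, b), (c, d)) = ((a', b'), (c', d'))) => h h' e.
  have := parE N a b c d _ h (ltn_ord a) e; have := parE N a' b' c' d' _ h' (ltn_ord a') erefl.
  move=> -[h1 h2 h3 h4 _] [g1 g2 g3 g4 _].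
  move: h h'; rewrite /offdiag => /and5P[_ _ bd _ ca] /and5P[_ _ bd' _ ca'].
  have e1 : (a + c = a' + c')%N by rewrite h1 g1.
  have e2 : (a - c = a' - c')%N by rewrite h4 g4.
  have e3 : (d + b = d' + b')%N by rewrite h3 g3.
  have e4 : (d - b = d' - b')%N by rewrite h2 g2.
  have [ea ec] := sum_diff_inj _ _ _ _ ca ca' e1 e2.
  have [ed eb] := sum_diff_inj _ _ _ _ (ltnW bd) (ltnW bd') e3 e4.
  by rewrite (val_inj ea) (val_inj eb) (val_inj ec) (val_inj ed).
have FG p : P p -> Wprod p.1.1 p.1.2 p.2.1 p.2.2 <= G (f p).
  case: p => [[a b] [c d]]; rewrite /P /f/= => h.
  move: (parE N a b c d _ h (ltn_ord a) erefl); move: (par N a b c d) => q [h1 h2 h3 h4 [h5 h6 h7 h8]].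
  move: h; rewrite /offdiag => /and5P[/eqP E b0 bd dc ca].
  apply: le_trans (Wprod_le a b c d E b0 bd dc ca) _; rewrite /G /Uterm.
  by rewrite h7 ltnS h8 /= mul1r h1 h2 h3 natrM invfM -!mulrA lexx.
have -> : sum4 N (fun a b c d => (offdiag a b c d)%:R * Wprod a b c d) =
    \sum_(p : I * I | P p) Wprod p.1.1 p.1.2 p.2.1 p.2.2 :> R.
  rewrite /sum4 pair_big/= [RHS]big_mkcond/=; apply: eq_bigr => p _.
  by rewrite /P; case: (offdiag _ _ _ _); rewrite ?mul1r ?mul0r.
apply: le_trans (sum_inj_le _ _ P f _ G G0 inj FG) _.
have -> : \sum_u G u = \sum_(i : J * J) 6 * (i.1%:R^-1 * i.2%:R^-1) * \sum_(al : J) \sum_(be : J) Uterm i.1 i.2 al be.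
  rewrite -(pair_big xpredT xpredT (fun i j => G (i, j)))/=; apply: eq_bigr => i _.
  by rewrite pair_big/= mulr_sumr.
apply: (@le_trans _ _ (\sum_(i : J * J) 72 * (i.1%:R^-1 * i.2%:R^-1))).
  apply: ler_sum => -[ga de] _ /=.
  have i0 : 0 <= ga%:R^-1 * de%:R^-1 :> R by rewrite mulr_ge0// invr_ge0.
  case: (posnP ga) => [->|ga0]; first by rewrite invr0 !mul0r !mulr0 mul0r.
  case: (posnP de) => [->|de0]; first by rewrite invr0 !mulr0 mul0r.
  have U : \sum_(al : J) \sum_(be : J) Uterm ga de al be <= 12 :> R.
    by have /orP[h|h] := leq_total ga de; [exact: sum_Uterm_le|exact: sum_Uterm_ge].
  by have := ler_wpM2l i0 U; lra.
rewrite -mulr_sumr; apply: ler_wpM2l; first lra.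
rewrite -(pair_big xpredT xpredT (fun i j : J => i%:R^-1 * j%:R^-1 : R))/=.
have H : \sum_(i : J) i%:R^-1 <= K.+2%:R :> R.
  apply: le_trans (harmonic_le K.+2); apply: (sum_widen_le (fun n => n%:R^-1)) => [n|]; first by rewrite invr_ge0.
  have N0 : (0 < N)%N by rewrite expn_gt0.
  by rewrite !expnS -/N mulnA ltn_pmul2r.
have H0 : 0 <= \sum_(i : J) i%:R^-1 :> R by apply: sumr_ge0 => i _; rewrite invr_ge0.
under eq_bigr do rewrite -mulr_sumr.
by rewrite -mulr_suml expr2; apply: ler_pM.
Qed.

(** The trivial solutions contribute the product of two harmonic sums, of the same order as the
    others. The 8 orderings give [600 = 8 * (3 + 72)]. *)
Lemma quad_sum_le {R : realType} (K : nat) :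
  sum4 (2 ^ K) (fun a b c d => (a ^ 2 + b ^ 2 == c ^ 2 + d ^ 2)%N%:R * Wprod a b c d) <= 600 * K.+2%:R ^+ 2 :> R.
Proof.
set N := (2 ^ K)%N.
have W0 a b c d : 0 <= Wprod a b c d :> R by rewrite /Wprod !mulr_ge0// isq_ge0.
have := sum4_order (R := R) N (fun a b c d => (a ^ 2 + b ^ 2 == c ^ 2 + d ^ 2)%N%:R * Wprod a b c d).
move=> h; apply: le_trans (h _ _ _ _) _ => [a b c d|a b c d|a b c d|a b c d|].
- by rewrite mulr_ge0.
- by rewrite addnC /Wprod (mulrC (isq b)).
- by rewrite [(d ^ 2 + _)%N]addnC /Wprod (mulrC (isq d)).
- by rewrite eq_sym /Wprod [X in _ * X]mulrC.
have -> : 600 * K.+2%:R ^+ 2 = 8 * (3 * K.+2%:R ^+ 2 + 72 * K.+2%:R ^+ 2) :> R by ring.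
apply: ler_wpM2l; first lra.
apply: (@le_trans _ _ (sum4 N (fun a b c d => ((a == c) && (b == d))%:R * (a%:R^-1 * b%:R^-1)) +
   sum4 N (fun a b c d => (offdiag a b c d)%:R * Wprod a b c d))).
  rewrite -sum4D; apply: sum4_le => a b c d.
  have D0 : 0 <= ((a == c) && (b == d))%:R * (a%:R^-1 * b%:R^-1) :> R.
    by rewrite !mulr_ge0// invr_ge0.
  have O0 : 0 <= (offdiag a b c d)%:R * Wprod a b c d :> R by rewrite mulr_ge0.
  case: (boolP [&& b <= a, d <= c & c <= a])%N; last first.
    by rewrite andbA => /negbTE ->; rewrite mul0r addr_ge0.
  case/and3P => ba dc ca; rewrite ba dc ca mul1r.
  have [E|] := eqVneq; last by rewrite mul0r addr_ge0.
  rewrite mul1r; case: (posnP b) => [b0|b0].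
    by rewrite /Wprod b0 isq0 mulr0 mul0r -b0 addr_ge0.
  have [bd|db] := ltnP b d.
    by rewrite /offdiag E eqxx b0 bd dc ca mul1r lerDr.
  (* With [d <= b] and [c <= a] the equation leaves only the trivial solution. *)
  have bdE : b = d by nia.
  have acE : a = c by nia.
  rewrite bdE acE !eqxx mul1r -!isq_sqr -lerBlDl.
  rewrite (_ : Wprod c d c d - _ = 0); last by rewrite /Wprod; ring.
  by rewrite mulr_ge0.
apply: lerD; last exact: sum_offdiag_le.
have -> : sum4 N (fun a b c d => ((a == c) && (b == d))%:R * (a%:R^-1 * b%:R^-1)) =
   \sum_(i : 'I_N * 'I_N) i.1%:R^-1 * i.2%:R^-1 :> R.
  apply: eq_bigr => i _; rewrite (bigD1 i)//= !eqxx mul1r big1 ?addr0// => j ji.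
  case: andP => [[/eqP e1 /eqP e2]|_]; last by rewrite mul0r.
  by case/eqP: ji; case: i j e1 e2 => [a b] [c d] /= /val_inj -> /val_inj ->.
rewrite -(pair_big xpredT xpredT (fun i j : 'I_N => i%:R^-1 * j%:R^-1 : R))/=.
have H := @harmonic_le R K.
have H0 : 0 <= \sum_(i < N) i%:R^-1 :> R by apply: sumr_ge0 => i _; rewrite invr_ge0.
under eq_bigr do rewrite -mulr_sumr.
rewrite -mulr_suml.
have HK : \sum_(i < N) i%:R^-1 <= K.+2%:R :> R by apply: le_trans H _; rewrite ler_nat; lia.
have := ler_pM H0 H0 HK HK; have := sqr_ge0 (K.+2%:R : R); rewrite expr2; lra.
Qed.

(** * The fourth moment at [s = 5/4] *)

Lemma T2_sqr {R : realType} (c : nat -> R) (L : nat) (x : R) : T2 c L x ^+ 2 =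
  GT ('I_L * 'I_L)%type (fun i => c i.1 * c i.2) (fun i => i.1 ^ 2 + i.2 ^ 2)%N x.
Proof. by rewrite (GT_sqr 'I_L (fun n => c n) (fun n => n ^ 2)%N). Qed.

Lemma Int_T2_sqr {R : realType} (c : nat -> R) (L : nat) :
  Int (fun x => T2 c L x ^+ 2) =
  sum4 L (fun a b d e => (a ^ 2 + b ^ 2 == d ^ 2 + e ^ 2)%N%:R * (c a * c b * (c d * c e))).
Proof.
under [X in Int X]eq_fun do rewrite T2_sqr.
rewrite Int_GT; apply: eq_bigr => i _; apply: eq_bigr => j _.
by rewrite mulrC.
Qed.

Lemma Ig_T2_sqr {R : realType} (c : nat -> R) (L : nat) :
  Ig (fun x => T2 c L x `^ 2)%R =
  (sum4 L (fun a b d e => (a ^ 2 + b ^ 2 == d ^ 2 + e ^ 2)%N%:R * (c a * c b * (c d * c e))))%:E.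
Proof.
under [X in Ig X]eq_fun do rewrite (powR_mulrn 2 (T2_ge0 _ _ _)).
rewrite -Int_T2_sqr Int_Ig//; under eq_fun do rewrite T2_sqr; exact: continuous_GT.
Qed.

Lemma powR_half_isq {R : realType} (n : nat) : n%:R `^ (- (5 / 2)) * (n ^ 2)%:R = isq n :> R.
Proof.
case: n => [|n]; first by rewrite isq0 mulr0.
have n0 : 0 < n.+1%:R :> R by rewrite ltr0n.
rewrite natrX -(powR_mulrn 2 (ltW n0)) -powRD; last by rewrite (gt_eqF n0) implybT.
by rewrite /isq -powR12_sqrt ?(ltW n0)// -powRN; congr (_ `^ _); field.
Qed.

(** The sine is at most [4 * n ^ 2 * l], and [n ^ (- 5 / 2) * n ^ 2 = n ^ (- 1 / 2)]: the
    coefficients become the weights of the counting problem. *)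
Lemma dcoef_abs_le {R : realType} (s l : R) (K n : nat) : s = 5 / 4 -> 0 < l ->
  `|dcoef l (vcoef s K) n| <= 4 * l * isq n.
Proof.
move=> s54 l0; have /andP[v0 v1] := vcoef_bounds s K n.
rewrite /dcoef normrM (ger0_norm v0).
have n0 : 0 <= (n ^ 2)%:R * l by rewrite mulr_ge0 ?ler0n// ltW.
have h : `|sin (pi * (n ^ 2)%:R * l)| <= 4 * ((n ^ 2)%:R * l).
  apply: le_trans (abs_sin_le _) _; rewrite -mulrA normrM (ger0_norm n0) ger0_norm; last exact: ltW (pi_gt0 _).
  by apply: ler_wpM2r => //; exact: pi_le4.
apply: le_trans (ler_pM v0 (normr_ge0 _) v1 h) _.
rewrite -(powR_half_isq n) /rcoef (_ : 2 * s = 5 / 2); last by rewrite s54; field.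
by rewrite le_eqVlt; apply/orP; left; apply/eqP; ring.
Qed.

Lemma SV4_low {R : realType} (s l : R) (K : nat) : s = 5 / 4 -> 0 < l < 1 ->
  (SV s K 4 l <= (16 * 256 * 600 * (l `^ 4 * K.+2%:R ^+ 2))%R%:E)%E.
Proof.
move=> s54 /andP[l0 l1].
have l01 : 0 <= l <= 1 by rewrite !ltW.
rewrite (SV_T2 s 4 l K l01) (_ : 4 / 2 = 2); last by field.
rewrite Ig_T2_sqr -EFinM lee_fin (powR_mulrn 4 (ler0n _ 2)) (powR_mulrn 4 (ltW l0)).
set c := dcoef l (vcoef s K).
have h : sum4 (2 ^ K) (fun a b d e => (a ^ 2 + b ^ 2 == d ^ 2 + e ^ 2)%N%:R * (c a * c b * (c d * c e))) <=
   (4 * l) ^+ 4 * sum4 (2 ^ K) (fun a b d e => (a ^ 2 + b ^ 2 == d ^ 2 + e ^ 2)%N%:R * Wprod a b d e).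
  rewrite /sum4 mulr_sumr; apply: ler_sum => i _; rewrite mulr_sumr; apply: ler_sum => j _.
  rewrite [leRHS]mulrCA; apply: ler_wpM2l => //.
  have ca n := dcoef_abs_le s l K n s54 l0.
  apply: le_trans (ler_norm _) _; rewrite (normrM (c i.1 * c i.2)) (normrM (c i.1)) (normrM (c j.1)).
  have -> : (4 * l) ^+ 4 * Wprod i.1 i.2 j.1 j.2 = (4 * l * isq i.1) * (4 * l * isq i.2) * ((4 * l * isq j.1) * (4 * l * isq j.2)).
    by rewrite /Wprod; ring.
  by apply: ler_pM; rewrite ?mulr_ge0//; apply: ler_pM => //; exact: ca.
have h2 := @quad_sum_le R K.
have l4 : 0 <= (4 * l) ^+ 4 by apply: exprn_ge0; rewrite mulr_ge0// ltW.
have := le_trans h (ler_wpM2l l4 h2); rewrite (_ : (4 * l) ^+ 4 = 256 * l ^+ 4); last by ring.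
lra.
Qed.

Lemma Dmod_V_split {R : realType} (s : R) (K J : nat) (l x : R) : (K <= J)%N ->
  Dmod (vcoef s J) (2 ^ J) l x <= Dmod (vcoef s K) (2 ^ K) l x + \sum_(j < J) (K <= j)%N%:R * Dpiece s j l x.
Proof.
move=> KJ.
have split (F : nat -> R) : \sum_(n < 2 ^ J) vcoef s J n * F n =
    \sum_(n < 2 ^ K) vcoef s K n * F n + \sum_(j < J) (K <= j)%N%:R * \sum_(n < 2 * 2 ^ j) piece s j n * F n.
  rewrite !vcoef_split (big_ord_widen _ (fun j => \sum_(n < 2 * 2 ^ j) piece s j n * F n) KJ).
  rewrite [X in _ = X + _]big_mkcond/= -big_split/=; apply: eq_bigr => j _.
  by case: ltnP => h; rewrite ?mul0r ?addr0 ?mul1r ?add0r.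
rewrite /Dmod /TC /TS.
rewrite !(split (fun n => cos (2 * pi * (n ^ 2)%:R * _))) !(split (fun n => sin (2 * pi * (n ^ 2)%:R * _))).
have e (a b c d : R) : a + b - (c + d) = (a - c) + (b - d) by ring.
rewrite !e; apply: le_trans (cmodD _ _ _ _) _; apply: lerD => //.
rewrite -!sumrB; apply: le_trans (cmod_sum _ _ _ _) _; apply: ler_sum => j _.
by case: (K <= j)%N; rewrite ?mul1r// !mul0r subrr /cmod expr0n/= addr0 sqrtr0.
Qed.

Lemma Dpiece4_high {R : realType} (s : R) : s = 5 / 4 -> exists2 C : R, 0 < C &
  forall (j : nat) (l : R), 0 < l < 1 -> 1 < l * 4 ^+ j ->
  (Ig (fun x => Dpiece s j l x `^ 4)%R <= (C * (l `^ 4 * (1 + ln (l^-1)) ^+ 2) * peak 3 3 (l * 4 ^+ j))%R%:E)%E.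
Proof.
move=> s54; have s0 : 0 < s by lra.
have h24 : 2 < 4 :> R by lra.
have [C1 C10 high] := Dpiece_high s 4 s0 h24.
have [C2 C21 lg] := logf_le 4 1 (@ltr01 R).
exists (C1 * C2); first by rewrite mulr_gt0//; lra.
move=> j l l01 h; apply: le_trans (high j l l01) _; rewrite lee_fin.
have /andP[l0 l1] := l01; have L0 := ln_inv_ge0 l l01.
set x := l * 4 ^+ j in h *.
have x0 : 0 < x by lra.
have -> : kap 4 - 2 * s = - 2.
  by rewrite /kap ltxx s54; field.
rewrite (two_pow_scale l _ j l0) -/x (_ : - 2 / 2 = - 1); last by field.
rewrite opprK powRr1 ?(ltW l0)// (@powRM _ _ _ _ (powR_ge0 _ _) (ltW l0)) -powRrM mulN1r.
have [_ l2] := lg j l l01; have := l2 h; rewrite /Lam eqxx -/x powRr1 ?(ltW x0)// => {l2} lb.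
have pk : peak 3 3 x = x `^ (- 4) * x.
  rewrite /peak leNgt h/=; have -> : (- 3 : R) = - 4 + 1 by ring.
  by rewrite powRD ?(powRr1 (ltW x0))// (gt_eqF x0) implybT.
rewrite pk.
set A := x `^ (- 4); have A0 : 0 <= A by exact: powR_ge0.
set B := l `^ 4; have B0 : 0 <= B by exact: powR_ge0.
set L := ln l^-1 in L0 lb *.
have q1 : A * B * logf 4 j <= A * B * (C2 * (1 + L) * x) by apply: ler_wpM2l => //; exact: mulr_ge0.
have q2 : C2 * (1 + L) * x <= C2 * (1 + L) ^+ 2 * x.
  apply: ler_wpM2r; first exact: ltW.
  apply: ler_wpM2l; first lra.
  by rewrite expr2 ler_peMr//; lra.
have q3 := ler_wpM2l (mulr_ge0 A0 B0) q2.
have := ler_wpM2l (ltW C10) (le_trans q1 q3); lra.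
Qed.

Lemma scale_cut {R : realType} (l : R) : 0 < l < 1 ->
  exists2 K : nat, 1 < l * 4 ^+ K & K%:R <= 15 + ln (l^-1).
Proof.
move=> l01; have /andP[l0 l1] := l01.
have [K0 h1 h2] : exists2 K : nat, 1 < l * 4 ^+ K & l * 4 ^+ K <= 16.
  have [l8|l8] := ltP l (1 / 8).
    have [K a b] := scale_exists l l0 l8; have e : 4 ^+ K.+3 = 16 * 4 ^+ K.+1 :> R by rewrite !exprS; ring.
    by exists K.+3; rewrite e; lra.
  by exists 2%N; rewrite expr2; lra.
exists K0 => //; apply: le_trans (index_le_log l K0 l01) _.
have x0 : 0 < l * 4 ^+ K0 by lra.
have := @le_ln1Dx R (l * 4 ^+ K0 - 1); have -> : 1 + (l * 4 ^+ K0 - 1) = l * 4 ^+ K0 by ring.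
move=> h; have {}h : ln (l * 4 ^+ K0) <= l * 4 ^+ K0 - 1 by apply: h; lra.
lra.
Qed.

(* The range [l * 4 ^ j <= 1] is treated as a single block by [SV4_low]. *)
Lemma SV4_upper_eq {R : realType} (s : R) : s = 5 / 4 ->
  SV_le s 4 (fun l => l `^ 4 * (1 + ln (l^-1)) ^+ 2).
Proof.
move=> s54; have [C1 C10 high] := Dpiece4_high s s54.
pose G1 : R := geo_const 4 2^-1 + geo_const 4 2^-1.
pose G2 : R := geo_const 4 1 + geo_const 4 1.
have b4 : 1 < 4 :> R by rewrite ltr1n.
have G10 : 0 < G1 by apply: addr_gt0; apply: geo_const_gt0 => //; rewrite invr_gt0.
have G20 : 0 < G2 by apply: addr_gt0; apply: geo_const_gt0.
pose C0 : R := 16 * 256 * 600 * 289.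
have C00 : 0 < C0 by rewrite /C0; lra.
exists ((1 + G1) `^ 4 * (C0 + C1 * G2)).
  apply: mulr_gt0; first by apply: powR_gt0; lra.
  by apply: addr_gt0 => //; exact: mulr_gt0.
move=> J l l01; have /andP[l0 l1] := l01; have L0 := ln_inv_ge0 l l01.
set L := ln l^-1 in L0 *.
have l4 : 0 <= l `^ 4 by exact: powR_ge0.
pose B := l `^ 4 * (1 + L) ^+ 2.
have B0 : 0 <= B by rewrite mulr_ge0// sqr_ge0.
have [K xK KL] := scale_cut l l01.
have low (k : nat) : (k <= K)%N -> (SV s k 4 l <= (C0 * B)%R%:E)%E.
  move=> kK; apply: le_trans (SV4_low s l k s54 l01) _; rewrite lee_fin.
  (* From [K <= 15 + L]; the square of 17 is the 289 in [C0]. *)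
  have k6 : k.+2%:R <= 17 * (1 + L).
    have : k%:R <= K%:R :> R by rewrite ler_nat.
    by rewrite -(natr1 k.+1) -(natr1 k); move: KL; rewrite -/L; lra.
  have k0 : 0 <= k.+2%:R :> R by rewrite ler0n.
  have := ler_pM k0 k0 k6 k6; rewrite -expr2 => h.
  have := ler_wpM2l l4 h; rewrite /B /C0; lra.
have P1 : 1 <= (1 + G1) `^ 4 by apply: ltW; apply: powR_gt1; lra.
have D0 : 0 <= C1 * G2 * B by rewrite mulr_ge0// mulr_ge0// ltW.
have [JK|KJ] := leqP J K.
  apply: le_trans (low J JK) _; rewrite lee_fin -mulrA.
  have CB : 0 <= C0 * B by rewrite mulr_ge0// ltW.
  have h : C0 * B <= (C0 + C1 * G2) * B by lra.
  by apply: le_trans h _; rewrite -[leLHS]mul1r; apply: ler_wpM2r => //; lra.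
have x0 (j : nat) : 0 < l * 4 ^+ j by rewrite mulr_gt0// exprn_gt0.
have Dp0 j x : 0 <= Dpiece s j l x by exact: cmod_ge0.
(* Index 0 carries the whole low range; index [j + 1] carries the piece [j], suppressed when it
   already belongs to that range. *)
pose a (j : nat) (x : R) := if j is j'.+1 then (K <= j')%N%:R * Dpiece s j' l x else Dmod (vcoef s K) (2 ^ K) l x.
pose lam (j : nat) := if j is j'.+1 then peak 2^-1 2^-1 (l * 4 ^+ j') else 1.
pose M (j : nat) := if j is j'.+1 then C1 * B * peak 3 3 (l * 4 ^+ j') else C0 * B.
have mDp j : measurable_fun setT (Dpiece s j l) by exact: measurable_Dpiece1.
have mD (k : nat) : measurable_fun setT (fun x : R => Dmod (vcoef s k) (2 ^ k) l x `^ 4).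
  by apply: (measurable_diff_powR (Vre s k) (Vim s k)); [exact: measurable_Vre|exact: measurable_Vim].
have ma j : measurable_fun setT (fun x : R => a j x `^ 4).
  case: j => [|j]; first exact: mD.
  by apply: measurable_powR_comp; apply: measurable_funM; [exact: measurable_cst|exact: mDp].
have a0 j x : 0 <= a j x by case: j => [|j] /=; [exact: cmod_ge0|rewrite mulr_ge0].
have lam0 j : 0 < lam j by case: j => [|j] //=; exact: peak_gt0.
have hle x : Dmod (vcoef s J) (2 ^ J) l x <= \sum_(j < J.+1) a j x.
  by rewrite big_ord_recl /=; exact: Dmod_V_split (ltnW KJ).
have hM j : (Ig (fun x => a j x `^ 4)%R <= (M j)%:E)%E.
  case: j => [|j] /=; first exact: low.
  have [Kj|jK] := leqP K j.
    under [X in Ig X]eq_fun do rewrite mul1r.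
    apply: high => //; apply: lt_le_trans xK _; apply: ler_wpM2l; first exact: ltW.
    by rewrite ler_weXn2l//; lra.
  under [X in Ig X]eq_fun do rewrite mul0r powR0 ?gt_eqF//.
  rewrite /Ig integral0 lee_fin; apply: mulr_ge0; last by apply: ltW; exact: peak_gt0.
  by apply: mulr_ge0 => //; exact: ltW.
rewrite SVE.
apply: le_trans (Ig_weighted_sum 4 J.+1 _ a lam M (ltr0n _ 4) (mD J) ma (fun x => cmod_ge0 _ _) a0 lam0 hle hM) _.
rewrite lee_fin !big_ord_recl /= powR1 divr1.
have S1 : (1 + \sum_(i < J) peak 2^-1 2^-1 (l * 4 ^+ i)) `^ 4 <= (1 + G1) `^ 4.
  apply: ler_powR2r; [|lra|].
    by rewrite addr_ge0// sumr_ge0// => i _; apply: ltW; exact: peak_gt0.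
  by rewrite lerD2l; apply: sum_peak => //; rewrite invr_gt0.
have S2 : \sum_(i < J) C1 * B * peak 3 3 (l * 4 ^+ i) / peak 2^-1 2^-1 (l * 4 ^+ i) `^ 4 <= C1 * B * G2.
  have -> : \sum_(i < J) C1 * B * peak 3 3 (l * 4 ^+ i) / peak 2^-1 2^-1 (l * 4 ^+ i) `^ 4 =
     C1 * B * \sum_(i < J) peak 1 1 (l * 4 ^+ i).
    rewrite mulr_sumr; apply: eq_bigr => i _; rewrite -mulrA; congr (_ * _).
    rewrite peak_powR; have ln0 : peak (2^-1 * 4) (2^-1 * 4) (l * 4 ^+ i) != 0 :> R by rewrite gt_eqF// peak_gt0.
    by apply: (mulIf ln0); rewrite divfK// peakM//; congr (peak _ _ _); field.
  apply: ler_wpM2l; first by rewrite mulr_ge0// ltW.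
  by apply: sum_peak.
have T0 : 0 <= \sum_(i < J) C1 * B * peak 3 3 (l * 4 ^+ i) / peak 2^-1 2^-1 (l * 4 ^+ i) `^ 4.
  apply: sumr_ge0 => i _; apply: divr_ge0; last exact: powR_ge0.
  by apply: mulr_ge0; [rewrite mulr_ge0// ltW|apply: ltW; exact: peak_gt0].
have CB : 0 <= C0 * B by rewrite mulr_ge0// ltW.
rewrite -/B -[leRHS]mulrA; apply: ler_pM; [exact: powR_ge0|by rewrite addr_ge0|exact: S1|].
rewrite mulrDl; apply: lerD => //; apply: le_trans S2 _.
by rewrite mulrAC.
Qed.

(** * Lower bound for the number of solutions *)

(** The range [B], common to all pairs, allows the sum over divisors to be exchanged with the sums
    over [x] and [z]. *)
Lemma gcdn_sum_totient (x z B : nat) : (0 < x)%N -> (gcdn x z <= B)%N ->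
  gcdn x z = (\sum_(d < B.+1 | (d %| x) && (d %| z)) totient d)%N.
Proof.
move=> x0 gB; have g0 : (0 < gcdn x z)%N by rewrite gcdn_gt0 x0.
rewrite -[LHS]sum_totient_dvd.
rewrite (big_ord_widen_cond B.+1 (fun d => d %| gcdn x z)%N totient)//.
apply: eq_bigl => d; rewrite -dvdn_gcd.
by case: (boolP (d %| gcdn x z)%N) => //= dg; rewrite ltnS dvdn_leq.
Qed.

(** Superadditivity of the integer part gives at least [X %/ d] multiples in [[X, 2 * X)], and
    [d <= X] makes this at least half of [X / d]. *)
Lemma count_multiples {R : realType} (d X : nat) : (0 < d)%N -> (d <= X)%N ->
  X%:R / (2 * d%:R) <= (\sum_(x < X) (d %| X + x))%N%:R :> R.
Proof.
move=> d0 dX; have X0 := leq_trans d0 dX.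
have dR : 0 < d%:R :> R by rewrite ltr0n.
have N : (X %/ d <= \sum_(x < X) (d %| X + x))%N.
  have e : (\sum_(1 <= i < (2 * X).-1.+1) (d %| i) = \sum_(1 <= i < X.-1.+1) (d %| i) + \sum_(x < X) (d %| X + x))%N.
    rewrite !prednK ?muln_gt0 ?X0// (@big_cat_nat _ _ _ X)//=; last by rewrite leq_pmull.
    congr (_ + _)%N; rewrite -{1}[X]add0n big_addn mul2n -addnn addnK big_mkord.
    by apply: eq_bigr => x _; rewrite addnC.
  rewrite -(leq_add2l (\sum_(1 <= i < X.-1.+1) (d %| i))%N) -e -!divn_count_dvd leq_divRL//.
  rewrite mulnDl; apply: leq_trans (leq_add (leq_trunc_div _ _) (leq_trunc_div _ _)) _.
  by rewrite mul2n -addnn; case: X X0 {dX e}.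
have h : (X <= 2 * (X %/ d) * d)%N.
  have := ltn_ceil X d0; have q1 : (0 < X %/ d)%N by rewrite divn_gt0.
  move=> lt; apply: leq_trans (ltnW lt) _; rewrite leq_pmul2r//; lia.
rewrite ler_pdivrMr ?mulr_gt0//.
apply: (@le_trans _ _ ((2 * (X %/ d) * d)%N%:R)); first by rewrite ler_nat.
have := @ler_nat R (X %/ d) (\sum_(x < X) (d %| X + x))%N; rewrite N => Nr.
rewrite !natrM; have := ler_wpM2r (ltW dR) Nr; lra.
Qed.

(** Writing [n] as the sum of the totients of its divisors, [1 + ... + D] becomes the sum of
    [totient d * (D %/ d)], which is at most [D] times the sum on the right. *)
Lemma sum_totient_div_ge {R : realType} (D : nat) :
  (D%:R / 2 : R) <= \sum_(d < D.+1) (totient d)%:R / d%:R.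
Proof.
case: (posnP D) => [->|D0]; first by rewrite mul0r sumr_ge0// => d _; rewrite divr_ge0.
have DR : 0 < D%:R :> R by rewrite ltr0n.
have e : (\sum_(n < D.+1) n = \sum_(n < D.+1) \sum_(d < D.+1 | (0 < n)%N && (d %| n)) totient d)%N.
  apply: eq_bigr => -[n nD] _ /=; case: (posnP n) => [->|n0]; first by rewrite big_pred0.
  rewrite -[LHS]sum_totient_dvd (big_ord_widen_cond D.+1 (fun d => d %| n)%N totient)//.
  apply: eq_bigl => d /=; case: (boolP (d %| n)%N) => //= dn; by rewrite ltnS dvdn_leq.
have e2 : (\sum_(n < D.+1) \sum_(d < D.+1 | (0 < n)%N && (d %| n)) totient d =
   \sum_(d < D.+1) totient d * (D %/ d))%N.
  under eq_bigr do rewrite big_mkcond/=.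
  rewrite exchange_big/=; apply: eq_bigr => d _.
  rewrite divn_count_dvd big_distrr/= -(big_mkord xpredT (fun n => if ((0 < n) && (d %| n))%N then totient d else 0%N)).
  rewrite big_ltn//= add0n; apply: eq_big_nat => n /andP[n0 _].
  by rewrite n0/=; case: (d %| n)%N; rewrite ?muln1 ?muln0.
have t : ((\sum_(n < D.+1) n) * 2 = D.+1 * D)%N.
  have := bin2_sum D.+1; rewrite big_mkord => ->; rewrite bin2 muln2.
  by rewrite /= -[RHS]odd_double_half oddM /=; case: odd.
have le : \sum_(d < D.+1) (totient d * (D %/ d))%N%:R <= D%:R * \sum_(d < D.+1) (totient d)%:R / d%:R :> R.
  rewrite mulr_sumr; apply: ler_sum => d _; rewrite natrM mulrCA; apply: ler_wpM2l => //.
  case: (posnP d) => [->|d0]; first by rewrite divn0 invr0 mulr0.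
  by rewrite ler_pdivlMr ?ltr0n// -natrM ler_nat leq_trunc_div.
rewrite -(ler_pM2l DR); apply: le_trans le.
rewrite -natr_sum -e2 -e -(ler_pM2r (ltr0n R 2)) -[leRHS]natrM -mulrA divfK ?pnatr_eq0//.
by rewrite t -natrM ler_nat leq_pmul2r// leqnSn.
Qed.

Lemma sum_totient_div_le {R : realType} (D : nat) :
  \sum_(d < D.+1) (totient d)%:R / d%:R <= D%:R :> R.
Proof.
rewrite big_ord_recl/= invr0 mulr0 add0r -[X in _ <= X%:R](card_ord D) -sumr_const.
apply: ler_sum => d _; rewrite ler_pdivrMr ?ltr0n// mul1r ler_nat.
by rewrite totient_count_coprime (leq_trans (leq_sum _ (fun i _ => leq_b1 _)))// sum_nat_const_nat subn0 muln1.
Qed.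

(* Dyadic blocks: [sum_(D < d <= 4 D) phi d / d >= 2 D - D]. *)
Lemma sum_totient_div_sqr {R : realType} (m : nat) :
  m%:R / 4 <= \sum_(d < (4 ^ m).+1) (totient d)%:R / d%:R ^+ 2 :> R.
Proof.
elim: m => [|m IH]; first by rewrite mul0r sumr_ge0// => d _; rewrite divr_ge0.
set D := (4 ^ m)%N in IH *; have D0 : (0 < D)%N by rewrite expn_gt0.
have DR : 0 < D%:R :> R by rewrite ltr0n.
rewrite expnS -/D.
have e : ((4 * D).+1 = D.+1 + 3 * D)%N by lia.
have h1 := @sum_totient_div_ge R (4 * D); have h2 := @sum_totient_div_le R D.
rewrite e big_split_ord/= in h1; rewrite e big_split_ord/=.
set S1 := \sum_(i < D.+1) _ / _ ^+ 2 in IH *.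
set T2 := \sum_(i < 3 * D) _ in h1; set S2 := \sum_(i < 3 * D) _.
have h : T2 <= 4 * D%:R * S2.
  rewrite /T2 /S2 mulr_sumr; apply: ler_sum => i _; set n := (D.+1 + i)%N.
  have n0 : 0 < n%:R :> R by rewrite ltr0n.
  have n4 : n%:R <= 4 * D%:R :> R by rewrite -natrM ler_nat /n -ltnS e ltn_add2l; exact: ltn_ord.
  rewrite mulrCA; apply: ler_wpM2l => //; rewrite expr2 invfM mulrA.
  by rewrite -[leLHS]mul1r; apply: ler_wpM2r; rewrite ?invr_ge0 ?(ltW n0)// ler_pdivlMr// mul1r.
rewrite natrM in h1.
have : D%:R * (1 / 4) <= D%:R * S2 by lra.
rewrite ler_pM2l// -(natr1 m); lra.
Qed.

(** Expanding the gcd in totients turns the double sum into the sum of [totient d] times the square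
    of the number of multiples of [d], at least [totient d * X ^ 2 / (4 * d ^ 2)] for [d <= X]. The
    logarithm comes from the remaining series. *)
Lemma sum_gcd_ge {R : realType} (X m : nat) : (4 ^ m <= X)%N ->
  X%:R ^+ 2 * (m%:R / 16) <= (\sum_(x < X) \sum_(z < X) gcdn (X + x) (X + z))%N%:R :> R.
Proof.
move=> mX; have X0 : (0 < X)%N by apply: leq_trans mX; rewrite expn_gt0.
have e : (\sum_(x < X) \sum_(z < X) gcdn (X + x) (X + z) =
   \sum_(d < (2 * X).+1) totient d * ((\sum_(x < X) (d %| X + x)) * (\sum_(z < X) (d %| X + z))))%N.
  transitivity (\sum_(x < X) \sum_(z < X) \sum_(d < (2 * X).+1) totient d * ((d %| X + x) * (d %| X + z)))%N.
    apply: eq_bigr => x _; apply: eq_bigr => z _.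
    rewrite (gcdn_sum_totient _ _ (2 * X)) ?addn_gt0 ?X0//; last first.
      apply: leq_trans (dvdn_leq _ (dvdn_gcdl _ _)) _; rewrite ?addn_gt0 ?X0//.
      by rewrite mul2n -addnn leq_add2l ltnW.
    rewrite big_mkcond/=; apply: eq_bigr => d _.
    by case: (_ %| _)%N; case: (_ %| _)%N; rewrite /= ?muln1 ?muln0.
  rewrite exchange_big/=; under eq_bigr do rewrite exchange_big/=.
  rewrite exchange_big/=; apply: eq_bigr => d _; rewrite big_distrl/= big_distrr/= exchange_big/=.
  by apply: eq_bigr => x _; rewrite !big_distrr/=.
rewrite e natr_sum.
have h := @sum_totient_div_sqr R m.
apply: (@le_trans _ _ (X%:R ^+ 2 / 4 * \sum_(d < (4 ^ m).+1) (totient d)%:R / d%:R ^+ 2)).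
  by have := ler_wpM2l (sqr_ge0 (X%:R : R)) h; lra.
have le : ((4 ^ m).+1 <= (2 * X).+1)%N by rewrite ltnS (leq_trans mX)// leq_pmull.
rewrite mulr_sumr (big_ord_widen _ (fun d => X%:R ^+ 2 / 4 * ((totient d)%:R / d%:R ^+ 2)) le) big_mkcond/=.
apply: ler_sum => d _; case: ifP => // dm.
case: (posnP d) => [->|d0]; first by rewrite expr0n invr0 !mulr0.
rewrite natrM mulrCA; apply: ler_wpM2l => //.
have dX : (d <= X)%N by rewrite (leq_trans _ mX).
have dR : 0 < d%:R :> R by rewrite ltr0n.
have c := @count_multiples R d X d0 dX.
have c0 : 0 <= X%:R / (2 * d%:R) :> R by rewrite divr_ge0// mulr_ge0.
rewrite natrM; apply: le_trans (ler_pM c0 c0 c c).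
rewrite le_eqVlt; apply/orP; left; apply/eqP; field; by rewrite gt_eqF.
Qed.

(* With [g = gcdn x z], the solutions of [x * y = t * z] with [x, z ~ X] and [y, t ~ 4 X] are
   [y = z / g * k], [t = x / g * k]; they give [y + x, t - z, y - x, t + z]. *)
Definition quad_y (x z k : nat) : nat := (z %/ gcdn x z * (4 * gcdn x z + k))%N.
Definition quad_t (x z k : nat) : nat := (x %/ gcdn x z * (4 * gcdn x z + k))%N.

(** The offset [4 * gcdn x z] puts [y] and [t] above [4 * X], so that the later subtractions are not
    truncated and leave numbers of size [X]. The range of [k] is proportional to the gcd, which is
    why gcd sums count the solutions. *)
Lemma quad_yt (X x z k : nat) : (X <= x)%N -> (x < 2 * X)%N -> (X <= z)%N -> (z < 2 * X)%N ->
  (k < 4 * gcdn x z)%N ->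
  [/\ (x * quad_y x z k = quad_t x z k * z)%N, (4 * X <= quad_y x z k)%N, (quad_y x z k < 16 * X)%N,
      (4 * X <= quad_t x z k)%N & (quad_t x z k < 16 * X)%N].
Proof.
rewrite /quad_y /quad_t => x1 x2 z1 z2; set g := gcdn x z => kg.
have g0 : (0 < g)%N by case: (posnP g) kg => // ->; rewrite muln0 ltn0.
have xE : (x = x %/ g * g)%N by rewrite divnK// dvdn_gcdl.
have zE : (z = z %/ g * g)%N by rewrite divnK// dvdn_gcdr.
set u := (x %/ g)%N in xE *; set v := (z %/ g)%N in zE *.
have a1 : (4 * z <= v * (4 * g + k))%N by rewrite {1}zE mulnCA mulnDr -mulnCA leq_addr.
have a2 : (v * (4 * g + k) <= 8 * z)%N.
  by rewrite zE mulnCA leq_mul2l; apply/orP; right; clear -kg; lia.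
have a3 : (4 * x <= u * (4 * g + k))%N by rewrite {1}xE mulnCA mulnDr -mulnCA leq_addr.
have a4 : (u * (4 * g + k) <= 8 * x)%N.
  by rewrite xE mulnCA leq_mul2l; apply/orP; right; clear -kg; lia.
split.
- by rewrite xE zE; ring.
- by apply: leq_trans a1; rewrite leq_mul2l.
- by apply: leq_ltn_trans a2 _; clear -z2; lia.
- by apply: leq_trans a3; rewrite leq_mul2l.
- by apply: leq_ltn_trans a4 _; clear -x2; lia.
Qed.

Lemma quad_bounds (X x z k : nat) : (X <= x)%N -> (x < 2 * X)%N -> (X <= z)%N -> (z < 2 * X)%N ->
  (k < 4 * gcdn x z)%N ->
  let y := quad_y x z k in let t := quad_t x z k in
  [/\ ((y + x) ^ 2 + (t - z) ^ 2 = (y - x) ^ 2 + (t + z) ^ 2)%N,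
      (X <= y + x <= 18 * X)%N, (X <= t - z <= 18 * X)%N, (X <= y - x <= 18 * X)%N &
      (X <= t + z <= 18 * X)%N].
Proof.
move=> x1 x2 z1 z2 kg y t; have [xy y1 y2 t1 t2] := quad_yt X x z k x1 x2 z1 z2 kg.
rewrite -/y -/t in xy y1 y2 t1 t2.
have xley : (x <= y)%N by clear -x2 y1; lia.
have zlet : (z <= t)%N by clear -z2 t1; lia.
split; [|clear -x1 x2 y1 y2; lia|clear -z1 z2 t1 t2; lia|clear -x1 x2 y1 y2; lia|clear -z1 z2 t1 t2; lia].
have e1 : ((y + x) ^ 2 = (y - x) ^ 2 + 4 * (x * y))%N.
  by rewrite -{1}(subnK xley); move: (subnK xley); set w := (y - x)%N => <-; ring.
have e2 : ((t + z) ^ 2 = (t - z) ^ 2 + 4 * (t * z))%N.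
  by rewrite -{1}(subnK zlet); move: (subnK zlet); set w := (t - z)%N => <-; ring.
by rewrite e1 e2 xy; ring.
Qed.

(** The triples [(x, z, k)] number four times the gcd sum and inject into the solutions: sums and
    differences recover [x], [z], [y], [t], and then [y] recovers [k]. The type of [k] has the
    uniform size [8 * X], an upper bound for [4 * gcdn x z]. *)
Lemma sum4_gcd_le {R : realType} (X N : nat) (c0 : R) (G : nat -> nat -> nat -> nat -> R) :
  0 <= c0 -> (18 * X <= N)%N -> (forall a b c d, (a <= N)%N -> (b <= N)%N -> (c <= N)%N -> (d <= N)%N -> 0 <= G a b c d) ->
  (forall a b c d, (X <= a <= N)%N -> (X <= b <= N)%N -> (X <= c <= N)%N -> (X <= d <= N)%N ->
    (a ^ 2 + b ^ 2 = c ^ 2 + d ^ 2)%N -> c0 <= G a b c d) ->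
  4 * c0 * (\sum_(x < X) \sum_(z < X) gcdn (X + x) (X + z))%N%:R <= sum4 N.+1 G.
Proof.
move=> c00 XN G0 Gc.
pose T := (('I_X * 'I_X) * 'I_(8 * X))%type.
pose P (p : T) := (p.2 < 4 * gcdn (X + p.1.1) (X + p.1.2))%N.
pose Y (p : T) := quad_y (X + p.1.1) (X + p.1.2) p.2.
pose Tt (p : T) := quad_t (X + p.1.1) (X + p.1.2) p.2.
pose f (p : T) : ('I_N.+1 * 'I_N.+1) * ('I_N.+1 * 'I_N.+1) :=
  ((inord (Y p + (X + p.1.1)), inord (Tt p - (X + p.1.2))),
   (inord (Y p - (X + p.1.1)), inord (Tt p + (X + p.1.2)))).
have bd (p : T) : P p -> let x := (X + p.1.1)%N in let z := (X + p.1.2)%N in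
  [/\ ((Y p + x) ^ 2 + (Tt p - z) ^ 2 = (Y p - x) ^ 2 + (Tt p + z) ^ 2)%N,
      (X <= Y p + x <= 18 * X)%N, (X <= Tt p - z <= 18 * X)%N, (X <= Y p - x <= 18 * X)%N &
      (X <= Tt p + z <= 18 * X)%N].
  move=> Pp; apply: quad_bounds => //; rewrite ?leq_addr// mul2n -addnn ltn_add2l; exact: ltn_ord.
have le (a : nat) : (X <= a <= 18 * X)%N -> (X <= a <= N)%N.
  by case/andP => -> /= h; exact: leq_trans h XN.
have lt (a : nat) : (X <= a <= 18 * X)%N -> (a < N.+1)%N by move=> /le /andP[].
pose G' (q : ('I_N.+1 * 'I_N.+1) * ('I_N.+1 * 'I_N.+1)) := G q.1.1 q.1.2 q.2.1 q.2.2.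
have inj : {in P &, injective f}.
  move=> p p' Pp Pp' e.
  have [_ b1 b2 b3 b4] := bd p Pp; have [_ b1' b2' b3' b4'] := bd p' Pp'.
  have h1 := congr1 (fun q : ('I_N.+1 * 'I_N.+1) * ('I_N.+1 * 'I_N.+1) => nat_of_ord q.1.1) e; have h2 := congr1 (fun q : ('I_N.+1 * 'I_N.+1) * ('I_N.+1 * 'I_N.+1) => nat_of_ord q.1.2) e.
  have h3 := congr1 (fun q : ('I_N.+1 * 'I_N.+1) * ('I_N.+1 * 'I_N.+1) => nat_of_ord q.2.1) e; have h4 := congr1 (fun q : ('I_N.+1 * 'I_N.+1) * ('I_N.+1 * 'I_N.+1) => nat_of_ord q.2.2) e.
  rewrite /= !inordK ?lt// in h1 h2 h3 h4.
  have X0 : (0 < X)%N by exact: leq_ltn_trans (leq0n _) (ltn_ord p.1.1).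
  have c1 : (X + p.1.1 <= Y p)%N by apply: ltnW; rewrite -subn_gt0; apply: leq_trans X0 _; case/andP: b3.
  have c1' : (X + p'.1.1 <= Y p')%N by apply: ltnW; rewrite -subn_gt0; apply: leq_trans X0 _; case/andP: b3'.
  have c2 : (X + p.1.2 <= Tt p)%N by apply: ltnW; rewrite -subn_gt0; apply: leq_trans X0 _; case/andP: b2.
  have c2' : (X + p'.1.2 <= Tt p')%N by apply: ltnW; rewrite -subn_gt0; apply: leq_trans X0 _; case/andP: b2'.
  have [eY ex] := sum_diff_inj _ _ _ _ c1 c1' h1 h3.
  have [eT ez] := sum_diff_inj _ _ _ _ c2 c2' h4 h2.
  have z0 : (0 < (X + p.1.2) %/ gcdn (X + p.1.1) (X + p.1.2))%N.
    by rewrite divn_gt0 ?gcdn_gt0 ?addn_gt0 ?X0 ?orbT// dvdn_leq ?dvdn_gcdr// addn_gt0 X0.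
  have ek : p.2 = p'.2 :> nat.
    by move: eY; rewrite /Y /quad_y ex ez; move/eqP; rewrite -ex -ez eqn_pmul2l// eqn_add2l => /eqP.
  case: p p' ex ez ek {Pp Pp' e b1 b2 b3 b4 b1' b2' b3' b4' h1 h2 h3 h4 c1 c1' c2 c2' eY eT z0} => [[x z] k] [[x' z'] k'] /= /addnI /val_inj -> /addnI /val_inj -> /val_inj -> //.
have -> : sum4 N.+1 G = \sum_q G' q by rewrite /sum4 pair_big.
have G'0 q : 0 <= G' q by apply: G0; rewrite -ltnS ltn_ord.
have FG p : P p -> c0 <= G' (f p).
  move=> Pp; have [E b1 b2 b3 b4] := bd p Pp.
  by rewrite /G' /f /= !inordK ?lt//; apply: Gc; rewrite ?le.
apply: le_trans (sum_inj_le _ _ P f (fun=> c0) G' G'0 inj FG).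
have -> : \sum_(p | P p) c0 = \sum_(i : 'I_X * 'I_X) \sum_(k : 'I_(8 * X)) (if P (i, k) then c0 else 0).
  by rewrite big_mkcond pair_big/=; apply: eq_bigr => -[i k].
rewrite (pair_big xpredT xpredT (fun x z : 'I_X => gcdn (X + x) (X + z)))/= natr_sum mulr_sumr.
apply: ler_sum => -[x z] _ /=; rewrite /P /=.
set g := gcdn _ _.
have g8 : (4 * g <= 8 * X)%N.
  have : (g <= X + x)%N by apply: dvdn_leq; [rewrite addn_gt0 orbC (leq_ltn_trans _ (ltn_ord x)) ?orbT|exact: dvdn_gcdl].
  by have := ltn_ord x; lia.
rewrite -big_mkcond/= -(big_ord_widen (8 * X) (fun=> c0) g8) sumr_const card_ord -[leRHS]mulr_natr natrM.
by rewrite le_eqVlt; apply/orP; left; apply/eqP; ring.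
Qed.

(* Let [H] be the truncation of [F] to [n <= N]. Pointwise
   [4 Re (F conj H) |H|^2 - 3 |H|^4 <= |F|^4], and the frequencies of [F] that interact
   with three frequencies of [H] satisfy [n ^ 2 <= 2 * N ^ 2]. *)
Lemma Ig_T2_sqr_ge {R : realType} (c : nat -> R) (N L : nat) : (N < L)%N ->
  (forall n, (n ^ 2 <= 2 * N ^ 2)%N -> 0 <= c n) ->
  ((sum4 N.+1 (fun a b d e => (a ^ 2 + b ^ 2 == d ^ 2 + e ^ 2)%N%:R * (c a * c b * (c d * c e))))%:E
    <= Ig (fun x => T2 c L x `^ 2)%R)%E.
Proof.
move=> NL cpos; set Q := sum4 _ _.
pose h := T2 c N.+1.
pose r (x : R) := \sum_(i : 'I_L * 'I_N.+1) c i.1 * c i.2 * cos (2 * pi * ((i.1 ^ 2)%:R - (i.2 ^ 2)%:R) * x).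
have rE x : r x = TC c L x * TC c N.+1 x + TS c L x * TS c N.+1 x.
  rewrite /r /TC /TS !mulr_suml -big_split/= -(pair_big xpredT xpredT (fun (i : 'I_L) (j : 'I_N.+1) =>
    c i * c j * cos (2 * pi * ((i ^ 2)%:R - (j ^ 2)%:R) * x)))/=.
  apply: eq_bigr => i _; rewrite !mulr_sumr -big_split/=; apply: eq_bigr => j _.
  have -> : 2 * pi * ((i ^ 2)%:R - (j ^ 2)%:R) * x = 2 * pi * (i ^ 2)%:R * x - 2 * pi * (j ^ 2)%:R * x by ring.
  by rewrite cosB; ring.
pose k (x : R) := 4 * (r x * h x) + - 3 * h x ^+ 2.
have cr : continuous r.
  by apply: continuous_sum => i; apply: continuous_mul; [exact: cst_continuous|exact: continuous_cosM].
have ch : continuous h by exact: continuous_T2.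
have crh : continuous (fun x => r x * h x) by exact: continuous_mul.
have chh : continuous (fun x => h x ^+ 2) by under eq_fun do rewrite expr2; exact: continuous_mul.
have c1 : continuous (fun x => 4 * (r x * h x)) by apply: continuous_mul => //; exact: cst_continuous.
have c2 : continuous (fun x => - 3 * h x ^+ 2) by apply: continuous_mul => //; exact: cst_continuous.
have ck : continuous k by exact: continuous_add.
pose Y (a : nat) : R := \sum_(d < N.+1) c a * c d * \sum_(b < N.+1) \sum_(e < N.+1) c b * c e * (a ^ 2 + b ^ 2 == d ^ 2 + e ^ 2)%N%:R.
have QY : Q = \sum_(a < N.+1) Y a.
  rewrite /Q /sum4 -(pair_big xpredT xpredT (fun a b : 'I_N.+1 => \sum_(j : 'I_N.+1 * 'I_N.+1)
    (a ^ 2 + b ^ 2 == j.1 ^ 2 + j.2 ^ 2)%N%:R * (c a * c b * (c j.1 * c j.2))))/=.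
  apply: eq_bigr => a _; rewrite /Y.
  under [RHS]eq_bigr do rewrite mulr_sumr.
  rewrite [RHS]exchange_big/=; apply: eq_bigr => b _.
  rewrite -(pair_big xpredT xpredT (fun d e : 'I_N.+1 =>
    (a ^ 2 + b ^ 2 == d ^ 2 + e ^ 2)%N%:R * (c a * c b * (c d * c e))))/=.
  apply: eq_bigr => d _; rewrite mulr_sumr; apply: eq_bigr => e _; ring.
have Y0 a : 0 <= Y a.
  apply: sumr_ge0 => d _; rewrite mulr_sumr; apply: sumr_ge0 => b _; rewrite mulr_sumr; apply: sumr_ge0 => e _.
  have [E|] := eqVneq; last by rewrite !mulr0.
  have n2 (n : 'I_N.+1) : (n ^ 2 <= N ^ 2)%N by rewrite leq_exp2r// -ltnS ltn_ord.
  have n3 (n : 'I_N.+1) : 0 <= c n by apply: cpos; rewrite (leq_trans (n2 n))// leq_pmull.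
  rewrite mulr1 !mulr_ge0//; apply: cpos.
  apply: (@leq_trans (a ^ 2 + b ^ 2)); first exact: leq_addr.
  by rewrite E mul2n -addnn leq_add.
have Irh : Int (fun x => r x * h x) = \sum_(a < L) Y a.
  rewrite (Int_cos_mul_GT ('I_L * 'I_N.+1)%type 'I_N.+1 (fun i => c i.1 * c i.2)
    (fun i => i.1 ^ 2)%N (fun i => i.2 ^ 2)%N (fun n => c n) (fun n => n ^ 2)%N).
  by rewrite -(pair_big xpredT xpredT (fun (i : 'I_L) (j : 'I_N.+1) =>
    c i * c j * \sum_(a < N.+1) \sum_(b < N.+1) c a * c b * (i ^ 2 + a ^ 2 == j ^ 2 + b ^ 2)%N%:R)).
have Ihh : Int (fun x => h x ^+ 2) = Q by exact: Int_T2_sqr.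
have QL : Q <= \sum_(a < L) Y a by rewrite QY; exact: sum_widen_le.
apply: (@le_trans _ _ (Int k)%:E).
  rewrite lee_fin /k (IntD _ _ c1 c2) (IntZ _ _ crh) (IntZ _ _ chh) Irh Ihh; lra.
apply: Ig_ge_Int => //.
- by apply: measurable_powR_comp; apply: continuous_measurable_fun; exact: continuous_T2.
- by move=> x; exact: powR_ge0.
move=> x; rewrite (powR_mulrn 2 (T2_ge0 _ _ _)) /k.
have h0 : 0 <= h x by exact: T2_ge0.
(* From [|F - H| ^ 2 >= 0]. Then [4 * r * h - 3 * h ^ 2 <= 2 * T * h - h ^ 2 <= T ^ 2] with
   [T = |F| ^ 2]. *)
have r2 : 2 * r x <= T2 c L x + h x.
  rewrite rE /h !T2E.
  have := sqr_ge0 (TC c L x - TC c N.+1 x); have := sqr_ge0 (TS c L x - TS c N.+1 x); lra.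
have q1 := ler_wpM2r h0 r2; have q2 := sqr_ge0 (T2 c L x - h x); lra.
Qed.

(** The frequencies from [X] to [N = 32 * X], with [X ^ 2] of order [1 / l], all have coefficients
    at least [v]. The solutions of this size number at least a constant times [X ^ 2 * ln l^-1], and
    the fourth moment is at least their number times [v ^ 4]. *)
Lemma SV4_ge_log {R : realType} (s : R) : 0 < s -> s < 5 / 4 ->
  SV_ge s 4 (fun l => l `^ (4 * s - 1) * (1 + ln (l^-1))).
Proof.
move=> s0 s1.
(* Lower bound for [X ^ 2 * l], as [1024 * X ^ 2 = 4 ^ K] and [l * 4 ^ K > 1 / 8]. *)
have [kp k0 kpP] : exists2 kp : R, 0 < kp & forall y, 1 / 8 < y * 1024 -> kp <= y.
  by exists (1 / 8 / 1024) => [|y]; lra.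
pose c1 : R := 32 `^ (- (8 * s)) * kp `^ (5 - 4 * s) / 80.
have c10 : 0 < c1 by rewrite divr_gt0 ?mulr_gt0 ?powR_gt0//; lra.
exists c1 => //.
have e0 : 0 < (4 ^- 13 : R) by rewrite invr_gt0 exprn_gt0.
exists (4 ^- 13); first by rewrite e0 invf_lt1 ?exprn_gt0// exprn_egt1// ltr1n.
move=> l /andP[l0 l1].
have l8 : l < 1 / 8.
  apply: lt_le_trans l1 _; rewrite div1r lef_pV2 ?posrE ?exprn_gt0//.
  by rewrite -natrX ler_nat.
have l01 : 0 <= l <= 1 by lra.
have [k h1 h2] := scale_exists l l0 l8; set K := k.+1 in h1 h2.
have hL := scale_log l K l0 h2.
have K11 : (11 < K)%N.
  rewrite ltnNge; apply/negP => K11.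
  have a1 : 4 ^+ K <= 4 ^+ 11 :> R by rewrite ler_weXn2l// ler1n.
  have a2 := ler_wpM2l (ltW l0) a1.
  have a3 : l * 4 ^+ 13 < 1 by rewrite -ltr_pdivlMr ?exprn_gt0// div1r.
  have a4 : (4 : R) ^+ 13 = 16 * 4 ^+ 11 by rewrite 2!(exprS _ _.+1) mulrA; congr (_ * _); ring.
  rewrite a4 in a3; lra.
exists K.+2 => J hJ.
set d := dcoef l (vcoef s J).
(* The factor [32 = 2 ^ 5] between [X] and [N] leaves room for the solutions, which go up to
   [18 * X]. *)
pose n := (K - 5)%N; pose X := (2 ^ n)%N; pose N := (2 ^ K)%N.
have Kn : (K = n + 5)%N by rewrite /n subnK// (leq_trans _ K11).
have NX : (N = 32 * X)%N by rewrite /N /X Kn expnD mulnC.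
have X0 : (0 < X)%N by rewrite expn_gt0.
have XR : 0 < X%:R :> R by rewrite ltr0n.
have NR : N%:R = 32 * X%:R :> R by rewrite NX natrM.
have NL : (N < 2 ^ J)%N by rewrite ltn_exp2l// (leq_trans _ hJ).
have KJ : (K < J)%N by exact: ltnW.
have N4 : (N ^ 2)%:R = 4 ^+ K :> R by rewrite natrX /N dyadic_sq.
have dpos a : (a ^ 2 <= 2 * N ^ 2)%N -> 0 <= d a.
  move=> aN; rewrite /d /dcoef; apply: mulr_ge0; first by have /andP[] := vcoef_bounds s J a.
  have aR : (a ^ 2)%:R <= 2 * 4 ^+ K :> R by rewrite -N4 -natrM ler_nat.
  have nl := ler_wpM2l (ltW l0) aR.
  apply: sin_ge0_pi; rewrite -mulrA mulr_ge0 ?mulr_ge0 ?(ltW (pi_gt0 _)) ?(ltW l0)//=.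
  rewrite -[leRHS]mulr1; apply: ler_wpM2l; first exact: ltW (pi_gt0 _).
  by rewrite mulrC; apply: le_trans nl _; lra.
pose v : R := N%:R `^ (- (2 * s)) * (X%:R ^+ 2 * l).
have v0 : 0 <= v by rewrite mulr_ge0 ?powR_ge0// mulr_ge0 ?sqr_ge0// ltW.
have vd a : (X <= a <= N)%N -> v <= d a.
  move=> /andP[Xa aN]; have a0 : (0 < a)%N := leq_trans X0 Xa.
  apply: le_trans (dcoef_lower s l K J a l0 h1 KJ a0 aN).
  apply: ler_pM; [exact: powR_ge0|by rewrite mulr_ge0 ?sqr_ge0// ltW| |].
    rewrite /rcoef !powRN lef_pV2 ?posrE ?powR_gt0 ?ltr0n ?expn_gt0//.
    by apply: ler_powR2r => //; [lra|rewrite ler_nat].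
  apply: ler_wpM2r; first exact: ltW.
  by rewrite natrX ler_pXn2r ?nnegrE ?ler0n// ler_nat.
have hT := Ig_T2_sqr_ge d N (2 ^ J) NL dpos.
have XN : (18 * X <= N)%N by rewrite NX leq_mul2r orbT.
have dn a : (a <= N)%N -> 0 <= d a.
  by move=> aN; apply: dpos; rewrite (@leq_trans (N ^ 2)) ?leq_exp2r ?leq_pmull.
have v40 : 0 <= v ^+ 4 by exact: exprn_ge0.
have := sum4_gcd_le (R := R) X N (v ^+ 4) (fun a b d' e => (a ^ 2 + b ^ 2 == d' ^ 2 + e ^ 2)%N%:R * (d a * d b * (d d' * d e))) v40 XN.
set Q := sum4 _ _ in hT * => hQ.
have {}hQ : 4 * v ^+ 4 * (\sum_(x < X) \sum_(z < X) gcdn (X + x) (X + z))%N%:R <= Q.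
  apply: hQ => [a b c e ha hb hc he|a b c e ha hb hc he ->].
    by apply: mulr_ge0 => //; apply: mulr_ge0; apply: mulr_ge0; exact: dn.
  have -> : v ^+ 4 = v * v * (v * v) by ring.
  have vv : 0 <= v * v by exact: mulr_ge0.
  have step u w : (X <= u <= N)%N -> (X <= w <= N)%N -> v * v <= d u * d w by move=> hu hw; apply: ler_pM => //; exact: vd.
  by rewrite eqxx mul1r; apply: ler_pM => //; exact: step.
pose m := (n./2)%N.
have mX : (4 ^ m <= X)%N.
  by rewrite /X (_ : 4 = 2 ^ 2)%N// -expnM leq_exp2l// /m mul2n -[leqRHS]odd_double_half leq_addl.
have hG := @sum_gcd_ge R X m mX.
(* Here [K >= 12], which is what [l < 4 ^ (- 13)] provides, absorbs the additive constants. *)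
have mL : (1 + ln l^-1) / 20 <= m%:R.
  have m2 : n%:R <= 2 * m%:R + 1 :> R.
    by rewrite -natrM (natr1 (2 * m)%N) ler_nat /m -addn1 mul2n -{1}(odd_double_half n) addnC leq_add2l leq_b1.
  have nK : K%:R = n%:R + 5 :> R by rewrite Kn natrD.
  have K12 : 12 <= K%:R :> R by rewrite ler_nat.
  lra.
rewrite (SV_T2 s 4 l J l01) (_ : 4 / 2 = 2); last by field.
rewrite -/d; set I := Ig _ in hT *.
apply: (@le_trans _ _ I); last first.
  rewrite -[leLHS]mul1e; apply: lee_wpmul2r; first by apply: Ig_ge0 => x; exact: powR_ge0.
  by rewrite lee_fin (powR_mulrn 4 (ler0n _ 2)) -natrX ler1n.
apply: le_trans hT; rewrite lee_fin; apply: le_trans hQ.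
have L0 : 0 <= 1 + ln l^-1.
  by have := ln_inv_ge0 l; rewrite l0 (lt_trans l8) => [/(_ isT)|]; clear; lra.
have X2 : X%:R ^+ 2 * 1024 = 4 ^+ K :> R.
  by rewrite /X dyadic_sq Kn exprD; congr (_ * _); ring.
have xl : kp / l <= X%:R ^+ 2.
  by rewrite ler_pdivrMr//; apply: kpP; rewrite mulrAC X2 (mulrC (4 ^+ K)).
have key : 32 `^ (- (8 * s)) * kp `^ (5 - 4 * s) * l `^ (4 * s - 1) <= v ^+ 4 * X%:R ^+ 2.
  have -> : v ^+ 4 * X%:R ^+ 2 = 32 `^ (- (8 * s)) * ((X%:R ^+ 2) `^ (5 - 4 * s) * l ^+ 4).
    have nX : N%:R `^ (- (2 * s)) ^+ 4 = 32 `^ (- (8 * s)) * X%:R `^ (- (8 * s)) :> R.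
      rewrite -(powR_mulrn 4 (powR_ge0 _ _)) -powRrM NR (@powRM _ _ _ _ (ler0n _ 32) (ltW XR)).
      by congr (_ `^ _ * _ `^ _); ring.
    have -> : (X%:R ^+ 2) `^ (5 - 4 * s) = X%:R `^ (- (8 * s)) * X%:R ^+ 10 :> R.
      rewrite -(powR_mulrn 2 (ltW XR)) -powRrM -(powR_mulrn 10 (ltW XR)) -powRD; last by rewrite (gt_eqF XR) implybT.
      by congr (_ `^ _); ring.
    by rewrite /v exprMn nX; ring.
  rewrite -mulrA; apply: ler_wpM2l; first exact: powR_ge0.
  have -> : l `^ (4 * s - 1) = l^-1 `^ (5 - 4 * s) * l ^+ 4.
    rewrite -(powR_mulrn 4 (ltW l0)) -(powR_inv1 (ltW l0)) -powRrM -powRD; last by rewrite (gt_eqF l0) implybT.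
    by congr (_ `^ _); ring.
  rewrite mulrA; apply: ler_wpM2r; first by apply: exprn_ge0; exact: ltW.
  rewrite -(@powRM _ _ _ _ (ltW k0)); last by rewrite invr_ge0 ltW.
  by apply: ler_powR2r; [apply: mulr_ge0; [exact: ltW|by rewrite invr_ge0 ltW]|lra|exact: xl].
set A := _ * _ * l `^ _ in key.
have A0 : 0 <= A by rewrite !mulr_ge0// powR_ge0.
have q1 := ler_wpM2l (mulr_ge0 (ler0n R 4) v40) hG.
apply: le_trans q1.
have q2 : A * ((1 + ln l^-1) / 20) <= v ^+ 4 * X%:R ^+ 2 * m%:R by apply: ler_pM => //; rewrite divr_ge0.
have -> : c1 * (l `^ (4 * s - 1) * (1 + ln l^-1)) = A * ((1 + ln l^-1) / 20) / 4 by rewrite /c1 /A; field.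
lra.
Qed.

(** * From the structure integrals to the flatness *)

(** Monotonicity of norms on a set of measure 1, up to the factor 2, from [powR_interp_le] with
    threshold [B ^ (1 / q)]. *)
Lemma Ig_powR_mono {R : realType} (g : R -> R) (p q B : R) : 0 < p -> p <= q -> 0 < B ->
  measurable_fun setT g -> (forall x, 0 <= g x) ->
  (Ig (fun x => g x `^ q)%R <= B%:E)%E -> (Ig (fun x => g x `^ p)%R <= (2 * B `^ (p / q))%R%:E)%E.
Proof.
move=> p0 pq B0 mg g0 hB; have q0 : 0 < q by lra.
have t0 : 0 < B `^ q^-1 by exact: powR_gt0.
have mgp (e : R) : measurable_fun setT (fun x : R => g x `^ e) by exact: measurable_powR_comp.
have mc (c : R) : measurable_fun setT (fun _ : R => c) by exact: measurable_cst.
have tq : (B `^ q^-1) `^ q = B by rewrite -powRrM mulVf ?gt_eqF// powRr1// ltW.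
have pt x : g x `^ p <= (B `^ q^-1) `^ (p - q) * (g x `^ q + 1 * (B + 0)).
  have := powR_interp_le _ _ p q t0 (g0 x) p0 pq; rewrite tq => h.
  rewrite mul1r addr0 (_ : p - q = - (q - p)); last by ring.
  by rewrite powRN ler_pdivlMl// powR_gt0.
have := Ig_combine (fun x => g x `^ p) (fun x => g x `^ q) (fun=> B) (fun=> 0) _ 1
  (mgp p) (mgp q) (mc B) (mc 0) (fun x => powR_ge0 _ _) (fun x => powR_ge0 _ _) (fun=> ltW B0) (fun=> lexx 0)
  (powR_ge0 _ _) ler01 pt.
rewrite !Ig_cst adde0 mul1e => h; apply: le_trans h _.
apply: (@le_trans _ _ (((B `^ q^-1) `^ (p - q))%:E * (B%:E + B%:E))%E).
  by apply: lee_wpmul2l; [rewrite lee_fin powR_ge0|exact: leeD].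
rewrite -EFinD -EFinM lee_fin -powRrM (_ : B + B = 2 * B); last by ring.
rewrite mulrCA -[X in _ * (_ * X)](powRr1 (ltW B0)) -powRD; last by rewrite (gt_eqF B0) implybT.
rewrite le_eqVlt; apply/orP; left; apply/eqP; congr (_ * _ `^ _).
by field; rewrite gt_eqF.
Qed.

Lemma measurable_cmod_diff {R : realType} (f g : R -> R) (l : R) :
  measurable_fun setT f -> measurable_fun setT g ->
  measurable_fun setT (fun x : R => cmod (f (x + l) - f x) (g (x + l) - g x)).
Proof.
move=> mf mg; have := measurable_diff_powR f g 1 l mf mg.
by under eq_fun do rewrite powRr1 ?cmod_ge0//.
Qed.

Lemma Sint_mono {R : realType} (fr fi : R -> R) (p q l B : R) : 0 < p -> p <= q -> 0 < B ->
  measurable_fun setT fr -> measurable_fun setT fi ->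
  (Sint fr fi q l <= B%:E)%E -> (Sint fr fi p l <= (2 * B `^ (p / q))%R%:E)%E.
Proof.
move=> p0 pq B0 mr mi; apply: Ig_powR_mono => //; first exact: measurable_cmod_diff.
by move=> x; exact: cmod_ge0.
Qed.

Lemma SV_mono {R : realType} (s p q l B : R) (J : nat) : 0 < p -> p <= q -> 0 < B ->
  (SV s J q l <= B%:E)%E -> (SV s J p l <= (2 * B `^ (p / q))%R%:E)%E.
Proof. by move=> p0 pq B0; apply: Sint_mono => //; [exact: measurable_Vre|exact: measurable_Vim]. Qed.

Lemma SV_le_mono {R : realType} (s p q : R) (F : R -> R) : 0 < p -> p <= q ->
  (forall l, 0 < l < 1 -> 0 < F l) -> SV_le s q F -> SV_le s p (fun l => F l `^ (p / q)).
Proof.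
move=> p0 pq F0 [C C0 h]; exists (2 * C `^ (p / q)); first by rewrite mulr_gt0// powR_gt0.
move=> J l l01; have B0 : 0 < C * F l by rewrite mulr_gt0// F0.
apply: le_trans (SV_mono s p q l _ J p0 pq B0 (h J l l01)) _.
by rewrite lee_fin (@powRM _ _ _ _ (ltW C0) (ltW (F0 l l01))) mulrA.
Qed.

Lemma SV_ge_mono {R : realType} (s p q : R) (F : R -> R) : 0 < q -> q <= p ->
  (forall l, 0 < l < 1 -> 0 < F l) -> SV_ge s q F -> SV_ge s p (fun l => F l `^ (p / q)).
Proof.
move=> q0 qp F0 [c c0 [l0 /andP[l00 l01] h]]; have p0 : 0 < p by lra.
have c4 : 0 < c / 4 by rewrite divr_gt0.
(* Descending to exponent [q] costs the factor 2, so the quarter still leaves a contradiction. *)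
exists ((c / 4) `^ (p / q)); first by rewrite powR_gt0.
exists l0; first by rewrite l00.
move=> l /andP[hl0 hl1]; have l1 : 0 < l < 1 by rewrite hl0 (lt_trans hl1).
have l2 : 0 < l < l0 by rewrite hl0.
have [J1 hJ] := h l l2; exists J1 => J JJ.
have Fl := F0 l l1; have cF : 0 < c / 4 * F l by rewrite mulr_gt0.
rewrite -(@powRM _ _ _ _ (ltW c4) (ltW Fl)) leNgt; apply/negP => lt.
have B0 : 0 < (c / 4 * F l) `^ (p / q) by rewrite powR_gt0.
have := SV_mono s q p l _ J q0 qp B0 (ltW lt).
have -> : ((c / 4 * F l) `^ (p / q)) `^ (q / p) = c / 4 * F l.
  rewrite -powRrM (_ : p / q * (q / p) = 1); last by field; rewrite (gt_eqF p0) gt_eqF.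
  by rewrite powRr1// ltW.
move=> le; have := le_trans (hJ J JJ) le; rewrite lee_fin; have := mulr_gt0 c0 Fl; lra.
Qed.

Definition S_le {R : realType} (S F : R -> R) : Prop :=
  exists2 C : R, 0 < C & forall l, 0 < l < 1 -> S l <= C * F l.

Definition S_ge {R : realType} (S F : R -> R) : Prop :=
  exists2 c : R, 0 < c & exists2 l0 : R, 0 < l0 < 1 & forall l, 0 < l < l0 -> c * F l <= S l.

Lemma Sfun_le {R : realType} (s p : R) (fr fi F : R -> R) : 1 <= p -> is_Rs s p fr fi ->
  (forall l, 0 < l < 1 -> 0 < F l) -> SV_le s p F -> S_le (Sfun fr fi p) F.
Proof.
move=> p1 hR F0 [C C0 h]; have q0 : 0 < 2 `^ p :> R by exact: powR_gt0.
exists (2 * 2 `^ p * C); first by rewrite !mulr_gt0.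
move=> l l01; rewrite -mulrA; apply: (Sfun_upper s p) => //.
- by case/andP: l01 => a b; rewrite !ltW.
- by rewrite mulr_gt0// F0.
- by move=> J; exact: h.
Qed.

Lemma Sfun_ge {R : realType} (s p : R) (fr fi F : R -> R) : 1 <= p -> is_Rs s p fr fi ->
  (forall l, 0 < l < 1 -> 0 < F l) -> SV_ge s p F -> S_ge (Sfun fr fi p) F.
Proof.
move=> p1 hR F0 [c c0 [l0 /andP[l00 l01] h]]; have q0 : 0 < 2 `^ p :> R by exact: powR_gt0.
have D0 : 0 < 2 * 2 `^ p :> R by rewrite mulr_gt0.
exists (c / (2 * 2 `^ p)); first by rewrite divr_gt0.
exists l0; first by rewrite l00.
move=> l l1; have /andP[hl0 hl1] := l1; have l2 : 0 < l < 1 by rewrite hl0 (lt_trans hl1).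
rewrite mulrAC ler_pdivrMr// [leRHS]mulrC; apply: (Sfun_lower s p) => //.
- by rewrite !ltW// (lt_trans hl1).
- by rewrite mulr_gt0// F0.
- exact: h.
Qed.

Definition near0_le {R : realType} (F H : R -> R) : Prop :=
  exists2 K : R, 0 < K & exists2 l1 : R, 0 < l1 < 1 & forall l, 0 < l < l1 -> F l <= K * H l.

Lemma Gfun_le {R : realType} (p : R) (fr fi F2 Fp H : R -> R) : 0 < p ->
  (forall l, 0 < l < 1 -> 0 < F2 l) ->
  S_ge (Sfun fr fi 2) F2 -> S_le (Sfun fr fi p) Fp -> near0_le Fp (fun l => H l * F2 l `^ (p / 2)) ->
  lesim (Gfun fr fi p) H.
Proof.
move=> p0 F20 [c c0 [l0 /andP[l00 l01] h2]] [C C0 hp] [K K0 [l1 /andP[l10 l11] hH]].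
have cp : 0 < c `^ (p / 2) by exact: powR_gt0.
exists (C * K / c `^ (p / 2)), (Num.min l0 l1); split; first by rewrite divr_gt0// mulr_gt0.
split; first by rewrite lt_min l00.
split; first by rewrite gt_min l01.
move=> l hl0; rewrite lt_min => /andP[ll0 ll1].
have l1' : 0 < l < 1 by rewrite hl0 (lt_trans ll0).
have F2l := F20 l l1'; have cF : 0 < c * F2 l by rewrite mulr_gt0.
have a1 : c * F2 l <= Sfun fr fi 2 l by apply: h2; rewrite hl0.
have a2 := hp l l1'; have a3 : Fp l <= K * (H l * F2 l `^ (p / 2)) by apply: hH; rewrite hl0.
have S20 : 0 < Sfun fr fi 2 l `^ (p / 2) by rewrite powR_gt0// (lt_le_trans cF).
rewrite /Gfun ler_pdivrMr//.
have a4 : (c * F2 l) `^ (p / 2) <= Sfun fr fi 2 l `^ (p / 2).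
  by apply: ler_powR2r; [exact: ltW|rewrite divr_ge0// ltW|exact: a1].
rewrite (@powRM _ _ _ _ (ltW c0) (ltW F2l)) in a4.
have Sp0 : 0 <= Sfun fr fi p l by rewrite SfunE fine_ge0// Sint_ge0.
have Hl : 0 <= H l.
  rewrite -(pmulr_lge0 _ (powR_gt0 (p / 2) F2l)) -(pmulr_rge0 _ K0) (le_trans _ a3)//.
  by rewrite -(pmulr_rge0 _ C0) (le_trans Sp0).
apply: le_trans a2 _; apply: (@le_trans _ _ (C * (K * (H l * F2 l `^ (p / 2))))).
  by apply: ler_wpM2l => //; exact: ltW.
have CKH : 0 <= C * K / c `^ (p / 2) * H l by rewrite mulr_ge0// divr_ge0 ?mulr_ge0// ltW.
apply: le_trans (ler_wpM2l CKH a4).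
by rewrite le_eqVlt; apply/orP; left; apply/eqP; field; rewrite gt_eqF.
Qed.

(** The lower bound for the second moment ensures that the denominator is positive, division by 0
    being 0; the upper bound is what makes the quotient large. *)
Lemma Gfun_ge {R : realType} (p : R) (fr fi F2 Fp H : R -> R) : 0 < p ->
  (forall l, 0 < l < 1 -> 0 < F2 l) -> (forall l, 0 < l < 1 -> 0 < Fp l) ->
  S_ge (Sfun fr fi 2) F2 ->
  S_le (Sfun fr fi 2) F2 -> S_ge (Sfun fr fi p) Fp -> near0_le (fun l => H l * F2 l `^ (p / 2)) Fp ->
  lesim H (Gfun fr fi p).
Proof.
move=> p0 F20 Fp0 [c2 c20 [l2 /andP[l20 l21] h2']] [C C0 h2] [c c0 [l0 /andP[l00 l01] hp]] [K K0 [l1 /andP[l10 l11] hH]].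
have Cp : 0 < C `^ (p / 2) by exact: powR_gt0.
exists (K / c * C `^ (p / 2)), (Num.min l2 (Num.min l0 l1)); split; first by rewrite mulr_gt0// divr_gt0.
split; first by rewrite !lt_min l20 l00.
split; first by rewrite gt_min l21.
move=> l hl0; rewrite !lt_min => /and3P[ll2 ll0 ll1].
have l1' : 0 < l < 1 by rewrite hl0 (lt_trans ll0).
have F2l := F20 l l1'.
have a0 : c2 * F2 l <= Sfun fr fi 2 l by apply: h2'; rewrite hl0.
have S2 : 0 < Sfun fr fi 2 l by rewrite (lt_le_trans _ a0)// mulr_gt0.
have a1 := h2 l l1'.
have a2 : c * Fp l <= Sfun fr fi p l by apply: hp; rewrite hl0.
have a3 : H l * F2 l `^ (p / 2) <= K * Fp l by apply: hH; rewrite hl0.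
have S20 : 0 < Sfun fr fi 2 l `^ (p / 2) by exact: powR_gt0.
have F2p : 0 < F2 l `^ (p / 2) by exact: powR_gt0.
have a4 : Sfun fr fi 2 l `^ (p / 2) <= (C * F2 l) `^ (p / 2).
  by apply: ler_powR2r; [exact: ltW|rewrite divr_ge0// ltW|exact: a1].
rewrite (@powRM _ _ _ _ (ltW C0) (ltW F2l)) in a4.
have Sp0 : 0 <= Sfun fr fi p l by rewrite SfunE fine_ge0// Sint_ge0.
rewrite /Gfun mulrA ler_pdivlMr//.
rewrite -(ler_pM2r F2p) [leLHS]mulrAC.
have KF : 0 <= K * Fp l by rewrite mulr_ge0 ?(ltW K0)// ltW// Fp0.
have b1 : H l * F2 l `^ (p / 2) * Sfun fr fi 2 l `^ (p / 2) <= K * Fp l * (C `^ (p / 2) * F2 l `^ (p / 2)).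
  apply: (@le_trans _ _ (K * Fp l * Sfun fr fi 2 l `^ (p / 2))).
    by apply: ler_wpM2r => //; exact: ltW.
  exact: ler_wpM2l.
apply: le_trans b1 _.
have e0 : 0 <= K / c * C `^ (p / 2) * F2 l `^ (p / 2) by rewrite !mulr_ge0 ?invr_ge0// ltW.
have := ler_wpM2l e0 a2.
have -> : K / c * C `^ (p / 2) * F2 l `^ (p / 2) * (c * Fp l) = K * Fp l * (C `^ (p / 2) * F2 l `^ (p / 2)).
  by field; rewrite gt_eqF.
by rewrite [leRHS]mulrAC.
Qed.

Local Open Scope classical_set_scope.

(** * Independence of the exponent of convergence for [s >= 3/2] *)

Lemma Ig_powR_eq0 {R : realType} (g : R -> R) (p q : R) : 0 < p -> 0 < q ->
  measurable_fun setT g -> (forall x, 0 <= g x) ->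
  Ig (fun x => g x `^ p)%R = 0%E -> Ig (fun x => g x `^ q)%R = 0%E.
Proof.
move=> p0 q0 mg g0 h.
have mI : measurable (`[(0:R), 1] : set (measurableTypeR R)) by exact: measurable_itv.
have me (e : R) : measurable_fun (`[(0:R), 1] : set (measurableTypeR R)) (fun x : R => (g x `^ e)%R%:E).
  by apply/measurable_EFinP; apply: (@measurable_funS _ _ _ _ setT) => //; exact: measurable_powR_comp.
have h1 : (\int[lebesgue_measure]_(x in `[(0:R)%R, (1:R)%R]) `|(g x `^ p)%R%:E| = 0)%E.
  by rewrite -h; apply: eq_integral => x _; rewrite gee0_abs// lee_fin powR_ge0.
have /(ae_eq_integral_abs lebesgue_measure mI (me p)) ae := h1.
have ae' : ae_eq lebesgue_measure (`[(0:R), 1] : set (measurableTypeR R)) (fun x : R => (g x `^ q)%R%:E) (cst 0%E).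
  apply: filterS ae => x /= hx Dx; have /eqP : g x `^ p = 0 by case: (hx Dx).
  by rewrite powR_eq0 => /andP[/eqP -> _]; rewrite powR0// gt_eqF.
have := (ae_eq_integral_abs lebesgue_measure mI (me q)).2 ae'.
by move=> <-; apply: eq_integral => x _; rewrite gee0_abs// lee_fin powR_ge0.
Qed.

Lemma rcoef_tail {R : realType} (s : R) (N M : nat) : 3 / 2 <= s -> (0 < N)%N -> (N <= M)%N ->
  \sum_(N.+1 <= n < M.+1) rcoef s n <= N%:R^-1 - M%:R^-1 :> R.
Proof.
move=> s32 N0; elim: M => [|M IH] NM; first by move: NM N0; rewrite leqn0 => /eqP ->.
move: NM; rewrite leq_eqVlt => /orP[/eqP <-|NM]; first by rewrite big_geq// subrr.
rewrite big_nat_recr//=.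
have M0 : 0 < M%:R :> R by rewrite ltr0n (leq_trans N0).
have S0 : 0 < M.+1%:R :> R by rewrite ltr0n.
have h : rcoef s M.+1 <= M%:R^-1 - M.+1%:R^-1.
  apply: (@le_trans _ _ (M.+1%:R `^ (- 2))).
    rewrite /rcoef !powRN lef_pV2 ?posrE ?powR_gt0//; apply: ler_powR; last lra.
    by rewrite ler1n.
  rewrite powRN (powR_mulrn 2 (ltW S0)).
  have -> : M%:R^-1 - M.+1%:R^-1 = (M%:R * M.+1%:R)^-1 :> R.
    by rewrite -(natr1 M); field; apply/andP; split; apply: lt0r_neq0; clear -M0; lra.
  rewrite lef_pV2 ?posrE ?exprn_gt0 ?mulr_gt0// expr2 ler_wpM2r ?(ltW S0)// ler_nat//.
by apply: le_trans (lerD (IH NM) h) _; rewrite addrA subrK.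
Qed.

Lemma cmod_scale_unit {R : realType} (c t : R) : 0 <= c -> cmod (c * cos t) (c * sin t) = c.
Proof.
by move=> c0; rewrite /cmod !exprMn -mulrDr cos2Dsin2 mulr1 sqrtr_sqr ger0_norm.
Qed.

Lemma Serr_le {R : realType} (s : R) (fr fi : R -> R) (N M : nat) (x : R) : 3 / 2 <= s -> (0 < N)%N -> (N <= M)%N ->
  Serr s fr fi N x <= Serr s fr fi M x + N%:R^-1.
Proof.
move=> s32 N0 NM; rewrite /Serr.
pose A := \sum_(N.+1 <= n < M.+1) rcoef s n * cos (2 * pi * (n ^ 2)%:R * x).
pose B := \sum_(N.+1 <= n < M.+1) rcoef s n * sin (2 * pi * (n ^ 2)%:R * x).
have eA : Rs_re s M x = Rs_re s N x + A by rewrite /Rs_re (@big_cat_nat _ _ _ N.+1).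
have eB : Rs_im s M x = Rs_im s N x + B by rewrite /Rs_im (@big_cat_nat _ _ _ N.+1).
have -> : Rs_re s N x - fr x = (Rs_re s M x - fr x) + - A by rewrite eA; ring.
have -> : Rs_im s N x - fi x = (Rs_im s M x - fi x) + - B by rewrite eB; ring.
apply: le_trans (cmodD _ _ _ _) _; rewrite lerD2l cmodN.
apply: le_trans (cmod_sum _ _ _ _) _.
rewrite (eq_bigr (rcoef s)) => [|n _]; last by rewrite cmod_scale_unit// rcoef_ge0.
apply: le_trans (rcoef_tail s N M s32 N0 NM) _.
by rewrite gerBl invr_ge0.
Qed.

(* For [s >= 3/2] the partial sums converge uniformly, so [f] is within [1/N] of [S_N] almost everywhere. *)
Lemma is_Rs_ge {R : realType} (s p q : R) (fr fi : R -> R) : 3 / 2 <= s -> 0 < p -> 0 < q ->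
  is_Rs s p fr fi -> is_Rs s q fr fi.
Proof.
move=> s32 p0 q0 hR; have [pf [mr [mi _]]] := hR; apply: is_Rs_of_cvg => //.
(* Excess of the error over [1 / N]. It is at most the error of [S_M] for every [M >= N], so its
   integral is 0; a vanishing integral does not depend on the exponent. *)
pose w (N : nat) (x : R) := Num.max 0 (Serr s fr fi N x - N%:R^-1).
have w0 N x : 0 <= w N x by rewrite /w le_max lexx.
have mS N : measurable_fun setT (Serr s fr fi N).
  by have := measurable_Serr s 1 fr fi N mr mi; under eq_fun do rewrite powRr1 ?cmod_ge0//.
have mw N : measurable_fun setT (w N).
  by apply: measurable_maxr; [exact: measurable_cst|apply: measurable_funB => //; exact: measurable_cst].
have wz N : (0 < N)%N -> Ig (fun x => w N x `^ q)%R = 0%E.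
  move=> N0; apply: (Ig_powR_eq0 (w N) p q) => //.
  have I0 : (0 <= Ig (fun x => w N x `^ p)%R)%E by apply: Ig_ge0 => x; exact: powR_ge0.
  apply/eqP; rewrite eq_le I0 andbT; apply/lee_addgt0Pr => e e0; rewrite add0e.
  have [M0 hM] := is_Rs_cvg _ _ _ _ hR e e0.
  apply: le_trans (hM (maxn M0 N) (leq_maxl _ _)).
  apply: Ig_le.
  - exact: measurable_powR_comp.
  - exact: measurable_Serr.
  - by move=> x _; exact: powR_ge0.
  move=> x _; apply: ler_powR2r => //; first exact: ltW.
  rewrite /w ge_max cmod_ge0/= lerBlDr; apply: Serr_le => //; exact: leq_maxr.
move=> e e0.
pose t := (e / 2 `^ q) `^ q^-1.
have e2 : 0 < e / 2 `^ q by rewrite divr_gt0// powR_gt0.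
have t0 : 0 < t by exact: powR_gt0.
have tq : t `^ q = e / 2 `^ q by rewrite /t powRVr ?gt_eqF//; exact: ltW.
have [N0 hN0] := ltr_add_invr t0; rewrite add0r in hN0.
exists N0.+1 => N NN; have N0' : (0 < N)%N by exact: leq_trans NN.
have NR : 0 < N%:R^-1 :> R by rewrite invr_gt0 ltr0n.
have Nt : N%:R^-1 <= t.
  apply: le_trans (ltW hN0); rewrite lef_pV2 ?posrE ?ltr0n//.
  by rewrite ler_nat.
have mz : measurable_fun setT (fun _ : R => (0 : R)) by exact: measurable_cst.
have mN : measurable_fun setT (fun _ : R => N%:R^-1 `^ q : R) by exact: measurable_cst.
have pt x : Serr s fr fi N x `^ q <= 2 `^ q * (0 + 1 * (w N x `^ q + N%:R^-1 `^ q)).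
  rewrite add0r mul1r; apply: le_trans (powR_addl _ _ q q0 (w0 N x) (ltW NR)).
  apply: ler_powR2r; [exact: cmod_ge0|exact: ltW|].
  by rewrite -lerBlDr /w le_max lexx orbT.
have := Ig_combine _ _ _ _ _ _ (measurable_Serr s q fr fi N mr mi) mz (measurable_powR_comp _ _ (mw N)) mN
  (fun x => powR_ge0 _ _) (fun=> lexx 0) (fun x => powR_ge0 _ _) (fun=> powR_ge0 _ _) (powR_ge0 2 q) ler01 pt.
rewrite !Ig_cst wz// add0e add0e mul1e => h; apply: le_trans h _.
rewrite -EFinM lee_fin mulrC -ler_pdivlMr ?powR_gt0// -tq.
by apply: ler_powR2r => //; exact: ltW.
Qed.

Local Close Scope classical_set_scope.

(** * The cases of the theorem *)

Lemma near0_le_eq {R : realType} (F H : R -> R) : (forall l, 0 < l < 1 -> F l = H l) -> near0_le F H.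
Proof.
move=> h; exists 1 => //; exists (1 / 2) => [|l l1]; first by lra.
by rewrite mul1r h//; lra.
Qed.

Lemma ln_inv_ge1 {R : realType} (l : R) : 0 < l < 1 / 4 -> 1 <= ln l^-1.
Proof.
move=> /andP[l0 l1]; apply: le_trans ln4_ge1 _.
rewrite ler_ln ?posrE ?invr_gt0//.
by rewrite -[leRHS]mul1r ler_pdivlMr//; lra.
Qed.

Lemma lesim_Gfun_le {R : realType} (s p : R) (fr fi F2 Fp H : R -> R) : 2 <= p -> is_Rs s p fr fi ->
  (forall l, 0 < l < 1 -> 0 < F2 l) -> (forall l, 0 < l < 1 -> 0 < Fp l) ->
  SV_ge s 2 F2 -> SV_le s p Fp -> near0_le Fp (fun l => H l * F2 l `^ (p / 2)) ->
  lesim (Gfun fr fi p) H.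
Proof.
move=> p2 hR F20 Fp0 g2 lp nr; have hR2 : is_Rs s 2 fr fi by apply: is_Rs_le hR; lra.
have p0 : 0 < p by lra. have p1 : 1 <= p by lra. have p12 : 1 <= (2 : R) by lra.
exact: (Gfun_le p fr fi F2 Fp H p0 F20 (Sfun_ge s 2 fr fi F2 p12 hR2 F20 g2) (Sfun_le s p fr fi Fp p1 hR Fp0 lp) nr).
Qed.

Lemma lesim_Gfun_ge {R : realType} (s p : R) (fr fi F2 Fp H : R -> R) : 2 <= p -> is_Rs s p fr fi ->
  (forall l, 0 < l < 1 -> 0 < F2 l) -> (forall l, 0 < l < 1 -> 0 < Fp l) ->
  SV_ge s 2 F2 -> SV_le s 2 F2 -> SV_ge s p Fp -> near0_le (fun l => H l * F2 l `^ (p / 2)) Fp ->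
  lesim H (Gfun fr fi p).
Proof.
move=> p2 hR F20 Fp0 g2 l2 gp nr; have hR2 : is_Rs s 2 fr fi by apply: is_Rs_le hR; lra.
have p0 : 0 < p by lra. have p1 : 1 <= p by lra. have p12 : 1 <= (2 : R) by lra.
exact: (Gfun_ge p fr fi F2 Fp H p0 F20 Fp0 (Sfun_ge s 2 fr fi F2 p12 hR2 F20 g2)
  (Sfun_le s 2 fr fi F2 p12 hR2 F20 l2) (Sfun_ge s p fr fi Fp p1 hR Fp0 gp) nr).
Qed.

(** Monotonicity of norms bounds the [p]-th moment below by the power [p / 2] of the second one,
    whatever the size of the latter. *)
Lemma lesim_one_Gfun {R : realType} (s p : R) (fr fi F2 : R -> R) : 2 <= p -> is_Rs s p fr fi ->
  (forall l, 0 < l < 1 -> 0 < F2 l) -> SV_ge s 2 F2 -> SV_le s 2 F2 ->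
  lesim (fun=> 1) (Gfun fr fi p).
Proof.
move=> p2 hR F20 g2 l2.
have Fp0 l : 0 < l < 1 -> 0 < F2 l `^ (p / 2) by move=> l01; rewrite powR_gt0// F20.
have gp : SV_ge s p (fun l => F2 l `^ (p / 2)) by apply: (SV_ge_mono s p 2 F2 _ p2 F20 g2); lra.
apply: (lesim_Gfun_ge s p fr fi F2 _ _ p2 hR F20 Fp0 g2 l2 gp).
by apply: near0_le_eq => l _; rewrite mul1r.
Qed.

Lemma SV_le_ext {R : realType} (s p : R) (F H : R -> R) : (forall l, 0 < l < 1 -> F l = H l) ->
  SV_le s p F -> SV_le s p H.
Proof. by move=> e [C C0 h]; exists C => // J l l01; rewrite -e//; exact: h. Qed.

Lemma powR_pos {R : realType} (e l : R) : 0 < l < 1 -> 0 < l `^ e.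
Proof. by case/andP => l0 _; exact: powR_gt0. Qed.

Section Cases.
Context {R : realType} (s p : R) (fr fi : R -> R).
Hypotheses (p2 : 2 <= p) (hR : is_Rs s p fr fi).

Let p_gt0 : 0 < p. Proof. exact: lt_le_trans (ltr0n R 2) p2. Qed.

Lemma SV_le_pos : 4 < p -> 0 < s -> 1 / 2 - 1 / p < s -> s < 3 / 2 - 1 / p ->
  SV_le s p (fun l => l `^ (p * s - p / 2 + 1)).
Proof.
move=> p4 s0 s1 s3; have p0 := p_gt0.
have kE : kap p / 2 = 1 / 2 - 1 / p by rewrite kap_gt4//; field; rewrite gt_eqF.
have h2 : 2 < p by lra.
have h3 : 0 < 1 + kap p / 2 - s by rewrite kE; lra.
have h4 : 0 < s - kap p / 2 by rewrite kE; lra.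
have [C C0 h] := SV_upper_pos s p h2 s0 h3 h4.
exists C => // J l l01; have := h J l l01; rewrite Lam_ne4// mulr1.
rewrite (_ : (s - kap p / 2) * p = p * s - p / 2 + 1)//.
by rewrite kE; field; rewrite gt_eqF.
Qed.

(** The Lipschitz bound is available above exponent 4 only; it is taken at an auxiliary [q] and
    brought down to [p]. *)
Lemma SV_le_linear (q : R) : p <= q -> 4 < q -> 0 < s -> 3 - 2 / q < 2 * s -> SV_le s p (fun l => l `^ p).
Proof.
move=> pq q4 s0 sq; have q0 : 0 < q by lra.
have neg : 2 + kap q - 2 * s < 0 by rewrite kap_gt4//; lra.
have [C C0 h] := SV_upper_neg s q q4 s0 neg.
have hq : SV_le s q (fun l => l `^ q) by exists C.
have p0 := p_gt0.
apply: SV_le_ext (SV_le_mono s p q _ p0 pq (powR_pos q) hq) => l _.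
by rewrite -powRrM mulrC divfK// gt_eqF.
Qed.

Lemma Gfun_lt_small : sstar p < s -> s < 5 / 4 -> p < 4 -> simeq (Gfun fr fi p) (fun=> 1).
Proof.
rewrite /sstar => ss s5 p4; have s14 : 1 / 4 < s by move: ss; rewrite (ltW p4).
have s0 : 0 < s by lra.
have g2 := SV2_ge_lt s s0 s5; have l2 := SV2_upper_lt s s14 s5.
have F20 := @powR_pos R (2 * s - 1 / 2).
split; last exact: (lesim_one_Gfun s p fr fi _ p2 hR F20 g2 l2).
(* The bound for the pieces requires an exponent above 2, while [p] may equal 2; staying below 4
   avoids the logarithm. *)
pose q := Num.max p 3.
have pq : p <= q by rewrite /q le_max lexx.
have q3 : 3 <= q by rewrite /q le_max lexx orbT.
have q4 : q < 4 by rewrite /q gt_max p4; lra.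
have q0 : 0 < q by lra.
have kE : kap q = 1 / 2 by rewrite /kap q4.
have h2 : 2 < q by lra.
have h3 : 0 < 1 + kap q / 2 - s by rewrite kE; lra.
have h4 : 0 < s - kap q / 2 by rewrite kE; lra.
have [C C0 h] := SV_upper_pos s q h2 s0 h3 h4.
have hq : SV_le s q (fun l => l `^ ((s - 1 / 4) * q)).
  exists C => // J l l01; have := h J l l01; rewrite /Lam (lt_eqF q4) mulr1 kE.
  by rewrite (_ : 1 / 2 / 2 = 1 / 4); last by field.
have hp := SV_le_mono s p q _ (lt_le_trans (ltr0n _ 2) p2) pq (powR_pos _) hq.
apply: (lesim_Gfun_le s p fr fi _ _ _ p2 hR F20 _ g2 hp).
  by move=> l l01; rewrite powR_gt0// powR_pos.
apply: near0_le_eq => l _ /=; rewrite [RHS]mul1r -!powRrM; congr (_ `^ _).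
by field; rewrite gt_eqF.
Qed.

Lemma Gfun_lt_four : s < 5 / 4 -> sstar p < s -> p = 4 -> simeq (Gfun fr fi p) (fun l => ln l^-1).
Proof.
rewrite /sstar => s5 ss p4; have s14 : 1 / 4 < s by move: ss; rewrite p4 lexx.
have s0 : 0 < s by lra.
have g2 := SV2_ge_lt s s0 s5; have l2 := SV2_upper_lt s s14 s5.
have F20 := @powR_pos R (2 * s - 1 / 2).
pose F (l : R) := l `^ (4 * s - 1) * (1 + ln l^-1).
have F0 l : 0 < l < 1 -> 0 < F l.
  by move=> l01; apply: mulr_gt0; [exact: powR_pos|have := ln_inv_ge0 l l01; lra].
have FE l : (l `^ (2 * s - 1 / 2)) `^ (p / 2) = l `^ (4 * s - 1).
  by rewrite -powRrM; congr (_ `^ _); rewrite p4; field.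
have l4 : 0 < (1 / 4 : R) < 1 by lra.
split.
  have hp : SV_le s p F.
    have kE : kap 4 / 2 = 1 / 4 :> R by rewrite /kap ltxx; field.
    have h2 : 2 < (4 : R) by lra.
    have h3 : 0 < 1 + kap 4 / 2 - s by rewrite kE; lra.
    have h4 : 0 < s - kap 4 / 2 by rewrite kE; lra.
    have [C C0 h] := SV_upper_pos s 4 h2 s0 h3 h4.
    exists C => // J l l01; have := h J l l01; rewrite p4 /Lam eqxx kE /F.
    by rewrite (_ : (s - 1 / 4) * 4 = 4 * s - 1); last by field.
  apply: (lesim_Gfun_le s p fr fi _ _ _ p2 hR F20 F0 g2 hp).
  exists 2 => //; exists (1 / 4) => // l lq; have L1 := ln_inv_ge1 l lq.
  rewrite FE /F; have := powR_ge0 l (4 * s - 1); set X := _ `^ _ => X0.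
  have h : 1 + ln l^-1 <= 2 * ln l^-1 by lra.
  by have := ler_wpM2l X0 h; lra.
have hp : SV_ge s p F by rewrite p4; exact: SV4_ge_log.
apply: (lesim_Gfun_ge s p fr fi _ _ _ p2 hR F20 F0 g2 l2 hp).
exists 1 => //; exists (1 / 4) => // l lq; rewrite FE /F.
have := powR_ge0 l (4 * s - 1); set X := _ `^ _ => X0; lra.
Qed.

Lemma Gfun_lt_big : s < 5 / 4 -> sstar p < s -> 4 < p ->
  simeq (Gfun fr fi p) (fun l => l `^ (- (p / 4 - 1))).
Proof.
rewrite /sstar => s5 ss p4; have p0 := p_gt0.
have sp : 1 / 2 - 1 / p < s by move: ss; rewrite leNgt p4.
have ip : 1 / p < 1 / 4 by rewrite !div1r ltf_pV2 ?posrE.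
have s0 : 0 < s by lra. have s14 : 1 / 4 < s by lra.
have g2 := SV2_ge_lt s s0 s5; have l2 := SV2_upper_lt s s14 s5.
have F20 := @powR_pos R (2 * s - 1 / 2); have F0 := @powR_pos R (p * s - p / 2 + 1).
have E l : 0 < l < 1 -> l `^ (- (p / 4 - 1)) * (l `^ (2 * s - 1 / 2)) `^ (p / 2) = l `^ (p * s - p / 2 + 1).
  case/andP => l0 _; rewrite -powRrM -powRD; last by rewrite (gt_eqF l0) implybT.
  by congr (_ `^ _); field.
have hle : SV_le s p (fun l => l `^ (p * s - p / 2 + 1)) by apply: SV_le_pos => //; lra.
have hge : SV_ge s p (fun l => l `^ (p * s - p / 2 + 1)) by apply: SV_ge_Fejer; lra.
split.
  apply: (lesim_Gfun_le s p fr fi _ _ _ p2 hR F20 F0 g2 hle).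
  by apply: near0_le_eq => l l01; rewrite E.
apply: (lesim_Gfun_ge s p fr fi _ _ _ p2 hR F20 F0 g2 l2 hge).
by apply: near0_le_eq => l l01; rewrite E.
Qed.

Let Fcrit (l : R) : R := l ^+ 2 * (1 + ln l^-1).

Lemma Fcrit_gt0 l : 0 < l < 1 -> 0 < Fcrit l.
Proof.
move=> l01; have := ln_inv_ge0 l l01; case/andP: l01 => l0 _ L0.
by apply: mulr_gt0; [exact: exprn_gt0|lra].
Qed.

Lemma Fcrit_powR (e l : R) : 0 < l < 1 -> Fcrit l `^ (e / 2) = l `^ e * (1 + ln l^-1) `^ (e / 2).
Proof.
move=> l01; have L0 := ln_inv_ge0 l l01; case/andP: l01 => l0 _.
rewrite /Fcrit (@powRM _ _ _ _ (sqr_ge0 l)); last by lra.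
by rewrite powR_sqr_half// ltW.
Qed.

Lemma SV_le_crit : s = 5 / 4 -> p <= 4 -> SV_le s p (fun l => Fcrit l `^ (p / 2)).
Proof.
move=> s5 p4; have h4 := SV4_upper_eq s s5.
have h : SV_le s 4 (fun l => Fcrit l `^ 2).
  apply: SV_le_ext h4 => l l01; have L0 := ln_inv_ge0 l l01; case/andP: l01 => l0 _.
  rewrite /Fcrit (powR_mulrn 4 (ltW l0)) powR_mulrn; last by rewrite mulr_ge0 ?sqr_ge0//; lra.
  ring.
have pos l : 0 < l < 1 -> 0 < Fcrit l `^ 2 by move=> /Fcrit_gt0 h0; exact: powR_gt0.
have p0 := p_gt0.
apply: SV_le_ext (SV_le_mono s p 4 _ p0 p4 pos h) => l _.
by rewrite -powRrM; congr (_ `^ _); field.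
Qed.

Lemma Gfun_crit_small : s = 5 / 4 -> p < 4 -> simeq (Gfun fr fi p) (fun=> 1).
Proof.
move=> s5 p4; have g2 := SV2_ge_eq s s5; have l2 := SV2_upper_eq s s5.
split; last exact: (lesim_one_Gfun s p fr fi _ p2 hR Fcrit_gt0 g2 l2).
apply: (lesim_Gfun_le s p fr fi _ _ _ p2 hR Fcrit_gt0 _ g2 (SV_le_crit s5 (ltW p4))).
  by move=> l l01; rewrite powR_gt0// Fcrit_gt0.
by apply: near0_le_eq => l _; rewrite mul1r.
Qed.

Lemma Gfun_crit_four : s = 5 / 4 -> p = 4 ->
  lesim (fun=> 1) (Gfun fr fi p) /\ lesim (Gfun fr fi p) (fun l => ln l^-1).
Proof.
move=> s5 p4; have g2 := SV2_ge_eq s s5; have l2 := SV2_upper_eq s s5.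
split; first exact: (lesim_one_Gfun s p fr fi _ p2 hR Fcrit_gt0 g2 l2).
have p4' : p <= 4 by lra.
apply: (lesim_Gfun_le s p fr fi _ _ _ p2 hR Fcrit_gt0 _ g2 (SV_le_crit s5 p4')).
  by move=> l l01; rewrite powR_gt0// Fcrit_gt0.
exists 1 => //; exists (1 / 4) => [|l lq]; first lra.
by rewrite mul1r ler_peMl ?powR_ge0// ln_inv_ge1.
Qed.

(** For [p > 4] the transition scale still dominates the [p]-th moment, which carries no logarithm;
    that of the second moment appears to a negative power. *)
Lemma Gfun_crit_big : s = 5 / 4 -> 4 < p ->
  simeq (Gfun fr fi p) (fun l => l `^ (- (p / 4 - 1)) * (ln l^-1) `^ (- (p / 2))).
Proof.
move=> s5 p4; have p0 := p_gt0.
have g2 := SV2_ge_eq s s5; have l2 := SV2_upper_eq s s5.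
have ip : 0 < 1 / p < 1 / 4 by rewrite !div1r ltf_pV2 ?posrE// invr_gt0 p0 p4.
have F0 := @powR_pos R (p * s - p / 2 + 1).
have E l : 0 < l < 1 -> l `^ (- (p / 4 - 1)) * (ln l^-1) `^ (- (p / 2)) * Fcrit l `^ (p / 2) =
    l `^ (p * s - p / 2 + 1) * ((ln l^-1) `^ (- (p / 2)) * (1 + ln l^-1) `^ (p / 2)).
  move=> l01; have [l0 _] := andP l01; rewrite Fcrit_powR// mulrACA -powRD; last by rewrite (gt_eqF l0) implybT.
  by congr (_ `^ _ * _); rewrite s5; field.
have hle : SV_le s p (fun l => l `^ (p * s - p / 2 + 1)) by apply: SV_le_pos => //; lra.
have hge : SV_ge s p (fun l => l `^ (p * s - p / 2 + 1)) by apply: SV_ge_Fejer; lra.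
have l4 : 0 < (1 / 4 : R) < 1 by lra.
have p20 : 0 <= p / 2 by lra.
split.
  apply: (lesim_Gfun_le s p fr fi _ _ _ p2 hR Fcrit_gt0 F0 g2 hle).
  exists 1 => //; exists (1 / 4) => // l lq; have L1 := ln_inv_ge1 l lq.
  rewrite mul1r E; last by lra.
  rewrite ler_peMr ?powR_ge0// powRN ler_pdivlMl ?mulr1; last by rewrite powR_gt0//; lra.
  by apply: ler_powR2r; lra.
apply: (lesim_Gfun_ge s p fr fi _ _ _ p2 hR Fcrit_gt0 F0 g2 l2 hge).
exists (2 `^ (p / 2)); first by rewrite powR_gt0.
exists (1 / 4) => // l lq; have L1 := ln_inv_ge1 l lq.
rewrite E; last by lra.
rewrite [leRHS]mulrC; apply: ler_wpM2l; first exact: powR_ge0.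
have L0 : 0 <= ln l^-1 by lra.
rewrite powRN ler_pdivrMl; last by rewrite powR_gt0//; lra.
rewrite [leRHS]mulrC -(@powRM _ _ _ _ (ler0n R 2) L0).
by apply: ler_powR2r; lra.
Qed.

Lemma sqr_pos (l : R) : 0 < l < 1 -> 0 < l ^+ 2.
Proof. by case/andP => l0 _; exact: exprn_gt0. Qed.

Lemma Gfun_linear : 5 / 4 < s -> SV_le s p (fun l => l `^ p) -> simeq (Gfun fr fi p) (fun=> 1).
Proof.
move=> s5 hp; have s0 : 0 < s by lra.
have g2 := SV2_ge_gt s s0; have l2 := SV2_upper_gt s s5.
split; last exact: (lesim_one_Gfun s p fr fi _ p2 hR sqr_pos g2 l2).
apply: (lesim_Gfun_le s p fr fi _ _ _ p2 hR sqr_pos (powR_pos p) g2 hp).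
by apply: near0_le_eq => l /andP[l0 _]; rewrite mul1r powR_sqr_half// ltW.
Qed.

Lemma Gfun_gt_small : 5 / 4 < s -> s < 3 / 2 -> p < 2 / (3 - 2 * s) -> simeq (Gfun fr fi p) (fun=> 1).
Proof.
move=> s5 s3 pP; apply: Gfun_linear => //.
have d0 : 0 < 3 - 2 * s by lra.
set P := 2 / (3 - 2 * s) in pP.
have P4 : 4 < P by rewrite /P ltr_pdivlMr//; lra.
(* An exponent above both 4 and [p], still below the critical [P]; the midpoint is one. *)
pose q := (Num.max 4 p + P) / 2.
have m4 : 4 <= Num.max 4 p by rewrite le_max lexx.
have mp : p <= Num.max 4 p by rewrite le_max lexx orbT.
have mP : Num.max 4 p < P by rewrite gt_max P4.
have q4 : 4 < q by rewrite /q; lra.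
have q0 : 0 < q by lra.
apply: (SV_le_linear q) => //; [by rewrite /q; lra|lra|].
have qP : q < P by rewrite /q; lra.
have h : 3 - 2 * s < 2 / q by rewrite ltr_pdivlMr// mulrC; move: qP; rewrite /P ltr_pdivlMr.
lra.
Qed.

Lemma Gfun_gt_big : 5 / 4 < s -> s < 3 / 2 -> 2 / (3 - 2 * s) < p ->
  simeq (Gfun fr fi p) (fun l => l `^ (- (3 * p / 2 - 1 - p * s))).
Proof.
move=> s5 s3 Pp; have p0 := p_gt0.
have d0 : 0 < 3 - 2 * s by lra.
have p4 : 4 < p by apply: lt_trans Pp; rewrite ltr_pdivlMr//; lra.
have s0 : 0 < s by lra.
have hp : 2 / p < 3 - 2 * s by rewrite ltr_pdivrMr// mulrC; move: Pp; rewrite ltr_pdivrMr.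
have g2 := SV2_ge_gt s s0; have l2 := SV2_upper_gt s s5.
have ip : 0 < 1 / p by rewrite divr_gt0.
have F0 := @powR_pos R (p * s - p / 2 + 1).
have E l : 0 < l < 1 -> l `^ (- (3 * p / 2 - 1 - p * s)) * (l ^+ 2) `^ (p / 2) = l `^ (p * s - p / 2 + 1).
  case/andP => l0 _; rewrite (powR_sqr_half _ _ (ltW l0)) -powRD; last by rewrite (gt_eqF l0) implybT.
  by congr (_ `^ _); field.
have ep : 2 / p = 2 * (1 / p) by rewrite mulrA mulr1.
have hle : SV_le s p (fun l => l `^ (p * s - p / 2 + 1)) by apply: SV_le_pos => //; lra.
have hge : SV_ge s p (fun l => l `^ (p * s - p / 2 + 1)) by apply: SV_ge_Fejer; lra.
split.
  apply: (lesim_Gfun_le s p fr fi _ _ _ p2 hR sqr_pos F0 g2 hle).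
  by apply: near0_le_eq => l l01; rewrite E.
apply: (lesim_Gfun_ge s p fr fi _ _ _ p2 hR sqr_pos F0 g2 l2 hge).
by apply: near0_le_eq => l l01; rewrite E.
Qed.

Lemma Gfun_gt_crit : 5 / 4 < s -> s < 3 / 2 -> p = 2 / (3 - 2 * s) ->
  lesim (fun=> 1) (Gfun fr fi p) /\ lesim (Gfun fr fi p) (fun l => (ln l^-1) `^ (p / 2)).
Proof.
move=> s5 s3 pP; have p0 := p_gt0.
have d0 : 0 < 3 - 2 * s by lra.
have p4 : 4 < p by rewrite pP ltr_pdivlMr//; lra.
have s0 : 0 < s by lra.
have g2 := SV2_ge_gt s s0; have l2 := SV2_upper_gt s s5.
split; first exact: (lesim_one_Gfun s p fr fi _ p2 hR sqr_pos g2 l2).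
have crit : 2 + kap p - 2 * s = 0.
  by rewrite kap_gt4// (_ : 2 / p = 3 - 2 * s); [ring|rewrite pP invf_div mulrC divfK// pnatr_eq0].
have hp := SV_upper_crit s p p4 s0 crit.
pose F (l : R) := l `^ p * (1 + ln l^-1).
have F0 l : 0 < l < 1 -> 0 < F l.
  by move=> l01; apply: mulr_gt0; [exact: powR_pos|have := ln_inv_ge0 l l01; lra].
apply: (lesim_Gfun_le s p fr fi _ F _ p2 hR sqr_pos F0 g2 hp).
exists 2 => //; exists (1 / 4) => [|l lq]; first lra.
have L1 := ln_inv_ge1 l lq; have /andP[l0 _] := lq.
rewrite (powR_sqr_half _ _ (ltW l0)) /F.
(* The moment carries one logarithm only, and [p / 2 >= 1] with [ln l^-1 >= 1] weakens it to the
   stated power. *)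
have L2 : ln l^-1 <= (ln l^-1) `^ (p / 2).
  rewrite -[leLHS](powRr1 (le_trans ler01 L1)); apply: ler_powR => //; lra.
have h : 1 + ln l^-1 <= 2 * (ln l^-1) `^ (p / 2) by lra.
by have := ler_wpM2l (powR_ge0 l p) h; lra.
Qed.

Lemma Gfun_smooth_ge2 : 3 / 2 <= s -> simeq (Gfun fr fi p) (fun=> 1).
Proof.
move=> s3; have p0 := p_gt0; apply: Gfun_linear; first lra.
have q0 : 0 < 2 / (p + 4) by rewrite divr_gt0//; lra.
by apply: (SV_le_linear (p + 4)); lra.
Qed.

End Cases.

(** Below exponent 2 monotonicity of norms gives the upper bound instead. The lower bound
    interpolates the second moment between exponents [p] and 4, all three functions being of size
    [l]. Convergence at exponents 2 and 4 follows from the assumed one by [is_Rs_ge]. *)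
Lemma Gfun_smooth_lt2 {R : realType} (s p : R) (fr fi : R -> R) : 0 < p -> p < 2 -> is_Rs s p fr fi ->
  3 / 2 <= s -> simeq (Gfun fr fi p) (fun=> 1).
Proof.
move=> p0 p2 hR s3; have s0 : 0 < s by lra. have s5 : 5 / 4 < s by lra.
have hR4 : is_Rs s 4 fr fi by apply: is_Rs_ge hR.
have hR2 : is_Rs s 2 fr fi by apply: is_Rs_le hR4; lra.
have [_ [mr [mi _]]] := hR.
have p12 : 1 <= (2 : R) by lra. have p14 : 1 <= (4 : R) by lra.
have g2 := Sfun_ge s 2 fr fi _ p12 hR2 sqr_pos (SV2_ge_gt s s0).
have l2 := Sfun_le s 2 fr fi _ p12 hR2 sqr_pos (SV2_upper_gt s s5).
have l4 : S_le (Sfun fr fi 4) (fun l => l `^ 4).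
  apply: (Sfun_le s 4 fr fi _ p14 hR4 (powR_pos 4)).
  have h24 : 2 <= (4 : R) by lra.
  by apply: (SV_le_linear s 4 h24 5); lra.
have Sp_le : S_le (Sfun fr fi p) (fun l => l `^ p).
  have [C C0 h] := l2; exists (2 * C `^ (p / 2)); first by rewrite mulr_gt0// powR_gt0.
  move=> l l01; have /andP[l0 l1] := l01; have l01' : 0 <= l <= 1 by rewrite !ltW.
  have B0 : 0 < C * l ^+ 2 by rewrite mulr_gt0// exprn_gt0.
  have hB : (Sint fr fi 2 l <= (C * l ^+ 2)%:E)%E.
    by rewrite -(fineK (Sint_fin s 2 fr fi l p12 hR2 l01')) lee_fin; exact: h.
  have hS := Sint_mono fr fi p 2 l _ p0 (ltW p2) B0 mr mi hB.
  have fp : Sint fr fi p l \is a fin_num by rewrite ge0_fin_numE ?Sint_ge0// (le_lt_trans hS)// ltry.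
  rewrite SfunE -lee_fin fineK//; apply: le_trans hS _.
  by rewrite lee_fin (@powRM _ _ _ _ (ltW C0) (sqr_ge0 l)) (powR_sqr_half _ _ (ltW l0)) mulrA.
have Sp_ge : S_ge (Sfun fr fi p) (fun l => l `^ p).
  have [c c0 [l0 /andP[l00 l01] h]] := g2; have [C C0 h4] := l4.
  have arith (a b d e : R) : c * a <= b -> b <= d + e -> e <= c / 2 * a -> c / 2 * a <= d by lra.
  (* With [t = kp * l] the fourth-moment term is at most half of the lower bound [c * l ^ 2] for the
     second moment. *)
  pose kp := Num.sqrt (2 * C / c).
  have kp2 : kp ^+ 2 = 2 * C / c by rewrite sqr_sqrtr// divr_ge0 ?mulr_ge0// ltW.
  have kp0 : 0 < kp by rewrite sqrtr_gt0 divr_gt0// mulr_gt0.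
  exists (c / 2 / kp `^ (2 - p)); first by rewrite !divr_gt0// powR_gt0.
  exists l0; first by rewrite l00.
  move=> l ll; have /andP[hl0 hl1] := ll.
  have lb : 0 < l < 1 by rewrite hl0 (lt_trans hl1).
  have lb' : 0 <= l <= 1 by case/andP: lb => ? ?; rewrite !ltW.
  pose t := kp * l; have t0 : 0 < t by rewrite mulr_gt0.
  pose g (x : R) := cmod (fr (x + l) - fr x) (fi (x + l) - fi x).
  have mg : measurable_fun setT g by exact: measurable_cmod_diff.
  have mge (e : R) : measurable_fun setT (fun x => g x `^ e) by exact: measurable_powR_comp.
  have tp0 : 0 <= t `^ (2 - p) by exact: powR_ge0.
  have ti0 : 0 <= t ^- 2 by rewrite invr_ge0 sqr_ge0.
  have g0 x : 0 <= g x by exact: cmod_ge0.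
  have pt x : g x `^ 2 <= 1 * (t `^ (2 - p) * g x `^ p + t ^- 2 * (g x `^ 4 + 0)).
    rewrite mul1r addr0 (powR_mulrn 2 (g0 x)) (powR_mulrn 4 (g0 x)).
    by apply: powR_interp_ge => //; exact: ltW.
  have mz : measurable_fun setT (fun _ : R => (0 : R)) by exact: measurable_cst.
  have mG : measurable_fun setT (fun x => t `^ (2 - p) * g x `^ p).
    by apply: measurable_funM; [exact: measurable_cst|exact: mge].
  have G0 x : 0 <= t `^ (2 - p) * g x `^ p by rewrite mulr_ge0// powR_ge0.
  have := Ig_combine _ _ _ _ _ _ (mge 2) mG (mge 4) mz (fun x => powR_ge0 _ _) G0 (fun x => powR_ge0 _ _)
    (fun=> lexx 0) ler01 ti0 pt.
  rewrite (IgZ _ _ (mge p) (fun x => powR_ge0 _ _) tp0) Ig_cst adde0 mul1e.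
  have hB : (Sint fr fi 2 l <= (Sfun fr fi 2 l)%:E)%E by rewrite SfunE fineK// (Sint_fin s).
  have S2 : c * l ^+ 2 <= Sfun fr fi 2 l by exact: h.
  have S4 := h4 l lb.
  have f2 := Sint_fin s 2 fr fi l p12 hR2 lb'.
  have f4 := Sint_fin s 4 fr fi l p14 hR4 lb'.
  (* Here [p] may be below 1, outside the range of [Sint_fin]; finiteness comes from the second
     moment. *)
  have fp : Sint fr fi p l \is a fin_num.
    have S20 : 0 < Sfun fr fi 2 l by apply: lt_le_trans S2; rewrite mulr_gt0// exprn_gt0.
    rewrite ge0_fin_numE ?Sint_ge0//.
    by rewrite (le_lt_trans (Sint_mono fr fi p 2 l _ p0 (ltW p2) S20 mr mi hB))// ltry.
  rewrite -/(Sint fr fi 2 l) -/(Sint fr fi p l) -/(Sint fr fi 4 l) -(fineK f2) -(fineK f4) -(fineK fp).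
  rewrite -(EFinM (t `^ (2 - p))) -(EFinM (t ^- 2)) -EFinD lee_fin -!SfunE => main.
  have e4 : t ^- 2 * (C * l `^ 4) = c / 2 * l ^+ 2.
    rewrite (powR_mulrn 4 (ltW hl0)) /t exprMn kp2; field.
    by rewrite !gt_eqF.
  have m4 : t ^- 2 * Sfun fr fi 4 l <= c / 2 * l ^+ 2 by rewrite -e4; exact: ler_wpM2l.
  have m5 : c / 2 * l ^+ 2 <= t `^ (2 - p) * Sfun fr fi p l by exact: arith S2 main m4.
  have kpp : 0 < kp `^ (2 - p) by exact: powR_gt0.
  have lpp : 0 < l `^ (2 - p) by exact: powR_gt0.
  rewrite mulrAC ler_pdivrMr// -(ler_pM2r lpp).
  have -> : c / 2 * l `^ p * l `^ (2 - p) = c / 2 * l ^+ 2.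
    rewrite -mulrA -powRD; last by rewrite (gt_eqF hl0) implybT.
    by rewrite addrC subrK (powR_mulrn 2 (ltW hl0)).
  apply: le_trans m5 _; rewrite /t (@powRM _ _ _ _ (ltW kp0) (ltW hl0)).
  by rewrite le_eqVlt; apply/orP; left; apply/eqP; ring.
have E l : 0 < l < 1 -> l `^ p = 1 * (l ^+ 2) `^ (p / 2).
  by case/andP => l0 _; rewrite mul1r powR_sqr_half// ltW.
split.
  by apply: (Gfun_le p fr fi _ _ _ p0 sqr_pos g2 Sp_le); apply: near0_le_eq.
by apply: (Gfun_ge p fr fi _ _ _ p0 sqr_pos (powR_pos p) g2 l2 Sp_ge); apply: near0_le_eq => l l01; rewrite -E.
Qed.

Theorem theoremB (R : realType) (s p : R) (fr fi : R -> R) :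
  0 < p -> is_Rs s p fr fi ->
  let G := Gfun fr fi p in
  let one := fun _ : R => (1 : R) in
  let L := fun l : R => ln (l^-1) in
  (* case s < 5/4 *)
  (2 <= p -> sstar p < s -> s < 5 / 4 ->
     (p < 4 -> simeq G one) /\
     (p = 4 -> simeq G L) /\
     (4 < p -> simeq G (fun l => l `^ (- (p / 4 - 1))))) /\
  (* case s = 5/4 *)
  (2 <= p -> sstar p < s -> s = 5 / 4 ->
     (p < 4 -> simeq G one) /\
     (4 < p -> simeq G (fun l => l `^ (- (p / 4 - 1)) * (L l) `^ (- (p / 2)))) /\
     (p = 4 -> lesim one G /\ lesim G L)) /\
  (* case 5/4 < s < 3/2 *)
  (2 <= p -> sstar p < s -> 5 / 4 < s -> s < 3 / 2 ->
     (p < 2 / (3 - 2 * s) -> simeq G one) /\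
     (2 / (3 - 2 * s) < p ->
        simeq G (fun l => l `^ (- (3 * p / 2 - 1 - p * s)))) /\
     (p = 2 / (3 - 2 * s) -> lesim one G /\ lesim G (fun l => (L l) `^ (p / 2)))) /\
  (* case s >= 3/2, any p > 0 *)
  (3 / 2 <= s -> simeq G one).
Proof.
move=> p0 hR G one L; split; [|split; [|split]].
- move=> p2 ss s5; split; [|split] => hp.
  + exact: (Gfun_lt_small s).
  + exact: (Gfun_lt_four s).
  + exact: (Gfun_lt_big s).
- move=> p2 _ s5; split; [|split] => hp.
  + exact: (Gfun_crit_small s).
  + exact: (Gfun_crit_big s).
  + exact: (Gfun_crit_four s).
- move=> p2 _ s5 s3; split; [|split] => hp.
  + exact: (Gfun_gt_small s).
  + exact: (Gfun_gt_big s).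
  + exact: (Gfun_gt_crit s).
- move=> s3; have [p2|p2] := leP 2 p.
  + exact: (Gfun_smooth_ge2 s).
  + exact: (Gfun_smooth_lt2 s).
Qed.
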